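(* Let $n\geq 3$ be an integer and let $g=e^{2u}|dx|^2$ be a smooth, complete conformal metric on $\mathbb{R}^n$ with finite total Q-curvature. Suppose that the scalar curvature $R_g\geq 0$ near infinity (i.e. outside some compact set). Then $\tau(g)\leq 1$.
   Context: The Q-curvature $Q$ of $g=e^{2u}|dx|^2$ is defined by $(-\Delta)^{n/2}u=Qe^{nu}$ on $\mathbb{R}^n$; for odd $n$, $(-\Delta)^{n/2}:=(-\Delta)^{1/2}\circ(-\Delta)^{(n-1)/2}$, with the assumption $(-\Delta)^{(n-1)/2}u\in L_{1/2}(\mathbb{R}^n):=\{\varphi\in L^1_{loc}: \int\frac{|\varphi|}{1+|x|^{n+1}}<\infty\}$ and $(-\Delta)^{1/2}f(x)=C(n)\,\mathrm{P.V.}\int\frac{f(x)-f(y)}{|x-y|^{n+1}}dy$ (i.e. Fourier multiplier $|\xi|$). Finite total Q-curvature means $Q$ is well defined and $Qe^{nu}\in L^1(\mathbb{R}^n)$. The scalar curvature is $R_g=2(n-1)e^{-2u}\big(-\Delta u-\frac{n-2}{2}|\nabla u|^2\big)$. The volume entropy is $\tau(g):=\limsup_{R\to\infty}\frac{\log V_g(B_R(0))}{\log|B_R(0)|}$, where $V_g(B_R(0))=\int_{B_R(0)}e^{nu}dx$ and $|B_R(0)|$ is the Euclidean volume of the Euclidean ball of radius $R$ about the origin. *)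

(* Defs.v *)
From HB Require Import structures.
From mathcomp Require Import all_boot all_order all_algebra.
From mathcomp Require Import all_classical all_reals all_analysis.
Set Implicit Arguments. Unset Strict Implicit. Unset Printing Implicit Defensive.
Import Order.TTheory GRing.Theory Num.Theory.
Import numFieldNormedType.Exports.
Local Open Scope classical_set_scope.
Local Open Scope ring_scope.

Section QCurv.
Variable R : realType.

(* Euclidean norm on R^n = 'rV[R]_n (the library norm on 'rV is the max norm). *)
Definition enorm (n : nat) (x : 'rV[R]_n) : R := Num.sqrt (\sum_(i < n) x 0 i ^+ 2).

(* Integral over R^n with respect to n-dimensional Lebesgue measure,
   written as an iterated one-dimensional Lebesgue integral (Fubini/Tonelli). *)
Fixpoint iint (n : nat) : ('rV[R]_n -> \bar R) -> \bar R :=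
  match n return ('rV[R]_n -> \bar R) -> \bar R with
  | 0 => fun f => f 0
  | n'.+1 => fun f =>
      (\int[@lebesgue_measure R]_t
          iint (fun v : 'rV[R]_n' => f (row_mx (\row_(j < 1) t) v)))%E
  end.

Definition partial (n : nat) (i : 'I_n) (f : 'rV[R]_n -> R) : 'rV[R]_n -> R :=
  fun x => 'D_(delta_mx 0 i) f x.

Definition iter_partial (n : nat) (s : seq 'I_n) (f : 'rV[R]_n -> R) :=
  foldr (fun i g => partial i g) f s.

Definition smooth (n : nat) (f : 'rV[R]_n -> R) : Prop :=
  forall s : seq 'I_n, continuous (iter_partial s f) /\
    forall (i : 'I_n) (x : 'rV[R]_n), derivable (iter_partial s f) x (delta_mx 0 i).

Definition lap (n : nat) (f : 'rV[R]_n -> R) : 'rV[R]_n -> R :=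
  fun x => \sum_(i < n) partial i (partial i f) x.

Definition grad_sq (n : nat) (f : 'rV[R]_n -> R) : 'rV[R]_n -> R :=
  fun x => \sum_(i < n) (partial i f x) ^+ 2.

Definition neglap_pow (n k : nat) (f : 'rV[R]_n -> R) : 'rV[R]_n -> R :=
  iter k (fun g x => - lap g x) f.

(* C(n) = Gamma((n+1)/2) / pi^((n+1)/2), normalizing (-Delta)^{1/2} to the
   Fourier multiplier |xi|; for odd n, (n+1)/2 = m is an integer, Gamma(m) = (m-1)!. *)
Definition Chalf (n : nat) : R := ((n.+1./2).-1`!)%:R / pi ^+ (n.+1./2).

Definition L_half (n : nat) (phi : 'rV[R]_n -> R) : Prop :=
  (iint (fun x => (`|phi x| / (1 + enorm x ^+ n.+1))%:E) < +oo)%E.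

Definition pv_trunc (n : nat) (phi : 'rV[R]_n -> R) (x : 'rV[R]_n) (eps : R) : \bar R :=
  iint (fun y => if eps < enorm (x - y)
                 then ((phi x - phi y) / enorm (x - y) ^+ n.+1)%:E else 0%E).

(* "(-Delta)^{n/2} u (x) is well defined and equals v" *)
Definition is_frac_lap (n : nat) (u : 'rV[R]_n -> R) (x : 'rV[R]_n) (v : R) : Prop :=
  if ~~ odd n then v = neglap_pow n./2 u x
  else L_half (neglap_pow n./2 u) /\
       pv_trunc (neglap_pow n./2 u) x eps @[eps --> 0^'+] --> (v / Chalf n)%:E.

Definition is_Qcurvature (n : nat) (u : 'rV[R]_n -> R) (Q : 'rV[R]_n -> R) : Prop :=
  forall x, is_frac_lap u x (Q x * expR (n%:R * u x)).

Definition finite_total_Q (n : nat) (u : 'rV[R]_n -> R) : Prop :=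
  exists Q : 'rV[R]_n -> R, is_Qcurvature u Q /\
    (iint (fun x => `|Q x * expR (n%:R * u x)|%:E) < +oo)%E.

Definition scal_curv (n : nat) (u : 'rV[R]_n -> R) : 'rV[R]_n -> R :=
  fun x => 2 * (n%:R - 1) * expR (- (2 * u x)) *
           (- lap u x - (n%:R - 2) / 2 * grad_sq u x).

Definition curve_length (n : nat) (u : 'rV[R]_n -> R) (gamma : R -> 'rV[R]_n) : \bar R :=
  (\int[@lebesgue_measure R]_(t in `[0%R, 1%R]%classic) (expR (u (gamma t)) * enorm (derive1 gamma t))%:E)%E.

Definition C1_curve (n : nat) (gamma : R -> 'rV[R]_n) : Prop :=
  (forall t, derivable gamma t 1) /\ continuous (derive1 gamma).

Definition gdist (n : nat) (u : 'rV[R]_n -> R) (x y : 'rV[R]_n) : \bar R :=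
  ereal_inf [set curve_length u gamma | gamma in
     [set gamma | C1_curve gamma /\ gamma 0 = x /\ gamma 1 = y]].

Definition complete_metric (n : nat) (u : 'rV[R]_n -> R) : Prop :=
  forall s : nat -> 'rV[R]_n,
    (forall e : R, 0 < e -> exists N, forall p q, (N <= p)%N -> (N <= q)%N ->
        (gdist u (s p) (s q) < e%:E)%E) ->
    exists y, forall e : R, 0 < e -> exists N, forall p, (N <= p)%N ->
        (gdist u (s p) y < e%:E)%E.

Definition ball0 (n : nat) (r : R) : set 'rV[R]_n := [set x | enorm x < r].

Definition gvol_ball (n : nat) (u : 'rV[R]_n -> R) (r : R) : \bar R :=
  iint (fun x => (indic (@ball0 n r) x * expR (n%:R * u x))%:E).

Definition evol_ball (n : nat) (r : R) : \bar R :=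
  iint (fun x : 'rV[R]_n => (indic (@ball0 n r) x)%:E).

Definition vol_entropy (n : nat) (u : 'rV[R]_n -> R) : \bar R :=
  limf_esup (fun r : R => (ln (fine (gvol_ball u r)) / ln (fine (evol_ball n r)))%:E)
            (pinfty_nbhs R).

End QCurv.

(* Main.v *)
(** Let [J k w x t] be the average of [w] around [x] against the kernel
    [H k t z = max (0, 1 - |z|^2 / t^2)^k], normalized by [t^-n]. The [t]-derivative of [t^-n * H k t]
    is a multiple of [t^(1-n)] times the Laplacian of [H k.+1 t], so the scale derivative of [J k w]
    is a multiple of [t * J k.+1 (lap w)]. Where [R_g >= 0] one has
    [(n-2)/2 * |grad u|^2 <= - lap u]; testing this against [H k t] bounds the energy in a ball of
    radius [t] by [C * t^(n-2)]. Climbing the ladder [m = n./2] times and using that energy bound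
    gives [u x <= C + C * \int_a^|x| s^(2m-1) |J (lap^m u) x s| ds], where [a] is any scale below
    which [u] oscillates by less than [1] around [x].

    Put [f = Q * exp (n * u)], which is integrable. Then
    [|J (lap^m u) x s| <= C * \int |f (x + z)| (s^2 + |z|^2)^-m dz]. This is immediate for even [n].
    For odd [n] the principal value formula, written with [|z|^-(n+1)] as a superposition of the
    kernels [H], gives [f = - c * \int_0^oo J (lap^(m+1) u) ds]; averaging this identity against
    Gaussians of all widths and using their semigroup law recovers [lap^m u] from [f].

    Hence [u x <= C + C * \int |f (x + z)| ln ((|x| + |z|) / (a + |z|)) dz]. The part of [f] in a fixed
    large cube contributes a bounded amount, and the rest has small mass, so that Jensen's
    inequality and Fubini bound the volume of the cube of radius [r] by [C * r^n]. *)

Require Import Defs.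
From HB Require Import structures.
From mathcomp Require Import all_boot all_order all_algebra.
From mathcomp Require Import all_classical all_reals all_analysis.
From mathcomp Require Import measurable_realfun ring lra zify.
Set Implicit Arguments. Unset Strict Implicit. Unset Printing Implicit Defensive.
Import Order.TTheory GRing.Theory Num.Theory.
Import numFieldNormedType.Exports.
Local Open Scope classical_set_scope.
Local Open Scope ring_scope.

(** * Lebesgue measure on row vectors *)

(** The classical route represents [u] as a logarithmic potential plus a polyharmonic remainder,
    which must then be excluded. Only an upper bound is needed here, and in the ladder the remainder
    shows up as boundary terms at scale |x|. They stay bounded because each Laplacian moved onto the
    kernel costs exactly [t^-2], the power that one rung gains; the average of [u] itself is bounded
    above because [u] is superharmonic far out.

    In odd dimension nothing bounds the iterated Laplacians of [u] pointwise, uniformly in space;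
    only their averages at a fixed scale are bounded. The identities are therefore mollified with
    [H] before Gaussians enter. Gaussians are superpositions of the [H] and form a semigroup, so a
    scale integral of a scale integral becomes an integral over a quadrant, computed in polar
    coordinates.

    The inner scale [a] shrinks with [r] in an uncontrolled way, so the volume bound must not depend
    on it. Small mass of [f] far out lowers the exponent in Jensen's inequality until only the
    square root of [r / (a + |z|)] is left; in a single coordinate this has integral at most a
    constant times [r], whatever [a] is. *)

Lemma row_norm_lt (R : realType) n (x : 'rV[R]_n) (e : R) : 0 < e ->
  (`|x| < e) <-> (forall i, `|x 0 i| < e).
Proof.
move=> e0; have -> : `|x| = \big[Num.max/0]_ij `|x ij.1 ij.2| by exact: mx_normrE.
split=> [h i|h].
  by have /bigmax_ltP[_ h'] := h; exact: (h' (0, i) isT).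
by apply: bigmax_lt => //= -[i j] _ /=; rewrite (ord1 i).
Qed.

Section RowMeas.
Variables (R : realType) (n : nat).
Definition rcoord (x : 'rV[R]_n) : n.-tuple (measurableTypeR R) := [tuple x 0 i | i < n].
(** The sigma-algebra is pulled back from tuples of reals, so that measurability into row vectors
    can be tested coordinate by coordinate; [open_row_measurable] ties it to the topology. *)
Definition row_measurable : set (set 'rV[R]_n) := preimage_set_system setT rcoord measurable.
Let rm0 : row_measurable set0.
Proof. by exists set0 => //; rewrite setTI preimage_set0. Qed.
Let rmC A : row_measurable A -> row_measurable (~` A).
Proof. by case=> B mB <-; exists (~` B); [exact: measurableC | rewrite !setTI preimage_setC]. Qed.
Let rmU (F : (set 'rV[R]_n)^nat) : (forall i, row_measurable (F i)) -> row_measurable (\bigcup_i (F i)).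
Proof.
move=> h; have /choice [G hG] : forall i, exists B, measurable B /\ rcoord @^-1` B = F i.
  by move=> i; have [B mB <-] := h i; exists B; rewrite setTI.
exists (\bigcup_i G i); first by apply: bigcupT_measurable => i; have [] := hG i.
by rewrite setTI preimage_bigcup; apply: eq_bigcup => // i _; have [] := hG i.
Qed.
HB.instance Definition _ := @isMeasurable.Build
  (measure_tuple_display default_measure_display) 'rV[R]_n row_measurable rm0 rmC rmU.

Lemma measurable_rcoord : measurable_fun setT rcoord.
Proof. by move=> _ B mB; exists B. Qed.

Lemma measurable_rowP d (T : measurableType d) (f : T -> 'rV[R]_n) :
  measurable_fun setT f <->
  forall i, measurable_fun setT (fun x => f x 0 i : measurableTypeR R).
Proof.
split=> [mf i|mf].
  have -> : (fun x => f x 0 i : measurableTypeR R) =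
      (@tnth n (measurableTypeR R) ^~ i) \o rcoord \o f.
    by apply/funext => x /=; rewrite tnth_mktuple.
  apply: measurableT_comp => //; apply: measurableT_comp.
    exact: measurable_tnth.
  exact: measurable_rcoord.
have : measurable_fun setT (rcoord \o f).
  apply/measurable_fun_tnthP => i.
  rewrite (_ : _ \o _ = fun x => f x 0 i : measurableTypeR R)//.
  by apply/funext => x /=; rewrite tnth_mktuple.
by move=> h _ _ [B mB <-]; rewrite setTI -comp_preimage; apply: h.
Qed.

Lemma measurable_coord i : measurable_fun setT (fun x : 'rV[R]_n => x 0 i : measurableTypeR R).
Proof. by move: i; apply/measurable_rowP; exact: measurable_id. Qed.

(** An open set is the union of those boxes with rational centre and half-width [1/(k+1)] that it
    contains, and there are countably many such boxes. *)
Lemma open_row_measurable (U : set 'rV[R]_n) : open U -> measurable U.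
Proof.
move=> oU.
pose B (qk : 'rV[rat]_n * nat) := [set x : 'rV[R]_n | forall i, `|x 0 i - ratr (qk.1 0 i)| < qk.2.+1%:R^-1].
have mB qk : measurable (B qk).
  have -> : B qk = \bigcap_(i in [set: 'I_n]) [set x : 'rV[R]_n | `|x 0 i - ratr (qk.1 0 i)| < qk.2.+1%:R^-1].
    by apply/seteqP; split => x /=; [move=> h i _; exact: h | move=> h i; exact: h].
  apply: fin_bigcap_measurable => // i _.
  have := @measurable_coord i.
  move=> /(_ measurableT [set t | `|t - ratr (qk.1 0 i)| < qk.2.+1%:R^-1]).
  rewrite setTI; apply.
  have -> : [set t : R | `|t - ratr (qk.1 0 i)| < qk.2.+1%:R^-1] = ball (ratr (qk.1 0 i) : R) (qk.2.+1%:R^-1).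
    by apply/seteqP; split => t /=; rewrite /ball/= distrC.
  exact: measurable_ball.
have -> : U = \bigcup_(qk in [set: 'rV[rat]_n * nat]) (if `[< B qk `<=` U >] then B qk else set0).
  apply/seteqP; split=> [x Ux|x [qk _]]; last by case: ifP => // /asboolP; apply.
  have /nbhs_ballP[e /= e0 xeU] : nbhs x U by apply: open_nbhs_nbhs.
  (* Half of [e], because two points of one box differ by up to twice its half-width. *)
  have [k hk] : exists k : nat, k.+1%:R^-1 < e / 2.
    have [k hk] := @ltr_add_invr _ (0:R) (e/2) (divr_gt0 e0 (ltr0Sn _ 1)).
    by exists k; rewrite add0r in hk.
  have /choice[q hq] : forall i, exists q : rat, ratr q \in `](x 0 i - k.+1%:R^-1), (x 0 i + k.+1%:R^-1)[.
    move=> i; have [|q hq] := @rat_in_itvoo _ (x 0 i - k.+1%:R^-1) (x 0 i + k.+1%:R^-1).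
      by rewrite ltrD2l gtrN // invr_gt0.
    by exists q.
  have xB : B (\row_i q i, k) x.
    by move=> i /=; rewrite mxE distrC ltr_distl; have := hq i; rewrite in_itv.
  exists (\row_i q i, k) => //; case: ifP => // /asboolP; case => y By; apply: xeU.
  rewrite -ball_normE /= /ball_ /=; apply/row_norm_lt => // j; rewrite !mxE.
  have := xB j; have := By j; rewrite /= mxE => h1 h2.
  have -> : x 0 j - y 0 j = (x 0 j - ratr (q j)) - (y 0 j - ratr (q j)) by ring.
  apply: (le_lt_trans (ler_normB _ _)); rewrite [e]splitr.
  by apply: ltrD; [exact: lt_trans h2 hk|exact: lt_trans h1 hk].
by apply: countable_bigcupT_measurable => // qk; case: ifP.
Qed.

Lemma continuous_row_measurable (f : 'rV[R]_n -> R) : continuous f -> measurable_fun setT f.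
Proof.
move=> /continuousP cf; apply: (measurability _ (RGenOpens.measurableE R)).
move=> _ [_ [a [b ->] <-]]; rewrite setTI; apply: open_row_measurable.
exact/cf/interval_open.
Qed.

End RowMeas.

(** Spelled like the vector assembled in [iint], so that the recursions for [iint] and for the
    measure [leb] match by conversion. *)
Definition consv (R : realType) n (t : R) (v : 'rV[R]_n) : 'rV[R]_n.+1 := row_mx (\row_(j < 1) t) v.

Lemma consv0 (R : realType) n t (v : 'rV[R]_n) : consv t v 0 ord0 = t.
Proof.
rewrite /consv mxE; case: split_ordP => j; first by rewrite mxE.
by move/(congr1 val).
Qed.

Lemma consvS (R : realType) n t (v : 'rV[R]_n) i : consv t v 0 (lift ord0 i) = v 0 i.
Proof.
rewrite /consv mxE; case: split_ordP => j; first by move/(congr1 val) => /=; rewrite /bump; case: j => -[].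
by move/(congr1 val) => /= h; congr (v 0 _); apply/val_inj; move: h; rewrite /bump/= => -[].
Qed.

Lemma rV_consP (R : realType) n (x y : 'rV[R]_n.+1) : x 0 ord0 = y 0 ord0 ->
  (forall i, x 0 (lift ord0 i) = y 0 (lift ord0 i)) -> x = y.
Proof.
move=> h0 hS; apply/rowP => i; case: (unliftP ord0 i) => [j ->|->//]; exact: hS.
Qed.

Section LebN.
Variable R : realType.
Local Notation Rm := (measurableTypeR R).
Local Notation la := (@lebesgue_measure R).

Lemma measurable_consv n d (T : measurableType d) (f : T -> Rm) (g : T -> 'rV[R]_n) :
  measurable_fun setT f -> measurable_fun setT g ->
  measurable_fun setT (fun x => consv (f x) (g x)).
Proof.
move=> mf mg; apply/measurable_rowP => i; case: (unliftP ord0 i) => [j ->|->].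
  under eq_fun do rewrite consvS.
  by have /measurable_rowP := mg; exact.
by under eq_fun do rewrite consv0.
Qed.

Lemma measurable_consv_pair n : measurable_fun setT (fun p : Rm * 'rV[R]_n => consv p.1 p.2).
Proof. exact: measurable_consv. Qed.

Definition cube n (k : R) := [set x : 'rV[R]_n | forall i, `|x 0 i| <= k].

Lemma measurable_cube n k : measurable (@cube n k).
Proof.
have -> : @cube n k = \bigcap_(i in [set: 'I_n]) [set x : 'rV[R]_n | `|x 0 i| <= k].
  by apply/seteqP; split => x /=; [move=> h i _; exact: h | move=> h i; exact: h].
apply: fin_bigcap_measurable => // i _.
have := @measurable_coord R n i.
move=> /(_ measurableT [set t | `|t| <= k]); rewrite setTI; apply.
have -> : [set t : R | `|t| <= k] = `[- k, k]%classic.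
  by apply/seteqP; split => t /=; rewrite in_itv/= ler_norml.
exact: measurable_itv.
Qed.

Section step.
Variables (n : nat) (m : {sigma_finite_measure set 'rV[R]_n -> \bar R}).
Hypothesis mcube : forall k, (m (@cube n k) < +oo)%E.
Definition leb_step : set 'rV[R]_n.+1 -> \bar R :=
  pushforward (la \x m)%E (fun p : Rm * 'rV[R]_n => consv p.1 p.2).

Let leb_step0 : leb_step set0 = 0%E.
Proof. by rewrite /leb_step /pushforward preimage_set0 measure0. Qed.
Let leb_step_ge0 A : (0 <= leb_step A)%E.
Proof. by rewrite /leb_step /pushforward measure_ge0. Qed.
Let leb_step_sadd : semi_sigma_additive leb_step.
Proof.
move=> F mF tF mUF; rewrite /leb_step /pushforward preimage_bigcup.
have mc := @measurable_consv_pair n.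
apply: measure_semi_sigma_additive.
- by move=> k; rewrite -[X in measurable X]setTI; exact: mc.
- apply/trivIsetP => /= i j _ _ ij; rewrite -preimage_setI.
  by move/trivIsetP : tF => /(_ _ _ _ _ ij) ->//; rewrite preimage_set0.
- by rewrite -preimage_bigcup -[X in measurable X]setTI; exact: mc.
Qed.
HB.instance Definition _ := isMeasure.Build _ _ _ leb_step leb_step0 leb_step_ge0 leb_step_sadd.

Lemma leb_step_cube k : (leb_step (@cube n.+1 k) < +oo)%E.
Proof.
rewrite /leb_step /pushforward.
rewrite (_ : _ @^-1` _ = `[- k, k]%classic `*` @cube n k); last first.
  apply/seteqP; split=> -[t v] /=.
    move=> h; split => [|i /=]; first by have := h ord0; rewrite consv0 in_itv/= ler_norml.
    by have := h (lift ord0 i); rewrite consvS.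
  rewrite in_itv/= -ler_norml => -[h1 h2] i.
  case: (unliftP ord0 i) => [j ->|->]; first by rewrite consvS.
  by rewrite consv0.
rewrite product_measure1E//; last exact: measurable_cube.
have h : la `[- k, k]%classic \is a fin_num.
  by rewrite lebesgue_measure_itv/=; case: ifP => //= kk; rewrite -EFinB.
by apply: lte_mul_pinfty => //; exact: h.
Qed.

Let leb_step_sigma_finite : sigma_finite setT leb_step.
Proof.
exists (fun k => @cube n.+1 k%:R).
  apply/seteqP; split => // x _ /=.
  have [k hk] : exists k : nat, `|x| < k%:R.
    by exists (Num.bound `|x|); rewrite archi_boundP.
  exists k => // i; apply/ltW; move: i; apply/row_norm_lt => //.
  exact: le_lt_trans hk.
by move=> k; split; [exact: measurable_cube | exact: leb_step_cube].
Qed.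
HB.instance Definition _ := Measure_isSigmaFinite.Build _ _ _ leb_step leb_step_sigma_finite.
Definition leb_step_sf : {sigma_finite_measure set 'rV[R]_n.+1 -> \bar R} := leb_step.
Lemma leb_step_sf_cube k : (leb_step_sf (@cube n.+1 k) < +oo)%E.
Proof. exact: leb_step_cube. Qed.
End step.

Lemma dirac_cube k : (dirac (0%R : 'rV[R]_0) (@cube 0 k) < +oo :> \bar R)%E.
Proof. by rewrite diracE ltry. Qed.

(** The finite mass of cubes is carried through the recursion together with the measure, since the
    sigma-finiteness needed for the next product rests on it. Dimension 0 is the Dirac mass at the
    only point. *)
Definition leb_pack n : {m : {sigma_finite_measure set 'rV[R]_n -> \bar R} | forall k, (m (@cube n k) < +oo)%E} :=
  nat_rect (fun n => {m : {sigma_finite_measure set 'rV[R]_n -> \bar R} | forall k, (m (@cube n k) < +oo)%E})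
    (exist _ (dirac (0 : 'rV[R]_0) : {sigma_finite_measure set _ -> \bar R}) dirac_cube)
    (fun n m => exist _ (leb_step_sf (svalP m)) (leb_step_sf_cube (svalP m))) n.
Definition leb n : {sigma_finite_measure set 'rV[R]_n -> \bar R} := sval (leb_pack n).

Lemma leb_cube n k : (leb n (@cube n k) < +oo)%E.
Proof. exact: svalP (leb_pack n) k. Qed.

Lemma ge0_integral_leb0 (f : 'rV[R]_0 -> \bar R) : measurable_fun setT f ->
  (\int[leb 0]_x f x = f 0%R)%E.
Proof. by move=> mf; rewrite integral_dirac// diracT mul1e. Qed.

Lemma ge0_integral_lebS n (f : 'rV[R]_n.+1 -> \bar R) : measurable_fun setT f ->
  (forall x, 0 <= f x)%E ->
  (\int[leb n.+1]_x f x = \int[la]_t \int[leb n]_v f (consv t v))%E.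
Proof.
move=> mf f0; rewrite [LHS](ge0_integral_pushforward (@measurable_consv_pair n))// preimage_setT.
rewrite fubini_tonelli1//; last by move=> x; exact: f0.
by apply: (measurableT_comp mf); exact: measurable_consv_pair.
Qed.

(** Tonelli's theorem, one coordinate at a time: the bridge from the integrals of the theorem to
    [leb]. Signed integrands are treated in [iint_integrable]. *)
Lemma iint_ge0 n (f : 'rV[R]_n -> \bar R) : measurable_fun setT f ->
  (forall x, 0 <= f x)%E -> (iint f = \int[leb n]_x f x)%E.
Proof.
elim: n f => [|n IH] f mf f0; first by rewrite ge0_integral_leb0.
rewrite ge0_integral_lebS//=; apply: eq_integral => t _; apply: IH => //.
apply: (measurableT_comp mf).
by apply: measurable_consv.
Qed.
End LebN.

(** * Real-valued integrals and Fubini's theorem *)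

Section Calc.
Context d (T : measurableType d) (R : realType).
Variable mu : {measure set T -> \bar R}.
Implicit Types f g : T -> R.

Definition ig f := mu.-integrable setT (EFin \o f).
(** [fine] sends infinite values to 0, which is why the linearity lemmas below ask for [ig], whereas
    [In_ge0] does not. *)
Definition In f : R := fine (\int[mu]_x (f x)%:E).

Lemma ig_meas f : ig f -> measurable_fun setT f.
Proof. by move/measurable_int/measurable_EFinP. Qed.

Lemma InE f : ig f -> (\int[mu]_x (f x)%:E)%E = (In f)%:E.
Proof. by move=> h; rewrite /In fineK//; exact: integrable_fin_num. Qed.

Lemma eq_In f g : f =1 g -> In f = In g.
Proof. by move=> /funext ->. Qed.

Lemma eq_ig f g : f =1 g -> ig f -> ig g.
Proof. by move=> /funext ->. Qed.

Lemma ig_le f g : measurable_fun setT f -> (forall x, `|f x| <= g x) -> ig g -> ig f.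
Proof.
move=> mf fg ig_g; apply: le_integrable ig_g => //; first exact/measurable_EFinP.
move=> x _ /=; rewrite lee_fin; apply: (le_trans (fg x)); exact: ler_norm.
Qed.

Lemma ig_abs f : ig f -> ig (fun x => `|f x|).
Proof. by move=> h; have := integrable_abse h. Qed.

Lemma igD f g : ig f -> ig g -> ig (fun x => f x + g x).
Proof. by move=> hf hg; have := integrableD measurableT hf hg. Qed.

Lemma igZ c f : ig f -> ig (fun x => c * f x).
Proof. by move=> hf; have := integrableZl measurableT c hf. Qed.

Lemma igN f : ig f -> ig (fun x => - f x).
Proof. by move=> hf; have := integrableN hf. Qed.

Lemma igB f g : ig f -> ig g -> ig (fun x => f x - g x).
Proof. by move=> hf hg; apply: igD => //; exact: igN. Qed.

Lemma InD f g : ig f -> ig g -> In (fun x => f x + g x) = In f + In g.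
Proof. by move=> hf hg; exact: RintegralD. Qed.

Lemma InZ c f : ig f -> In (fun x => c * f x) = c * In f.
Proof. by move=> hf; exact: RintegralZl. Qed.

Lemma InN f : ig f -> In (fun x => - f x) = - In f.
Proof.
move=> hf; rewrite -mulN1r -InZ//; apply: eq_In => x; by rewrite mulN1r.
Qed.

Lemma InB f g : ig f -> ig g -> In (fun x => f x - g x) = In f - In g.
Proof. by move=> hf hg; exact: RintegralB. Qed.

Lemma In_le f g : ig f -> ig g -> (forall x, f x <= g x) -> In f <= In g.
Proof. by move=> hf hg fg; apply: le_Rintegral. Qed.

Lemma In_ge0 f : (forall x, 0 <= f x) -> 0 <= In f.
Proof. by move=> h; exact: Rintegral_ge0. Qed.

Lemma In_abs f : ig f -> `|In f| <= In (fun x => `|f x|).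
Proof. by move=> h; exact: le_normr_Rintegral. Qed.

Lemma In_absle f g : ig f -> ig g -> (forall x, `|f x| <= g x) -> `|In f| <= In g.
Proof.
move=> hf hg h; apply: (le_trans (In_abs hf)); apply: In_le => //; exact: ig_abs.
Qed.

Lemma In0 : In (fun=> 0) = 0.
Proof. by rewrite /In integral0. Qed.

Lemma ig0 : ig (fun=> 0).
Proof. exact: integrable0. Qed.

Lemma ig_In_sum (I : Type) (r : seq I) (F : I -> T -> R) : (forall i, ig (F i)) ->
  ig (fun x => \sum_(i <- r) F i x) /\
  In (fun x => \sum_(i <- r) F i x) = \sum_(i <- r) In (F i).
Proof.
move=> h; elim: r => [|i r [IH1 IH2]].
  by rewrite (_ : (fun x => _) = fun=> 0) ?big_nil ?In0; [split=> //; exact: ig0|apply/funext => x; rewrite big_nil].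
rewrite (_ : (fun x => _) = fun x => F i x + \sum_(i <- r) F i x); last by apply/funext => x; rewrite big_cons.
by split; [exact: igD|rewrite big_cons -IH2 InD].
Qed.

Lemma ig_sum (I : finType) (F : I -> T -> R) : (forall i, ig (F i)) ->
  ig (fun x => \sum_i F i x).
Proof. by move=> h; have [] := ig_In_sum (index_enum I) h. Qed.

Lemma In_sum (I : finType) (F : I -> T -> R) : (forall i, ig (F i)) ->
  In (fun x => \sum_i F i x) = \sum_i In (F i).
Proof. by move=> h; have [] := ig_In_sum (index_enum I) h. Qed.

Lemma ge0_igP f : measurable_fun setT f -> (forall x, 0 <= f x) ->
  ig f <-> (\int[mu]_x (f x)%:E < +oo)%E.
Proof.
move=> mf f0; split=> [/integrableP[_]|h].
  by under eq_integral do rewrite /= ger0_norm//.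
apply/integrableP; split; first exact/measurable_EFinP.
by under eq_integral do rewrite /= ger0_norm//.
Qed.

Lemma In_gt0_le f g : measurable_fun setT f -> (forall x, 0 <= f x <= g x) -> ig g -> In f <= In g.
Proof.
move=> mf h hg; apply: In_le => //; last by move=> x; have /andP[] := h x.
apply: ig_le hg => // x; have /andP[h1 h2] := h x; by rewrite ger0_norm.
Qed.

End Calc.

Section RealFubini.
Context d1 d2 (T1 : measurableType d1) (T2 : measurableType d2) (R : realType).
Variables (m1 : {sigma_finite_measure set T1 -> \bar R}) (m2 : {sigma_finite_measure set T2 -> \bar R}).
Variable f : T1 -> T2 -> R.
Hypothesis mf : measurable_fun setT (fun p : T1 * T2 => f p.1 p.2).

Lemma measurable_slice1 x : measurable_fun setT (f x).
Proof. by have := measurableT_comp mf (measurable_pair1 x). Qed.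

Lemma measurable_slice2 y : measurable_fun setT (f ^~ y).
Proof. by have := measurableT_comp mf (measurable_pair2 y). Qed.

Lemma measurable_In1 : measurable_fun setT (fun x => In m2 (f x)).
Proof.
apply: measurableT_comp => //.
have mF : measurable_fun setT (fun p : T1 * T2 => (f p.1 p.2)%:E) by exact/measurable_EFinP.
under eq_fun do rewrite integralE.
apply: emeasurable_funB.
  have := measurable_fun_fubini_tonelli_F (m2 := m2) _ (measurable_funepos mF) (fun p => funepos_ge0 _ p).
  by congr measurable_fun; apply/funext => x; apply: eq_integral => y _; rewrite !funeposE.
have := measurable_fun_fubini_tonelli_F (m2 := m2) _ (measurable_funeneg mF) (fun p => funeneg_ge0 _ p).
by congr measurable_fun; apply/funext => x; apply: eq_integral => y _; rewrite !funenegE.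
Qed.

(** The bound [g] on the inner integrals of absolute values is Tonelli's criterion for integrability
    on the product. Every section, not just almost every one, is assumed integrable, so that the
    partial integrals coincide with [In] everywhere. *)
Lemma real_fubini g : (forall x, ig m2 (f x)) -> (forall y, ig m1 (f ^~ y)) ->
  ig m1 g -> (forall x, In m2 (fun y => `|f x y|) <= g x) ->
  [/\ ig m1 (fun x => In m2 (f x)), ig m2 (fun y => In m1 (f ^~ y)) &
      In m1 (fun x => In m2 (f x)) = In m2 (fun y => In m1 (f ^~ y))].
Proof.
move=> i2 i1 hg fg.
have mF : measurable_fun setT (fun p : T1 * T2 => (f p.1 p.2)%:E) by exact/measurable_EFinP.
have int12 : (m1 \x m2)%E.-integrable setT (fun p => (f p.1 p.2)%:E).
  apply/(integrable12ltyP _ _ mF); apply: (@le_lt_trans _ _ (\int[m1]_x (g x)%:E)%E).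
    apply: ge0_le_integral => //.
    - by move=> x _; exact: integral_ge0.
    - by apply: (measurable_fun_fubini_tonelli_F (fun p => `|(f p.1 p.2)%:E|%E)) => //; exact: measurableT_comp.
    - exact/measurable_EFinP/(ig_meas hg).
    - move=> x _; have h := InE (ig_abs (i2 x)).
      by rewrite [leLHS]h lee_fin.
  by rewrite (InE hg) ltry.
have e1 x : (\int[m2]_y (f x y)%:E)%E = (In m2 (f x))%:E by exact: InE.
have e2 y : (\int[m1]_x (f x y)%:E)%E = (In m1 (f^~ y))%:E by exact: InE.
have j1 : ig m1 (fun x => In m2 (f x)).
  have := integrable_fubini_F int12; congr integrable; apply/funext => x; exact: e1.
have j2 : ig m2 (fun y => In m1 (f ^~ y)).
  have mF' : measurable_fun setT (fun p : T2 * T1 => (f p.2 p.1)%:E).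
    by have := measurableT_comp mF (@measurable_swap _ _ T2 T1).
  have int21 : (m2 \x m1)%E.-integrable setT (fun p => (f p.2 p.1)%:E).
    by apply/(integrable12ltyP _ _ mF'); exact: ((integrable21ltyP m1 m2 mF).1 int12).
  have := integrable_fubini_F int21; congr integrable; apply/funext => x; exact: e2.
split => //.
have := Fubini int12; under eq_integral do rewrite /= e1.
under [RHS]eq_integral do rewrite /= e2.
by rewrite (InE j1) (InE j2) => -[].
Qed.

End RealFubini.

(** * Invariance of Lebesgue measure *)

Section LebInvariance.
Variable R : realType.
Local Notation Rm := (measurableTypeR R).
Local Notation la := (@lebesgue_measure R).
Local Notation leb n := (leb R n).

(** The image measure gives half-open intervals their length, and this characterizes Lebesgue
    measure. Scaling is handled in the same way. *)
Lemma ge0_integral_la_shift (a : R) (g : Rm -> \bar R) : measurable_fun setT g ->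
  (forall t, 0 <= g t)%E -> (\int[la]_t g (t + a)%R = \int[la]_t g t)%E.
Proof.
move=> mg g0.
have ms : measurable_fun setT (fun t : Rm => t + a : Rm).
  by apply: measurable_funD => //; exact: measurable_cst.
rewrite -[LHS](ge0_integral_pushforward ms la measurableT mg)//.
apply: eq_measure_integral => A mA _; apply/esym/lebesgue_measure_unique => // _ [[x y]] _ <-.
rewrite /pushforward.
rewrite [RHS](_ : _ = la `](x - a), (y - a)]%classic); last first.
  by congr (la _); apply/seteqP; split => t /=; rewrite !in_itv/= ltrBlDr lerBrDr.
by rewrite !lebesgue_measure_itv/= !lte_fin ltrD2r -!EFinD opprD addrACA subrr addr0.
Qed.

Lemma ge0_integral_la_opp (g : Rm -> \bar R) : measurable_fun setT g ->
  (forall t, 0 <= g t)%E -> (\int[la]_t g (- t)%R = \int[la]_t g t)%E.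
Proof.
move=> mg g0.
have ms : measurable_fun setT (fun t : Rm => - t : Rm) by exact: oppr_measurable.
rewrite -[LHS](ge0_integral_pushforward ms la measurableT mg)//.
apply: eq_measure_integral => A mA _; exact: lebesgue_measureN.
Qed.

Lemma ge0_integral_la_scale (c : R) (g : Rm -> \bar R) : 0 < c -> measurable_fun setT g ->
  (forall t, 0 <= g t)%E -> (c%:E * \int[la]_t g (c * t)%R = \int[la]_t g t)%E.
Proof.
move=> c0 mg g0.
have ms : measurable_fun setT (fun t : Rm => c * t : Rm) by exact: mulrl_measurable.
rewrite -[X in (_ * X)%E](ge0_integral_pushforward ms la measurableT mg)//.
have -> : c = (NngNum (ltW c0))%:num by [].
rewrite -[LHS](ge0_integral_mscale _ measurableT (NngNum (ltW c0)) mg)//.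
apply: eq_measure_integral => A mA _; apply/esym/lebesgue_measure_unique => // _ [[x y]] _ <-.
transitivity (c%:E * la `](x / c)%R, (y / c)%R]%classic)%E; last first.
  rewrite /mscale /pushforward; congr (_ * la _)%E; apply/seteqP.
  by split => t /=; rewrite !in_itv/= ltr_pdivrMr// ler_pdivlMr// ![t * c]mulrC.
rewrite !lebesgue_measure_itv/= !lte_fin ltr_pM2r ?invr_gt0//; case: ifP => // _; last by rewrite mule0.
by rewrite -!EFinB -EFinM mulrBr !mulrA ![c * _]mulrC !mulfK// gt_eqF.
Qed.

Lemma measurable_fubini_consv n (f : 'rV[R]_n.+1 -> \bar R) : measurable_fun setT f ->
  (forall x, 0 <= f x)%E -> measurable_fun setT (fun t : Rm => \int[leb n]_v f (consv t v))%E.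
Proof.
move=> mf f0.
apply: (measurable_fun_fubini_tonelli_F (m2 := leb n) (fun p => f (consv p.1 p.2))) => //.
by have := measurableT_comp mf (@measurable_consv_pair R n).
Qed.

Lemma measurable_consv_slice n d (T : measurableType d) (f : 'rV[R]_n.+1 -> T) t :
  measurable_fun setT f -> measurable_fun setT (fun v => f (consv t v)).
Proof.
move=> mf; have mt : measurable_fun setT (fun v : 'rV[R]_n => consv t v).
  by apply: measurable_consv; [exact: measurable_cst | exact: measurable_id].
exact: (measurableT_comp mf mt).
Qed.

(** Fubini reduces invariance under a coordinatewise map to invariance on the line; translations and
    the reflection through the origin are the two instances. *)
Lemma ge0_integral_leb_coord n (h : 'I_n -> Rm -> Rm) :
  (forall i, measurable_fun setT (h i)) ->
  (forall i (g : Rm -> \bar R), measurable_fun setT g -> (forall t, 0 <= g t)%E ->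
     (\int[la]_t g (h i t) = \int[la]_t g t)%E) ->
  forall f : 'rV[R]_n -> \bar R, measurable_fun setT f -> (forall x, 0 <= f x)%E ->
  (\int[leb n]_x f (\row_i h i (x 0%R i)) = \int[leb n]_x f x)%E.
Proof.
elim: n h => [|n IH] h mh hh f mf f0.
  rewrite !ge0_integral_leb0//; first by congr f; apply/rowP => -[].
  apply: (measurableT_comp mf); apply/measurable_rowP => -[]//.
have mr : measurable_fun setT (fun x : 'rV[R]_n.+1 => \row_i h i (x 0 i)).
  apply/measurable_rowP => i; under eq_fun do rewrite mxE.
  by apply: (measurableT_comp (mh i)); exact: measurable_coord.
have mf' := measurableT_comp mf mr.
rewrite !ge0_integral_lebS//.
transitivity (\int[la]_t \int[leb n]_v f (consv (h ord0 t) v))%E.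
  apply: eq_integral => t _.
  rewrite -(IH (fun i => h (lift ord0 i)) _ _ (fun v => f (consv (h ord0 t) v)))//.
  - apply: eq_integral => v _; congr f; apply/rV_consP.
      by rewrite mxE !consv0.
    by move=> i; rewrite mxE !consvS mxE.
  - by move=> i; exact: hh.
  - exact: measurable_consv_slice.
by rewrite (hh ord0 (fun t => \int[leb n]_v f (consv t v))%E) => //; [exact: measurable_fubini_consv|move=> t; exact: integral_ge0].
Qed.

Lemma ge0_integral_leb_shift n a (f : 'rV[R]_n -> \bar R) : measurable_fun setT f ->
  (forall x, 0 <= f x)%E -> (\int[leb n]_x f (x + a)%R = \int[leb n]_x f x)%E.
Proof.
move=> mf f0; rewrite -[RHS](@ge0_integral_leb_coord n (fun i t => t + a 0 i))//.
- by apply: eq_integral => x _; congr f; apply/rowP => i; rewrite !mxE.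
- by move=> i; apply: measurable_funD => //; exact: measurable_cst.
- by move=> i g mg g0; rewrite (@ge0_integral_la_shift (a 0 i)).
Qed.

Lemma ge0_integral_leb_opp n (f : 'rV[R]_n -> \bar R) : measurable_fun setT f ->
  (forall x, 0 <= f x)%E -> (\int[leb n]_x f (- x)%R = \int[leb n]_x f x)%E.
Proof.
move=> mf f0; rewrite -[RHS](@ge0_integral_leb_coord n (fun i t => - t))//.
- by apply: eq_integral => x _; congr f; apply/rowP => i; rewrite !mxE.
- by move=> i; exact: oppr_measurable.
- by move=> i g mg g0; rewrite ge0_integral_la_opp.
Qed.

Lemma ge0_integral_leb_prod n (g : 'I_n -> Rm -> R) :
  (forall i, measurable_fun setT (g i)) -> (forall i t, 0 <= g i t) ->
  (\int[leb n]_x (\prod_i g i (x 0%R i))%:E = \prod_i \int[la]_t (g i t)%:E)%E.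
Proof.
elim: n g => [|n IH] g mg g0.
  rewrite ge0_integral_leb0 ?big_ord0//; apply/measurable_EFinP.
  by under eq_fun do rewrite big_ord0; exact: measurable_cst.
have mp m (k : 'I_m -> Rm -> R) : (forall i, measurable_fun setT (k i)) ->
    measurable_fun setT (fun x : 'rV[R]_m => \prod_i k i (x 0%R i)).
  move=> mk; apply: measurable_prod => i _.
  by apply: (measurableT_comp (mk i)); exact: measurable_coord.
rewrite ge0_integral_lebS; last 2 first.
- by apply/measurable_EFinP; exact: mp.
- by move=> x; rewrite lee_fin prodr_ge0.
rewrite big_ord_recl.
transitivity (\int[la]_t ((g ord0 t)%:E * \prod_(i < n) \int[la]_t (g (lift ord0 i) t)%:E))%E.
  apply: eq_integral => t _.
  under eq_integral do rewrite big_ord_recl consv0 EFinM.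
  have mP : measurable_fun setT (fun v : 'rV[R]_n => (\prod_(i < n) g (lift ord0 i) (consv t v 0%R (lift ord0 i)))%:E).
    apply/measurable_EFinP; under eq_fun do under eq_bigr do rewrite consvS.
    exact: (mp _ (fun i => g (lift ord0 i))).
  rewrite (ge0_integralZl _ _ mP)//; last 2 first.
  - by move=> v _; rewrite lee_fin prodr_ge0.
  - by rewrite lee_fin.
  congr (_ * _)%E; rewrite -IH//; apply: eq_integral => v _.
  by congr (_%:E); apply: eq_bigr => i _; rewrite consvS.
rewrite ge0_integralZr//; last 3 first.
- exact/measurable_EFinP.
- by move=> t _; rewrite lee_fin.
- by apply: prode_ge0 => i _; apply: integral_ge0 => t _; rewrite lee_fin.
Qed.

(** Positive and negative parts are translated separately, so the identity holds with or without
    integrability. *)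
Lemma In_shift n a (f : 'rV[R]_n -> R) : measurable_fun setT f ->
  In (leb n) (fun x => f (x + a)) = In (leb n) f.
Proof.
move=> mf; have mF : measurable_fun setT (fun x => (f x)%:E) by exact/measurable_EFinP.
rewrite /In integralE [in RHS]integralE.
have := ge0_integral_leb_shift a (measurable_funepos mF) (fun x => funepos_ge0 _ x).
have := ge0_integral_leb_shift a (measurable_funeneg mF) (fun x => funeneg_ge0 _ x).
move=> <- <-; congr (fine (_ - _)); apply: eq_integral => x _.
  by rewrite !funeposE.
by rewrite !funenegE.
Qed.

Lemma In_opp n (f : 'rV[R]_n -> R) : measurable_fun setT f ->
  In (leb n) (fun x => f (- x)) = In (leb n) f.
Proof.
move=> mf; have mF : measurable_fun setT (fun x => (f x)%:E) by exact/measurable_EFinP.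
rewrite /In integralE [in RHS]integralE.
have := ge0_integral_leb_opp (measurable_funepos mF) (fun x => funepos_ge0 _ x).
have := ge0_integral_leb_opp (measurable_funeneg mF) (fun x => funeneg_ge0 _ x).
move=> <- <-; congr (fine (_ - _)); apply: eq_integral => x _.
  by rewrite !funeposE.
by rewrite !funenegE.
Qed.

Lemma measurable_rowD n d (T : measurableType d) (f g : T -> 'rV[R]_n) :
  measurable_fun setT f -> measurable_fun setT g -> measurable_fun setT (fun x => f x + g x).
Proof.
move=> /measurable_rowP mf /measurable_rowP mg; apply/measurable_rowP => i.
by under eq_fun do rewrite mxE; apply: measurable_funD; [exact: mf|exact: mg].
Qed.

Lemma measurable_rowN n d (T : measurableType d) (f : T -> 'rV[R]_n) :
  measurable_fun setT f -> measurable_fun setT (fun x => - f x).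
Proof.
move=> /measurable_rowP mf; apply/measurable_rowP => i.
under eq_fun do rewrite mxE; apply: (measurableT_comp (@oppr_measurable _ _)); exact: mf.
Qed.

Lemma measurable_rowZ n d (T : measurableType d) (c : T -> R) (f : T -> 'rV[R]_n) :
  measurable_fun setT c -> measurable_fun setT f -> measurable_fun setT (fun x => c x *: f x).
Proof.
move=> mc /measurable_rowP mf; apply/measurable_rowP => i.
by under eq_fun do rewrite mxE; apply: measurable_funM; [exact: mc|exact: mf].
Qed.

Lemma ig_shift n a (f : 'rV[R]_n -> R) : ig (leb n) f -> ig (leb n) (fun x => f (x + a)).
Proof.
move=> hf; have mf := ig_meas hf.
have ms : measurable_fun setT (fun x : 'rV[R]_n => x + a) by apply: measurable_rowD => //; exact: measurable_cst.
apply/integrableP; split; first by apply/measurable_EFinP; exact: (measurableT_comp mf ms).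
have mF : measurable_fun setT (fun x => `|(f x)%:E|%E) by apply: measurableT_comp => //; exact/measurable_EFinP.
rewrite (@ge0_integral_leb_shift n a (fun x => `|(f x)%:E|%E))//.
by have /integrableP[] := hf.
Qed.

Lemma ig_opp n (f : 'rV[R]_n -> R) : ig (leb n) f -> ig (leb n) (fun x => f (- x)).
Proof.
move=> hf; have mf := ig_meas hf.
have ms : measurable_fun setT (fun x : 'rV[R]_n => - x) by apply: measurable_rowN.
apply/integrableP; split; first by apply/measurable_EFinP; exact: (measurableT_comp mf ms).
have mF : measurable_fun setT (fun x => `|(f x)%:E|%E) by apply: measurableT_comp => //; exact/measurable_EFinP.
rewrite (@ge0_integral_leb_opp n (fun x => `|(f x)%:E|%E))//.
by have /integrableP[] := hf.
Qed.

End LebInvariance.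

(** * Derivatives along lines and integrals over intervals *)

Section Lines.
Variable R : realType.
Local Notation Rm := (measurableTypeR R).
Local Notation la := (@lebesgue_measure R).

Lemma is_derive_line (V : normedModType R) (F : V -> R) (x v : V) (s df : R) :
  is_derive (s *: v + x) v F df <-> is_derive s (1 : R) (fun r : R => F (r *: v + x)) df.
Proof.
have E : (fun h : R => h^-1 *: ((F \o shift (s *: v + x)) (h *: v) - F (s *: v + x))) =
    (fun h : R => h^-1 *: (((fun r : R => F (r *: v + x)) \o shift s) (h *: (1 : R)) - F (s *: v + x))).
  by apply/funext => h /=; rewrite -[h *: 1]/(h * 1) mulr1 scalerDl addrA.
split=> -[h1 h2]; split; rewrite /derivable /derive.
- by rewrite -E.
- by rewrite -E.
- by rewrite E.
- by rewrite E.
Qed.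

Lemma is_derive_comp_line (V : normedModType R) (phi : R -> R) (g : V -> R) (x v : V) (dg dphi : R) :
  is_derive x v g dg -> is_derive (g x) (1 : R) phi dphi ->
  is_derive x v (phi \o g) (dg * dphi).
Proof.
move=> hg hphi.
have h1 : is_derive (0 : R) (1 : R) (fun r : R => g (r *: v + x)) dg.
  by have := (is_derive_line g x v 0 dg).1; rewrite scale0r add0r; apply.
have h2 : is_derive (g ((0 : R) *: v + x)) (1 : R) phi dphi by rewrite scale0r add0r.
have := (is_derive_line (phi \o g) x v 0 _).2 (is_derive1_comp h2 h1).
by rewrite scale0r add0r mulrC.
Qed.

(** The interval enters as a numerical factor, so that the rules for [In] over the whole line apply
    without restricting the measure. *)
Definition Ii (a b : R) (g : R -> R) : R := In la (fun t : Rm => (a <= t <= b)%R%:R * g t).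

Lemma Ii_Rintegral a b g : Ii a b g = \int[la]_(t in `[a, b]) g t.
Proof.
rewrite Rintegral_mkcond; apply: eq_In => t; rewrite patchE mem_setE in_itv/=.
by case: ifP => _; rewrite ?mul1r ?mul0r.
Qed.

Lemma is_derive_continuous (g : R -> R) t d : is_derive t (1:R) g d -> {for t, continuous g}.
Proof. by move=> [h _]; apply/differentiable_continuous/derivable1_diffP. Qed.

Lemma FTC_Ii (g g' : R -> R) (a b : R) : a <= b ->
  (forall t, a <= t <= b -> is_derive t (1:R) g (g' t)) ->
  (forall t, a <= t <= b -> {for t, continuous g'}) ->
  Ii a b g' = g b - g a.
Proof.
rewrite le_eqVlt => /predU1P[<- _ _|ab dg cg].
  by rewrite Ii_Rintegral set_itv1 Rintegral_set1 subrr.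
have cg' t : a <= t <= b -> {for t, continuous g}.
  by move=> /dg; exact: is_derive_continuous.
rewrite Ii_Rintegral /Rintegral (@continuous_FTC2 _ g' g)//.
- apply: continuous_in_subspaceT => t; rewrite inE /= in_itv/=; exact: cg.
- split.
  + move=> t; rewrite in_itv/= => /andP[h1 h2]; have [] // := dg t _.
    by rewrite !ltW.
  + by apply: cvg_at_right_filter; apply: cg'; rewrite lexx ltW.
  + by apply: cvg_at_left_filter; apply: cg'; rewrite lexx ltW.
- move=> t; rewrite in_itv/= => /andP[h1 h2]; rewrite derive1E.
  by have [] // := dg t _; rewrite !ltW.
Qed.

Lemma measurable_itvb (a b : R) : measurable_fun setT (fun t : Rm => (a <= t <= b)%R%:R : R).
Proof.
have := @measurable_indic _ Rm R setT `[a, b]%classic (measurable_itv _).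
by congr measurable_fun; apply/funext => t; rewrite indicE mem_setE in_itv.
Qed.

Lemma ig_itvb (a b c : R) : ig la (fun t : Rm => (a <= t <= b)%R%:R * c).
Proof.
have h : ig la (fun t : Rm => (a <= t <= b)%R%:R : R).
  apply/(@ge0_igP _ _ _ la); [exact: measurable_itvb|by []|].
  rewrite (_ : (\int[la]_x _)%E = la `[a, b]%classic).
    by rewrite lebesgue_measure_itv/=; case: ifP => // _; rewrite -EFinB ltry.
  rewrite -[RHS]mul1e -(integral_cst la) // [RHS]integral_mkcond.
  by apply: eq_integral => t _; rewrite patchE mem_setE in_itv/=; case: ifP.
by have := igZ c h; apply: eq_ig => t; rewrite mulrC.
Qed.

Lemma ig_Ii a b c (g : Rm -> R) : measurable_fun setT g ->
  (forall t, a <= t <= b -> `|g t| <= c) -> ig la (fun t : Rm => (a <= t <= b)%R%:R * g t).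
Proof.
move=> mg hc; apply: (ig_le _ _ (ig_itvb a b c)).
  by apply: measurable_funM => //; exact: measurable_itvb.
by move=> t; case: (boolP (a <= t <= b)) => /= [/hc|_]; rewrite ?mul1r// !mul0r normr0.
Qed.

Lemma In_itvb (a b c : R) : a <= b -> In la (fun t : Rm => (a <= t <= b)%R%:R * c) = c * (b - a).
Proof.
move=> ab; rewrite mulrBr; apply: (@FTC_Ii (fun t => c * t) (fun=> c)) => // t _; last exact: cvg_cst.
have -> : (fun t => c * t) = c \*: (id : R -> R) by [].
by apply: is_derive_eq; rewrite -[_ *: _]/(_ * _) mulr1.
Qed.

Lemma Ii_ge0 a b g : (forall t, a <= t <= b -> 0 <= g t) -> 0 <= Ii a b g.
Proof. by move=> h; apply: In_ge0 => t; case: (boolP (a <= t <= b)) => /= [/h|_]; rewrite ?mul1r ?mul0r. Qed.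

End Lines.

(** * Integrals of compactly supported functions *)

Section CompactSupport.
Variable R : realType.
Local Notation Rm := (measurableTypeR R).
Local Notation la := (@lebesgue_measure R).
Local Notation leb n := (leb R n).

Lemma ig_cube n k (c : R) : ig (leb n) (fun x => \1_(@cube R n k) x * c).
Proof.
have h : ig (leb n) (fun x => \1_(@cube R n k) x).
  have mc := @measurable_cube R n k.
  apply/(@ge0_igP _ _ _ (leb n)); [exact: measurable_indic|by move=> x; rewrite indicE|].
  by rewrite integral_indic// setIT; exact: leb_cube.
by have := igZ c h; apply: eq_ig => t; rewrite mulrC.
Qed.

Lemma ig_csupp n k c (f : 'rV[R]_n -> R) : measurable_fun setT f ->
  (forall x, `|f x| <= c) -> (forall x, f x != 0 -> cube k x) -> ig (leb n) f.
Proof.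
move=> mf hc hk; apply: (ig_le mf _ (ig_cube n k c)) => x; rewrite indicE.
have [->|/hk h] := eqVneq (f x) 0; first by rewrite normr0 mulr_ge0// (le_trans _ (hc x)).
by rewrite mem_set// mul1r.
Qed.

Lemma closed_cube n k : closed (@cube R n k).
Proof.
have -> : @cube R n k = \bigcap_(i in [set: 'I_n]) [set x : 'rV[R]_n | `|x 0 i| <= k].
  by apply/seteqP; split => x /=; [move=> h i _; exact: h | move=> h i; exact: h].
apply: closed_bigI => i _.
have -> : [set x : 'rV[R]_n | `|x 0 i| <= k] = (fun x : 'rV[R]_n => `|x 0 i|) @^-1` [set t | t <= k] by [].
apply: closed_comp; last exact: closed_le.
by move=> x _; apply: continuous_comp; [exact: coord_continuous|exact: norm_continuous].
Qed.

Lemma compact_cube n k : compact (@cube R n k).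
Proof.
apply: bounded_closed_compact; last exact: closed_cube.
exists (`|k| + 1); split; first by rewrite num_real.
move=> M hM x hx; apply/ltW/row_norm_lt; first by apply: le_lt_trans hM; rewrite addr_ge0.
move=> i; apply: le_lt_trans (hx i) _; apply: lt_trans hM.
by apply: le_lt_trans (ler_norm _) _; rewrite ltrDl.
Qed.

Lemma continuous_cube_bounded n k (f : 'rV[R]_n -> R) : continuous f ->
  exists2 c, 0 <= c & forall x, cube k x -> `|f x| <= c.
Proof.
move=> cf; have /compact_bounded[M [_ hM]] : compact (f @` @cube R n k).
  by apply: continuous_compact; [exact/continuous_subspaceT|exact: compact_cube].
exists (`|M| + 1); first by rewrite addr_ge0.
move=> x hx; apply: (hM (`|M| + 1)); last by exists x.
by apply: le_lt_trans (ler_norm _) _; rewrite ltrDl.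
Qed.

Lemma csupp_bounded n k (f : 'rV[R]_n -> R) : continuous f ->
  (forall x, f x != 0 -> cube k x) -> exists2 c, 0 <= c & forall x, `|f x| <= c.
Proof.
move=> cf hk; have [c c0 hc] := @continuous_cube_bounded n k f cf.
exists c => // x; have [->|/hk/hc//] := eqVneq (f x) 0; by rewrite normr0.
Qed.

Lemma ig_ccsupp n k (f : 'rV[R]_n -> R) : continuous f ->
  (forall x, f x != 0 -> cube k x) -> ig (leb n) f.
Proof.
move=> cf hk; have [c _ hc] := csupp_bounded cf hk.
by apply: (ig_csupp _ hc hk); exact: continuous_row_measurable.
Qed.

(** A common bound and a common cube containing the supports supply the domination for Fubini; both
    are required only for [t] in the interval. *)
Lemma fubini_Ii n k c a b (f : 'rV[R]_n -> R -> R) : a <= b ->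
  measurable_fun setT (fun p : 'rV[R]_n * Rm => f p.1 p.2) ->
  (forall x t, a <= t <= b -> `|f x t| <= c) ->
  (forall x t, a <= t <= b -> f x t != 0 -> cube k x) ->
  [/\ ig (leb n) (fun x => Ii a b (f x)),
     ig la (fun t : Rm => (a <= t <= b)%R%:R * In (leb n) (f ^~ t)) &
  In (leb n) (fun x => Ii a b (f x)) = Ii a b (fun t => In (leb n) (f ^~ t))].
Proof.
move=> ab mf hc hk.
have c0 : 0 <= c by apply: le_trans (hc 0 a _) => //; rewrite lexx.
have mg : measurable_fun setT (fun p : 'rV[R]_n * Rm => (a <= p.2 <= b)%R%:R * f p.1 p.2).
  apply: measurable_funM => //.
  exact: (measurableT_comp (measurable_itvb a b) measurable_snd).
have m1 x : measurable_fun setT (f x) by exact: (measurable_slice1 mf).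
have m2 t : measurable_fun setT (f^~ t) by exact: (measurable_slice2 mf).
have i1 t : ig (leb n) (fun x => (a <= t <= b)%R%:R * f x t).
  case: (boolP (a <= t <= b)) => /= h; last by under eq_fun do rewrite mul0r; exact: ig0.
  under eq_fun do rewrite mul1r.
  by apply: (@ig_csupp n k c) => // x; [exact: hc|exact: hk].
have h0 x t : ~ cube k x -> (a <= t <= b)%R%:R * f x t = 0.
  move=> hx; case: (boolP (a <= t <= b)) => /= h; last by rewrite mul0r.
  by rewrite mul1r; apply/eqP/negPn/negP => /hk-/(_ h).
have hg x : In la (fun t : Rm => `|(a <= t <= b)%R%:R * f x t|) <= \1_(cube k) x * (c * (b - a)).
  rewrite indicE; case: (boolP (x \in _)) => /= [_|].
    rewrite mul1r -In_itvb//; apply: In_le.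
    + exact: (ig_abs (ig_Ii (m1 x) (fun t => hc x t))).
    + exact: ig_itvb.
    + move=> t; rewrite normrM normr_nat; case: (boolP (a <= t <= b)) => /= h; last by rewrite !mul0r.
      by rewrite !mul1r hc.
  rewrite notin_setE => hx; rewrite mul0r; under eq_In do rewrite h0// normr0.
  by rewrite In0.
have [j1 j2 e] := @real_fubini _ _ _ _ _ (leb n) la (fun x t => (a <= t <= b)%R%:R * f x t) mg
  (fun x => \1_(cube k) x * (c * (b - a))) (fun x => ig_Ii (m1 x) (fun t => hc x t)) i1 (ig_cube n k _) hg.
have e' t : In (leb n) (fun x => (a <= t <= b)%R%:R * f x t) = (a <= t <= b)%R%:R * In (leb n) (f^~ t).
  case: (boolP (a <= t <= b)) => /= h; last by rewrite mul0r; under eq_In do rewrite mul0r; exact: In0.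
  by rewrite mul1r; under eq_In do rewrite mul1r.
split => //; first by apply: eq_ig j2 => t; exact: e'.
by rewrite e; apply: eq_In => t; exact: e'.
Qed.

End CompactSupport.

(** * Partial derivatives and integration by parts *)

Section PartialCalculus.
Variables (R : realType) (n : nat).
Local Notation Rm := (measurableTypeR R).
Local Notation la := (@lebesgue_measure R).
Local Notation leb := (leb R n).
Implicit Types (i : 'I_n) (F G : 'rV[R]_n -> R) (x z : 'rV[R]_n).
Local Notation e i := (delta_mx 0 i : 'rV[R]_n).

Definition pd i F F' := forall x, is_derive x (e i) F (F' x).

Lemma pd_line i F F' : pd i F F' -> forall x (s : R),
  is_derive s (1 : R) (fun r : R => F (r *: e i + x)) (F' (s *: e i + x)).
Proof. by move=> h x s; exact: ((is_derive_line F x (e i) s _).1 (h _)). Qed.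

Lemma line_pd i F F' : (forall x, is_derive (0 : R) (1 : R) (fun r : R => F (r *: e i + x)) (F' x)) ->
  pd i F F'.
Proof. by move=> h x; have /is_derive_line := h x; rewrite scale0r add0r. Qed.

Lemma pd_shift i F F' a : pd i F F' -> pd i (fun x => F (x + a)) (fun x => F' (x + a)).
Proof.
move=> h; apply: line_pd => x.
have -> : (fun r : R => F (r *: e i + x + a)) = (fun r : R => F (r *: e i + (x + a))).
  by apply/funext => r; rewrite addrA.
by have := pd_line h (x + a) 0; rewrite scale0r add0r.
Qed.

Lemma pd_lshift i F F' a : pd i F F' -> pd i (fun x => F (a + x)) (fun x => F' (a + x)).
Proof.
move=> /(pd_shift a); congr pd; apply/funext => x; by rewrite addrC.
Qed.

Lemma pdM i F F' G G' : pd i F F' -> pd i G G' ->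
  pd i (fun x => F x * G x) (fun x => F x * G' x + F' x * G x).
Proof.
move=> hF hG x; have := is_deriveM (hF x) (hG x).
by rewrite [G x *: _]mulrC.
Qed.

Lemma pdZ i c F F' : pd i F F' -> pd i (fun x => c * F x) (fun x => c * F' x).
Proof. by move=> hF x; have := is_deriveZ c (hF x). Qed.

Lemma pd_ext i F F' G' : F' =1 G' -> pd i F F' -> pd i F G'.
Proof. by move=> /funext ->. Qed.

Lemma pd_coord i j : pd i (fun x => x 0 j) (fun=> (i == j)%:R).
Proof.
apply: line_pd => x.
have -> : (fun r : R => (r *: e i + x) 0 j) = (i == j)%:R \*: (id : R -> R) + cst (x 0 j).
  by apply/funext => r; rewrite !mxE eqxx [r * _]mulrC /= eq_sym.
by apply: is_derive_eq; rewrite addr0 -[_ *: _]/(_ * _) mulr1.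
Qed.

Lemma continuous_rowshift (f : 'rV[R]_n -> R) a : continuous f -> continuous (fun x => f (x + a)).
Proof.
move=> cf x; suff : {for x, continuous (f \o shift a)} by [].
rewrite continuous_shift.
have -> : (f \o shift a) \o shift x = f \o shift (x + a) by apply/funext => z /=; rewrite addrA.
rewrite -continuous_shift; exact: cf.
Qed.

Lemma continuous_rowlshift (f : 'rV[R]_n -> R) a : continuous f -> continuous (fun x => f (a + x)).
Proof.
move=> /(@continuous_rowshift f a); rewrite (_ : (fun x => f (x + a)) = (fun x => f (a + x)))//.
by apply/funext => x; rewrite addrC.
Qed.

Lemma continuousMr (f g : 'rV[R]_n -> R) : continuous f -> continuous g -> continuous (fun z => f z * g z).
Proof. by move=> cf cg z; exact: (cvgM (cf z) (cg z)). Qed.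

Lemma measurable_row_comp d (T : measurableType d) (g : T -> 'rV[R]_n) F :
  continuous F -> measurable_fun setT g -> measurable_fun setT (fun t => F (g t)).
Proof. by move=> /continuous_row_measurable mF mg; exact: (measurableT_comp mF mg). Qed.

Lemma measurable_line i : measurable_fun setT (fun p : 'rV[R]_n * Rm => p.2 *: e i + p.1).
Proof.
apply: measurable_rowD => //; apply: measurable_rowZ => //.
Qed.

Lemma continuous_line i F x : continuous F -> continuous (fun s : R => F (s *: e i + x)).
Proof.
move=> cF t; apply: (@continuous_comp _ _ _ (fun s : R => s *: e i + x) F); last exact: cF.
by apply: cvgD; [apply: cvgZr_tmp; exact: cvg_id|exact: cvg_cst].
Qed.

Lemma cube_line i (k b : R) x (s : R) : 0 <= s <= b -> cube k (s *: e i + x) -> cube (k + b) x.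
Proof.
move=> /andP[s0 sb] h j; have := h j; rewrite !mxE eqxx /= => hj.
have -> : x 0 j = (s * (j == i)%:R + x 0 j) - s * (j == i)%:R by rewrite addrC addKr.
apply: (le_trans (ler_normB _ _)); apply: lerD => //; case: (j == i) => /=.
  by rewrite mulr1 ger0_norm.
by rewrite mulr0 normr0 (le_trans s0).
Qed.

Lemma row_norm_coord x i : `|x 0 i| <= `|x|.
Proof.
apply/ler_addgt0Pr => eps e0; apply/ltW; move: i; apply/row_norm_lt; last by rewrite ltrDl.
by rewrite ltr_wpDl.
Qed.

(** Translation invariance takes the place of an integration in coordinate [i]. All translates of
    [F'] by [s e_i] have the same integral, and integrating them over [0 <= s <= 1] yields the
    integral of [F (x + e_i) - F x], which is 0. *)
Lemma In_pd0 i k F F' : pd i F F' -> continuous F -> continuous F' ->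
  (forall x, F x != 0 -> cube k x) -> (forall x, F' x != 0 -> cube k x) ->
  In leb F' = 0.
Proof.
move=> hF cF cF' sF sF'.
have [c c0 hc] := csupp_bounded cF' sF'.
have mF' := continuous_row_measurable cF'; have mF := continuous_row_measurable cF.
have [_ _ h] := @fubini_Ii R n (k + 1) c 0 1 (fun x s => F' (s *: e i + x)) ler01
  (measurable_row_comp cF' (measurable_line i)) (fun x t _ => hc _)
  (fun x t h1 h2 => cube_line h1 (sF' _ h2)).
have iF := ig_ccsupp cF sF.
have iFs : ig leb (fun x => F (x + e i)) by exact: ig_shift.
have e1 : In leb (fun x => Ii 0 1 (fun s => F' (s *: e i + x))) = 0.
  rewrite (_ : (fun x => _) = (fun x => F (x + e i) - F x)).
    by rewrite InB// In_shift// subrr.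
  apply/funext => x.
  rewrite [LHS](FTC_Ii ler01 (fun t _ => pd_line hF x t) (fun t _ => @continuous_line i F' x cF' t)).
  by rewrite scale1r scale0r add0r [e i + x]addrC.
have e2 t : In leb (fun x => F' (t *: e i + x)) = In leb F'.
  by rewrite -[RHS](In_shift (t *: e i))//; apply: eq_In => x; rewrite addrC.
move: h; rewrite e1 /Ii => /esym; under eq_In do rewrite e2.
by rewrite In_itvb// subr0 mulr1.
Qed.

Lemma In_ibp i k F F' G G' x : pd i F F' -> pd i G G' ->
  continuous F -> continuous F' -> continuous G -> continuous G' ->
  (forall z, G z != 0 -> cube k z) -> (forall z, G' z != 0 -> cube k z) ->
  In leb (fun z => F' (x + z) * G z) = - In leb (fun z => F (x + z) * G' z).
Proof.
move=> hF hG cF cF' cG cG' sG sG'.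
have hFx := pd_lshift x hF.
have c1 : continuous (fun z => F (x + z) * G' z) by apply: continuousMr => //; exact: continuous_rowlshift.
have c2 : continuous (fun z => F' (x + z) * G z) by apply: continuousMr => //; exact: continuous_rowlshift.
have c3 : continuous (fun z => F (x + z) * G z) by apply: continuousMr => //; exact: continuous_rowlshift.
have iA : ig leb (fun z => F (x + z) * G' z).
  by apply: (@ig_ccsupp _ _ k) => // z; rewrite mulf_eq0 negb_or => /andP[_ /sG'].
have iB : ig leb (fun z => F' (x + z) * G z).
  by apply: (@ig_ccsupp _ _ k) => // z; rewrite mulf_eq0 negb_or => /andP[_ /sG].
have := @In_pd0 i k _ _ (pdM hFx hG) c3; rewrite InD// => h.
apply/eqP; rewrite -addr_eq0 addrC h//.
- by move=> z; exact: (cvgD (c1 z) (c2 z)).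
- by move=> z; rewrite mulf_eq0 negb_or => /andP[_ /sG].
- move=> z; apply: contraNP => hz.
  have -> : G z = 0 by apply/eqP/negPn/negP => /sG.
  have -> : G' z = 0 by apply/eqP/negPn/negP => /sG'.
  by rewrite !mulr0 addr0.
Qed.

(** The difference of the two averages is the integral, along the segment, of the averages of [F'].
    Only these averages are bounded by [L]; nothing is asked of [F'] pointwise. Used to move the
    centre of an average of [u]. *)
Lemma In_shift_line_le i (k L : R) F F' (K : 'rV[R]_n -> R) x (d : R) : pd i F F' -> continuous F -> continuous F' ->
  continuous K -> (forall z, K z != 0 -> cube k z) ->
  (forall y, `|In leb (fun z => F' (y + z) * K z)| <= L) -> 0 <= d ->
  `|In leb (fun z => F (d *: e i + x + z) * K z) - In leb (fun z => F (x + z) * K z)| <= L * d.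
Proof.
move=> hF cF cF' cK sK hL d0.
have iy (f : 'rV[R]_n -> R) y : continuous f -> ig leb (fun z => f (y + z) * K z).
  move=> cf; apply: (@ig_ccsupp _ _ k).
    by apply: continuousMr => //; exact: continuous_rowlshift.
  by move=> z; rewrite mulf_eq0 negb_or => /andP[_ /sK].
have [cK0 cK00 hcK] := csupp_bounded cK sK.
have [c c0 hc] := @continuous_cube_bounded _ n (k + (d + `|x|)) F' cF'.
have xz z s : 0 <= s <= d -> cube k z -> cube (k + (d + `|x|)) (s *: e i + x + z).
  move=> /andP[s0 sd] hz j; rewrite addrC mxE; apply: (le_trans (ler_normD _ _)); apply: lerD => //.
  rewrite !mxE eqxx /=; apply: (le_trans (ler_normD _ _)); apply: lerD; last exact: row_norm_coord.
  by case: (j == i); rewrite ?mulr1 ?mulr0 ?normr0 ?ger0_norm// (le_trans s0).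
have m0 : measurable_fun setT (fun p : 'rV[R]_n * Rm => F' (p.2 *: e i + x + p.1) * K p.1).
  apply: measurable_funM; last exact: (measurableT_comp (continuous_row_measurable cK)).
  apply: measurable_row_comp => //; apply: measurable_rowD => //; apply: measurable_rowD => //.
  exact: measurable_rowZ.
have b0 z s : 0 <= s <= d -> `|F' (s *: e i + x + z) * K z| <= c * cK0.
  move=> hs; rewrite normrM; have [->|/sK hz] := eqVneq (K z) 0.
    by rewrite normr0 mulr0 mulr_ge0.
  by apply: ler_pM => //; apply: hc; exact: xz.
have s0 z s : 0 <= s <= d -> F' (s *: e i + x + z) * K z != 0 -> cube k z.
  by move=> hs; rewrite mulf_eq0 negb_or => /andP[_ /sK].
have [_ j2 E] := @fubini_Ii R n k (c * cK0) 0 d (fun z s => F' (s *: e i + x + z) * K z) d0 m0 b0 s0.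
rewrite -InB; [|exact: iy|exact: iy].
have -> : In leb (fun z => F (d *: e i + x + z) * K z - F (x + z) * K z) =
   In leb (fun z => Ii 0 d (fun s => F' (s *: e i + x + z) * K z)).
  apply: eq_In => z.
  have -> : (fun s => F' (s *: e i + x + z) * K z) = (fun s => K z * F' (s *: e i + (x + z))).
    by apply/funext => s; rewrite mulrC addrA.
  rewrite [RHS](FTC_Ii d0 (fun t _ => is_deriveZ (K z) (pd_line hF (x + z) t))
    (fun t _ => cvgM (cvg_cst (K z)) (@continuous_line i F' (x + z) cF' t))).
  by rewrite /= scale0r add0r addrA mulrC [F (x + z) * _]mulrC.
rewrite E; apply: (@le_trans _ _ (In la (fun t : Rm => (0 <= t <= d)%R%:R * L))); last by rewrite In_itvb// subr0.
apply: In_absle => //; first exact: ig_itvb.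
move=> t; rewrite normrM normr_nat; case: (boolP (0 <= t <= d)) => /= h; last by rewrite !mul0r.
by rewrite !mul1r.
Qed.

End PartialCalculus.

(** * Smooth functions and the kernels H *)

Section ContinuousReal.
Variables (R : realType) (T : topologicalType).
Implicit Types f g : T -> R.

Lemma ctD f g : continuous f -> continuous g -> continuous (fun x => f x + g x).
Proof. by move=> cf cg x; exact: (cvgD (cf x) (cg x)). Qed.

Lemma ctB f g : continuous f -> continuous g -> continuous (fun x => f x - g x).
Proof. by move=> cf cg x; exact: (cvgB (cf x) (cg x)). Qed.

Lemma ctM f g : continuous f -> continuous g -> continuous (fun x => f x * g x).
Proof. by move=> cf cg x; exact: (cvgM (cf x) (cg x)). Qed.

Lemma ct_cst (c : R) : continuous (fun _ : T => c).
Proof. by move=> x; exact: cvg_cst. Qed.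

Lemma ctZ c f : continuous f -> continuous (fun x => c * f x).
Proof. by move=> cf; apply: ctM => //; exact: ct_cst. Qed.

Lemma ctX f k : continuous f -> continuous (fun x => f x ^+ k).
Proof.
move=> cf; elim: k => [|k IH]; first exact: ct_cst.
by rewrite (_ : (fun x => _) = fun x => f x * f x ^+ k); [exact: ctM|apply/funext => x; rewrite exprS].
Qed.

Lemma ct_sum (I : Type) (r : seq I) (F : I -> T -> R) : (forall i, continuous (F i)) ->
  continuous (fun x => \sum_(i <- r) F i x).
Proof.
move=> h; elim: r => [|i r IH].
  by rewrite (_ : (fun x => _) = fun=> 0); [exact: ct_cst|apply/funext => x; rewrite big_nil].
rewrite (_ : (fun x => _) = fun x => F i x + \sum_(i <- r) F i x); first exact: ctD.
by apply/funext => x; rewrite big_cons.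
Qed.

End ContinuousReal.

Section Smooth.
Variables (R : realType) (n : nat).
Implicit Types (f g : 'rV[R]_n -> R).

Lemma smooth_continuous f : smooth f -> continuous f.
Proof. by move=> /(_ [::])[]. Qed.

Lemma smooth_pd f i : smooth f -> pd i f (partial i f).
Proof. by move=> /(_ [::])[_ h] x; split => //; exact: h. Qed.

Lemma smooth_partial f i : smooth f -> smooth (partial i f).
Proof.
move=> h s; have := h (rcons s i).
by rewrite /iter_partial foldr_rcons.
Qed.

Lemma iter_partialD f g : smooth f -> smooth g -> forall s,
  iter_partial s (fun x => f x + g x) = (fun x => iter_partial s f x + iter_partial s g x).
Proof.
move=> hf hg; elim=> [//|i s IH]; rewrite /= IH; apply/funext => x.
have [_ df] := hf s; have [_ dg] := hg s.
by rewrite /partial -[LHS]/('D__ (iter_partial s f + iter_partial s g) x) deriveD.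
Qed.

Lemma smoothD f g : smooth f -> smooth g -> smooth (fun x => f x + g x).
Proof.
move=> hf hg s; rewrite iter_partialD//; have [cf df] := hf s; have [cg dg] := hg s.
split; first by move=> x; exact: (cvgD (cf x) (cg x)).
by move=> i x; exact: (derivableD (df i x) (dg i x)).
Qed.

Lemma iter_partialN f : smooth f -> forall s,
  iter_partial s (fun x => - f x) = (fun x => - iter_partial s f x).
Proof.
move=> hf; elim=> [//|i s IH]; rewrite /= IH; apply/funext => x.
have [_ df] := hf s.
by rewrite /partial -[LHS]/('D__ (- iter_partial s f) x) deriveN.
Qed.

Lemma smoothN f : smooth f -> smooth (fun x => - f x).
Proof.
move=> hf s; rewrite iter_partialN//; have [cf df] := hf s.
split; first by move=> x; exact: (cvgN (cf x)).
by move=> i x; exact: (derivableN (df i x)).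
Qed.

Lemma smooth0 : smooth (fun _ : 'rV[R]_n => 0 : R).
Proof.
have h s : iter_partial s (fun _ : 'rV[R]_n => 0 : R) = cst 0.
  by elim: s => [//|i s /= ->]; apply/funext => x; rewrite /partial derive_cst.
by move=> s; rewrite h; split => [|i x]; [exact: ct_cst|exact: (@ex_derive _ _ _ _ _ _ _ (is_derive_cst _ _ _))].
Qed.

Lemma smooth_sum (I : Type) (r : seq I) (F : I -> 'rV[R]_n -> R) :
  (forall i, smooth (F i)) -> smooth (fun x => \sum_(i <- r) F i x).
Proof.
move=> h; elim: r => [|i r IH].
  by rewrite (_ : (fun x => _) = fun=> 0); [exact: smooth0|apply/funext => x; rewrite big_nil].
rewrite (_ : (fun x => _) = fun x => F i x + \sum_(i <- r) F i x); first exact: smoothD.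
by apply/funext => x; rewrite big_cons.
Qed.

Lemma smooth_lap f : smooth f -> smooth (lap f).
Proof. by move=> hf; apply: smooth_sum => i; do 2 apply: smooth_partial. Qed.

Lemma smooth_iter_lap f k : smooth f -> smooth (iter k (@lap R n) f).
Proof. by move=> hf; elim: k => [//|k IH]; exact: smooth_lap. Qed.

Lemma neglap_powE f k : smooth f -> neglap_pow k f = (fun x => (-1) ^+ k * iter k (@lap R n) f x).
Proof.
move=> hf; rewrite /neglap_pow; elim: k => [|k IH].
  by apply/funext => x; rewrite expr0 mul1r.
rewrite [LHS]iterS IH; apply/funext => x; rewrite iterS exprS mulN1r mulNr; congr (- _).
rewrite /lap mulr_sumr; apply: eq_bigr => i _.
have hk := smooth_iter_lap k hf.
have e1 : partial i (fun y => (-1) ^+ k * iter k (@lap R n) f y) =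
    (fun y => (-1) ^+ k * partial i (iter k (@lap R n) f) y).
  apply/funext => y; rewrite {1}/partial.
  by have [_ ->] := pdZ ((-1) ^+ k) (smooth_pd i hk) y.
rewrite e1 {1}/partial.
by have [_ ->] := pdZ ((-1) ^+ k) (smooth_pd i (smooth_partial i hk)) x.
Qed.

Lemma smooth_neglap_pow f k : smooth f -> smooth (neglap_pow k f).
Proof. by move=> hf; elim: k => [//|k IH]; apply: smoothN; exact: smooth_lap. Qed.

End Smooth.

Lemma exp_funE (R : realType) (f : R -> R) j r : (f ^+ j) r = f r ^+ j.
Proof. by elim: j => [//|j IH]; rewrite !exprS -IH. Qed.

Section Kernel.
Variables (R : realType) (n : nat).
Local Notation Rm := (measurableTypeR R).
Local Notation la := (@lebesgue_measure R).
Local Notation leb := (leb R n).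
Implicit Types (x z : 'rV[R]_n) (s t : R).
Local Notation e i := (delta_mx 0 i : 'rV[R]_n).

Definition nsq x : R := \sum_(i < n) x 0 i ^+ 2.

Lemma nsq_ge0 x : 0 <= nsq x.
Proof. by apply: sumr_ge0 => i _; exact: sqr_ge0. Qed.

Lemma coord_nsq x i : x 0 i ^+ 2 <= nsq x.
Proof. by rewrite /nsq (bigD1 i)//= lerDl sumr_ge0// => j _; exact: sqr_ge0. Qed.

Lemma enorm_sq x : enorm x ^+ 2 = nsq x.
Proof. by rewrite sqr_sqrtr// nsq_ge0. Qed.

Lemma enorm_ge0 x : 0 <= enorm x.
Proof. exact: sqrtr_ge0. Qed.

Lemma pd_nsq i : pd i nsq (fun x => 2 * x 0 i).
Proof.
apply: line_pd => x.
have -> : (fun r : R => nsq (r *: e i + x)) = (id : R -> R) ^+ 2 + (2 * x 0 i) \*: (id : R -> R) + cst (nsq x).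
  apply/funext => r; have -> : ((id : R -> R) ^+ 2 + (2 * x 0 i) \*: (id : R -> R) + cst (nsq x)) r =
    r ^+ 2 + 2 * x 0 i * r + nsq x by [].
  rewrite /nsq (bigD1 i)//= [in RHS](bigD1 i)//= !mxE !eqxx mulr1.
  under eq_bigr => j ji do rewrite !mxE eqxx (negbTE ji) mulr0 add0r.
  rewrite !addrA; congr (_ + _); ring.
by apply: is_derive_eq; rewrite /= expr1 -![_ *: _]/(_ * _); ring.
Qed.

Lemma continuous_nsq : continuous nsq.
Proof.
by apply: ct_sum => i; apply: ctX => x; exact: coord_continuous.
Qed.

(** Since [0 ^+ 0 = 1], exponent 0 gives the constant 1 rather than an indicator. Hence compact
    support of [H] starts at exponent 1, and differentiability everywhere at exponent 2. *)
Definition pospow k s : R := (Num.max 0 s) ^+ k.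

Lemma pospow_ge0 k s : 0 <= pospow k s.
Proof. by rewrite exprn_ge0// le_max lexx. Qed.

Lemma continuous_pospow k : continuous (pospow k).
Proof.
apply: ctX => s; apply: (@continuous_max _ R (cst 0) id); [exact: cvg_cst|exact: cvg_id].
Qed.

Lemma is_derive_pospow k s : is_derive s (1 : R) (pospow k.+2) (k.+2%:R * pospow k.+1 s).
Proof.
have [s0|s0|s0] := ltgtP s 0.
- rewrite {2}/pospow max_l ?ltW// expr0n mulr0.
  apply: (@near_eq_is_derive _ _ _ (cst 0)); rewrite ?oner_neq0//.
  by near=> y; rewrite /pospow max_l ?expr0n//; apply/ltW; near: y; exact: lt_nbhsl.
- have -> : pospow k.+1 s = s ^+ k.+1 by rewrite /pospow max_r// ltW.
  apply: (@near_eq_is_derive _ _ _ ((id : R -> R) ^+ k.+2)); rewrite ?oner_neq0//.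
    near=> y; have y0 : 0 < y by near: y; exact: lt_nbhsr.
    by rewrite exp_funE /pospow (_ : Num.max 0 y = y)//; apply: max_r; exact: ltW.
  by apply: is_derive_eq; rewrite /= -[_ *: _]/(_ * _) mulr1.
- rewrite s0 {2}/pospow maxxx expr0n mulr0.
  have c0 : pospow k.+1 x @[x --> (0:R)] --> (0:R).
    have := @continuous_pospow k.+1 0.
    by rewrite /continuous_at (_ : pospow k.+1 0 = 0)// /pospow maxxx expr0n.
  suff h : h^-1 *: ((pospow k.+2 \o shift 0) (h *: (1:R)) - pospow k.+2 0) @[h --> 0^'] --> (0 : R).
    by apply: DeriveDef; [apply/cvg_ex; exists 0|apply/cvg_lim].
  (* At 0 the difference quotient lies between [- pospow k.+1 h] and [pospow k.+1 h]: it is 0 for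
     negative [h] and equals the upper bound for positive [h]. *)
  apply: (@squeeze_cvgr _ _ _ _ (fun h : R => - pospow k.+1 h) (pospow k.+1)).
  + near=> h.
    have h0 : h != 0 by near: h; exact: nbhs_dnbhs_neq.
    have -> : h^-1 *: ((pospow k.+2 \o shift 0) (h *: (1:R)) - pospow k.+2 0) = h^-1 * pospow k.+2 h.
      by rewrite /= addr0 -[h *: 1]/(h * 1) mulr1 [pospow k.+2 0]/pospow maxxx expr0n subr0.
    have [hp|hn|h1] := ltgtP h 0; last by rewrite h1 eqxx in h0.
      have p0 l : pospow l.+1 h = 0 by rewrite /pospow max_l ?expr0n// ltW.
      by rewrite !p0 mulr0 oppr0 lexx.
    have p0 l : pospow l h = h ^+ l by rewrite /pospow max_r// ltW.
    rewrite !p0 [h ^+ k.+2]exprS mulrA mulVf// mul1r lexx andbT.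
    by rewrite (@le_trans _ _ 0)// ?oppr_le0 exprn_ge0// ltW.
  + rewrite -[X in _ --> X]oppr0; apply: cvgN; apply: cvg_within_filter; exact: c0.
  + apply: cvg_within_filter; exact: c0.
Unshelve. all: by end_near. Qed.

Definition H k t z : R := pospow k (1 - nsq z / t ^+ 2).

Lemma H_ge0 k t z : 0 <= H k t z. Proof. exact: pospow_ge0. Qed.

Lemma H_base t z : 0 <= Num.max 0 (1 - nsq z / t ^+ 2) <= 1.
Proof.
rewrite le_max lexx/= ge_max ler01/= gerBl.
by rewrite divr_ge0// ?nsq_ge0// sqr_ge0.
Qed.

Lemma H_le1 k t z : H k t z <= 1.
Proof. by have /andP[h1 h2] := H_base t z; exact: exprn_ile1. Qed.

Lemma H_mono j k t z : (j <= k)%N -> H k t z <= H j t z.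
Proof. by move=> jk; have /andP[h1 h2] := H_base t z; apply: ler_wiXn2l. Qed.

Lemma H_supp k t z : 0 < t -> H k.+1 t z != 0 -> nsq z < t ^+ 2.
Proof.
move=> t0; apply: contraNT; rewrite -leNgt => h; rewrite /H /pospow max_l ?expr0n//.
by rewrite subr_le0 ler_pdivlMr ?exprn_gt0// mul1r.
Qed.

Lemma nsq_cube t z : 0 <= t -> nsq z <= t ^+ 2 -> cube t z.
Proof.
move=> t0 h i; rewrite -ler_sqr ?nnegrE// real_normK ?num_real//.
exact: le_trans (coord_nsq z i) h.
Qed.

Lemma H_cube k t z : 0 < t -> H k.+1 t z != 0 -> cube t z.
Proof. by move=> t0 /(H_supp t0) h; apply: nsq_cube; apply/ltW. Qed.

Lemma continuous_H k t : continuous (H k t).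
Proof.
have c1 : continuous (fun z => 1 - nsq z / t ^+ 2).
  by apply: ctB; [exact: ct_cst|apply: ctM; [exact: continuous_nsq|exact: ct_cst]].
by move=> z; exact: (@continuous_comp _ _ _ _ (pospow k) z (c1 z) (@continuous_pospow k _)).
Qed.

(** On the support [nsq z / t^2] is 1 minus the base of the power. The quadratic weight is thus
    traded for a change of exponent, which keeps Laplacians of kernels inside the family [H]. *)
Lemma H_nsq k t z : 0 < t -> nsq z / t ^+ 2 * H k.+1 t z = H k.+1 t z - H k.+2 t z.
Proof.
move=> t0; rewrite /H /pospow; have [h|h] := leP (1 - nsq z / t ^+ 2) 0.
  by rewrite !expr0n mulr0 subr0.
rewrite [(_ : R) ^+ k.+2]exprS; ring.
Qed.

Definition dH k t i z := - (2 * k.+2%:R / t ^+ 2) * (z 0 i * H k.+1 t z).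

Lemma pd_H k t i : pd i (H k.+2 t) (dH k t i).
Proof.
move=> z.
have h : is_derive z (e i) (fun z => 1 - nsq z / t ^+ 2) (- (2 * z 0 i / t ^+ 2)).
  have h1 := is_deriveB (is_derive_cst (1:R) z (e i)) (is_deriveZ (t ^- 2) (pd_nsq i z)).
  rewrite (_ : (fun z => _) = cst 1 - (t ^- 2 \*: nsq)); last by apply/funext => y; rewrite /= mulrC.
  by rewrite (_ : - (_ / _) = 0 - (t ^- 2 *: (2 * z 0 i)))// sub0r -[_ *: _]/(_ * _) mulrC.
have := is_derive_comp_line h (is_derive_pospow k _).
by rewrite (_ : _ * _ = dH k t i z)// /dH /H; ring.
Qed.

Lemma continuous_coordH k t i : continuous (fun z => z 0 i * H k t z).
Proof. by move=> z; exact: (cvgM (@coord_continuous _ _ _ _ _ z) (@continuous_H k t z)). Qed.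

Lemma continuous_dH k t i : continuous (dH k t i).
Proof. by apply: ctZ; exact: continuous_coordH. Qed.

Lemma dH_cube k t i z : 0 < t -> dH k t i z != 0 -> cube t z.
Proof. by move=> t0; rewrite !mulf_eq0 !negb_or => /andP[_ /andP[_ /(H_cube t0)]]. Qed.

Definition ddH k t i z := - (2 * k.+3%:R / t ^+ 2) * (H k.+2 t z - (2 * k.+2%:R / t ^+ 2) * (z 0 i ^+ 2 * H k.+1 t z)).

Lemma pd_dH k t i : pd i (dH k.+1 t i) (ddH k t i).
Proof.
apply: pdZ; have := pdM (pd_coord i i) (pd_H k t i); apply: pd_ext => z.
by rewrite eqxx mul1r /dH; ring.
Qed.

Lemma continuous_ddH k t i : continuous (ddH k t i).
Proof.
apply: ctZ; apply: ctB; first exact: continuous_H.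
apply: ctZ; apply: ctM; last exact: continuous_H.
by apply: ctX => z; exact: coord_continuous.
Qed.

Lemma ddH_cube k t i z : 0 < t -> ddH k t i z != 0 -> cube t z.
Proof.
move=> t0; apply: contraNP => hz.
have hk j : H j.+1 t z = 0 by apply/eqP/negPn/negP => /(H_cube t0).
by rewrite /ddH !hk !(mulr0, subr0).
Qed.

(** This is the Laplacian of [H k.+3 t]: two derivatives lower the exponent by two, and [k.+1] is
    the smallest exponent that occurs. *)
Definition lapH k t z := \sum_i ddH k t i z.

Lemma lapH_nsq k t z : lapH k t z =
  - (2 * k.+3%:R / t ^+ 2) * (n%:R * H k.+2 t z - 2 * k.+2%:R * (nsq z / t ^+ 2 * H k.+1 t z)).
Proof.
rewrite /lapH /ddH -mulr_sumr sumrB sumr_const card_ord -mulr_natl -mulr_sumr -mulr_suml -/(nsq z).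
ring.
Qed.

Lemma lapHE k t z : 0 < t -> lapH k t z =
  t ^- 2 * ((4 * k.+3%:R * k.+2%:R) * H k.+1 t z - (2 * k.+3%:R * (n%:R + 2 * k.+2%:R)) * H k.+2 t z).
Proof. by move=> t0; rewrite lapH_nsq H_nsq//; ring. Qed.

Lemma In_lap k t (w : 'rV[R]_n -> R) x : 0 < t -> smooth w ->
  In leb (fun z => lap w (x + z) * H k.+3 t z) = In leb (fun z => w (x + z) * lapH k t z).
Proof.
move=> t0 sw.
have iP i : ig leb (fun z => partial i (partial i w) (x + z) * H k.+3 t z).
  apply: (@ig_ccsupp _ _ t).
    apply: continuousMr; last exact: continuous_H.
    by apply: continuous_rowlshift; apply: smooth_continuous; do 2 apply: smooth_partial.
  by move=> z; rewrite mulf_eq0 negb_or => /andP[_ /(H_cube t0)].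
have iQ i : ig leb (fun z => w (x + z) * ddH k t i z).
  apply: (@ig_ccsupp _ _ t).
    apply: continuousMr; last exact: continuous_ddH.
    by apply: continuous_rowlshift; exact: smooth_continuous.
  by move=> z; rewrite mulf_eq0 negb_or => /andP[_ /(ddH_cube t0)].
under eq_In do rewrite /lap mulr_suml.
under [RHS]eq_In do rewrite /lapH mulr_sumr.
rewrite !In_sum//; apply: eq_bigr => i _.
have swi := smooth_partial i sw; have swii := smooth_partial i swi.
rewrite (@In_ibp _ _ i t _ _ _ _ x (smooth_pd i swi) (pd_H k.+1 t i)); last 6 first.
- exact: smooth_continuous.
- exact: smooth_continuous.
- exact: continuous_H.
- exact: continuous_dH.
- by move=> z; exact: H_cube.
- by move=> z; exact: dH_cube.
rewrite (@In_ibp _ _ i t _ _ _ _ x (smooth_pd i sw) (pd_dH k t i)) ?opprK//.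
- exact: smooth_continuous.
- exact: smooth_continuous.
- exact: continuous_dH.
- exact: continuous_ddH.
- by move=> z; exact: dH_cube.
- by move=> z; exact: ddH_cube.
Qed.

(** For a kernel [t^-n h(z/t)] the scale derivative is [-1/t] times the divergence of
    [z t^-n h(z/t)]. With [h] of exponent [k.+2] the field [z H] is a multiple of the gradient of
    [H k.+3], and its divergence is a Laplacian. *)
Lemma is_derive_tH k z (t : R) : 0 < t ->
  is_derive t (1 : R) (fun r : R => r ^- n * H k.+2 r z) (t / (2 * k.+3%:R) * (t ^- n * lapH k t z)).
Proof.
move=> t0; have tn0 : t != 0 by rewrite gt_eqF.
have d1 : is_derive t (1 : R) (fun r : R => r^-1) (- t ^- 2).
  have := @is_deriveV R (id : R -> R) t 1 1 tn0 (is_derive_id _ _).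
  by rewrite -[_ *: _]/(_ * _) mulr1.
have d2 j : is_derive t (1 : R) (fun r : R => r ^- j) (- (j%:R * t ^- j.+1)).
  have := is_deriveX j d1.
  rewrite (_ : (fun r : R => r^-1) ^+ j = (fun r : R => r ^- j)); last first.
    by apply/funext => r; rewrite exp_funE exprVn.
  move=> hj; apply: (is_derive_eq hj); rewrite -[_ *: _]/(_ * _) mulrN; congr (- _).
  clear hj; case: j => [|j]; first by rewrite !mul0r.
  by rewrite /= -mulrA -exprVn -!exprVn -exprD addn2.
have h1 : is_derive t (1 : R) (fun r : R => 1 - nsq z * r ^- 2) (2 * nsq z * t ^- 3).
  have := is_deriveB (is_derive_cst (1:R) t 1) (is_deriveZ (nsq z) (d2 2)).
  by move=> hj; apply: (is_derive_eq hj); rewrite -[_ *: _]/(_ * _); ring.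
have h2 := @is_derive1_comp R (pospow k.+2) (fun r => 1 - nsq z * r ^- 2) t _ _ (is_derive_pospow k _) h1.
have hj := is_deriveM (d2 n) h2; apply: (is_derive_eq hj).
rewrite -![_ *: _]/(_ * _) lapH_nsq /H /=.
have k0 : k.+3%:R != 0 :> R by rewrite pnatr_eq0.
have tnn : t ^+ n != 0 by rewrite expf_neq0.
rewrite [t ^+ n.+1]exprS; field.
by rewrite tnn tn0 /=.
Qed.

End Kernel.

(** * Kernel averages and their scale ladder *)

Lemma measurable_invr (R : realType) : measurable_fun setT (fun t : measurableTypeR R => t^-1 : R).
Proof.
have -> : [set: measurableTypeR R] = [set t : R | t != 0] `|` [set 0].
  by apply/seteqP; split => t // _ /=; have [->|] := eqVneq t 0; [right|left].
have o : open [set t : R | t != 0] by exact: open_neq.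
apply/measurable_funU; [exact: open_measurable|exact: measurable_set1|split].
  apply: open_continuous_measurable_fun => // t; rewrite inE /= => t0; exact: inv_continuous.
exact: measurable_fun_set1.
Qed.

Section Averages.
Variables (R : realType) (n : nat).
Local Notation Rm := (measurableTypeR R).
Local Notation la := (@lebesgue_measure R).
Local Notation leb := (leb R n).
Implicit Types (x z : 'rV[R]_n) (s t a b : R) (w : 'rV[R]_n -> R).

Lemma measurable_invX d (T : measurableType d) (f : T -> R) k : measurable_fun setT f ->
  measurable_fun setT (fun y => f y ^- k).
Proof.
move=> mf; under eq_fun do rewrite -exprVn; apply: measurable_funX.
exact: (measurableT_comp (@measurable_invr R) mf).
Qed.

Lemma measurable_H k : measurable_fun setT (fun p : 'rV[R]_n * Rm => H k p.2 p.1).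
Proof.
have mp : measurable_fun setT (pospow k : R -> R).
  by apply: continuous_measurable_fun; exact: continuous_pospow.
apply: (measurableT_comp mp); apply: measurable_funB; first exact: measurable_cst.
apply: measurable_funM; last exact: measurable_invX.
by apply: measurable_row_comp => //; exact: continuous_nsq.
Qed.

Lemma measurable_nsq d (T : measurableType d) (f : T -> 'rV[R]_n) :
  measurable_fun setT f -> measurable_fun setT (fun y => nsq (f y)).
Proof. by move=> mf; apply: measurable_row_comp => //; exact: continuous_nsq. Qed.

Lemma measurable_lapH k : measurable_fun setT (fun p : 'rV[R]_n * Rm => lapH k p.2 p.1).
Proof.
under eq_fun do rewrite lapH_nsq.
apply: measurable_funM.
  apply: (measurableT_comp (@oppr_measurable R setT)).
  by apply: measurable_funM; [exact: measurable_cst|exact: measurable_invX].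
apply: measurable_funB; first by apply: measurable_funM; [exact: measurable_cst|exact: measurable_H].
apply: measurable_funM; first exact: measurable_cst.
apply: measurable_funM; last exact: measurable_H.
by apply: measurable_funM; [exact: measurable_nsq|exact: measurable_invX].
Qed.

Definition J k w x t : R := t ^- n * In leb (fun z => w (x + z) * H k t z).

Lemma ct_wH k w x t : continuous w -> continuous (fun z => w (x + z) * H k t z).
Proof.
by move=> cw; apply: ctM; [exact: continuous_rowlshift|exact: continuous_H].
Qed.

Lemma ig_wH k w x t : 0 < t -> continuous w -> ig leb (fun z => w (x + z) * H k.+1 t z).
Proof.
move=> t0 cw; apply: (@ig_ccsupp _ _ t); first exact: ct_wH.
by move=> z; rewrite mulf_eq0 negb_or => /andP[_ /(H_cube t0)].
Qed.

Lemma ig_H k t : 0 < t -> ig leb (H k.+1 t).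
Proof.
move=> t0; have := @ig_wH k (fun=> 1) 0 t t0 (@ct_cst _ _ _).
by apply: eq_ig => z; rewrite mul1r.
Qed.

Lemma measurable_In_wH k w x : continuous w ->
  measurable_fun setT (fun t : Rm => In leb (fun z => w (x + z) * H k t z)).
Proof.
move=> cw.
apply: (@measurable_In1 _ _ Rm 'rV[R]_n R leb (fun t z => w (x + z) * H k t z)).
apply: measurable_funM; last first.
  exact: (measurableT_comp (measurable_H k) (@measurable_swap _ _ Rm _)).
by apply: measurable_row_comp => //; apply: measurable_rowD => //; exact: measurable_cst.
Qed.

Lemma measurable_J k w x : continuous w -> measurable_fun setT (fun t : Rm => J k w x t).
Proof.
by move=> cw; apply: measurable_funM; [exact: measurable_invX|exact: measurable_In_wH].
Qed.

Lemma In_cube t : 0 <= t -> In leb (\1_(@cube R n t)) = (2 * t) ^+ n.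
Proof.
move=> t0; rewrite /In.
have -> : (\int[leb]_x (\1_(@cube R n t) x)%:E = \int[leb]_x (\prod_i (`|x 0%R i| <= t)%R%:R)%:E)%E.
  apply: eq_integral => x _; congr (_%:E); rewrite indicE.
  have [h|h] := boolP (x \in _).
    by move/set_mem : h => h; rewrite big1// => i _; rewrite h.
  have [i hi] : exists i, ~ (`|x 0 i| <= t).
    apply/existsNP => hx; move: h; rewrite notin_setE; exact.
  by rewrite (bigD1 i)//= (negbTE (introN idP hi)) mul0r.
rewrite (ge0_integral_leb_prod (g := fun i t' => (`|t'| <= t)%R%:R))//; last first.
  move=> i; have := @measurable_itvb R (- t) t; congr measurable_fun.
  by apply/funext => s; rewrite ler_norml.
have -> : (\int[la]_s (`|s| <= t)%R%:R%:E = (2 * t)%:E)%E.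
  have -> : (\int[la]_s (`|s| <= t)%R%:R%:E = \int[la]_s ((- t <= s <= t)%R%:R * 1)%:E)%E.
    by apply: eq_integral => s _; rewrite ler_norml mulr1.
  rewrite InE; last exact: ig_itvb.
  by rewrite In_itvb ?ge0_cp// mul1r opprK mulr2n mulrDl mul1r.
have -> // : (\prod_(i < n) (2 * t)%:E = ((2 * t) ^+ n)%:E)%E.
elim: n => [|m IH]; first by rewrite big_ord0.
by rewrite big_ord_recl IH exprS EFinM.
Qed.

Lemma ig_1cube t : ig leb (\1_(@cube R n t)).
Proof. by have := ig_cube n t (1 : R); apply: eq_ig => x; rewrite mulr1. Qed.

Lemma H_le_cube k t z : 0 < t -> H k.+1 t z <= \1_(cube t) z.
Proof.
move=> t0; rewrite indicE; have [h|h] := boolP (z \in _); first exact: H_le1.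
rewrite notin_setE in h; rewrite le_eqVlt; apply/orP; left; apply/eqP.
by apply/eqP/negPn/negP => /(H_cube t0).
Qed.

Lemma In_H_le k t : 0 < t -> In leb (H k.+1 t) <= (2 * t) ^+ n.
Proof.
move=> t0; have t0' := ltW t0; rewrite -In_cube//; apply: In_le; [exact: ig_H|exact: ig_1cube|].
by move=> z; exact: H_le_cube.
Qed.

(** On the cube of half-side [t/(2n)] one has [nsq z <= t^2/4], so the kernel is at least a power of
    3/4 there; this cube has volume [(t/n)^n]. *)
Lemma In_H_ge k t : 0 < t -> (0 < n)%N -> (3 / 4) ^+ k.+1 * (t / n%:R) ^+ n <= In leb (H k.+1 t).
Proof.
move=> t0 n0.
have nR : 0 < n%:R :> R by rewrite ltr0n.
have e1 : t / n%:R = 2 * (t / (2 * n%:R)) by field; rewrite pnatr_eq0 -lt0n.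
have t0' := ltW t0; rewrite e1 -In_cube ?divr_ge0 ?mulr_ge0// -InZ; last exact: ig_1cube.
apply: In_le; [by apply: igZ; exact: ig_1cube|exact: ig_H|].
move=> z; rewrite indicE; have [/set_mem h|h] := boolP (z \in _); last by rewrite mulr0 H_ge0.
rewrite mulr1 /H /pospow; apply: lerXn2r; rewrite ?nnegrE ?le_max ?lexx ?divr_ge0//.
rewrite (_ : 3 / 4 = 1 - 1 / 4); last by field.
apply/orP; right; rewrite lerD2l lerN2 ler_pdivrMr ?exprn_gt0//.
apply: (@le_trans _ _ (\sum_(i < n) (t / (2 * n%:R)) ^+ 2)).
  apply: ler_sum => i _; rewrite -[x in x <= _]real_normK ?num_real//.
  by rewrite lerXn2r ?nnegrE// divr_ge0 ?mulr_ge0.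
rewrite sumr_const card_ord -[X in X <= _]mulr_natl.
have -> : n%:R * (t / (2 * n%:R)) ^+ 2 = (1 / 4 * t ^+ 2) / n%:R by field; rewrite pnatr_eq0 -lt0n.
by rewrite ler_pdivrMr// ler_peMr ?mulr_ge0 ?sqr_ge0 ?divr_ge0// ler1n.
Qed.

Lemma J_le k w x t M : 0 < t -> continuous w -> 0 <= M -> (forall z, cube t z -> `|w (x + z)| <= M) ->
  `|J k.+1 w x t| <= M * 2 ^+ n.
Proof.
move=> t0 cw M0 hM; have t0' := ltW t0; rewrite /J normrM ger0_norm ?invr_ge0 ?exprn_ge0//.
rewrite [leLHS]mulrC ler_pdivrMr ?exprn_gt0// -mulrA -exprMn.
apply: (@le_trans _ _ (M * In leb (H k.+1 t))); last by rewrite ler_wpM2l// In_H_le.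
rewrite -InZ; last exact: ig_H.
apply: In_absle; [exact: ig_wH|by apply: igZ; exact: ig_H|].
move=> z; rewrite normrM (ger0_norm (H_ge0 _ _ _)).
have [->|/(H_cube t0) hz] := eqVneq (H k.+1 t z) 0; first by rewrite !mulr0.
by rewrite ler_wpM2r ?H_ge0// hM.
Qed.

Lemma J_bounded k w x a b : 0 < a -> continuous w ->
  exists2 c, 0 <= c & forall t, a <= t <= b -> `|J k.+1 w x t| <= c.
Proof.
move=> a0 cw.
have [M M0 hM] := @continuous_cube_bounded _ _ b _ (@continuous_rowlshift _ _ w x cw).
exists (M * 2 ^+ n) => [|t /andP[at' tb]]; first by rewrite mulr_ge0 ?exprn_ge0.
apply: J_le => //; first exact: lt_le_trans at'.
by move=> z hz; apply: hM => i; exact: le_trans (hz i) tb.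
Qed.

Lemma ddH_bound k t z : 0 < t -> `|lapH k t z| <= t ^- 2 * (4 * k.+3%:R * k.+2%:R + 2 * k.+3%:R * (n%:R + 2 * k.+2%:R)).
Proof.
move=> t0; have t0' := ltW t0; rewrite lapHE// normrM ger0_norm ?invr_ge0 ?exprn_ge0//.
apply: ler_wpM2l; first by rewrite invr_ge0 exprn_ge0.
have c1 : 0 <= 4 * k.+3%:R * k.+2%:R :> R by rewrite -!natrM.
have c2 : 0 <= 2 * k.+3%:R * (n%:R + 2 * k.+2%:R) :> R by rewrite -!natrM -natrD -natrM.
apply: (le_trans (ler_normB _ _)); apply: lerD; rewrite normrM ger0_norm//.
  by rewrite ler_piMr// ger0_norm ?H_ge0// H_le1.
by rewrite ler_piMr// ger0_norm ?H_ge0// H_le1.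
Qed.

Lemma lapH_cube k t z : 0 < t -> lapH k t z != 0 -> cube t z.
Proof.
move=> t0; apply: contraNP => hz.
have hk j : H j.+1 t z = 0 by apply/eqP/negPn/negP => /(H_cube t0).
by rewrite lapHE// !hk !(mulr0, subr0).
Qed.

(** Differentiate the kernel in the scale, exchange the integrals, and move the Laplacian from the
    kernel to [w] by two integrations by parts. *)
Lemma J_ladder k w x a b : smooth w -> 0 < a -> a <= b ->
  J k.+2 w x b - J k.+2 w x a = Ii a b (fun t => t / (2 * k.+3%:R) * J k.+3 (lap w) x t).
Proof.
move=> sw a0 ab; have cw := smooth_continuous sw.
have b0 : 0 < b by exact: lt_le_trans ab.
have a0' := ltW a0; have b0' := ltW b0.
have [M M0 hM] := @continuous_cube_bounded _ _ b _ (@continuous_rowlshift _ _ w x cw).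
set c := 4 * k.+3%:R * k.+2%:R + 2 * k.+3%:R * (n%:R + 2 * k.+2%:R) : R.
have c0 : 0 <= c by rewrite /c -!natrM -natrD -natrM -natrD.
pose f z t := w (x + z) * (t / (2 * k.+3%:R) * (t ^- n * lapH k t z)).
have mf : measurable_fun setT (fun p : 'rV[R]_n * Rm => f p.1 p.2).
  apply: measurable_funM.
    by apply: measurable_row_comp => //; apply: measurable_rowD => //; exact: measurable_cst.
  apply: measurable_funM; first by apply: measurable_funM => //; exact: measurable_cst.
  by apply: measurable_funM; [exact: measurable_invX|exact: measurable_lapH].
have bf z t : a <= t <= b -> `|f z t| <= M * (b * (a ^- n * (a ^- 2 * c))).
  move=> /andP[at' tb]; have t0 : 0 < t by exact: lt_le_trans at'.
  have t0' := ltW t0.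
  rewrite /f; have [->|hz] := eqVneq (lapH k t z) 0.
    by rewrite !mulr0 normr0 !mulr_ge0 ?invr_ge0 ?exprn_ge0.
  rewrite normrM; apply: ler_pM => //.
    by apply: hM => i; apply: le_trans tb; exact: (lapH_cube t0 hz).
  rewrite normrM; apply: ler_pM => //.
    rewrite ger0_norm ?divr_ge0 ?mulr_ge0// ler_pdivrMr ?mulr_gt0//.
    apply: (le_trans tb); rewrite ler_peMr//.
    by rewrite -natrM ler1n muln_gt0.
  rewrite normrM; apply: ler_pM => //.
    rewrite ger0_norm ?invr_ge0 ?exprn_ge0// lef_pV2 ?posrE ?exprn_gt0//.
    by rewrite lerXn2r ?nnegrE.
  apply: (le_trans (ddH_bound k z t0)); rewrite ler_wpM2r// lef_pV2 ?posrE ?exprn_gt0//.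
  by rewrite lerXn2r ?nnegrE.
have sf z t : a <= t <= b -> f z t != 0 -> cube b z.
  move=> /andP[at' tb]; have t0 : 0 < t by exact: lt_le_trans at'.
  rewrite !mulf_eq0 !negb_or => /andP[_ /andP[_ /andP[_ /(lapH_cube t0) h]]] i.
  exact: le_trans (h i) tb.
have [_ _ E] := fubini_Ii ab mf bf sf.
have -> : J k.+2 w x b - J k.+2 w x a = In leb (fun z => Ii a b (f z)).
  rewrite /J -InZ; last exact: ig_wH.
  rewrite -InZ; last exact: ig_wH.
  rewrite -InB; [|by apply: igZ; exact: ig_wH|by apply: igZ; exact: ig_wH].
  apply: eq_In => z.
  have dt t : a <= t <= b -> is_derive t (1:R) (fun t => w (x + z) * (t ^- n * H k.+2 t z)) (f z t).
    move=> /andP[at' tb]; have t0 : 0 < t by exact: lt_le_trans at'.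
    by have := is_deriveZ (w (x + z)) (is_derive_tH k z t0).
  have ct t : a <= t <= b -> {for t, continuous (f z)}.
    move=> /andP[at' tb]; have t0 : 0 < t by exact: lt_le_trans at'.
    have tn0 : t != 0 by rewrite gt_eqF.
    have cV : {for t, continuous (fun r : R => r^-1)} by exact: inv_continuous.
    have cVX j : {for t, continuous (fun r : R => r ^- j)}.
      rewrite (_ : (fun r : R => r ^- j) = (fun r : R => (r^-1) ^+ j)); last by apply/funext => r; rewrite exprVn.
      elim: j => [|j IH]; first exact: cvg_cst.
      by rewrite (_ : (fun r => _) = fun r : R => r^-1 * r^-1 ^+ j); [exact: cvgM cV IH|apply/funext => r; rewrite exprS].
    have cH j : {for t, continuous (fun r : R => H j r z)}.
      apply: (@continuous_comp _ _ _ (fun r : R => 1 - nsq z * r ^- 2) (pospow j)); last exact: continuous_pospow.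
      exact: (cvgB (cvg_cst _) (cvgM (cvg_cst (nsq z)) (cVX 2%N))).
    rewrite (_ : f z = (fun t => w (x + z) * (t / (2 * k.+3%:R) * (t ^- n * (- (2 * k.+3%:R / t ^+ 2) *
      (n%:R * H k.+2 t z - 2 * k.+2%:R * (nsq z / t ^+ 2 * H k.+1 t z))))))); last first.
      by apply/funext => r; rewrite /f lapH_nsq.
    apply: cvgM; first exact: cvg_cst.
    apply: cvgM; first by apply: cvgM; [exact: cvg_id|exact: cvg_cst].
    apply: cvgM; first exact: cVX.
    apply: cvgM; first by apply: cvgN; apply: cvgM; [exact: cvg_cst|exact: cVX].
    apply: cvgB; first by apply: cvgM; [exact: cvg_cst|exact: cH].
    apply: cvgM; first exact: cvg_cst.
    by apply: cvgM; [apply: cvgM; [exact: cvg_cst|exact: cVX]|exact: cH].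
  by rewrite [RHS](FTC_Ii ab dt ct); ring.
rewrite E; apply: eq_In => t; have [/andP[at' tb]|_] := boolP (a <= t <= b); last by rewrite !mul0r.
have t0 : 0 < t by exact: lt_le_trans at'.
rewrite !mul1r /J (In_lap k x t0 sw) /f.
have iw : ig leb (fun z => w (x + z) * lapH k t z).
  apply: (@ig_ccsupp _ _ t); last by move=> z; rewrite mulf_eq0 negb_or => /andP[_ /(lapH_cube t0)].
  apply: ctM; first exact: continuous_rowlshift.
  by apply: ct_sum => i; exact: continuous_ddH.
by rewrite mulrA -InZ//; apply: eq_In => z; ring.
Qed.
End Averages.

(** * Iterating the scale ladder *)

Section Taylor.
Variables (R : realType) (n : nat).
Local Notation Rm := (measurableTypeR R).
Local Notation la := (@lebesgue_measure R).
Local Notation leb := (leb R n).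
Implicit Types (x z : 'rV[R]_n) (s t a b : R) (w : 'rV[R]_n -> R).

Lemma measurable_boolR d (T : measurableType d) (P : T -> bool) :
  measurable_fun setT P -> measurable_fun setT (fun y => (P y)%:R : R).
Proof.
move=> mP; rewrite (_ : (fun y => _) = (fun y => if P y then 1 else 0 : R)).
  by apply: measurable_fun_ifT => //; exact: measurable_cst.
by apply/funext => y; case: (P y).
Qed.

(** Exchanging the order of integration leaves the inner integral of [t^l] over [[a, s]], which is
    at most [s^(l+1)]. So two nested integrals collapse into one and the power rises by two. *)
Lemma Ii_iter (q : Rm -> R) l a b c : 0 < a -> a <= b -> measurable_fun setT q ->
  (forall t, a <= t <= b -> 0 <= q t <= c) ->
  ig la (fun t : Rm => (a <= t <= b)%R%:R * (t ^+ l * Ii t b (fun s => s * q s))) /\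
  Ii a b (fun t => t ^+ l * Ii t b (fun s => s * q s)) <= Ii a b (fun s => s ^+ l.+2 * q s).
Proof.
move=> a0 ab mq qc.
have b0 : 0 < b by exact: lt_le_trans ab.
have c0 : 0 <= c by have /andP[h1 h2] := qc a (introT andP (conj (lexx a) ab)); exact: le_trans h2.
pose f (t s : Rm) : R := (a <= t <= b)%R%:R * (t ^+ l * ((t <= s <= b)%R%:R * (s * q s))).
have msq : measurable_fun setT (fun s : Rm => s * q s) by exact: measurable_funM.
have mf : measurable_fun setT (fun p : Rm * Rm => f p.1 p.2).
  apply: measurable_funM.
    exact: (measurableT_comp (measurable_itvb a b) measurable_fst).
  apply: measurable_funM; first exact: measurable_funX.
  apply: measurable_funM; last exact: (measurableT_comp msq measurable_snd).
  apply: measurable_boolR; apply: measurable_and; first exact: measurable_fun_ler.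
  by apply: measurable_fun_ler => //; exact: measurable_cst.
have sqb t s : a <= t <= b -> t <= s <= b -> `|s * q s| <= b * c.
  move=> /andP[at' tb] /andP[ts sb]; have as' := le_trans at' ts.
  have /andP[q0 qc'] := qc s (introT andP (conj as' sb)).
  have s0 := le_trans (ltW a0) as'.
  by rewrite ger0_norm ?mulr_ge0//; apply: ler_pM.
have i2 t : ig la (f t).
  have [h|h] := boolP (a <= t <= b); last first.
    by apply: eq_ig (@ig0 _ _ _ la) => s; rewrite /f (negbTE h) mul0r.
  have := igZ (t ^+ l) (@ig_Ii _ t b (b * c) _ msq (fun s => sqb t s h)).
  by apply: eq_ig => s; rewrite /f h mul1r.
(* The triangle [a <= t <= s <= b], now with [s] as the outer variable. *)
have fE s t : f t s = (a <= s <= b)%R%:R * (s * q s) * ((a <= t <= s)%R%:R * t ^+ l).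
  rewrite /f; case: (boolP (a <= t)) => at'; rewrite /= ?(mul0r, mulr0)//.
  case: (boolP (t <= b)) => tb; rewrite /=; last first.
    case: (boolP (t <= s)) => ts; rewrite ?andbF /= ?(mul0r, mulr0)//.
    by rewrite (negbTE (_ : ~~ (s <= b))) ?andbF ?(mul0r)//; apply: contraNN tb => /(le_trans ts).
  case: (boolP (t <= s)) => ts; rewrite /= ?(mul0r, mulr0)//.
  by rewrite (le_trans at' ts) /= !mul1r; ring.
have i1s s : ig la (fun t : Rm => (a <= t <= s)%R%:R * t ^+ l).
  apply: (@ig_Ii _ a s (`|s| ^+ l)); first exact: measurable_funX.
  move=> t /andP[at' ts]; have t0 := le_trans (ltW a0) at'.
  by rewrite ger0_norm ?exprn_ge0// lerXn2r ?nnegrE// (le_trans ts) ?ler_norm.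
have i1 s : ig la (f ^~ s).
  have := igZ ((a <= s <= b)%R%:R * (s * q s)) (i1s s).
  by apply: eq_ig => t; rewrite fE.
have mX : measurable_fun setT (fun t : Rm => t ^+ l) by exact: measurable_funX.
have bl t : a <= t <= b -> `|t ^+ l| <= b ^+ l.
  move=> /andP[at' tb]; have t0 := le_trans (ltW a0) at'.
  by rewrite ger0_norm ?exprn_ge0// lerXn2r ?nnegrE// ltW.
have hg t : In la (fun s => `|f t s|) <= (a <= t <= b)%R%:R * (b ^+ l * (b * c * b)).
  have [h|h] := boolP (a <= t <= b); last first.
    by rewrite mul0r; under eq_In do rewrite /f (negbTE h) mul0r normr0; rewrite In0.
  rewrite mul1r; have /andP[at' tb] := h; have t0 := le_trans (ltW a0) at'.
  apply: (@le_trans _ _ (In la (fun s : Rm => (t <= s <= b)%R%:R * (b ^+ l * (b * c))))).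
    apply: In_le; [exact: ig_abs|exact: ig_itvb|].
    move=> s; rewrite /f h mul1r !normrM normr_nat.
    have [h'|h'] := boolP (t <= s <= b); last by rewrite !mul0r mulr0.
    by rewrite !mul1r; apply: ler_pM => //; [exact: bl|rewrite -normrM; exact: (sqb t)].
  have b0' := ltW b0; rewrite In_itvb// [leRHS]mulrA; apply: ler_wpM2l; last by rewrite gerBl (le_trans (ltW a0)).
  by rewrite mulr_ge0 ?exprn_ge0// mulr_ge0.
have [j1 j2 E] := real_fubini mf i2 i1 (ig_itvb a b _) hg.
have eI t : (a <= t <= b)%R%:R * (t ^+ l * Ii t b (fun s => s * q s)) = In la (f t).
  have [h|h] := boolP (a <= t <= b); last first.
    by rewrite mul0r; under eq_In do rewrite /f (negbTE h) mul0r; rewrite In0.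
  rewrite mul1r /Ii -InZ; last by apply: (@ig_Ii _ t b (b * c)) => // s; exact: sqb.
  by apply: eq_In => s; rewrite /f h mul1r.
split; first by apply: eq_ig j1 => t; rewrite eI.
have -> : Ii a b (fun t => t ^+ l * Ii t b (fun s => s * q s)) = In la (fun t => In la (f t)).
  by apply: eq_In => t; exact: eI.
rewrite E; clear E eI; apply: In_le => //.
  apply: (@ig_Ii _ a b (b ^+ l.+2 * c)); first by apply: measurable_funM => //; exact: measurable_funX.
  move=> s h; have /andP[as' sb] := h; have s0 := le_trans (ltW a0) as'.
  have /andP[q0 qc'] := qc s h.
  rewrite normrM; apply: ler_pM => //; last by rewrite ger0_norm.
  by rewrite ger0_norm ?exprn_ge0// lerXn2r ?nnegrE// ltW.
move=> s; under eq_In do rewrite fE.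
rewrite InZ//; have [h|h] := boolP (a <= s <= b); last by rewrite !mul0r.
have /andP[as' sb] := h; have s0 := le_trans (ltW a0) as'; have /andP[q0 qc'] := qc s h.
rewrite !mul1r (_ : s ^+ l.+2 * q s = s * q s * s ^+ l.+1); last by rewrite !exprS; ring.
apply: ler_wpM2l; first by rewrite mulr_ge0.
apply: (@le_trans _ _ (In la (fun t : Rm => (a <= t <= s)%R%:R * s ^+ l))).
  apply: In_le => //; first exact: ig_itvb.
  move=> t; have [/andP[at' ts]|_] := boolP (a <= t <= s); last by rewrite !mul0r.
  by rewrite !mul1r lerXn2r ?nnegrE// (le_trans (ltW a0)).
by rewrite In_itvb// exprSr ler_wpM2l ?exprn_ge0// gerBl ltW.
Qed.

Lemma J_ladder_le k w x a b : smooth w -> 0 < a -> a <= b ->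
  `|J k.+2 w x a - J k.+2 w x b| <= Ii a b (fun t => t * `|J k.+3 (lap w) x t|).
Proof.
move=> sw a0 ab; rewrite distrC J_ladder// /Ii.
have cw := smooth_continuous (smooth_lap sw).
have mJ := measurable_J k.+3 x cw.
have [c c0 hc] := J_bounded k.+2 x b a0 cw.
have b0 : 0 < b by exact: lt_le_trans ab.
have bd t : a <= t <= b -> `|t * `|J k.+3 (lap w) x t| | <= b * c.
  move=> h; have /andP[at' tb] := h; rewrite normrM normr_id; apply: ler_pM => //; last exact: hc.
  by rewrite ger0_norm// (le_trans (ltW a0)).
have k0 : 1 <= 2 * k.+3%:R :> R by rewrite -natrM ler1n muln_gt0.
have le1 t : a <= t <= b -> `|t / (2 * k.+3%:R) * J k.+3 (lap w) x t| <= t * `|J k.+3 (lap w) x t|.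
  move=> /andP[at' tb]; have t0 := le_trans (ltW a0) at'.
  have k0' : 0 < 2 * k.+3%:R :> R by exact: lt_le_trans k0.
  have k0'' := ltW k0'.
  by rewrite normrM ler_wpM2r// ger0_norm ?divr_ge0// ler_pdivrMr// ler_peMr.
apply: In_absle.
- apply: (@ig_Ii _ a b (b * c)); first by do 2 apply: measurable_funM => //; exact: measurable_cst.
  by move=> t h; apply: le_trans (le1 t h) _; apply: le_trans (bd t h); exact: ler_norm.
- by apply: (@ig_Ii _ a b (b * c)) => //; apply: measurable_funM => //; exact: measurableT_comp.
- move=> t; rewrite normrM normr_nat; have [h|_] := boolP (a <= t <= b); last by rewrite !mul0r.
  by rewrite !mul1r; exact: le1.
Qed.

(** A Taylor formula in the scale: the sum collects boundary terms at the large scale [b], and the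
    integral carries the highest power of the Laplacian. The factors [1/(2k)] of the rungs are at
    most 1 and are dropped. *)
Lemma J_taylor l k w x a b : smooth w -> 0 < a -> a <= b ->
  `|J k.+2 w x a - J k.+2 w x b| <=
  \sum_(j < l) b ^+ (2 * j.+1) * `|J (k.+2 + j.+1) (iter j.+1 (@lap R n) w) x b| +
  Ii a b (fun t => t ^+ (2 * l).+1 * `|J (k.+3 + l) (iter l.+1 (@lap R n) w) x t|).
Proof.
move=> sw a0 ab; elim: l => [|l IH].
  rewrite big_ord0 add0r; apply: (le_trans (J_ladder_le k x sw a0 ab)).
  by rewrite addn0 muln0.
apply: (le_trans IH); rewrite big_ord_recr /= -addrA lerD2l.
have b0 : 0 < b by exact: lt_le_trans ab.
set w1 := iter l.+1 (@lap R n) w; have sw1 : smooth w1 by exact: smooth_iter_lap.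
have e1 : (k.+3 + l = (k.+1 + l).+2)%N by rewrite !addSn.
have e2 : (k.+3 + l.+1 = (k.+1 + l).+3)%N by rewrite addnS !addSn.
have e3 : (k.+2 + l.+1 = (k.+1 + l).+2)%N by rewrite addnS !addSn.
have cw1 := smooth_continuous sw1; have cw2 := smooth_continuous (smooth_lap sw1).
rewrite -![lap (iter l _ w)]/w1 e1 e2 e3.
have [c c0 hc] := J_bounded (k.+1 + l).+1 x b a0 cw1.
have [d d0 hd] := J_bounded (k.+1 + l).+2 x b a0 cw2.
set q := fun t : Rm => `|J (k.+1 + l).+3 (lap w1) x t|.
have mq : measurable_fun setT q by apply: measurableT_comp => //; exact: measurable_J.
have mJ1 : measurable_fun setT (fun t : Rm => `|J (k.+1 + l).+2 w1 x t|) by apply: measurableT_comp => //; exact: measurable_J.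
set Jb := `|J (k.+1 + l).+2 w1 x b|.
have bX m t : a <= t <= b -> `|t ^+ m| <= b ^+ m.
  move=> /andP[at' tb]; have t0 := le_trans (ltW a0) at'.
  by rewrite ger0_norm ?exprn_ge0// lerXn2r ?nnegrE// ltW.
have i1 : ig la (fun t : Rm => (a <= t <= b)%R%:R * (t ^+ (2 * l).+1 * `|J (k.+1 + l).+2 w1 x t|)).
  apply: (@ig_Ii _ a b (b ^+ (2 * l).+1 * c)); first by apply: measurable_funM => //; exact: measurable_funX.
  by move=> t h; rewrite normrM normr_id; apply: ler_pM => //; [exact: bX|exact: hc].
have qd t : a <= t <= b -> 0 <= q t <= d by move=> h; rewrite normr_ge0 /=; exact: hd.
have [iI hI] := @Ii_iter q (2 * l).+1 a b d a0 ab mq qd.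
have mX : measurable_fun setT (fun t : Rm => t ^+ (2 * l).+1) by exact: measurable_funX.
have iX := @ig_Ii _ a b (b ^+ (2 * l).+1) _ mX (bX (2 * l).+1).
(* One more rung, from [t] to [b]. The value at [b] becomes the next boundary term, and the new
   nested integral is collapsed by [Ii_iter]. *)
have le2 : Ii a b (fun t => t ^+ (2 * l).+1 * `|J (k.+1 + l).+2 w1 x t|) <=
    Jb * Ii a b (fun t => t ^+ (2 * l).+1) + Ii a b (fun t => t ^+ (2 * l).+1 * Ii t b (fun s => s * q s)).
  rewrite /Ii -InZ// -InD//; last exact: igZ.
  apply: In_le => //; first by apply: igD => //; exact: igZ.
  move=> t; have [h|_] := boolP (a <= t <= b); last by rewrite !mul0r mulr0 addr0.
  have /andP[at' tb] := h; have t0 : 0 < t by exact: lt_le_trans at'.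
  have h1 : `|J (k.+1 + l).+2 w1 x t| <= Jb + Ii t b (fun s => s * q s).
    rewrite -lerBlDl; apply: le_trans (J_ladder_le (k.+1 + l)%N x sw1 t0 tb); exact: lerB_dist.
  have gen (Y X Z T : R) : 0 <= T -> X <= Z + Y -> 1 * (T * X) <= Z * (1 * T) + 1 * (T * Y).
    by move=> T0 XZY; rewrite !mul1r [Z * _]mulrC -mulrDr; apply: ler_wpM2l.
  by apply: gen h1; apply: exprn_ge0; exact: ltW.
apply: (le_trans le2); apply: lerD; last by rewrite mulnS.
rewrite mulrC; apply: ler_wpM2r; first exact: normr_ge0.
apply: (@le_trans _ _ (In la (fun t : Rm => (a <= t <= b)%R%:R * b ^+ (2 * l).+1))).
  apply: In_le => //; first exact: ig_itvb.
  move=> t; have [h|_] := boolP (a <= t <= b); last by rewrite !mul0r.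
  by rewrite !mul1r; apply: (le_trans (ler_norm _)); exact: bX.
rewrite In_itvb// (_ : (2 * l.+1 = (2 * l).+2)%N) ?mulnS// [leRHS]exprSr.
by apply: ler_wpM2l; rewrite ?exprn_ge0 ?gerBl// ltW.
Qed.

End Taylor.

(** * Consequences of nonnegative scalar curvature *)

(** Solves for [U] with one constant that serves both the additive term and the factor of [I], and
    that does not depend on [I]. *)
Lemma affine_bound (R : realFieldType) (U M I c : R) : 0 <= M -> 0 <= I -> 0 < c ->
  c * (U - 1) <= M + I -> U <= (1 + M / c + c^-1) + (1 + M / c + c^-1) * I.
Proof.
move=> M0 I0 c0 h.
have : U - 1 <= (M + I) / c by rewrite ler_pdivlMr// mulrC.
have i0 : 0 <= c^-1 by rewrite invr_ge0 ltW.
rewrite mulrDl; set p := M / c => h1.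
have p0 : 0 <= p by exact: mulr_ge0.
have : 0 <= p * I by exact: mulr_ge0.
have e : (1 + p + c^-1) * I = I + p * I + I / c by ring.
by rewrite e; lra.
Qed.

Section Energy.
Variables (R : realType) (n : nat).
Local Notation Rm := (measurableTypeR R).
Local Notation la := (@lebesgue_measure R).
Local Notation leb := (leb R n).
Implicit Types (x z : 'rV[R]_n) (s t a b : R) (w : 'rV[R]_n -> R).

Lemma In_1cube_shift r x : In leb (fun z => \1_(cube r) (x + z)) = In leb (\1_(@cube R n r)).
Proof.
rewrite -(In_shift x (measurable_indic (@measurable_cube R n r))).
by apply: eq_In => z; rewrite addrC.
Qed.

(** Each Laplacian moved onto the kernel costs [t^-2] and two exponents. As [lapHE] produces two
    neighbouring exponents, the induction is used at [k] and at [k.+1], and the larger exponent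
    gives the smaller kernel. *)
Lemma In_lap_iter_le w j k : smooth w -> exists2 C, 0 <= C &
  forall x t, 0 < t ->
  `|In leb (fun z => iter j (@lap R n) w (x + z) * H (k.+1 + 2 * j) t z)| <=
    C * t ^- (2 * j) * In leb (fun z => `|w (x + z)| * H k.+1 t z).
Proof.
move=> sw; elim: j k => [|j IH] k.
  exists 1 => // x t t0; rewrite muln0 expr0 invr1 !mul1r addn0.
  apply: In_absle; first exact: ig_wH (smooth_continuous sw).
  - apply: (@eq_ig _ _ _ _ (fun z => `|w (x + z) * H k.+1 t z|)) => [z|].
      by rewrite normrM (ger0_norm (H_ge0 _ _ _)).
    by apply: ig_abs; exact: ig_wH (smooth_continuous sw).
  - by move=> z; rewrite normrM (ger0_norm (H_ge0 _ _ _)).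
have [C1 C10 h1] := IH k; have [C2 C20 h2] := IH k.+1.
set w1 := iter j (@lap R n) w; have sw1 : smooth w1 by exact: smooth_iter_lap.
set m := (k + 2 * j)%N.
have e0 : (k.+1 + 2 * j.+1 = m.+3)%N by rewrite /m; lia.
have e1 : (k.+1 + 2 * j = m.+1)%N by rewrite /m; lia.
have e2 : (k.+2 + 2 * j = m.+2)%N by rewrite /m; lia.
set c1 : R := 4 * m.+3%:R * m.+2%:R; set c2 : R := 2 * m.+3%:R * (n%:R + 2 * m.+2%:R).
have c10 : 0 <= c1 by rewrite /c1 -!natrM.
have c20 : 0 <= c2 by rewrite /c2 -!natrM -natrD -natrM.
exists (c1 * C1 + c2 * C2); first by rewrite addr_ge0 ?mulr_ge0.
move=> x t t0; rewrite e0 -[iter j.+1 _ w]/(lap w1) In_lap//.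
have i1 : ig leb (fun z => w1 (x + z) * H m.+1 t z) by apply: ig_wH => //; exact: smooth_continuous.
have i2 : ig leb (fun z => w1 (x + z) * H m.+2 t z) by apply: ig_wH => //; exact: smooth_continuous.
have -> : In leb (fun z => w1 (x + z) * lapH m t z) =
   t ^- 2 * (c1 * In leb (fun z => w1 (x + z) * H m.+1 t z) - c2 * In leb (fun z => w1 (x + z) * H m.+2 t z)).
  rewrite -!InZ// -InB; [|exact: igZ|exact: igZ].
  rewrite -InZ; last by apply: igB; exact: igZ.
  by apply: eq_In => z; rewrite lapHE// -/c1 -/c2; ring.
have t0' := ltW t0.
have h1' := h1 x t t0; have h2' := h2 x t t0; rewrite e1 -/w1 in h1'; rewrite e2 -/w1 in h2'.
have hle : In leb (fun z => `|w (x + z)| * H k.+2 t z) <= In leb (fun z => `|w (x + z)| * H k.+1 t z).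
  have ia l : ig leb (fun z => `|w (x + z)| * H l.+1 t z).
    apply: (@eq_ig _ _ _ _ (fun z => `|w (x + z) * H l.+1 t z|)) => [z|].
      by rewrite normrM (ger0_norm (H_ge0 _ _ _)).
    by apply: ig_abs; apply: ig_wH => //; exact: smooth_continuous.
  by apply: In_le => // z; apply: ler_wpM2l => //; exact: H_mono.
move: h1' h2' hle; set I1 := In leb (fun z => w1 _ * _); set I2 := In leb (fun z => w1 _ * _).
set N1 := In leb (fun z => `|w _| * H k.+1 t z); set N2 := In leb (fun z => `|w _| * H k.+2 t z) => h1' h2' hle.
rewrite normrM ger0_norm ?invr_ge0 ?exprn_ge0//.
have q0 : 0 <= t ^- (2 * j) by rewrite invr_ge0 exprn_ge0.
rewrite (_ : t ^- (2 * j.+1) = t ^- 2 * t ^- (2 * j)); last by rewrite mulnS exprD invfM.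
have gen (p q a1 a2 b1 b2 N : R) : (a1 * b1 + a2 * b2) * (p * q) * N = p * (a1 * (b1 * q * N) + a2 * (b2 * q * N)).
  by ring.
rewrite gen.
apply: ler_wpM2l; first by rewrite invr_ge0 exprn_ge0.
apply: (le_trans (ler_normB _ _)); apply: lerD; rewrite normrM ger0_norm//; apply: ler_wpM2l => //.
by apply: (le_trans h2'); apply: ler_wpM2l => //; rewrite mulr_ge0.
Qed.

Variable u : 'rV[R]_n -> R.
Hypothesis su : smooth u.
Variables (C0 r0 : R).
Hypothesis C00 : 0 <= C0.
Hypothesis r00 : 0 <= r0.
Hypothesis n3 : (3 <= n)%N.
(** Nonnegative scalar curvature far out, made global: whatever fails inside the cube [r0] is
    absorbed by [C0] times its indicator. *)
Hypothesis hS : forall x, (n%:R - 2) / 2 * grad_sq u x <= - lap u x + C0 * \1_(cube r0) x.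

Lemma grad_sq_ge0 x : 0 <= grad_sq u x.
Proof. by apply: sumr_ge0 => i _; exact: sqr_ge0. Qed.

Lemma continuous_grad_sq : continuous (grad_sq u).
Proof.
by apply: ct_sum => i; apply: ctX; apply: smooth_continuous; exact: smooth_partial.
Qed.

Lemma n2_gt0 : 0 < n%:R - 2 :> R.
Proof. by rewrite subr_gt0 ltr_nat. Qed.

Lemma lap_le x : lap u x <= C0 * \1_(cube r0) x.
Proof.
have := hS x; have : 0 <= (n%:R - 2) / 2 * grad_sq u x.
  by rewrite mulr_ge0 ?grad_sq_ge0// divr_ge0// ltW// n2_gt0.
move=> h1 h2; have := le_trans h1 h2; by rewrite addrC subr_ge0.
Qed.

(** The absolute value is minus the Laplacian plus twice its positive part, and the positive part
    lives in the cube. *)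
Lemma abs_lap_le x : `|lap u x| <= - lap u x + 2 * (C0 * \1_(cube r0) x).
Proof.
have h := lap_le x.
have c0 : 0 <= C0 * \1_(cube r0) x :> R by rewrite mulr_ge0// indicE.
have [l0|l0] := leP 0 (lap u x); first by rewrite ger0_norm//; lra.
by rewrite ltr0_norm//; lra.
Qed.

(** Integrate by parts once and complete the square, [H k.+3] being the geometric mean of [H k.+4]
    and [H k.+2]. The coefficient [(n-2)/4] is half of the one in [hS], which leaves half of the
    gradient term to be kept. *)
Lemma In_neglap k x t : 0 < t ->
  In leb (fun z => - lap u (x + z) * H k.+4 t z) <=
  (n%:R - 2) / 4 * In leb (fun z => grad_sq u (x + z) * H k.+4 t z) +
  (k.+4%:R ^+ 2 / ((n%:R - 2) / 4) / t ^+ 2) * In leb (H k.+2 t).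
Proof.
move=> t0; set a := (n%:R - 2) / 4.
have a0 : 0 < a by rewrite divr_gt0// n2_gt0.
have t0' : t != 0 by rewrite gt_eqF.
have sp i := smooth_partial i su.
have ip i : ig leb (fun z => partial i u (x + z) * dH k.+2 t i z).
  apply: (@ig_ccsupp _ _ t).
    by apply: ctM; [apply: continuous_rowlshift; exact: smooth_continuous|exact: continuous_dH].
  by move=> z; rewrite mulf_eq0 negb_or => /andP[_ /(dH_cube t0)].
have e1 : In leb (fun z => - lap u (x + z) * H k.+4 t z) =
    In leb (fun z => \sum_i partial i u (x + z) * dH k.+2 t i z).
  rewrite In_sum//.
  under eq_In do rewrite mulNr.
  rewrite InN; last by apply: ig_wH => //; apply: smooth_continuous; exact: smooth_lap.
  under eq_In do rewrite /lap mulr_suml.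
  rewrite In_sum; last first.
    by move=> i; apply: ig_wH => //; apply: smooth_continuous; exact: smooth_partial.
  rewrite -sumrN; apply: eq_bigr => i _.
  rewrite (@In_ibp _ _ i t _ _ _ _ x (smooth_pd i (sp i)) (pd_H k.+2 t i)) ?opprK//.
  - exact: smooth_continuous.
  - by apply: smooth_continuous; exact: smooth_partial.
  - exact: continuous_H.
  - exact: continuous_dH.
  - by move=> z; exact: H_cube.
  - by move=> z; exact: dH_cube.
have ig1 : ig leb (fun z => grad_sq u (x + z) * H k.+4 t z) by apply: ig_wH => //; exact: continuous_grad_sq.
have ig2 := @ig_H R n k.+1 t t0.
rewrite e1 -!InZ// -InD; [|exact: igZ|exact: igZ].
apply: In_le; [exact: ig_sum|by apply: igD; exact: igZ|].
move=> z; set B := Num.max 0 (1 - nsq z / t ^+ 2).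
have HB j : H j t z = B ^+ j by [].
have B0 : 0 <= B by rewrite le_max lexx.
(* Either [nsq z <= t^2] or the base [B] vanishes. *)
have hn : nsq z * B ^+ k.+2 <= t ^+ 2 * B ^+ k.+2.
  have [h|h] := leP (nsq z) (t ^+ 2); first by rewrite ler_wpM2r// exprn_ge0.
  suff -> : B = 0 by rewrite expr0n !mulr0.
  by apply: max_l; rewrite subr_le0 ler_pdivlMr ?exprn_gt0// mul1r ltW.
apply: (@le_trans _ _ (\sum_i (a * (partial i u (x + z) ^+ 2 * B ^+ k.+4) + (k.+4%:R ^+ 2 / a / t ^+ 2 / t ^+ 2) * (z 0 i ^+ 2 * B ^+ k.+2)))).
  apply: ler_sum => i _; rewrite /dH !HB.
  set p := partial i u (x + z); set q := z 0 i.
  rewrite -subr_ge0.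
  have -> : a * (p ^+ 2 * B ^+ k.+4) + k.+4%:R ^+ 2 / a / t ^+ 2 / t ^+ 2 * (q ^+ 2 * B ^+ k.+2) -
     p * (- (2 * k.+4%:R / t ^+ 2) * (q * B ^+ k.+3)) =
     a * (p * B + k.+4%:R * q / (a * t ^+ 2)) ^+ 2 * B ^+ k.+2.
    by rewrite [B ^+ k.+4]exprS [B ^+ k.+3]exprS; field; rewrite (gt_eqF a0) t0'.
  apply: mulr_ge0; last exact: exprn_ge0.
  by apply: mulr_ge0; [exact: ltW|exact: sqr_ge0].
rewrite big_split /= -!mulr_sumr -!mulr_suml -/(nsq z) !HB -/(grad_sq u (x + z)).
rewrite lerD2l -[leLHS]mulrA; apply: ler_wpM2l.
  apply: divr_ge0; last by apply: exprn_ge0; exact: ltW.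
  by apply: divr_ge0; [exact: exprn_ge0|exact: ltW].
by rewrite mulrC ler_pdivrMr ?exprn_gt0// [leRHS]mulrC.
Qed.

Lemma ig_1cube_shift x : ig leb (fun z => \1_(cube r0) (x + z)).
Proof.
have := ig_shift x (@ig_1cube R n r0); apply: eq_ig => z; by rewrite addrC.
Qed.

Lemma In_cubeH_le k x t : 0 < t ->
  ig leb (fun z => C0 * \1_(cube r0) (x + z) * H k.+1 t z) /\
  In leb (fun z => C0 * \1_(cube r0) (x + z) * H k.+1 t z) <= C0 * In leb (\1_(@cube R n r0)).
Proof.
move=> t0; have ic := igZ C0 (ig_1cube_shift x).
have le1 z : 0 <= C0 * \1_(cube r0) (x + z) * H k.+1 t z <= C0 * \1_(cube r0) (x + z).
  have c0 : 0 <= C0 * \1_(cube r0) (x + z) :> R by rewrite mulr_ge0// indicE.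
  by rewrite mulr_ge0 ?H_ge0//= ler_piMr// H_le1.
have m : measurable_fun setT (fun z => C0 * \1_(cube r0) (x + z) * H k.+1 t z).
  apply: measurable_funM; first exact: ig_meas ic.
  by apply: continuous_row_measurable; exact: continuous_H.
split; first by apply: ig_le m _ ic => z; have /andP[h1 h2] := le1 z; rewrite ger0_norm.
apply: (le_trans (In_gt0_le m le1 ic)).
by rewrite InZ; [rewrite In_1cube_shift|exact: ig_1cube_shift].
Qed.

Lemma expn_sub2 t : t ^+ n = t ^+ 2 * t ^+ (n - 2).
Proof. by rewrite -exprD subnKC// ltnW. Qed.

(** With [G] the gradient energy and [L] the integral of minus the Laplacian, [hS] gives
    [2 a G <= L + V] and [In_neglap] gives [L <= a G + C t^(n-2)], so [G] is absorbed. The constant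
    [V] of the cube is below [V t^(n-2)] because [t >= 1]. *)
Lemma energy k : exists2 C, 0 <= C & forall x t, 1 <= t ->
  In leb (fun z => grad_sq u (x + z) * H k.+4 t z) <= C * t ^+ (n - 2) /\
  In leb (fun z => `|lap u (x + z)| * H k.+4 t z) <= C * t ^+ (n - 2).
Proof.
set a := (n%:R - 2) / 4 : R.
have a0 : 0 < a by rewrite divr_gt0// n2_gt0.
set V := C0 * In leb (\1_(@cube R n r0)).
have V0 : 0 <= V by rewrite mulr_ge0// In_ge0// => x; rewrite indicE.
set M := k.+4%:R ^+ 2 / a * 2 ^+ n + V.
have Ma : 0 <= k.+4%:R ^+ 2 / a * 2 ^+ n by rewrite mulr_ge0 ?exprn_ge0// divr_ge0 ?exprn_ge0// ltW.
have M0 : 0 <= M by rewrite addr_ge0.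
exists (M / a + 4 * M); first by apply: addr_ge0; [apply: divr_ge0 => //; exact: ltW|exact: mulr_ge0].
move=> x t t1; have t0 : 0 < t by exact: lt_le_trans t1.
have t0n : t != 0 by rewrite gt_eqF.
set p := t ^+ (n - 2); have p1 : 1 <= p by rewrite exprn_ege1.
have cl := smooth_continuous (smooth_lap su).
have iG : ig leb (fun z => grad_sq u (x + z) * H k.+4 t z) by apply: ig_wH => //; exact: continuous_grad_sq.
have iL : ig leb (fun z => - lap u (x + z) * H k.+4 t z).
  apply: (@ig_wH _ _ k.+3 (fun y => - lap u y)) => // y; exact: (cvgN (cl y)).
have iA : ig leb (fun z => `|lap u (x + z)| * H k.+4 t z).
  apply: (@eq_ig _ _ _ _ (fun z => `|lap u (x + z) * H k.+4 t z|)) => [z|].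
    by rewrite normrM (ger0_norm (H_ge0 _ _ _)).
  by apply: ig_abs; exact: ig_wH.
have [iC hC] := In_cubeH_le k.+3 x t0.
set G := In leb (fun z => grad_sq u (x + z) * H k.+4 t z).
set L := In leb (fun z => - lap u (x + z) * H k.+4 t z).
have h1 : L <= a * G + (k.+4%:R ^+ 2 / a * 2 ^+ n) * p.
  apply: (le_trans (In_neglap k x t0)); rewrite lerD2l.
  have hH := In_H_le n k.+1 t0.
  apply: (@le_trans _ _ (k.+4%:R ^+ 2 / a / t ^+ 2 * (2 * t) ^+ n)).
    apply: ler_wpM2l => //; apply: divr_ge0; last by apply: exprn_ge0; exact: ltW.
    by apply: divr_ge0; [exact: exprn_ge0|exact: ltW].
  rewrite exprMn (expn_sub2 t) -/p le_eqVlt; apply/orP; left; apply/eqP; field.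
  by rewrite t0n gt_eqF.
have h2 : 2 * a * G <= L + V.
  apply: le_trans (_ : _ <= L + In leb (fun z => C0 * \1_(cube r0) (x + z) * H k.+4 t z)) _; last by rewrite lerD2l.
  rewrite -InZ// -InD//; apply: In_le; [exact: igZ|exact: igD|].
  move=> z; rewrite -mulrDl mulrA; apply: ler_wpM2r; first exact: H_ge0.
  by apply: le_trans (hS (x + z)); rewrite /a le_eqVlt; apply/orP; left; apply/eqP; field.
have h3 : In leb (fun z => `|lap u (x + z)| * H k.+4 t z) <= L + 2 * V.
  apply: le_trans (_ : _ <= L + 2 * In leb (fun z => C0 * \1_(cube r0) (x + z) * H k.+4 t z)) _; last first.
    by rewrite lerD2l ler_wpM2l.
  rewrite -InZ// -InD//; last exact: igZ.
  apply: In_le => //; first by apply: igD => //; exact: igZ.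
  move=> z; rewrite mulrA -mulrDl; apply: ler_wpM2r; first exact: H_ge0.
  exact: abs_lap_le.
have VM : V <= V * p by rewrite ler_peMr.
have aG : a * G <= M * p by rewrite /M mulrDl; lra.
have M4 : 0 <= M * p by rewrite mulr_ge0// (le_trans _ p1).
have h4 : (k.+4%:R ^+ 2 / a * 2 ^+ n) * p <= M * p by rewrite /M mulrDl lerDl mulr_ge0// (le_trans _ p1).
have V4 : V * p <= M * p by rewrite /M mulrDl lerDr mulr_ge0// (le_trans _ p1).
split.
  have : G <= M / a * p by rewrite mulrAC ler_pdivlMr// mulrC.
  by move=> /le_trans; apply; rewrite [leRHS]mulrDl lerDl -mulrA mulr_ge0.
apply: (le_trans h3).
have : 0 <= M / a * p.
  by apply: mulr_ge0; [apply: divr_ge0 => //; exact: ltW|exact: le_trans p1].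
by rewrite mulrDl -mulrA; lra.
Qed.

(** The first Laplacian is paid by [energy], which gives [t^(n-2)], and the other [j] by [t^-2]
    each. The resulting bound is scale invariant and controls every boundary term of [J_taylor]. *)
Lemma Jlap_bound j k : exists2 C, 0 <= C & forall x t, 1 <= t ->
  t ^+ (2 * j.+1) * `|J (k.+4 + 2 * j) (iter j.+1 (@lap R n) u) x t| <= C.
Proof.
have [C1 C10 h1] := In_lap_iter_le j k.+3 (smooth_lap su).
have [C2 C20 h2] := energy k.
exists (C1 * C2); first by rewrite mulr_ge0.
move=> x t t1; have t0 : 0 < t by exact: lt_le_trans t1.
have t0' := ltW t0; have tn : t != 0 by rewrite gt_eqF.
have {}h1 := h1 x t t0; have [_ {}h2] := h2 x t t1.
rewrite -iterSr in h1.
rewrite /J normrM (ger0_norm (_ : 0 <= t ^- n)) ?invr_ge0 ?exprn_ge0//.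
apply: (@le_trans _ _ (t ^+ (2 * j.+1) * (t ^- n * (C1 * t ^- (2 * j) * (C2 * t ^+ (n - 2)))))).
  do 2 (apply: ler_wpM2l; first by rewrite ?invr_ge0 exprn_ge0).
  apply: (le_trans h1); apply: ler_wpM2l => //.
  by rewrite mulr_ge0// invr_ge0 exprn_ge0.
rewrite (expn_sub2 t) mulnS exprD; set p := t ^+ (n - 2); set q := t ^+ (2 * j).
have p0 : p != 0 by rewrite expf_neq0. have q0 : q != 0 by rewrite expf_neq0.
by rewrite le_eqVlt; apply/orP; left; apply/eqP; field; rewrite p0 q0 tn.
Qed.

(** Outside the cube [u] is superharmonic, so only the cube can raise the average. It raises it at a
    rate of at most [V t^(1-n) <= V t^-2], integrable at infinity since [n >= 3]. *)
Lemma J0_bound k : exists C, forall t, 1 <= t -> J k.+4 u 0 t <= C.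
Proof.
set V := C0 * In leb (\1_(@cube R n r0)).
have V0 : 0 <= V by rewrite mulr_ge0// In_ge0// => x; rewrite indicE.
exists (J k.+4 u 0 1 + V) => b b1.
have b0 : 0 < b by exact: lt_le_trans b1.
rewrite -lerBlDl (J_ladder k.+2 0 su ltr01 b1).
have cl := smooth_continuous (smooth_lap su).
have [c c0 hc] := J_bounded k.+4 0 b ltr01 cl.
have k0 : 1 <= 2 * k.+4.+1%:R :> R by rewrite -natrM ler1n muln_gt0.
have k0' : 0 < 2 * k.+4.+1%:R :> R by exact: lt_le_trans k0.
have bX : forall t : R, 1 <= t <= b -> `|t ^- 2| <= 1.
  move=> t /andP[t1 tb]; rewrite ger0_norm ?invr_ge0 ?exprn_ge0 ?(le_trans _ t1)//.
  by rewrite invf_le1 ?exprn_gt0 ?(lt_le_trans _ t1)// exprn_ege1.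
have mX : measurable_fun setT (fun t : Rm => t ^- 2) by exact: measurable_invX.
have i1 : ig la (fun t : Rm => (1 <= t <= b)%R%:R * (V * t ^- 2)).
  apply: (@ig_Ii _ 1 b V); first by apply: measurable_funM => //; exact: measurable_cst.
  by move=> t h; rewrite normrM (ger0_norm V0) ler_piMr// bX.
apply: (@le_trans _ _ (Ii 1 b (fun t => V * t ^- 2))).
  apply: In_le => //.
    apply: (@ig_Ii _ 1 b (b * c)).
      by apply: measurable_funM; [apply: measurable_funM => //; exact: measurable_cst|exact: measurable_J].
    move=> t h; have /andP[t1 tb] := h; rewrite normrM; apply: ler_pM => //; last exact: hc.
    have t0 : 0 <= t by exact: le_trans t1.
    have q0 : 0 <= t / (2 * k.+4.+1%:R) by apply: divr_ge0 => //; exact: ltW.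
    rewrite (ger0_norm q0) ler_pdivrMr// (le_trans tb)// ler_peMr//; exact: ltW.
  move=> t; have [h|_] := boolP (1 <= t <= b); last by rewrite !mul0r.
  have /andP[t1 tb] := h; have t0 : 0 < t by exact: lt_le_trans t1.
  have t0' := ltW t0; have tn : t != 0 by rewrite gt_eqF.
  rewrite !mul1r.
  have hJ : J k.+4.+1 (lap u) 0 t <= t ^- n * V.
    rewrite /J; apply: ler_wpM2l; first by rewrite invr_ge0 exprn_ge0.
    have [iC hC] := In_cubeH_le k.+4 0 t0; apply: le_trans hC.
    apply: In_le => //; first exact: ig_wH.
    by move=> z; apply: ler_wpM2r; [exact: H_ge0|exact: lap_le].
  apply: (@le_trans _ _ (t / (2 * k.+4.+1%:R) * (t ^- n * V))).
    by apply: ler_wpM2l => //; rewrite divr_ge0//; exact: ltW.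
  apply: (@le_trans _ _ (t * (t ^- n * V))).
    apply: ler_wpM2r; first by rewrite mulr_ge0 ?invr_ge0 ?exprn_ge0.
    by rewrite ler_pdivrMr// ler_peMr.
  rewrite mulrA [V * _]mulrC; apply: ler_wpM2r => //.
  have -> : t ^+ n = t * t ^+ (n.-1) by rewrite -exprS prednK// (leq_trans _ n3).
  rewrite invfM mulrA mulfV// mul1r lef_pV2 ?posrE ?exprn_gt0//.
  by rewrite ler_weXn2l// -ltnS prednK// (leq_trans _ n3).
have dt t : 1 <= t <= b -> is_derive t (1 : R) (fun t : R => V * - t^-1) (V * t ^- 2).
  move=> /andP[t1 _]; have tn : t != 0 by rewrite gt_eqF// (lt_le_trans _ t1).
  have h := @is_deriveV R (id : R -> R) t 1 1 tn (is_derive_id _ _).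
  have h' := is_deriveZ V (is_deriveN h).
  by apply: (is_derive_eq h'); rewrite -[_ *: 1]/(_ * _) mulr1 opprK.
have ct t : 1 <= t <= b -> {for t, continuous (fun t : R => V * t ^- 2)}.
  move=> /andP[t1 _]; have tn : t != 0 by rewrite gt_eqF// (lt_le_trans _ t1).
  have cV : {for t, continuous (fun r : R => r^-1)} by exact: inv_continuous.
  rewrite (_ : (fun t : R => V * t ^- 2) = (fun t : R => V * (t^-1 * t^-1))).
    exact: (cvgM (cvg_cst V) (cvgM cV cV)).
  by apply/funext => r; rewrite expr2 invfM.
rewrite (FTC_Ii b1 dt ct) -mulrBr ler_piMr// opprK invr1 addrC lerBlDr lerDl.
by rewrite invr_ge0 ltW.
Qed.

(** Walks from 0 to [x] one coordinate at a time; a negative step is a positive one read from its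
    other end. *)
Lemma steps_le (G : 'rV[R]_n -> R) L x :
  (forall i d y, 0 <= d -> `|G (d *: (delta_mx 0 i : 'rV[R]_n) + y) - G y| <= L * d) ->
  `|G x - G 0| <= L * \sum_i `|x 0 i|.
Proof.
move=> hG.
have h1 i d y : `|G (d *: (delta_mx 0 i : 'rV[R]_n) + y) - G y| <= L * `|d|.
  have [d0|d0] := leP 0 d; first by rewrite (ger0_norm d0) hG.
  have d0' : 0 <= - d by rewrite oppr_ge0 ltW.
  have := hG i (- d) (d *: delta_mx 0 i + y) d0'.
  by rewrite addrA -scalerDl addNr scale0r add0r distrC (ltr0_norm d0).
have : forall r : seq 'I_n, `|G (\sum_(i <- r) x 0 i *: (delta_mx 0 i : 'rV[R]_n)) - G 0| <= L * \sum_(i <- r) `|x 0 i|.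
  elim=> [|i r IH]; first by rewrite !big_nil subrr normr0 mulr0.
  rewrite !big_cons mulrDr; apply: (le_trans _ (lerD (h1 i (x 0 i) _) IH)).
  exact: ler_distD.
by move=> /(_ (index_enum _)); rewrite -row_sum_delta.
Qed.

(** Carries [J0_bound] from the origin to [x]. At scale [t] the averaged gradient is at most [L/t]
    by the energy bound, while the path along the coordinates has length at most [n t]. *)
Lemma Jx_bound k : exists C, forall x t, 1 <= t -> cube t x -> J k.+4 u x t <= C.
Proof.
have [C1 h1] := J0_bound k.
have [C2 C20 h2] := energy k.
set L := (2 ^+ n + C2) / 2.
have L0 : 0 <= L by rewrite divr_ge0// addr_ge0 ?exprn_ge0.
exists (C1 + n%:R * L) => x t t1 xt.
have t0 : 0 < t by exact: lt_le_trans t1.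
have t0' := ltW t0; have tn : t != 0 by rewrite gt_eqF.
apply: le_trans (_ : _ <= J k.+4 u 0 t + n%:R * L) _; last by rewrite lerD2r h1.
rewrite -lerBlDl; apply: (le_trans (ler_norm _)).
have hL i y : `|In leb (fun z => partial i u (y + z) * H k.+4 t z)| <= L * t ^+ n / t.
  have cp := smooth_continuous (smooth_partial i su).
  have iG : ig leb (fun z => grad_sq u (y + z) * H k.+4 t z) by apply: ig_wH => //; exact: continuous_grad_sq.
  have iH := @ig_H R n k.+3 t t0.
  have [hg _] := h2 y t t1.
  (* The bound [|p| <= 1/(2t) + t p^2/2], weighted so that the kernel mass and the energy contribute
     the same power of [t]. *)
  apply: (@le_trans _ _ (In leb (fun z => (t^-1 / 2) * H k.+4 t z + (t / 2) * (grad_sq u (y + z) * H k.+4 t z)))).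
    apply: In_absle; [exact: ig_wH|by apply: igD; exact: igZ|].
    move=> z; rewrite normrM (ger0_norm (H_ge0 _ _ _)) [t / 2 * (_ * _)]mulrA -mulrDl.
    apply: ler_wpM2r; first exact: H_ge0.
    apply: (@le_trans _ _ (t^-1 / 2 + t / 2 * partial i u (y + z) ^+ 2)); last first.
      rewrite lerD2l ler_wpM2l ?divr_ge0// /grad_sq (bigD1 i)//= lerDl sumr_ge0// => j _; exact: sqr_ge0.
    rewrite -[partial i u (y + z) ^+ 2]real_normK ?num_real//.
    set p := `|partial i u (y + z)|; rewrite -subr_ge0.
    have -> : t^-1 / 2 + t / 2 * p ^+ 2 - p = (t * p - 1) ^+ 2 / (2 * t) by field; rewrite tn.
    by rewrite divr_ge0 ?sqr_ge0// mulr_ge0.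
  rewrite InD; [|exact: igZ|exact: igZ].
  rewrite !InZ//; have hH := In_H_le n k.+3 t0.
  apply: (@le_trans _ _ (t^-1 / 2 * (2 * t) ^+ n + t / 2 * (C2 * t ^+ (n - 2)))).
    apply: lerD; apply: ler_wpM2l => //; first by rewrite divr_ge0// invr_ge0.
    by rewrite divr_ge0.
  rewrite exprMn (expn_sub2 t) /L; set q := t ^+ (n - 2).
  by rewrite le_eqVlt; apply/orP; left; apply/eqP; field; rewrite tn.
have step i d y : 0 <= d -> `|J k.+4 u (d *: (delta_mx 0 i : 'rV[R]_n) + y) t - J k.+4 u y t| <= L / t * d.
  move=> d0; rewrite /J -mulrBr normrM ger0_norm ?invr_ge0 ?exprn_ge0//.
  rewrite mulrC ler_pdivrMr ?exprn_gt0//.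
  have := @In_shift_line_le R n i t (L * t ^+ n / t) u _ (H k.+4 t) y d (smooth_pd i su)
    (smooth_continuous su) (smooth_continuous (smooth_partial i su)) (@continuous_H _ _ _ _)
    (fun z => H_cube t0) (hL i) d0.
  by congr (_ <= _); ring.
apply: (le_trans (steps_le x step)).
apply: (@le_trans _ _ (L / t * (n%:R * t))).
  apply: ler_wpM2l; first by rewrite divr_ge0.
  apply: (@le_trans _ _ (\sum_(i < n) t)); first by apply: ler_sum => i _; exact: xt.
  by rewrite sumr_const card_ord mulr_natl.
by rewrite le_eqVlt; apply/orP; left; apply/eqP; field; rewrite tn.
Qed.

(** [J_taylor] between the small scale [a] and a scale [t] comparable to the distance of [x]: the
    top average is bounded above by [Jx_bound], the boundary terms by [Jlap_bound], and at scale [a]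
    the average sees [u x] up to 1. *)
Lemma u_upper_bound m : (0 < m)%N -> exists2 C, 0 <= C & forall x t a0, 1 <= t -> cube t x ->
  (forall z, `|z| < a0 -> `|u (x + z) - u x| < 1) ->
  forall a, 0 < a -> a < a0 -> a <= t ->
  u x <= C + C * Ii a t (fun s => s ^+ (2 * m).-1 * `|J (2 * m + 4 + m) (iter m (@lap R n) u) x s|).
Proof.
(* Rung [j] needs [2 j + 4 <= K + j + 1] for [Jlap_bound] to apply; this [K] satisfies it for every
   [j < m]. *)
case: m => // m _; set K := (2 * m.+1 + 4)%N.
have hK : exists k, K = k.+4 by exists (2 * m.+1)%N; rewrite /K addnC.
have [k eK] := hK.
have [C1 h1] := Jx_bound k.
have hj (j : 'I_m) : exists2 C, 0 <= C & forall x t, 1 <= t ->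
   t ^+ (2 * j.+1) * `|J (K + j.+1) (iter j.+1 (@lap R n) u) x t| <= C.
  have [C C0' hC] := Jlap_bound j (K + j.+1 - 2 * j - 4)%N.
  exists C => // x t t1; have := hC x t t1.
  by rewrite (_ : (_.+4 + 2 * j = K + j.+1)%N)// /K; have := ltn_ord j; lia.
have /choice[D hD] : forall j : 'I_m, exists C, 0 <= C /\ forall x t, 1 <= t ->
   t ^+ (2 * j.+1) * `|J (K + j.+1) (iter j.+1 (@lap R n) u) x t| <= C.
  by move=> j; have [C C0' hC] := hj j; exists C.
set c0 : R := (3 / 4) ^+ K * n%:R ^- n.
have n0 : (0 < n)%N by exact: leq_trans n3.
have c00 : 0 < c0 by rewrite mulr_gt0 ?invr_gt0 ?exprn_gt0// ?divr_gt0// ltr0n.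
set M := `|C1| + \sum_j D j.
have M0 : 0 <= M by rewrite addr_ge0// sumr_ge0// => j _; have [] := hD j.
exists (1 + M / c0 + c0^-1); first by rewrite !addr_ge0 ?divr_ge0 ?invr_ge0// ltW.
move=> x t a0 t1 xt ha; have t0 : 0 < t by exact: lt_le_trans t1.
have cu := smooth_continuous su.
move=> a a_gt0 aa0 at'.
have a0' := ltW a_gt0.
have hT := J_taylor m k.+2 x su a_gt0 at'.
have eK1 : (k.+2.+2 = K)%N by rewrite eK.
set I := Ii a t (fun s => s ^+ (2 * m.+1).-1 * `|J (K + m.+1) (iter m.+1 (@lap R n) u) x s|).
have I0 : 0 <= I.
  by apply: Ii_ge0 => s /andP[as' _]; rewrite mulr_ge0// exprn_ge0// (le_trans a0').
have hJ : J K u x a <= M + I.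
  have : J K u x a <= `|J K u x a - J K u x t| + J K u x t by rewrite -lerBlDr ler_norm.
  move=> /le_trans; apply; rewrite /M.
  have hC1 : J K u x t <= `|C1| by rewrite eK; apply: le_trans (h1 x t t1 xt) _; exact: ler_norm.
  rewrite addrC -addrA; apply: (lerD hC1).
  rewrite -eK1; apply: (le_trans hT); apply: lerD.
    apply: ler_sum => j _; rewrite eK1; have [_ h] := hD j; exact: h.
  rewrite /I le_eqVlt; apply/orP; left; apply/eqP; congr Ii; apply/funext => s.
  by rewrite (_ : ((2 * m.+1).-1 = (2 * m).+1)%N) ?mulnS// -eK1 (_ : (k.+4 + m.+1 = k.+2.+3 + m)%N)// addnS.
apply: (affine_bound M0 I0 c00); clear hT.
(* If [u x <= 1] the left-hand side is nonpositive. Otherwise [u >= u x - 1 > 0] on the support of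
   the kernel, and the lower bound on the kernel mass may be multiplied in. *)
have [ux|ux] := leP (u x) 1.
  have h1' : c0 * (u x - 1) <= 0 by apply: mulr_ge0_le0; [exact: ltW|rewrite subr_le0].
  by apply: (le_trans h1'); apply: addr_ge0.
have hlow : c0 * (u x - 1) <= J K u x a.
  rewrite /J; apply: (@le_trans _ _ (a ^- n * ((u x - 1) * In leb (H K a)))).
    rewrite mulrCA [c0 * _]mulrC; apply: ler_wpM2l; first by rewrite subr_ge0 ltW.
    rewrite eK; have := @In_H_ge R n k.+3 a a_gt0 n0; rewrite -eK => h.
    rewrite mulrC ler_pdivlMr ?exprn_gt0//; apply: le_trans h.
    by rewrite [(a / _) ^+ n]exprMn exprVn /c0 mulrAC -mulrA.
  apply: ler_wpM2l; first by rewrite invr_ge0 exprn_ge0.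
  have iH : ig leb (H K a) by rewrite eK; exact: ig_H.
  rewrite -InZ//; apply: In_le; [exact: igZ|by rewrite eK; exact: ig_wH|].
  move=> z; have [->|hz] := eqVneq (H K a z) 0; first by rewrite !mulr0.
  apply: ler_wpM2r; first exact: H_ge0.
  have za : `|z| < a0.
    apply/row_norm_lt => [|i]; first exact: lt_trans aa0.
    by rewrite eK in hz; apply: (le_lt_trans (H_cube a_gt0 hz i)).
  have := ha z za; rewrite ltr_norml => /andP[h _]; lra.
exact: le_trans hlow hJ.
Qed.

End Energy.

(** * Integrals over the half-line *)

Section HalfLine.
Variable R : realType.
Local Notation Rm := (measurableTypeR R).
Local Notation la := (@lebesgue_measure R).
Implicit Types (c s t p q : R).

Definition Ip (g : R -> R) : R := In la (fun s : Rm => (0 < s)%R%:R * g s).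

Lemma measurable_pos : measurable_fun setT (fun s : Rm => (0 < s)%R%:R : R).
Proof.
have := @measurable_indic _ Rm R setT `]0%R, +oo[%classic (measurable_itv _).
by congr measurable_fun; apply/funext => t; rewrite indicE mem_setE in_itv/= andbT.
Qed.

Lemma oneDsq_gt0 s : 0 < 1 + s ^+ 2.
Proof. by rewrite ltr_pwDl// sqr_ge0. Qed.

Lemma measurable_oneDsqrV : measurable_fun setT (fun s : Rm => (1 + s ^+ 2)^-1).
Proof.
apply: (measurableT_comp (@measurable_invr R)).
by apply: measurable_funD; [exact: measurable_cst|exact: measurable_funX].
Qed.

Lemma ig_oneDsqr_pos : ig la (fun s : Rm => (0 < s)%R%:R * (1 + s ^+ 2)^-1).
Proof.
apply/(@ge0_igP _ _ _ la).
- by apply: measurable_funM; [exact: measurable_pos|exact: measurable_oneDsqrV].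
- by move=> s; rewrite mulr_ge0// invr_ge0 ltW// oneDsq_gt0.
apply: (@le_lt_trans _ _ (\int[la]_(x in `[0%R, +oo[) (oneDsqr x)^-1%:E)%E); last first.
  by rewrite integral0y_oneDsqr ltry.
rewrite [leRHS]integral_mkcond; apply: ge0_le_integral => //.
- by move=> s _; rewrite lee_fin mulr_ge0// invr_ge0 ltW// oneDsq_gt0.
- by apply/measurable_EFinP; apply: measurable_funM; [exact: measurable_pos|exact: measurable_oneDsqrV].
- apply/(measurable_restrictT _ _).1 => //; apply/measurable_EFinP.
  exact: (measurable_funS _ _ measurable_oneDsqrV).
- move=> s _; rewrite patchE mem_setE in_itv/= andbT.
  have [s0|s0] := ltP 0 s; first by rewrite (ltW s0) mul1r.
  by rewrite mul0r; case: ifP => // _; rewrite lee_fin invr_ge0 ltW// oneDsq_gt0.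
Qed.

(** The number pi/2, kept symbolic. *)
Definition om : R := Ip (fun s => (1 + s ^+ 2)^-1).

Lemma ig_Ip (g : R -> R) c : measurable_fun setT (g : Rm -> R) ->
  (forall s, 0 < s -> `|g s| <= c * (1 + s ^+ 2)^-1) ->
  ig la (fun s : Rm => (0 < s)%R%:R * g s).
Proof.
move=> mg h; apply: (ig_le _ _ (igZ c ig_oneDsqr_pos)).
  by apply: measurable_funM => //; exact: measurable_pos.
move=> s; rewrite normrM normr_nat mulrCA.
by have [s0|s0] := ltP 0 s; [rewrite !mul1r; exact: h|rewrite !mul0r].
Qed.

Lemma eq_Ip (g h : R -> R) : (forall s, 0 < s -> g s = h s) -> Ip g = Ip h.
Proof.
by move=> gh; apply: eq_In => s; have [s0|] := ltP 0 s; rewrite ?mul0r// gh.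
Qed.

Lemma om_ge0 : 0 <= om.
Proof. by apply: In_ge0 => s; rewrite mulr_ge0// invr_ge0 ltW// oneDsq_gt0. Qed.

Lemma In_la_scale c (g : Rm -> R) : 0 < c -> measurable_fun setT g ->
  In la (fun t : Rm => g (c * t)) = c^-1 * In la g.
Proof.
move=> c0 mg; have mF : measurable_fun setT (fun x : Rm => (g x)%:E) by exact/measurable_EFinP.
have cn : c != 0 by rewrite gt_eqF.
rewrite -[LHS](mulKf cn); congr (_ * _).
rewrite /In integralE [in RHS]integralE.
have ep := ge0_integral_la_scale c0 (measurable_funepos mF) (fun x => funepos_ge0 _ x).
have en := ge0_integral_la_scale c0 (measurable_funeneg mF) (fun x => funeneg_ge0 _ x).
rewrite -ep -en.
have -> : (\int[la]_x (fun x : Rm => (g (c * x))%:E)^\+%E x)%E = (\int[la]_x (fun x : Rm => (g x)%:E)^\+%E (c * x)%R)%E by apply: eq_integral => x _; rewrite !funeposE.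
have -> : (\int[la]_x (fun x : Rm => (g (c * x))%:E)^\-%E x)%E = (\int[la]_x (fun x : Rm => (g x)%:E)^\-%E (c * x)%R)%E by apply: eq_integral => x _; rewrite !funenegE.
set X := (\int[la]_x _)%E; set Y := (\int[la]_x _)%E.
have X0 : (0 <= X)%E by exact: integral_ge0.
have Y0 : (0 <= Y)%E by exact: integral_ge0.
clear ep en; move: X0 Y0; case: X => [X||] //; case: Y => [Y||] // _ _;
  rewrite ?gt0_muley ?lte_fin//= ?mulr0 ?mulrBr//.
Qed.

Lemma ig_la_scale c (g : Rm -> R) : 0 < c -> ig la g -> ig la (fun t : Rm => g (c * t)).
Proof.
move=> c0 ig_g; have mg := ig_meas ig_g.
have ms : measurable_fun setT (fun t : Rm => c * t : Rm) by exact: mulrl_measurable.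
apply/integrableP; split; first by apply/measurable_EFinP; exact: (measurableT_comp mg ms).
have mF : measurable_fun setT (fun x : Rm => `|(g x)%:E|%E) by apply: measurableT_comp => //; exact/measurable_EFinP.
have e := ge0_integral_la_scale c0 mF (fun x => abse_ge0 _).
have /integrableP[_] := ig_g; rewrite /= -e.
set X := (\int[la]_x _)%E.
have X0 : (0 <= X)%E by exact: integral_ge0.
rewrite -/X; move: X0; case: X => [X||] // _; first by rewrite !ltry.
by rewrite gt0_muley ?lte_fin.
Qed.

Lemma Ip_scale c (g : R -> R) : 0 < c -> measurable_fun setT (g : Rm -> R) ->
  Ip (fun s => g (c * s)) = c^-1 * Ip g.
Proof.
move=> c0 mg; rewrite /Ip -In_la_scale//; last by apply: measurable_funM => //; exact: measurable_pos.
by apply: eq_In => s; rewrite pmulr_rgt0.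
Qed.

(** Adds the inequalities [p^i <= i! e^p] for [i = j] and [i = j + 2]. *)
Lemma expRN_powM p j : 0 <= p ->
  expR (- p) * p ^+ j <= (j`!%:R + (j.+2)`!%:R) * (1 + p ^+ 2)^-1.
Proof.
move=> p0; rewrite ler_pdivlMr ?oneDsq_gt0// expRN -mulrA mulrC ler_pdivrMr ?expR_gt0//.
have f0 i : 0 < i`!%:R :> R by rewrite ltr0n fact_gt0.
have h i : p ^+ i <= i`!%:R * expR p.
  rewrite mulrC -ler_pdivrMr//; case: i => [|i]; first by rewrite expr0 fact0 divr1 -expR0 ler_expR.
  by apply: le_trans (expR_ge1Dxn i p0); rewrite lerDr.
by rewrite mulrDl mulrDr mulr1 -exprD addn2 lerD.
Qed.

Lemma ig_expRN_pow j : ig la (fun p : Rm => (0 < p)%R%:R * (expR (- p) * p ^+ j)).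
Proof.
apply: (@ig_Ip _ (j`!%:R + (j.+2)`!%:R)) => [|p p0].
  apply: measurable_funM; last exact: measurable_funX.
  by apply: (measurableT_comp (@measurable_expR R)); exact: oppr_measurable.
rewrite ger0_norm; first exact/expRN_powM/ltW.
by rewrite mulr_ge0 ?expR_ge0// exprn_ge0// ltW.
Qed.

Lemma measurable_sqrt : measurable_fun setT (fun s : Rm => Num.sqrt s : R).
Proof. by apply: continuous_measurable_fun; exact: sqrt_continuous. Qed.

Lemma measurable_pospow k d (T : measurableType d) (f : T -> R) : measurable_fun setT f ->
  measurable_fun setT (fun y => pospow k (f y)).
Proof.
move=> mf; apply: (measurableT_comp _ mf).
by apply: continuous_measurable_fun; exact: continuous_pospow.
Qed.

(** Polar coordinates in a quadrant by one-dimensional substitutions: put [r = s w] at fixed [s],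
    exchange the integrals, then rescale [s] by the square root of [1 + w^2] at fixed [w]. The
    remaining integral of [1/(1 + w^2)] is the angle. *)
Lemma Ip_polar (g : R -> R) c : measurable_fun setT (g : Rm -> R) ->
  (forall s, 0 < s -> `|g s| <= c * (1 + s ^+ 2) ^- 2) ->
  Ip (fun s => Ip (fun r => g (Num.sqrt (r ^+ 2 + s ^+ 2)))) = om * Ip (fun s => s * g s).
Proof.
move=> mg hg.
have c0 : 0 <= c.
  have := le_trans (normr_ge0 _) (hg 1 ltr01); rewrite pmulr_lge0// invr_gt0 exprn_gt0//; exact: oneDsq_gt0.
have msg : measurable_fun setT (fun s : Rm => s * g s) by exact: measurable_funM.
have bsg s : 0 < s -> `|s * g s| <= c * (1 + s ^+ 2)^-1.
  move=> s0; rewrite normrM gtr0_norm//.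
  apply: (@le_trans _ _ (s * (c * (1 + s ^+ 2) ^- 2))); first by rewrite ler_wpM2l ?hg// ltW.
  rewrite mulrCA; apply: ler_wpM2l => //.
  have p0 := oneDsq_gt0 s; rewrite expr2 invfM mulrA ler_piMl ?invr_ge0 ?(ltW p0)//.
  by rewrite ler_pdivrMr// mul1r; have := sqr_ge0 (s - 1); rewrite -subr_ge0; nra.
have isg := ig_Ip msg bsg.
(* The integrand after the substitution [r = s w], with Jacobian [s]. *)
set f := fun (w s : Rm) => (0 < w)%R%:R * ((0 < s)%R%:R * (s * g (Num.sqrt (1 + w ^+ 2) * s))).
have mw : measurable_fun setT (fun p : Rm * Rm => Num.sqrt (1 + p.1 ^+ 2)).
  apply: (measurableT_comp measurable_sqrt).
  by apply: measurable_funD; [exact: measurable_cst|apply: measurable_funX; exact: measurable_fst].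
have mf : measurable_fun setT (fun p : Rm * Rm => f p.1 p.2).
  apply: measurable_funM; first by apply: (measurableT_comp measurable_pos); exact: measurable_fst.
  apply: measurable_funM; first by apply: (measurableT_comp measurable_pos); exact: measurable_snd.
  apply: measurable_funM; first exact: measurable_snd.
  by apply: (measurableT_comp mg); apply: measurable_funM => //; exact: measurable_snd.
have q0 (w : R) : 0 < Num.sqrt (1 + w ^+ 2) by rewrite sqrtr_gt0 oneDsq_gt0.
have q2 (w : R) : Num.sqrt (1 + w ^+ 2) ^+ 2 = 1 + w ^+ 2 by rewrite sqr_sqrtr// ltW// oneDsq_gt0.
have e1 (h : R -> R) w : ig la (fun s : Rm => (0 < s)%R%:R * (s * h s)) ->
   ig la (fun s : Rm => (0 < s)%R%:R * (s * h (Num.sqrt (1 + w ^+ 2) * s))) /\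
   In la (fun s : Rm => (0 < s)%R%:R * (s * h (Num.sqrt (1 + w ^+ 2) * s))) = (1 + w ^+ 2)^-1 * Ip (fun s => s * h s).
  move=> ih; have i' := ig_la_scale (q0 w) ih.
  have e s : (Num.sqrt (1 + w ^+ 2))^-1 * (fun s : Rm => (0 < s)%R%:R * (s * h s)) (Num.sqrt (1 + w ^+ 2) * s) =
      (0 < s)%R%:R * (s * h (Num.sqrt (1 + w ^+ 2) * s)).
    rewrite /= pmulr_rgt0//; set q := Num.sqrt _; have qn : q != 0 by rewrite /q gt_eqF.
    by field.
  split; first by apply: (eq_ig _ (igZ (Num.sqrt (1 + w ^+ 2))^-1 i')) => s; exact: e.
  by rewrite -[in RHS]q2 expr2 invfM -mulrA -(In_la_scale (q0 w) (ig_meas ih)) -InZ//; apply: eq_In => s; rewrite e.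
have i1 w : ig la (f w) by apply: igZ; have [] := e1 g w isg.
have i2 s : ig la (f ^~ s).
  have [s0|s0] := ltP 0 s; last first.
    by apply: (eq_ig _ (@ig0 _ _ _ la)) => w; rewrite /f [0 < s]ltNge s0/= mul0r mulr0.
  apply: (@ig_Ip _ (s * c / s ^+ 2)).
    do 2 (apply: measurable_funM; first exact: measurable_cst).
    apply: (measurableT_comp mg); apply: measurable_funM; last exact: measurable_cst.
    apply: (measurableT_comp measurable_sqrt).
    by apply: measurable_funD; [exact: measurable_cst|exact: measurable_funX].
  move=> w w0; rewrite /f s0 mul1r normrM (gtr0_norm s0) -!mulrA; apply: ler_wpM2l; first exact: ltW.
  have qs0 := mulr_gt0 (q0 w) s0.
  apply: (le_trans (hg _ qs0)); apply: ler_wpM2l => //.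
  rewrite exprMn q2 -invfM lef_pV2 ?posrE ?exprn_gt0 ?mulr_gt0 ?oneDsq_gt0 ?exprn_gt0//; last first.
    by rewrite ltr_pwDl// mulr_ge0 ?sqr_ge0// ltW// oneDsq_gt0.
  have : 0 <= (1 + w ^+ 2) * s ^+ 2 by rewrite mulr_ge0 ?sqr_ge0// ltW// oneDsq_gt0.
  by rewrite [s ^+ 2 * _]mulrC; set X := _ * _ => X0; nra.
have iasg : ig la (fun s : Rm => (0 < s)%R%:R * (s * `|g s|)).
  apply: (eq_ig _ (ig_abs isg)) => s; rewrite normrM normr_nat.
  by have [s0|] := ltP 0 s; rewrite ?mul0r// !mul1r normrM gtr0_norm.
set D := Ip (fun s => s * `|g s|).
have hD w : In la (fun s => `|f w s|) <= D * ((0 < w)%R%:R * (1 + w ^+ 2)^-1).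
  have [i3 e3] := e1 _ w iasg.
  rewrite mulrC -mulrA -/D -e3 -InZ// le_eqVlt; apply/orP; left; apply/eqP; apply: eq_In => s.
  rewrite /f !normrM !normr_nat.
  by have [s0|] := ltP 0 s; rewrite ?mul0r// !mul1r gtr0_norm.
have [_ _ e] := real_fubini mf i1 i2 (igZ D ig_oneDsqr_pos) hD.
transitivity (In la (fun s => In la (f ^~ s))).
  apply: eq_In => s; have [s0|s0] := ltP 0 s; last first.
    by rewrite mul0r (@eq_In _ _ _ la _ (fun=> 0)) ?In0// => w; rewrite /f [0 < s]ltNge s0/= mul0r mulr0.
  have mgs : measurable_fun setT (fun r : Rm => g (Num.sqrt (r ^+ 2 + s ^+ 2))).
    apply: (measurableT_comp mg); apply: (measurableT_comp measurable_sqrt).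
    by apply: measurable_funD; [exact: measurable_funX|exact: measurable_cst].
  have eS w : Num.sqrt ((s * w) ^+ 2 + s ^+ 2) = Num.sqrt (1 + w ^+ 2) * s.
    rewrite (_ : (s * w) ^+ 2 + s ^+ 2 = (1 + w ^+ 2) * s ^+ 2); last by ring.
    by rewrite sqrtrM ?(ltW (oneDsq_gt0 w))// sqrtr_sqr gtr0_norm.
  have := Ip_scale s0 mgs => /(congr1 (fun z => s * z)); rewrite mulVKf ?gt_eqF// mul1r => <-.
  have e2 w : (0 < w)%R%:R * g (Num.sqrt ((s * w) ^+ 2 + s ^+ 2)) = s^-1 * f w s.
    by rewrite eS /f s0 mul1r [s * g _]mulrC; field; rewrite gt_eqF.
  rewrite /Ip -InZ; last by apply: (eq_ig _ (igZ s^-1 (i2 s))) => w; rewrite e2.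
  by apply: eq_In => w; rewrite e2 mulVKf ?gt_eqF.
rewrite -e /om mulrC -InZ; last exact: ig_oneDsqr_pos.
apply: eq_In => w; have [_ e3] := e1 g w isg.
rewrite /f InZ; last by have [] := e1 g w isg.
rewrite e3; ring.
Qed.

(** By homogeneity in the square root of [N]. With [N = |z|^2] and [n = 2m+1] the right-hand side is
    a multiple of [|z|^-(n+1)], and the left-hand side a superposition of the kernels [H k.+1 s]. *)
Lemma Ip_invpow m k : exists2 kap, 0 < kap & forall N, 0 < N ->
  Ip (fun s => s ^- (2 * m + 3) * pospow k.+1 (1 - N / s ^+ 2)) = kap * N ^- m.+1.
Proof.
set G := fun N s : R => s ^- (2 * m + 3) * pospow k.+1 (1 - N / s ^+ 2).
have mG N : measurable_fun setT (G N : Rm -> R).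
  apply: measurable_funM; first exact: (measurable_invX _ (@measurable_id _ _ setT)).
  apply: measurable_pospow; apply: measurable_funB; first exact: measurable_cst.
  by apply: measurable_funM; [exact: measurable_cst|exact: (measurable_invX _ (@measurable_id _ _ setT))].
have G0 s : 0 < s -> 0 <= G 1 s by move=> s0; rewrite mulr_ge0 ?pospow_ge0// invr_ge0 exprn_ge0// ltW.
have bG s : 0 < s -> `|G 1 s| <= 2 * (1 + s ^+ 2)^-1.
  move=> s0; rewrite ger0_norm ?G0// /G.
  have [s1|s1] := leP s 1.
    rewrite [pospow _ _](_ : _ = 0) ?mulr0 ?mulr_ge0 ?invr_ge0 ?(ltW (oneDsq_gt0 s))//.
    rewrite /pospow max_l ?expr0n//; rewrite subr_le0 ler_pdivlMr ?exprn_gt0// !mul1r.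
    by rewrite exprn_ile1// ltW.
  have h1 : pospow k.+1 (1 - 1 / s ^+ 2) <= 1.
    by rewrite /pospow exprn_ile1 ?le_max ?lexx// ge_max ler01/= gerBl divr_ge0// exprn_ge0// ltW.
  apply: (@le_trans _ _ (s ^- (2 * m + 3))); first by rewrite ler_piMr// invr_ge0 exprn_ge0// ltW.
  rewrite ler_pdivlMr ?oneDsq_gt0// mulrC ler_pdivrMr ?exprn_gt0//.
  apply: (@le_trans _ _ (2 * s ^+ 2)); first by have := exprn_ege1 2 (ltW s1); lra.
  by rewrite ler_pM2l// ler_weXn2l ?(ltW s1)// addnC.
exists (Ip (G 1)).
  (* Positivity is seen on [[2, 3]], where [1 - 1/s^2 >= 3/4]. *)
  apply: (@lt_le_trans _ _ (In la (fun s : Rm => (2 <= s <= 3)%R%:R * (3 ^- (2 * m + 3) * (3 / 4) ^+ k.+1)))).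
    rewrite In_itvb ?ler_nat// mulr_gt0 ?subr_gt0 ?ltr_nat// mulr_gt0 ?invr_gt0 ?exprn_gt0// divr_gt0//.
  apply: In_le; [exact: ig_itvb|exact: ig_Ip bG|].
  move=> s; have [/andP[s2 s3]|_] := boolP (2 <= s <= 3); last first.
    by rewrite mul0r; have [s0|] := ltP 0 s; rewrite ?mul0r// mul1r G0.
  have s0 : 0 < s by apply: lt_le_trans s2.
  rewrite s0 !mul1r; apply: ler_pM; rewrite ?invr_ge0 ?exprn_ge0//.
    by rewrite lef_pV2 ?posrE ?exprn_gt0// lerXn2r ?nnegrE// ltW.
  have h : 3 / 4 <= 1 - 1 / s ^+ 2.
    rewrite lerBrDr -lerBrDl mul1r -[leRHS]invrK lef_pV2 ?posrE ?exprn_gt0//; last by rewrite invr_gt0; lra.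
    apply: (@le_trans _ _ 4); last by nra.
    by rewrite (_ : (1 - 3 / 4)^-1 = 4 :> R)//; field.
  by rewrite /pospow lerXn2r ?nnegrE ?le_max ?h ?orbT ?divr_ge0 ?lexx.
move=> N N0; have c0 : 0 < Num.sqrt N by rewrite sqrtr_gt0.
have := Ip_scale c0 (mG N).
have cn : Num.sqrt N != 0 by rewrite gt_eqF.
have -> : Ip (fun s => G N (Num.sqrt N * s)) = Num.sqrt N ^- (2 * m + 3) * Ip (G 1).
  rewrite /Ip -InZ; last exact: ig_Ip bG.
  apply: eq_In => s; have [s0|] := ltP 0 s; last by rewrite !mul0r mulr0.
  rewrite !mul1r /G !exprMn invfM -!mulrA; congr (_ * (_ * pospow _ (1 - _))).
  by rewrite [X in N / X]mulrA -expr2 sqr_sqrtr ?(ltW N0)// invfM mulrA mulfV ?gt_eqF.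
move=> /(congr1 (fun z => Num.sqrt N * z)); rewrite mulVKf// => <-.
rewrite mulrA [RHS]mulrC; congr (_ * _).
rewrite (_ : (2 * m + 3 = (2 * m.+1).+1)%N); last by lia.
by rewrite exprS invfM mulVKf// exprM sqr_sqrtr// ltW.
Qed.

Lemma ge0_In_la_shift a (g : Rm -> R) : measurable_fun setT g -> (forall t, 0 <= g t) ->
  In la (fun t : Rm => g (t + a)) = In la g.
Proof.
move=> mg g0; congr fine.
by have := @ge0_integral_la_shift R a (fun t => (g t)%:E) _ _; apply => //; exact/measurable_EFinP.
Qed.

(** For [p > 0] the powers combine to the positive part of [p - a], and a translation by [a]
    produces [exp(-a)]. This is how a Gaussian becomes a superposition of kernels [H]. *)
Lemma Ip_expR_pospow k a : 0 <= a ->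
  Ip (fun p => expR (- p) * p ^+ k.+1 * pospow k.+1 (1 - a / p)) =
  expR (- a) * Ip (fun p => expR (- p) * p ^+ k.+1).
Proof.
move=> a0.
set F := fun p : Rm => expR (- a) * (expR (- p) * pospow k.+1 p).
have mF : measurable_fun setT F.
  apply: measurable_funM; first exact: measurable_cst.
  apply: measurable_funM; last by apply: measurable_pospow; exact: measurable_id.
  by apply: (measurableT_comp (@measurable_expR R)); exact: oppr_measurable.
have F0 p : 0 <= F p by rewrite /F !mulr_ge0 ?expR_ge0 ?pospow_ge0.
rewrite /Ip -InZ; last exact: ig_expRN_pow.
transitivity (In la F); last first.
  apply: eq_In => p; rewrite /F /pospow; have [p0|p0] := ltP 0 p.
    by rewrite mul1r.
  by rewrite expr0n !mulr0 mul0r mulr0.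
rewrite -(ge0_In_la_shift (- a) mF F0); apply: eq_In => p; rewrite /F /pospow.
have [p0|p0] := ltP 0 p; last by rewrite mul0r max_l ?expr0n ?mulr0//; lra.
rewrite mul1r mulrA -expRD (_ : - a + - (p - a) = - p); last by ring.
rewrite -mulrA; congr (_ * _).
rewrite -exprMn maxr_pMr ?(ltW p0)// mulr0 mulrBr mulr1 mulrCA mulfV ?mulr1 ?gt_eqF//.
Qed.

End HalfLine.

(** * Gaussian averages *)

Lemma measurable_integral1 d1 d2 (T1 : measurableType d1) (T2 : measurableType d2) (R : realType)
    (m2 : {sigma_finite_measure set T2 -> \bar R}) (f : T1 * T2 -> \bar R) :
  measurable_fun setT f -> measurable_fun setT (fun x => (\int[m2]_y f (x, y))%E).
Proof.
move=> mf; under eq_fun do rewrite integralE.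
apply: emeasurable_funB.
  have := measurable_fun_fubini_tonelli_F (m2 := m2) _ (measurable_funepos mf) (fun p => funepos_ge0 _ p).
  by congr measurable_fun; apply/funext => x; apply: eq_integral => y _; rewrite !funeposE.
have := measurable_fun_fubini_tonelli_F (m2 := m2) _ (measurable_funeneg mf) (fun p => funeneg_ge0 _ p).
by congr measurable_fun; apply/funext => x; apply: eq_integral => y _; rewrite !funenegE.
Qed.

(** * Iterated integrals of signed functions *)

Section IteratedIntegral.
Variable R : realType.
Local Notation Rm := (measurableTypeR R).
Local Notation la := (@lebesgue_measure R).

(** Holds without sign or integrability, since the integrals of the positive and of the negative
    part are each measurable in the parameter. *)
Lemma measurable_iint n d (T : measurableType d) (F : T -> 'rV[R]_n -> \bar R) :
  measurable_fun setT (fun p : T * 'rV[R]_n => F p.1 p.2) ->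
  measurable_fun setT (fun x => iint (F x)).
Proof.
elim: n d T F => [|n IH] d T F mF.
  exact: (measurableT_comp mF (measurable_fun_pair (@measurable_id _ T setT) (@measurable_cst _ _ T _ setT (0 : 'rV[R]_0)))).
have mG : measurable_fun setT (fun p : T * Rm => iint (fun v => F p.1 (consv p.2 v))).
  apply: (IH _ _ (fun p v => F p.1 (consv p.2 v))).
  have m1 : measurable_fun setT (fun q : T * Rm * 'rV[R]_n => q.1.1).
    exact: (measurableT_comp measurable_fst measurable_fst).
  have m2 : measurable_fun setT (fun q : T * Rm * 'rV[R]_n => consv q.1.2 q.2).
    apply: measurable_consv; last exact: measurable_snd.
    exact: (measurableT_comp measurable_snd measurable_fst).
  exact: (measurableT_comp mF (measurable_fun_pair m1 m2)).
exact: (measurable_integral1 la mG).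
Qed.

(* For almost every value of the first coordinate the slice is integrable; on the other slices
   [iint] is junk, but jointly measurable, hence harmless. *)
Lemma iint_integrable n (f : 'rV[R]_n -> \bar R) :
  (leb R n).-integrable setT f -> iint f = (\int[leb R n]_x f x)%E.
Proof.
elim: n f => [|n IH] f i_f; have /integrableP[mf _] := i_f.
  rewrite [RHS]integralE !ge0_integral_leb0//; try exact: measurable_funepos; try exact: measurable_funeneg.
  by rewrite {1}[f]funeposneg.
have mc := @measurable_consv_pair R n.
have ip : (la \x leb R n)%E.-integrable setT (f \o (fun p : Rm * 'rV[R]_n => consv p.1 p.2)).
  apply/(integrable12ltyP _ _ (measurableT_comp mf mc)).
  have /integrableP[_] := i_f; rewrite ge0_integral_lebS//.
  exact: measurableT_comp.
have -> : (\int[leb R n.+1]_x f x = \int[la \x leb R n]_p (f \o (fun p : Rm * 'rV[R]_n => consv p.1 p.2)) p)%E.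
  by rewrite [LHS](integral_pushforward mc) ?preimage_setT.
rewrite -integral12_prod_meas1//=.
apply: ae_eq_integral => //.
- apply: (@measurable_iint _ _ _ (fun t v => f (consv t v))); exact: (measurableT_comp mf mc).
- exact: (measurable_fubini_F ip).
have := ae_integrable1 ip; apply: filterS => t it _; exact: IH.
Qed.
End IteratedIntegral.

Lemma ig_la_opp (R : realType) (f : measurableTypeR R -> R) :
  ig (@lebesgue_measure R) f -> ig (@lebesgue_measure R) (fun t : measurableTypeR R => f (- t)).
Proof.
move=> i_f; have mf := ig_meas i_f.
have ms : measurable_fun setT (fun t : measurableTypeR R => - t : measurableTypeR R) by exact: oppr_measurable.
apply/integrableP; split; first by apply/measurable_EFinP; exact: (measurableT_comp mf ms).
have mF : measurable_fun setT (fun x : measurableTypeR R => `|(f x)%:E|%E) by apply: measurableT_comp => //; exact/measurable_EFinP.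
have /integrableP[_] := i_f.
by rewrite -(ge0_integral_la_opp mF (fun x => abse_ge0 _)).
Qed.

Section Gaussian.
Variables (R : realType) (n : nat).
Local Notation Rm := (measurableTypeR R).
Local Notation la := (@lebesgue_measure R).
Local Notation leb := (leb R n).
Implicit Types (x z : 'rV[R]_n) (s t a b r : R) (w : 'rV[R]_n -> R).

Definition gs r z : R := expR (- (nsq z / r ^+ 2)).

Lemma gs_ge0 r z : 0 <= gs r z. Proof. exact: expR_ge0. Qed.

Lemma gs_le1 r z : gs r z <= 1.
Proof. by rewrite -expR0 ler_expR oppr_le0 divr_ge0 ?nsq_ge0// sqr_ge0. Qed.

(** Exponents above 1 only decrease the kernel, and [1 - a <= exp(-a)]. *)
Lemma H_le_gs k r z : H k.+1 r z <= gs r z.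
Proof.
have h1 := H_mono r z (ltn0Sn k); apply: (le_trans h1).
rewrite /H /pospow expr1 ge_max expR_ge0/=.
by apply: le_trans (expR_ge1Dx _).
Qed.

Lemma measurable_gs d (T : measurableType d) (r : T -> R) (z : T -> 'rV[R]_n) :
  measurable_fun setT r -> measurable_fun setT z -> measurable_fun setT (fun y => gs (r y) (z y)).
Proof.
move=> mr mz; apply: (measurableT_comp (@measurable_expR R)).
apply: (measurableT_comp (@oppr_measurable R setT)).
by apply: measurable_funM; [exact: measurable_nsq|exact: measurable_invX].
Qed.

(** The square root of pi, kept symbolic. *)
Definition g1 : R := In la (fun t : Rm => expR (- t ^+ 2)).

Lemma mg1 c : measurable_fun setT (fun t : Rm => expR (- (c * t) ^+ 2) : R).
Proof.
apply: (measurableT_comp (@measurable_expR R)); apply: (measurableT_comp (@oppr_measurable R setT)).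
by apply: measurable_funX; apply: measurable_funM => //; exact: measurable_cst.
Qed.

Lemma ig_g1 : ig la (fun t : Rm => expR (- t ^+ 2)).
Proof.
have m1 : measurable_fun setT (fun t : Rm => expR (- t ^+ 2) : R).
  by have := mg1 1; congr measurable_fun; apply/funext => t; rewrite mul1r.
have hp : ig la (fun t : Rm => (0 < t)%R%:R * expR (- t ^+ 2)).
  apply: (@ig_Ip _ _ 1) => // s s0; rewrite ger0_norm ?expR_ge0// mul1r expRN.
  by rewrite lef_pV2 ?posrE ?expR_gt0 ?oneDsq_gt0// expR_ge1Dx.
have hn := ig_la_opp hp.
have h1 := @ig_itvb R 0 0 1.
apply: (ig_le m1 _ (igD (igD hp hn) h1)) => t.
rewrite ger0_norm ?expR_ge0// sqrrN oppr_gt0.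
by have [t0|t0|->] := ltgtP t 0; rewrite ?mul1r ?mul0r ?mulr1 ?add0r ?addr0 ?lexx ?lerDl// expr0n oppr0 expR0 !add0r.
Qed.

Lemma g1_gt0 : 0 < g1.
Proof.
apply: (@lt_le_trans _ _ (In la (fun t : Rm => (0 <= t <= 1)%R%:R * expR (- 1)))).
  by rewrite In_itvb// subr0 mulr1 expR_gt0.
apply: In_le; [exact: ig_itvb|exact: ig_g1|].
move=> t; have [/andP[t0 t1]|_] := boolP (0 <= t <= 1); last by rewrite mul0r expR_ge0.
by rewrite mul1r ler_expR lerN2 exprn_ile1.
Qed.

Lemma In_gs r : 0 < r -> ig leb (gs r) /\ In leb (gs r) = (r * g1) ^+ n.
Proof.
move=> r0; have e z : gs r z = \prod_i expR (- (r^-1 * z 0 i) ^+ 2).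
  rewrite -expR_sum /gs /nsq mulr_suml -sumrN; congr expR; apply: eq_bigr => i _.
  by rewrite exprMn exprVn mulrC.
have h : (\int[leb]_x (gs r x)%:E = ((r * g1) ^+ n)%:E)%E.
  under eq_integral do rewrite e.
  rewrite (@ge0_integral_leb_prod R n (fun i t => expR (- (r^-1 * t) ^+ 2))) => [||i t]; [|by move=> i; exact: mg1|exact: expR_ge0].
  rewrite big_const cardE size_enum_ord.
  have i1 : ig la (fun t : Rm => expR (- (r^-1 * t) ^+ 2)).
    by apply: (ig_la_scale _ ig_g1); rewrite invr_gt0.
  rewrite (InE i1) (@In_la_scale _ _ (fun t : Rm => expR (- t ^+ 2))) ?invr_gt0//; last exact: ig_meas ig_g1.
  rewrite invrK -/g1; elim: {e} n => [|k IH] /=; first by rewrite expr0.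
  by rewrite IH -EFinM exprS.
split; last by rewrite /In h.
apply/(@ge0_igP _ _ _ leb); [|exact: gs_ge0|by rewrite h ltry].
by apply: measurable_gs => //; exact: measurable_cst.
Qed.

(** Completing the square in [z]: the widths add as squares, and the leftover Gaussian is a
    translate whose integral over [z] does not depend on [y]. *)
Lemma gs_mul s r y z : 0 < s -> 0 < r ->
  gs s z * gs r (y - z) = gs (Num.sqrt (s ^+ 2 + r ^+ 2)) y *
    gs (s * r / Num.sqrt (s ^+ 2 + r ^+ 2)) (z - (s ^+ 2 / (s ^+ 2 + r ^+ 2)) *: y).
Proof.
move=> s0 r0; rewrite /gs -!expRD; congr expR.
set q := Num.sqrt _; have q2 : q ^+ 2 = s ^+ 2 + r ^+ 2 by rewrite sqr_sqrtr// addr_ge0// sqr_ge0.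
have sr0 : 0 < s ^+ 2 + r ^+ 2 by rewrite addr_gt0// exprn_gt0.
rewrite expr_div_n q2 -!opprD; congr (- _); rewrite /nsq !mulr_suml -!big_split /=.
apply: eq_bigr => i _; rewrite !mxE.
by field; rewrite !gt_eqF.
Qed.

Lemma In_gs_mul s r y : 0 < s -> 0 < r ->
  ig leb (fun z => gs s z * gs r (y - z)) /\
  In leb (fun z => gs s z * gs r (y - z)) =
    (s * r / Num.sqrt (s ^+ 2 + r ^+ 2) * g1) ^+ n * gs (Num.sqrt (s ^+ 2 + r ^+ 2)) y.
Proof.
move=> s0 r0; set q := Num.sqrt _.
have q0 : 0 < q by rewrite sqrtr_gt0 addr_gt0// exprn_gt0.
have p0 : 0 < s * r / q by rewrite divr_gt0// mulr_gt0.
have [i1 e1] := In_gs p0.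
set a := - ((s ^+ 2 / (s ^+ 2 + r ^+ 2)) *: y).
have e z : gs q y * gs (s * r / q) (z + a) = gs s z * gs r (y - z) by rewrite gs_mul.
have i2 := ig_shift a i1.
split; first by apply: (eq_ig e); exact: igZ.
rewrite -(eq_In leb e) InZ// mulrC; congr (_ * _).
by rewrite In_shift ?e1//; exact: ig_meas i1.
Qed.

(* Normalized so that the kernel of [Eg] has mass [g1 ^+ n]. *)
Definition Eg r w x : R := r ^- n * In leb (fun z => w (x + z) * gs r z).

Lemma ig_Eg r w x : 0 < r -> measurable_fun setT w ->
  (exists M, forall y, `|w y| <= M) -> ig leb (fun z => w (x + z) * gs r z).
Proof.
move=> r0 mw [M hM]; have [i1 _] := In_gs r0.
apply: (ig_le _ _ (igZ M i1)).
  apply: measurable_funM; last by apply: measurable_gs => //; exact: measurable_cst.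
  by apply: (measurableT_comp mw); apply: measurable_rowD => //; exact: measurable_cst.
by move=> z; rewrite normrM (ger0_norm (gs_ge0 _ _)) ler_wpM2r ?gs_ge0.
Qed.

End Gaussian.

(** * The semigroup law and passage between kernels and Gaussians *)

Section Semigroup.
Variables (R : realType) (n : nat).
Local Notation Rm := (measurableTypeR R).
Local Notation la := (@lebesgue_measure R).
Local Notation leb := (leb R n).
Implicit Types (x z : 'rV[R]_n) (s t a b r p : R) (w : 'rV[R]_n -> R).

(** Fubini only needs the averages of [|w|] to be bounded uniformly in the centre. A bound on [w]
    itself would be too strong: the law is also applied to the absolute value of a merely integrable
    function. *)
Lemma Eg_semigroup w s r x M : 0 < s -> 0 < r -> measurable_fun setT w ->
  (forall y, ig leb (fun z => w (y + z) * gs s z)) ->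
  (forall y, In leb (fun z => `|w (y + z)| * gs s z) <= M) ->
  Eg r (Eg s w) x = g1 R ^+ n * Eg (Num.sqrt (s ^+ 2 + r ^+ 2)) w x.
Proof.
move=> s0 r0 mw hw hM; set q := Num.sqrt _.
have q0 : 0 < q by rewrite sqrtr_gt0 addr_gt0// exprn_gt0.
set f := fun z y : 'rV[R]_n => w (x + y) * gs s (y - z) * gs r z.
have mwx d (T : measurableType d) (h : T -> 'rV[R]_n) : measurable_fun setT h -> measurable_fun setT (fun y => w (x + h y)).
  by move=> mh; apply: (measurableT_comp mw); apply: measurable_rowD => //; exact: measurable_cst.
have mf : measurable_fun setT (fun p : 'rV[R]_n * 'rV[R]_n => f p.1 p.2).
  apply: measurable_funM; last by apply: measurable_gs; [exact: measurable_cst|exact: measurable_fst].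
  apply: measurable_funM; first by apply: mwx; exact: measurable_snd.
  apply: measurable_gs; first exact: measurable_cst.
  by apply: measurable_rowD; [exact: measurable_snd|apply: measurable_rowN; exact: measurable_fst].
have e1 (v : 'rV[R]_n -> R) z y : v (x + y) * gs s (y - z) = (fun y => v (x + z + y) * gs s y) (y - z).
  by congr (v _ * _); rewrite [y - z]addrC addrA addrK.
have i1 z : ig leb (fun y => w (x + y) * gs s (y - z)).
  by apply: (eq_ig (fun y => esym (e1 w z y))); exact: (ig_shift _ (hw (x + z))).
have I1 z : In leb (fun y => w (x + y) * gs s (y - z)) = s ^+ n * Eg s w (x + z).
  rewrite (eq_In leb (e1 w z)) (@In_shift _ _ _ (fun y => w (x + z + y) * gs s y)); last exact: ig_meas (hw _).
  by rewrite /Eg mulVKf// expf_neq0// gt_eqF.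
have f1 z : ig leb (f z) by apply: (eq_ig _ (igZ (gs r z) (i1 z))) => y; rewrite mulrC.
have f2 y : ig leb (f ^~ y).
  have [h _] := In_gs_mul y r0 s0.
  by apply: (eq_ig _ (igZ (w (x + y)) h)) => z; rewrite /f -mulrA [gs r z * _]mulrC.
have hg z : In leb (fun y => `|f z y|) <= M * gs r z.
  have i2 := ig_abs (hw (x + z)).
  rewrite (@eq_In _ _ _ leb _ (fun y => gs r z * (fun y => `|w (x + z + y) * gs s y|) (y - z))); last first.
    move=> y; rewrite /f normrM (ger0_norm (gs_ge0 _ _)) mulrC; congr (_ * `|w _ * _|).
    by rewrite [y - z]addrC addrA addrK.
  rewrite InZ; last exact: (ig_shift _ i2).
  rewrite mulrC ler_wpM2r ?gs_ge0// (In_shift _ (ig_meas i2)); apply: le_trans (hM (x + z)).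
  rewrite le_eqVlt; apply/orP; left; apply/eqP; apply: eq_In => y.
  by rewrite normrM (ger0_norm (gs_ge0 _ _)).
have [ir _] := @In_gs R n r r0.
have sn : s ^+ n != 0 by rewrite expf_neq0// gt_eqF.
have rn : r ^+ n != 0 by rewrite expf_neq0// gt_eqF.
have qn : q ^+ n != 0 by rewrite expf_neq0// gt_eqF.
rewrite {1}/Eg.
have [j1 j2 e] := real_fubini mf f1 f2 (igZ M ir) hg.
have e2 z : Eg s w (x + z) * gs r z = s ^- n * In leb (f z).
  have -> : In leb (f z) = In leb (fun y => gs r z * (w (x + y) * gs s (y - z))) by apply: eq_In => y; exact: mulrC.
  by rewrite (InZ (gs r z) (i1 z)) I1 [RHS]mulrCA (mulKf sn) [RHS]mulrC.
rewrite (eq_In leb e2) (InZ (s ^- n) j1) e.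
set c := (r * s / q * g1 R) ^+ n.
have c0 : 0 < r * s / q * g1 R := mulr_gt0 (divr_gt0 (mulr_gt0 r0 s0) q0) (g1_gt0 R).
have cn : c != 0 := expf_neq0 n (lt0r_neq0 c0).
have e3 y : In leb (f ^~ y) = c * (w (x + y) * gs q y).
  have [h1 h2] := In_gs_mul y r0 s0.
  have -> : In leb (f ^~ y) = In leb (fun z => w (x + y) * (gs r z * gs s (y - z))).
    by apply: eq_In => z; rewrite /f -mulrA [gs r z * _]mulrC.
  by rewrite (InZ (w (x + y)) h1) h2 [r ^+ 2 + _]addrC -/q mulrCA.
have i3 : ig leb (fun y => w (x + y) * gs q y).
  by apply: (eq_ig _ (igZ c^-1 j2)) => y; rewrite e3 mulKf.
rewrite (eq_In leb e3) (InZ c i3) /Eg /c.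
have gen (a b d h i : R) : a != 0 -> b != 0 -> a^-1 * (b^-1 * (a * b * d * h * i)) = h * (d * i) by move=> a0 b0; field; rewrite a0 b0.
by rewrite !exprMn exprVn; exact: gen.
Qed.

(** The Gamma integral with value [(k+1)!]. *)
Definition Gam k : R := Ip (fun p : R => expR (- p) * p ^+ k.+1).

Lemma Gam_gt0 k : 0 < Gam k.
Proof.
apply: (@lt_le_trans _ _ (In la (fun p : Rm => (1 <= p <= 2)%R%:R * expR (- 2)))).
  by rewrite In_itvb ?ler1n// mulr_gt0 ?expR_gt0// subr_gt0 ltr1n.
apply: In_le; [exact: ig_itvb|exact: ig_expRN_pow|].
move=> p; have [/andP[p1 p2]|_] := boolP (1 <= p <= 2); last first.
  by rewrite mul0r; have [p0|] := ltP 0 p; rewrite ?mul0r// mul1r mulr_ge0 ?expR_ge0// exprn_ge0// ltW.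
rewrite (lt_le_trans ltr01 p1) !mul1r -[leLHS]mulr1; apply: ler_pM; rewrite ?expR_ge0// ?exprn_ege1//.
by rewrite ler_expR lerN2.
Qed.

Lemma gs_superpose k r z : 0 < r ->
  Ip (fun p : R => expR (- p) * p ^+ k.+1 * H k.+1 (r * Num.sqrt p) z) = Gam k * gs r z.
Proof.
move=> r0; rewrite mulrC /gs -Ip_expR_pospow; last by rewrite divr_ge0 ?nsq_ge0// sqr_ge0.
apply: eq_Ip => p p0; congr (_ * pospow _ (1 - _)).
by rewrite exprMn sqr_sqrtr ?(ltW p0)// invfM mulrA.
Qed.

Lemma measurable_Jm k w d (T : measurableType d) (a : T -> 'rV[R]_n) (b : T -> R) :
  measurable_fun setT w -> measurable_fun setT a -> measurable_fun setT b ->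
  measurable_fun setT (fun y => J k w (a y) (b y)).
Proof.
move=> mw ma mb; apply: measurable_funM; first exact: measurable_invX.
apply: (@measurable_In1 _ _ T _ R leb (fun y z => w (a y + z) * H k (b y) z)).
apply: measurable_funM.
  apply: (measurableT_comp mw); apply: measurable_rowD; last exact: measurable_snd.
  exact: (measurableT_comp ma measurable_fst).
apply: measurable_pospow; apply: measurable_funB; first exact: measurable_cst.
apply: measurable_funM; first by apply: measurable_nsq; exact: measurable_snd.
by apply: measurable_invX; exact: (measurableT_comp mb measurable_fst).
Qed.

(** [gs_superpose] integrated against [w]. The factor [Num.sqrt p ^+ n] undoes the normalization of
    [J] at scale [r] times the square root of [p]. *)
Lemma Eg_J k w r x M : 0 < r -> measurable_fun setT w -> (forall y, `|w y| <= M) ->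
  Gam k * Eg r w x = Ip (fun p : R => expR (- p) * p ^+ k.+1 * Num.sqrt p ^+ n * J k.+1 w x (r * Num.sqrt p)).
Proof.
move=> r0 mw hM.
set f := fun (z : 'rV[R]_n) (p : Rm) => (0 < p)%R%:R * (expR (- p) * p ^+ k.+1) * (w (x + z) * H k.+1 (r * Num.sqrt p) z).
have me : measurable_fun setT (fun p : Rm => (0 < p)%R%:R * (expR (- p) * p ^+ k.+1)) by exact: ig_meas (@ig_expRN_pow R _).
have mwx : measurable_fun setT (fun z => w (x + z)).
  by apply: (measurableT_comp mw); apply: measurable_rowD => //; exact: measurable_cst.
have mrs : measurable_fun setT (fun p : Rm => r * Num.sqrt p : R).
  by apply: measurable_funM; [exact: measurable_cst|exact: measurable_sqrt].
have mf : measurable_fun setT (fun q : 'rV[R]_n * Rm => f q.1 q.2).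
  apply: measurable_funM; first exact: (measurableT_comp me measurable_snd).
  apply: measurable_funM; first exact: (measurableT_comp mwx measurable_fst).
  apply: measurable_pospow; apply: measurable_funB; first exact: measurable_cst.
  apply: measurable_funM; first by apply: measurable_nsq; exact: measurable_fst.
  by apply: measurable_invX; exact: (measurableT_comp mrs measurable_snd).
have e0 (p : R) : 0 <= (0 < p)%R%:R * (expR (- p) * p ^+ k.+1).
  by have [p0|] := ltP 0 p; rewrite ?mul0r// mul1r mulr_ge0 ?expR_ge0// exprn_ge0// ltW.
have M0 : 0 <= M by apply: le_trans (hM 0).
have f1 z : ig la (f z).
  apply: (ig_le _ _ (igZ M (@ig_expRN_pow R k.+1))); first exact: measurable_slice1 mf z.
  move=> p; rewrite /f normrM (ger0_norm (e0 p)) mulrC ler_wpM2r// normrM (ger0_norm (H_ge0 _ _ _)).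
  by rewrite -[leRHS]mulr1 ler_pM ?H_ge0 ?H_le1.
have f2 (p : Rm) : ig leb (f ^~ p).
  have [p0|p0] := ltP 0 p; last first.
    by apply: (eq_ig _ (@ig0 _ _ _ leb)) => z; rewrite /f ltNge p0/= !mul0r.
  have rp0 : 0 < r * Num.sqrt p by rewrite mulr_gt0// sqrtr_gt0.
  apply: igZ; have [i _] := In_gs n rp0.
  apply: (ig_le _ _ (igZ M i)).
    apply: measurable_funM => //; apply: continuous_row_measurable; exact: continuous_H.
  by move=> z; rewrite normrM (ger0_norm (H_ge0 _ _ _)) ler_pM ?H_ge0 ?H_le_gs.
have ph z : ig la (fun p : Rm => (0 < p)%R%:R * (expR (- p) * p ^+ k.+1 * H k.+1 (r * Num.sqrt p) z)).
  apply: (ig_le _ _ (@ig_expRN_pow R k.+1)).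
    apply: measurable_funM; first exact: measurable_pos.
    apply: measurable_funM.
      apply: measurable_funM; last exact: measurable_funX.
      by apply: (measurableT_comp (@measurable_expR R)); exact: oppr_measurable.
    apply: measurable_pospow; apply: measurable_funB; first exact: measurable_cst.
    by apply: measurable_funM; [exact: measurable_cst|exact: measurable_invX].
  by move=> p; rewrite mulrA normrM (ger0_norm (e0 p)) (ger0_norm (H_ge0 _ _ _)) ler_piMr// H_le1.
have e1 z : In la (fun p => `|f z p|) = Gam k * (`|w (x + z)| * gs r z).
  rewrite mulrCA -gs_superpose// /Ip -InZ//; apply: eq_In => p.
  by rewrite /f normrM (ger0_norm (e0 p)) normrM (ger0_norm (H_ge0 _ _ _)); ring.
have hg z : In la (fun p => `|f z p|) <= (Gam k * M) * gs r z.
  rewrite e1 -mulrA ler_wpM2l ?(ltW (Gam_gt0 k))// ler_wpM2r ?gs_ge0//.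
have [ir _] := @In_gs R n r r0.
have [j1 j2 e] := real_fubini mf f1 f2 (igZ _ ir) hg.
have e2 z : In la (f z) = Gam k * (w (x + z) * gs r z).
  rewrite mulrCA -gs_superpose// /Ip -InZ//; apply: eq_In => p.
  by rewrite /f; ring.
have iE := ig_Eg x r0 mw (ex_intro _ M hM).
rewrite /Eg mulrCA -InZ// -(eq_In leb e2) e /Ip.
have e3 (p : Rm) : (0 < p)%R%:R * (expR (- p) * p ^+ k.+1 * Num.sqrt p ^+ n * J k.+1 w x (r * Num.sqrt p)) =
    r ^- n * In leb (f ^~ p).
  have [p0|p0] := ltP 0 p; last first.
    by rewrite mul0r (@eq_In _ _ _ leb _ (fun=> 0)) ?In0 ?mulr0// => z; rewrite /f ltNge p0/= !mul0r.
  have p1 : 0 < Num.sqrt p by rewrite sqrtr_gt0.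
  have rp0 : 0 < r * Num.sqrt p by rewrite mulr_gt0.
  have [i _] := In_gs n rp0.
  rewrite mul1r /f InZ.
    rewrite p0 mul1r /J exprMn invfM; set I := In leb _; set E := expR _ * _.
    have pn : Num.sqrt p ^+ n != 0 by rewrite expf_neq0// gt_eqF.
    have gen (a b c d : R) : b != 0 -> a * b * (c / b * d) = c * (a * d) by move=> b0; field.
    exact: gen.
  apply: (ig_le _ _ (igZ M i)).
    by apply: measurable_funM => //; apply: continuous_row_measurable; exact: continuous_H.
  by move=> z; rewrite normrM (ger0_norm (H_ge0 _ _ _)) ler_pM ?H_ge0 ?H_le_gs.
by rewrite (eq_In la e3) (InZ (r ^- n) j2).
Qed.

(** Changing the scale by the square root of [p] costs a factor [p^-2] for [p <= 1] and nothing for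
    [p > 1]. *)
Lemma decay_scale p r : 0 < p -> (1 + (r * Num.sqrt p) ^+ 2) ^- 2 <= (1 + p ^- 2) * (1 + r ^+ 2) ^- 2.
Proof.
move=> p0; rewrite exprMn sqr_sqrtr ?(ltW p0)//.
have r2 : 0 <= r ^+ 2 by exact: sqr_ge0.
have pp : 0 < p ^+ 2 by rewrite exprn_gt0.
have X0 : 0 < 1 + r ^+ 2 * p by rewrite ltr_pwDl// mulr_ge0// ltW.
have Y0 := oneDsq_gt0 r.
rewrite ler_pdivlMr ?exprn_gt0// mulrC ler_pdivrMr ?exprn_gt0//.
rewrite mulrDl mul1r; have [p1|p1] := leP p 1.
  apply: ler_wpDl; first by rewrite exprn_ge0// ltW.
  rewrite mulrC ler_pdivlMr// -exprMn lerXn2r ?nnegrE ?mulr_ge0 ?(ltW X0) ?(ltW Y0) ?(ltW p0)//.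
  by rewrite mulrDl mul1r lerD2r.
apply: ler_wpDr; first by rewrite mulr_ge0 ?invr_ge0 ?exprn_ge0// ltW.
by rewrite lerXn2r ?nnegrE ?(ltW X0) ?(ltW Y0)// lerD2l ler_peMr// ltW.
Qed.

Lemma sqrt_pow_le p j : 0 <= p -> Num.sqrt p ^+ j <= 1 + p ^+ j.
Proof.
move=> p0; have [p1|p1] := leP p 1.
  by apply: ler_wpDr; rewrite ?exprn_ge0// exprn_ile1 ?sqrtr_ge0// -sqrtr1 ler_wsqrtr.
apply: ler_wpDl => //; rewrite lerXn2r ?nnegrE ?sqrtr_ge0//.
by rewrite -[leRHS](ger0_norm p0) -sqrtr_sqr ler_wsqrtr// expr2 ler_peMr// ltW.
Qed.

Lemma expRN_sqrt_ge0 p j i : 0 < p -> 0 <= expR (- p) * p ^+ j * Num.sqrt p ^+ i.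
Proof. by move=> /ltW p0; rewrite !mulr_ge0 ?expR_ge0 ?exprn_ge0 ?sqrtr_ge0. Qed.

Lemma ig_expRN_sqrt j i : ig la (fun p : Rm => (0 < p)%R%:R * (expR (- p) * p ^+ j * Num.sqrt p ^+ i)).
Proof.
apply: (ig_le _ _ (igD (@ig_expRN_pow R j) (@ig_expRN_pow R (j + i)))).
  apply: measurable_funM; first exact: measurable_pos.
  apply: measurable_funM; last by apply: measurable_funX; exact: measurable_sqrt.
  apply: measurable_funM; last exact: measurable_funX.
  by apply: (measurableT_comp (@measurable_expR R)); exact: oppr_measurable.
move=> p; have [p0|p0] := ltP 0 p; last by rewrite !mul0r normr0 addr0.
rewrite !mul1r exprD mulrA -[X in X + _]mulr1 -mulrDr ger0_norm; last first.
  by rewrite !mulr_ge0 ?expR_ge0 ?exprn_ge0 ?sqrtr_ge0// ltW.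
by apply: ler_wpM2l; [rewrite mulr_ge0 ?expR_ge0 ?exprn_ge0// ltW|rewrite sqrt_pow_le// ltW].
Qed.

Lemma Eg_decay k w A : measurable_fun setT w -> (exists M, forall y, `|w y| <= M) ->
  (forall y s, 0 < s -> `|J k.+3 w y s| <= A * (1 + s ^+ 2) ^- 2) ->
  exists A', forall y s, 0 < s -> `|Eg s w y| <= A' * (1 + s ^+ 2) ^- 2.
Proof.
move=> mw [M hM] hA.
have A0 : 0 <= A.
  have := le_trans (normr_ge0 _) (hA 0 1 ltr01); rewrite pmulr_lge0// invr_gt0 exprn_gt0//; exact: oneDsq_gt0.
(* The factor [1 + p^-2] of [decay_scale] splits the weight [p^(k+3)] into [p^(k+3) + p^(k+1)];
   having exponent [k.+3] to begin with keeps both integrable. *)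
set W := In la (fun p : Rm => (0 < p)%R%:R * (expR (- p) * p ^+ k.+3 * Num.sqrt p ^+ n) +
   (0 < p)%R%:R * (expR (- p) * p ^+ k.+1 * Num.sqrt p ^+ n)).
exists (A * W / Gam k.+2) => y s s0.
have G0 := Gam_gt0 k.+2.
rewrite mulrAC ler_pdivlMr// mulrC -{1}(ger0_norm (ltW G0)) -normrM (Eg_J _ _ s0 mw hM).
have i1 := igD (@ig_expRN_sqrt k.+3 n) (@ig_expRN_sqrt k.+1 n).
rewrite mulrAC /W -InZ// /Ip.
have mJ : measurable_fun setT (fun p : Rm => J k.+3 w y (s * Num.sqrt p)).
  apply: measurable_Jm => //.
  by apply: measurable_funM; [exact: measurable_cst|exact: measurable_sqrt].
have le p : `|(0 < p)%R%:R * (expR (- p) * p ^+ k.+3 * Num.sqrt p ^+ n * J k.+3 w y (s * Num.sqrt p))| <=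
   A * (1 + s ^+ 2) ^- 2 * ((0 < p)%R%:R * (expR (- p) * p ^+ k.+3 * Num.sqrt p ^+ n) +
   (0 < p)%R%:R * (expR (- p) * p ^+ k.+1 * Num.sqrt p ^+ n)).
  have [p0|p0] := ltP 0 p; last by rewrite !mul0r normr0 addr0 mulr0.
  rewrite !mul1r normrM (ger0_norm (expRN_sqrt_ge0 k.+3 n p0)).
  have sp : 0 < s * Num.sqrt p by rewrite mulr_gt0// sqrtr_gt0.
  have h := le_trans (hA y _ sp) (ler_wpM2l A0 (decay_scale s p0)).
  apply: (le_trans (ler_wpM2l _ h)); first exact: expRN_sqrt_ge0.
  rewrite le_eqVlt; apply/orP; left; apply/eqP.
  have gen (e P q B X c : R) : c != 0 ->
    e * (c * (c * P)) * q * (B * ((1 + c ^- 2) * X)) = B * X * (e * (c * (c * P)) * q + e * P * q).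
    by move=> c0; field.
  by rewrite [p ^+ k.+3]exprS [p ^+ k.+2]exprS; apply: gen; exact: lt0r_neq0.
apply: In_absle => //; last exact: igZ.
apply: (ig_le _ _ (igZ (A * (1 + s ^+ 2) ^- 2) i1)) => [|p]; last exact: le.
apply: measurable_funM; first exact: measurable_pos.
apply: measurable_funM => //.
apply: measurable_funM; last by apply: measurable_funX; exact: measurable_sqrt.
apply: measurable_funM; last exact: measurable_funX.
by apply: (measurableT_comp (@measurable_expR R)); exact: oppr_measurable.
Qed.

(** Rescaling [s] by the square root of [p] separates the two variables, so the zeroth and first
    moments in scale of the Gaussian averages are fixed multiples of those of [J]. The substitution
    uses up [i + 1] of the [n] factors [Num.sqrt p]. *)
Lemma Ip_Eg_J k i w x A : (i <= 1)%N -> measurable_fun setT w -> (exists M, forall y, `|w y| <= M) ->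
  (forall s, 0 < s -> `|J k.+3 w x s| <= A * (1 + s ^+ 2) ^- 2) -> (2 <= n)%N ->
  Gam k.+2 * Ip (fun s => s ^+ i * Eg s w x) =
  Ip (fun p : R => expR (- p) * p ^+ k.+3 * Num.sqrt p ^+ (n - i.+1)) * Ip (fun s => s ^+ i * J k.+3 w x s).
Proof.
move=> i1 mw [M hM] hA n2.
have A0 : 0 <= A.
  have := le_trans (normr_ge0 _) (hA 1 ltr01); rewrite pmulr_lge0// invr_gt0 exprn_gt0//; exact: oneDsq_gt0.
have mJ : measurable_fun setT (fun s : Rm => J k.+3 w x s) by exact: measurable_Jm.
have msJ : measurable_fun setT (fun s : Rm => s ^+ i * J k.+3 w x s) by apply: measurable_funM.
have bsJ s : 0 < s -> `|s ^+ i * J k.+3 w x s| <= A * (1 + s ^+ 2)^-1.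
  move=> s0; rewrite normrM ger0_norm ?exprn_ge0 ?(ltW s0)//.
  apply: (le_trans (ler_wpM2l _ (hA s s0))); first by rewrite exprn_ge0// ltW.
  have o0 := oneDsq_gt0 s; have o0' := ltW o0.
  rewrite mulrCA ler_wpM2l// [(_ + _) ^+ 2]expr2 invfM mulrA ler_piMl ?invr_ge0//.
  rewrite ler_pdivrMr// mul1r; case: i i1 {msJ} => [|[|//]] _; first by rewrite expr0 lerDl sqr_ge0.
  by rewrite expr1; have := sqr_ge0 (s - 1); nra.
have isJ := ig_Ip msJ bsJ.
set f := fun p s : Rm => (0 < p)%R%:R * (expR (- p) * p ^+ k.+3 * Num.sqrt p ^+ n) *
   ((0 < s)%R%:R * (s ^+ i * J k.+3 w x (s * Num.sqrt p))).
have mW := ig_meas (@ig_expRN_sqrt k.+3 n).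
have mf : measurable_fun setT (fun q : Rm * Rm => f q.1 q.2).
  apply: measurable_funM; first exact: (measurableT_comp mW measurable_fst).
  apply: measurable_funM; first exact: (measurableT_comp (@measurable_pos R) measurable_snd).
  apply: measurable_funM; first by apply: measurable_funX; exact: measurable_snd.
  apply: (measurableT_comp mJ); apply: measurable_funM; first exact: measurable_snd.
  exact: (measurableT_comp (@measurable_sqrt R) measurable_fst).
have e1 (h : R -> R) p : 0 < p -> ig la (fun s : Rm => (0 < s)%R%:R * (s ^+ i * h s)) ->
   ig la (fun s : Rm => (0 < s)%R%:R * (s ^+ i * h (s * Num.sqrt p))) /\
   Num.sqrt p ^+ n * In la (fun s : Rm => (0 < s)%R%:R * (s ^+ i * h (s * Num.sqrt p))) =
   Num.sqrt p ^+ (n - i.+1) * Ip (fun s => s ^+ i * h s).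
  move=> p0 ih; have q0 : 0 < Num.sqrt p by rewrite sqrtr_gt0.
  set q := Num.sqrt p in q0 *; have qn : q != 0 := lt0r_neq0 q0.
  have i' := ig_la_scale q0 ih.
  have e s : q ^- i * (fun s : Rm => (0 < s)%R%:R * (s ^+ i * h s)) (q * s) = (0 < s)%R%:R * (s ^+ i * h (s * q)).
    rewrite /= pmulr_rgt0// exprMn [q * s]mulrC.
    by have gen (a b c d : R) : a != 0 -> a^-1 * (b * (a * c * d)) = b * (c * d); [move=> a0; field|apply: gen; exact: expf_neq0].
  split; first by apply: (eq_ig _ (igZ (q ^- i) i')) => s; exact: e.
  rewrite -(eq_In la e) (InZ _ i') (In_la_scale q0 (ig_meas ih)) /Ip.
  rewrite -{1}(subnK (_ : i.+1 <= n)%N); last by rewrite (leq_ltn_trans i1).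
  rewrite exprD -mulrA; congr (_ * _); rewrite exprSr.
  have gen (a b c : R) : a != 0 -> b != 0 -> a * b * (a^-1 * (b^-1 * c)) = c by move=> a0 b0; field; rewrite a0 b0.
  by apply: gen => //; exact: expf_neq0.
have f1 p : ig la (f p).
  have [p0|p0] := ltP 0 p; last first.
    by apply: (eq_ig _ (@ig0 _ _ _ la)) => s; rewrite /f ltNge p0/= !mul0r.
  by apply: igZ; have [] := e1 _ p p0 isJ.
have f2 s : ig la (f ^~ s).
  have [s0|s0] := ltP 0 s; last first.
    by apply: (eq_ig _ (@ig0 _ _ _ la)) => p; rewrite /f [0 < s]ltNge s0/= mul0r mulr0.
  apply: (ig_le _ _ (igZ (s ^+ i * A) (@ig_expRN_sqrt k.+3 n))); first exact: measurable_slice2 mf s.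
  move=> p; rewrite /f s0 mul1r normrM mulrC [X in _ * X]ger0_norm; last first.
    by have [p0|] := ltP 0 p; [rewrite mul1r; exact: expRN_sqrt_ge0|rewrite mul0r].
  have [p0|_] := ltP 0 p; last by rewrite !mul0r !mulr0.
  rewrite mul1r; apply: ler_wpM2r; first exact: expRN_sqrt_ge0.
  have sp : 0 < s * Num.sqrt p by rewrite mulr_gt0// sqrtr_gt0.
  rewrite normrM ger0_norm ?exprn_ge0 ?(ltW s0)// ler_wpM2l ?exprn_ge0 ?(ltW s0)//.
  apply: (le_trans (hA _ sp)); rewrite ler_piMr// invf_le1 ?exprn_gt0 ?oneDsq_gt0//.
  by rewrite exprn_ege1// lerDl sqr_ge0.
have iasJ : ig la (fun s : Rm => (0 < s)%R%:R * (s ^+ i * `|J k.+3 w x s|)).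
  apply: (eq_ig _ (ig_abs isJ)) => s; rewrite normrM normr_nat.
  have [s0|_] := ltP 0 s; last by rewrite !mul0r.
  by rewrite !mul1r normrM (ger0_norm (exprn_ge0 i (ltW s0))).
have hg p : In la (fun s => `|f p s|) <= Ip (fun s => s ^+ i * `|J k.+3 w x s|) *
    ((0 < p)%R%:R * (expR (- p) * p ^+ k.+3 * Num.sqrt p ^+ (n - i.+1))).
  have [p0|p0] := ltP 0 p; last first.
    by rewrite (@eq_In _ _ _ la _ (fun=> 0)) ?In0 ?mul0r ?mulr0// => s; rewrite /f ltNge p0/= !mul0r normr0.
  have [i3 e3] := e1 _ p p0 iasJ.
  rewrite mul1r [leRHS]mulrC -[leRHS]mulrA -e3 [leRHS]mulrA -(InZ _ i3).
  rewrite le_eqVlt; apply/orP; left; apply/eqP; apply: eq_In => s.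
  rewrite /f p0 mul1r normrM (ger0_norm (expRN_sqrt_ge0 k.+3 n p0)); congr (_ * _).
  rewrite normrM normr_nat; have [s0|_] := ltP 0 s; last by rewrite !mul0r.
  by rewrite !mul1r normrM (ger0_norm (exprn_ge0 i (ltW s0))).
have [_ j2 e] := real_fubini mf f1 f2 (igZ _ (@ig_expRN_sqrt k.+3 (n - i.+1))) hg.
have eE s : (0 < s)%R%:R * (s ^+ i * Eg s w x) = (Gam k.+2)^-1 * In la (f ^~ s).
  have [s0|s0] := ltP 0 s; last first.
    have -> : In la (f ^~ s) = 0.
      by rewrite -(In0 la); apply: eq_In => p; rewrite /f [0 < s]ltNge s0/= mul0r mulr0.
    by rewrite mul0r mulr0.
  have Gn : Gam k.+2 != 0 := lt0r_neq0 (Gam_gt0 k.+2).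
  have sn : s ^+ i != 0 := expf_neq0 i (lt0r_neq0 s0).
  have i3 : ig la (fun p : Rm => (0 < p)%R%:R * (expR (- p) * p ^+ k.+3 * Num.sqrt p ^+ n * J k.+3 w x (s * Num.sqrt p))).
    apply: (eq_ig _ (igZ (s ^- i) (f2 s))) => p; rewrite /f s0 mul1r.
    have gen (a b c d : R) : a != 0 -> a^-1 * (b * c * (a * d)) = b * (c * d) by move=> a0; field.
    exact: gen.
  apply: (mulfI Gn); rewrite (mulVKf Gn) mul1r [LHS]mulrCA (Eg_J k.+2 x s0 mw hM) /Ip -(InZ (s ^+ i) i3).
  apply: eq_In => p; rewrite /f s0 mul1r.
  have gen (a b c d : R) : a * (b * (c * d)) = b * c * (a * d) by ring.
  exact: gen.
rewrite {1}/Ip (eq_In la eE) (InZ _ j2) mulVKf; last exact: lt0r_neq0 (Gam_gt0 k.+2).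
rewrite -e mulrC /Ip -InZ; last exact: ig_expRN_sqrt.
apply: eq_In => p; have [p0|p0] := ltP 0 p; last first.
  have -> : In la (f p) = 0.
    by rewrite -(In0 la); apply: eq_In => s; rewrite /f ltNge p0/= !mul0r.
  by rewrite mul0r mulr0.
have [i3 e3] := e1 _ p p0 isJ.
rewrite mul1r [RHS]mulrC -[RHS]mulrA -e3 [RHS]mulrA -(InZ _ i3); apply: eq_In => s.
by rewrite /f p0 mul1r.
Qed.

End Semigroup.

(** * Second differences and the half Laplacian *)

Section SecondDifference.
Variables (R : realType) (n : nat).
Implicit Types (i : 'I_n) (x y z : 'rV[R]_n) (c s r L : R).
Local Notation e i := (delta_mx 0 i : 'rV[R]_n).

Lemma line_lip i h dh c L y : pd i h dh ->
  (forall s, `|s| <= `|c| -> `|dh (s *: e i + y)| <= L) -> `|h (c *: e i + y) - h y| <= L * `|c|.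
Proof.
move=> hd hL.
have dl s := pd_line hd y s.
have cl s : {for s, continuous (fun r : R => h (r *: e i + y))} by exact: is_derive_continuous (dl s).
have h0 : h y = h ((0 : R) *: e i + y) by rewrite scale0r add0r.
have [c0|c0] := leP 0 c.
  have [a] := @MVT_segment R (fun r : R => h (r *: e i + y)) _ 0 c c0 (fun s _ => dl s)
    (continuous_subspaceT cl).
  rewrite in_itv/= => /andP[a0 ac]; rewrite subr0 -h0 => ->.
  by rewrite normrM ler_wpM2r// hL// !ger0_norm.
have [a] := @MVT_segment R (fun r : R => h (r *: e i + y)) _ c 0 (ltW c0) (fun s _ => dl s)
    (continuous_subspaceT cl).
rewrite in_itv/= => /andP[a0 ac]; rewrite sub0r -h0 distrC => ->.
by rewrite normrM normrN ler_wpM2r// hL// !ler0_norm ?lerN2// ltW.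
Qed.

(** The walk from 0 to [z] runs through partial sums over a list without repetitions. Their
    coordinates are 0 or those of [z], so the path never leaves the cube on which the derivatives
    are bounded. *)
Lemma coord_lip h (dh : 'I_n -> 'rV[R]_n -> R) r L z : (forall i, pd i h (dh i)) -> 0 <= L ->
  (forall i y, cube r y -> `|dh i y| <= L) -> cube r z -> `|h z - h 0| <= L * (n%:R * r).
Proof.
move=> hd L0 hL hz.
have main : forall l : seq 'I_n, uniq l ->
   (forall k, (\sum_(i <- l) z 0 i *: e i) 0 k = (k \in l)%:R * z 0 k) /\
   `|h (\sum_(i <- l) z 0 i *: e i) - h 0| <= L * \sum_(i <- l) `|z 0 i|.
  elim=> [_|i l IH /= /andP[il /IH[e1 h1]]].
    by rewrite !big_nil subrr normr0 mulr0 lexx; split => // k; rewrite !mxE mul0r.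
  rewrite !big_cons; set y := \sum_(i <- l) _ in e1 h1 *.
  have yl k : `|y 0 k| <= `|z 0 k|.
    by rewrite e1; case: (k \in l); rewrite ?mul1r// mul0r normr0.
  split=> [k|].
    rewrite !mxE eqxx/= in_cons e1; have [->|ki] := eqVneq k i.
      by rewrite (negbTE il) mul0r mulr1 addr0 mul1r.
    by rewrite mulr0 add0r.
  rewrite mulrDr; apply: (le_trans (ler_distD (h y) _ _)); apply: lerD => //.
  apply: (line_lip (hd i)) => s hs; apply: hL => k; rewrite !mxE eqxx/=.
  have [->|ki] := eqVneq k i; last by rewrite mulr0 add0r (le_trans (yl k)).
  by rewrite e1 (negbTE il) mul0r mulr1 addr0 (le_trans hs).
have [_] := main _ (index_enum_uniq 'I_n); rewrite -row_sum_delta => /le_trans; apply.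
rewrite ler_wpM2l//; apply: (@le_trans _ _ (\sum_(i < n) r)); first by apply: ler_sum => i _; exact: hz.
by rewrite sumr_const card_ord mulr_natl.
Qed.

Lemma pd_lshift_opp i h dh x : pd i h dh -> pd i (fun z => h (x - z)) (fun z => - dh (x - z)).
Proof.
move=> hd; apply: line_pd => z.
have -> : (fun r : R => h (x - (r *: e i + z))) = (fun r : R => h (r *: e i + (x - z))) \o (fun r : R => - r).
  by apply/funext => r /=; rewrite opprD scaleNr addrCA.
have h1 := pd_line hd (x - z) (- 0); rewrite oppr0 in h1.
have h2 : is_derive (0 : R) (1 : R) (fun r : R => - r) (-1).
  exact: (is_deriveN (is_derive_id (0 : R) (1 : R))).
have h3 : is_derive ((fun r : R => - r) 0) (1 : R) (fun r : R => h (r *: e i + (x - z))) (dh ((0 : R) *: e i + (x - z))).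
  by rewrite oppr0.
have h4 := is_derive1_comp h3 h2.
by apply: (is_derive_eq h4); rewrite scale0r add0r ?mulrN1 ?mulN1r.
Qed.

Lemma row_norm_le r z : 0 <= r -> cube r z -> `|z| <= r.
Proof.
move=> r0 hz; apply/ler_addgt0Pr => eps e0; apply/ltW/row_norm_lt; first by rewrite ltr_pwDr.
by move=> i; apply: (le_lt_trans (hz i)); rewrite ltrDl.
Qed.

Definition diff2 (h : 'rV[R]_n -> R) x z : R := 2 * h x - h (x + z) - h (x - z).

(** The second difference and its first derivatives vanish at [z = 0], so [coord_lip] applies twice,
    each time gaining a factor [|z|]. *)
Lemma diff2_bound h x : smooth h ->
  exists2 M, 0 <= M & forall z, cube 1 z -> `|diff2 h x z| <= M * nsq z.
Proof.
move=> sh.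
have /choice[B hB] : forall ij : 'I_n * 'I_n, exists M, forall z, cube 1 z -> `|partial ij.2 (partial ij.1 h) (x + z)| <= M.
  move=> [i j]; have [M _ hM] := @continuous_cube_bounded _ _ 1 _
    (@continuous_rowlshift _ _ _ x (smooth_continuous (smooth_partial j (smooth_partial i sh)))).
  by exists M.
set M := \sum_ij `|B ij|.
have M0 : 0 <= M by exact: sumr_ge0.
have hM i j z : cube 1 z -> `|partial j (partial i h) (x + z)| <= M.
  move=> hz; apply: (le_trans (hB (i, j) z hz)); apply: (le_trans (ler_norm _)).
  by rewrite /M (bigD1 (i, j))//= lerDl sumr_ge0.
exists (2 * M * n%:R * n%:R); first by rewrite !mulr_ge0.
move=> z hz; set r := `|z|.
have hr : cube r z by move=> i; exact: row_norm_coord.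
have r0 : 0 <= r by exact: normr_ge0.
have r1 : r <= 1 by exact: row_norm_le.
have cr y : cube r y -> cube 1 y by move=> hy i; exact: le_trans (hy i) r1.
have cN y : cube r y -> cube r (- y) by move=> hy i; rewrite mxE normrN.
set d := fun i z => partial i h (x + z) - partial i h (x - z).
have pl (g : 'rV[R]_n -> R) dg i : pd i g dg -> pd i (fun z => g (x + z)) (fun z => dg (x + z)) by exact: pd_lshift.
have hd i y : cube r y -> `|d i y| <= 2 * M * (n%:R * r).
  move=> hy; have dd j : pd j (d i) (fun z => partial j (partial i h) (x + z) + partial j (partial i h) (x - z)).
    move=> v; have h4 := is_deriveB (pl _ _ j (smooth_pd j (smooth_partial i sh)) v)
      (pd_lshift_opp x (smooth_pd j (smooth_partial i sh)) v).
    by apply: (is_derive_eq h4); rewrite opprK.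
  have := coord_lip dd (mulr_ge0 (ler0n _ 2) M0) _ hy.
  rewrite {2}/d addr0 subr0 subrr subr0; apply => j v hv.
  apply: (le_trans (ler_normD _ _)); rewrite mulrDl mul1r; apply: lerD; apply: hM; first exact: cr.
  exact/cr/cN.
have dD i : pd i (diff2 h x) (fun z => - d i z).
  move=> v; have h4 := is_deriveB (is_deriveB (is_derive_cst (2 * h x) v (e i)) (pl _ _ i (smooth_pd i sh) v))
    (pd_lshift_opp x (smooth_pd i sh) v).
  by apply: (is_derive_eq h4); rewrite sub0r /d opprB opprK addrC.
have K0 : 0 <= 2 * M * (n%:R * r) by rewrite !mulr_ge0.
have hdN i y : cube r y -> `|- d i y| <= 2 * M * (n%:R * r) by rewrite normrN; exact: hd.
have := coord_lip dD K0 hdN hr.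
have -> : diff2 h x 0 = 0 by rewrite /diff2 addr0 subr0; ring.
rewrite subr0 => /le_trans; apply.
have rn : r ^+ 2 <= nsq z.
  rewrite -enorm_sq lerXn2r ?nnegrE ?enorm_ge0//; apply: row_norm_le; first exact: enorm_ge0.
  by apply: nsq_cube; [exact: enorm_ge0|rewrite enorm_sq].
have -> : 2 * M * (n%:R * r) * (n%:R * r) = 2 * M * n%:R * n%:R * r ^+ 2 by ring.
by rewrite ler_wpM2l// !mulr_ge0.
Qed.

End SecondDifference.

(** * The weight of the space [L_half] and large scales *)

Section TailWeight.
Variables (R : realType) (m : nat).
Local Notation n := (2 * m).+1.
Local Notation Rm := (measurableTypeR R).
Local Notation la := (@lebesgue_measure R).
Local Notation leb := (leb R n).
Implicit Types (x y z : 'rV[R]_n) (s t : R) (phi : 'rV[R]_n -> R).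

Lemma ig_invpow k (N : R) : 0 < N ->
  ig la (fun s : Rm => (0 < s)%R%:R * (s ^- (2 * m + 3) * pospow k.+1 (1 - N / s ^+ 2))).
Proof.
move=> N0; have q0 : 0 < Num.sqrt N by rewrite sqrtr_gt0.
have q2 : Num.sqrt N ^+ 2 = N by rewrite sqr_sqrtr// ltW.
set q := Num.sqrt N in q0 q2.
apply: (@ig_Ip _ _ (q ^- (2 * m + 3) + q ^- (2 * m + 1))).
  apply: measurable_funM; first exact: (measurable_invX _ (@measurable_id _ _ setT)).
  apply: measurable_pospow; apply: measurable_funB; first exact: measurable_cst.
  by apply: measurable_funM; [exact: measurable_cst|exact: (measurable_invX _ (@measurable_id _ _ setT))].
move=> s s0; have s0' := ltW s0.
have C0 : 0 <= q ^- (2 * m + 3) + q ^- (2 * m + 1) by rewrite addr_ge0// invr_ge0 exprn_ge0// ltW.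
have [sN|sN] := leP (s ^+ 2) N.
  rewrite [pospow _ _](_ : _ = 0) ?mulr0 ?normr0 ?mulr_ge0 ?invr_ge0 ?(ltW (oneDsq_gt0 s))//.
  by rewrite /pospow max_l ?expr0n// subr_le0 ler_pdivlMr ?exprn_gt0// mul1r.
have qs : q <= s by rewrite -(@ler_pXn2r _ 2) ?nnegrE ?q2 ?ltW.
have p1 : pospow k.+1 (1 - N / s ^+ 2) <= 1.
  rewrite /pospow exprn_ile1 ?le_max ?lexx// ge_max ler01/= gerBl divr_ge0 ?exprn_ge0//; exact: ltW.
have s3 : 0 <= s ^- (2 * m + 3) by rewrite invr_ge0 exprn_ge0.
rewrite ger0_norm ?mulr_ge0 ?pospow_ge0//.
apply: (@le_trans _ _ (s ^- (2 * m + 3))); first by rewrite ler_piMr.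
rewrite ler_pdivlMr ?oneDsq_gt0// mulrDr mulr1; apply: lerD.
  by rewrite lef_pV2 ?posrE ?exprn_gt0// lerXn2r ?nnegrE// ltW.
have -> : s ^- (2 * m + 3) * s ^+ 2 = s ^- (2 * m + 1).
  rewrite (_ : (2 * m + 3 = (2 * m + 1) + 2)%N); last by lia.
  by rewrite exprD invfM -mulrA mulVf ?mulr1// expf_neq0// gt_eqF.
by rewrite lef_pV2 ?posrE ?exprn_gt0// lerXn2r ?nnegrE// ltW.
Qed.

(** This is [1/(1 + |z|^(n+1))], the weight in [L_half], as [n + 1 = 2(m+1)]. *)
Definition wt z : R := (1 + nsq z ^+ m.+1)^-1.

Lemma wt_gt0 z : 0 < wt z.
Proof. by rewrite invr_gt0 ltr_pwDl// exprn_ge0// nsq_ge0. Qed.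

Lemma wt_le1 z : wt z <= 1.
Proof. by rewrite invf_le1 ?lerDl ?exprn_ge0 ?nsq_ge0// ltr_pwDl// exprn_ge0// nsq_ge0. Qed.

Lemma measurable_wt : measurable_fun setT wt.
Proof.
apply: (measurableT_comp (@measurable_invr R)); apply: measurable_funD; first exact: measurable_cst.
by apply: measurable_funX; apply: measurable_nsq; exact: measurable_id.
Qed.

(** The scales [s >= 1] of the superposition in [Ip_invpow]; integrated over [s] they are comparable
    to [wt] far out and stay bounded near 0. *)
Definition tker k s z : R := (0 < s)%R%:R * ((1 <= s)%R%:R * (s ^- (2 * m + 3) * H k.+1 s z)).

Lemma tker_ge0 k s z : 0 <= tker k s z.
Proof.
rewrite /tker; have [s0|] := ltP 0 s; rewrite ?mul0r// mul1r.
by rewrite !mulr_ge0 ?H_ge0// invr_ge0 exprn_ge0// ltW.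
Qed.

Lemma measurable_tker k : measurable_fun setT (fun p : Rm * 'rV[R]_n => tker k p.1 p.2).
Proof.
apply: measurable_funM; first exact: (measurableT_comp (@measurable_pos R) measurable_fst).
have m1 : measurable_fun setT (fun s : Rm => (1 <= s)%R%:R : R).
  have := @measurable_indic _ Rm R setT `[1%R, +oo[%classic (measurable_itv _).
  by congr measurable_fun; apply/funext => t; rewrite indicE mem_setE in_itv/= andbT.
apply: measurable_funM; first exact: (measurableT_comp m1 measurable_fst).
apply: measurable_funM; first by apply: measurable_invX; exact: measurable_fst.
apply: measurable_pospow; apply: measurable_funB; first exact: measurable_cst.
apply: measurable_funM; first by apply: measurable_nsq; exact: measurable_snd.
by apply: measurable_invX; exact: measurable_fst.
Qed.

Lemma tker_le k s z : tker k s z <= 2 * ((0 < s)%R%:R * (1 + s ^+ 2)^-1).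
Proof.
rewrite /tker; have [s0|] := ltP 0 s; rewrite ?mul0r ?mulr0// !mul1r.
have o0 := oneDsq_gt0 s.
have [s1|_] := leP 1 s; last by rewrite mul0r mulr_ge0// invr_ge0 ltW.
rewrite mul1r; apply: (@le_trans _ _ (s ^- (2 * m + 3))).
  by rewrite ler_piMr ?H_le1// invr_ge0 exprn_ge0// ltW.
rewrite ler_pdivlMr// mulrC ler_pdivrMr ?exprn_gt0//.
apply: (@le_trans _ _ (2 * s ^+ 2)); first by have := exprn_ege1 2 s1; lra.
by rewrite ler_pM2l// ler_weXn2l// addnC.
Qed.

Lemma ig_tker k z : ig la (fun s : Rm => tker k s z).
Proof.
apply: (ig_le _ _ (igZ 2 (@ig_oneDsqr_pos R))); first exact: measurable_slice2 (measurable_tker k) z.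
by move=> s; rewrite ger0_norm ?tker_ge0 ?tker_le.
Qed.

Lemma tker_In k : ig la (fun s : Rm => In leb (tker k s)) /\
  ig leb (fun z => In la (fun s : Rm => tker k s z)).
Proof.
have i1 s : ig leb (tker k s).
  have [s0|s0] := ltP 0 s; last first.
    by apply: (eq_ig _ (@ig0 _ _ _ leb)) => z; rewrite /tker ltNge s0 mul0r.
  by do 3 apply: igZ; exact: ig_H.
have hg s : In leb (fun z => `|tker k s z|) <= (2 * 2 ^+ n) * ((0 < s)%R%:R * (1 + s ^+ 2)^-1).
  rewrite (@eq_In _ _ _ leb _ (tker k s)); last by move=> z; rewrite ger0_norm// tker_ge0.
  have [s0|s0] := ltP 0 s; last first.
    rewrite (@eq_In _ _ _ leb _ (fun=> 0)) ?In0 ?mul0r ?mulr0// => z.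
    by rewrite /tker ltNge s0 mul0r.
  have o0 := oneDsq_gt0 s; have s0' := ltW s0.
  rewrite mul1r; have iH := @ig_H R n k s s0.
  have [s1|s1] := leP 1 s; last first.
    rewrite (@eq_In _ _ _ leb _ (fun=> 0)) ?In0 ?mulr_ge0 ?exprn_ge0 ?invr_ge0 ?(ltW o0)// => z.
    by rewrite /tker leNgt s1 mul0r mulr0.
  have -> : In leb (tker k s) = s ^- (2 * m + 3) * In leb (H k.+1 s).
    by rewrite -(InZ _ iH); apply: eq_In => z; rewrite /tker s0 s1 !mul1r.
  apply: (@le_trans _ _ (s ^- (2 * m + 3) * (2 * s) ^+ n)).
    by rewrite ler_wpM2l ?In_H_le// invr_ge0 exprn_ge0.
  rewrite (_ : (2 * m + 3 = n + 2)%N); last by lia.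
  have sn : s ^+ n != 0 by rewrite expf_neq0// gt_eqF.
  have -> : s ^- (n + 2) * (2 * s) ^+ n = 2 ^+ n * s ^- 2.
    rewrite exprD invfM exprMn; have gen (a b c : R) : a != 0 -> a^-1 * b * (c * a) = c * b by move=> a0; field.
    exact: gen.
  rewrite [2 * 2 ^+ n]mulrC -mulrA; apply: ler_wpM2l; first by rewrite exprn_ge0.
  rewrite ler_pdivlMr// mulrC ler_pdivrMr ?exprn_gt0//; have := exprn_ege1 2 s1; lra.
have [h1 h2 _] := real_fubini (measurable_tker k) i1 (ig_tker k) (igZ _ (@ig_oneDsqr_pos R)) hg.
by [].
Qed.

(** For [|z| >= 1] the kernels of scale below 1 vanish at [z], so the cut at [s = 1] removes nothing
    from [Ip_invpow]. *)
Lemma tker_nsq_ge1 k : exists2 c, 0 < c & forall z, 1 <= nsq z ->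
  In la (fun s : Rm => tker k s z) = c * nsq z ^- m.+1.
Proof.
have [c c0 hc] := Ip_invpow R m k; exists c => // z z1.
rewrite -hc; last exact: lt_le_trans z1.
apply: eq_In => s; have [s0|] := ltP 0 s; last by rewrite /tker => s0; rewrite ltNge s0 !mul0r.
rewrite /tker s0 !mul1r; have [s1|s1] := leP 1 s; first by rewrite mul1r.
rewrite mul0r -/(H k.+1 s z); have [->|/(H_supp s0) h] := eqVneq (H k.+1 s z) 0; first by rewrite mulr0.
have := lt_le_trans s1 z1; rewrite ltNge => /negP[].
have : nsq z < 1 by apply: (lt_trans h); rewrite exprn_ilt1// ltW.
by rewrite ltNge z1.
Qed.

Lemma tker_le_wt k : exists2 c, 0 <= c & forall z, In la (fun s : Rm => tker k s z) <= c * wt z.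
Proof.
have [c c0 hc] := tker_nsq_ge1 k.
exists (2 * c + 4 * om R); first by rewrite addr_ge0// mulr_ge0 ?om_ge0// ltW.
move=> z; have w0 := ltW (wt_gt0 z).
have N0 := nsq_ge0 z; have o0 := om_ge0 R.
have [z1|z1] := leP 1 (nsq z).
  rewrite hc// mulrDl; apply: ler_wpDr; first by rewrite !mulr_ge0.
  rewrite [2 * c]mulrC -mulrA ler_wpM2l ?(ltW c0)// /wt.
  have p1 : 1 <= nsq z ^+ m.+1 by rewrite exprn_ege1.
  rewrite ler_pdivlMr; last by rewrite (lt_le_trans ltr01)// lerDl (le_trans _ p1).
  rewrite mulrC ler_pdivrMr; last exact: lt_le_trans p1.
  by lra.
have w2 : 1 <= 2 * wt z.
  rewrite /wt ler_pdivlMr ?mul1r; last by rewrite ltr_pwDl// exprn_ge0.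
  have : nsq z ^+ m.+1 <= 1 by rewrite exprn_ile1// ltW.
  by lra.
rewrite mulrDl; apply: ler_wpDl; first by rewrite !mulr_ge0// ltW.
apply: (@le_trans _ _ (2 * om R)).
  rewrite /om /Ip -InZ; last exact: ig_oneDsqr_pos.
  by apply: In_le; [exact: ig_tker|apply: igZ; exact: ig_oneDsqr_pos|move=> s; exact: tker_le].
rewrite (_ : 4 * om R * wt z = 2 * om R * (2 * wt z)); last by ring.
by rewrite ler_peMr// mulr_ge0.
Qed.

(** Far out [wt] lies below a multiple of the scale integral of [tker], whose integrability comes
    from Fubini and the volume bound for [H]; near 0 it is at most 1. *)
Lemma ig_wt : ig leb wt.
Proof.
have [c c0 hc] := tker_nsq_ge1 0; have [_ iK] := tker_In 0.
apply: (ig_le measurable_wt _ (igD (igZ c^-1 iK) (@ig_1cube R n 1))) => z.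
rewrite (ger0_norm (ltW (wt_gt0 z))).
have K0 : 0 <= In la (fun s : Rm => tker 0 s z) by apply: In_ge0 => s; exact: tker_ge0.
have [z1|z1] := leP 1 (nsq z).
  apply: ler_wpDr; first by rewrite indicE.
  have p0 : 0 < nsq z ^+ m.+1 by rewrite exprn_gt0// (lt_le_trans _ z1).
  by rewrite hc// mulKf ?gt_eqF// /wt lef_pV2 ?posrE ?lerDr// ltr_pwDl// ltW.
apply: ler_wpDl; first by rewrite mulr_ge0// invr_ge0 ltW.
rewrite indicE mem_set ?wt_le1//=; apply: nsq_cube => //; rewrite expr1n; exact: ltW.
Qed.

Lemma nsqD_le x z : nsq (x + z) <= 2 * (nsq x + nsq z).
Proof.
rewrite /nsq -big_split mulr_sumr; apply: ler_sum => i _; rewrite mxE.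
rewrite -subr_ge0 (_ : _ - _ = (x 0 i - z 0 i) ^+ 2) ?sqr_ge0//=; ring.
Qed.

(** Translation changes the weight by a factor depending on [x] alone, so the condition [L_half] may
    be used around any centre. *)
Lemma wt_shift x : exists2 c, 0 <= c & forall z, wt z <= c * wt (x + z).
Proof.
have Nx := nsq_ge0 x.
have c0 : 0 <= 2 * (1 + nsq x) by rewrite mulr_ge0// addr_ge0.
exists (1 + (2 * (1 + nsq x)) ^+ m.+1 * 2 ^+ m.+1); first by rewrite addr_ge0// mulr_ge0 ?exprn_ge0.
move=> z; have Nz := nsq_ge0 z; have Nxz := nsq_ge0 (x + z).
rewrite /wt ler_pdivlMr; last by rewrite ltr_pwDl// exprn_ge0.
rewrite mulrC ler_pdivrMr; last by rewrite ltr_pwDl// exprn_ge0.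
have p0 : 0 <= nsq z ^+ m.+1 by rewrite exprn_ge0.
have h1 : nsq (x + z) ^+ m.+1 <= (2 * (1 + nsq x)) ^+ m.+1 * (1 + nsq z) ^+ m.+1.
  rewrite -exprMn lerXn2r ?nnegrE ?mulr_ge0 ?addr_ge0//.
  by apply: (le_trans (nsqD_le x z)); nra.
have h2 : (1 + nsq z) ^+ m.+1 <= 2 ^+ m.+1 * (1 + nsq z ^+ m.+1).
  have [z1|z1] := leP (nsq z) 1.
    apply: (@le_trans _ _ (2 ^+ m.+1)); last by rewrite ler_peMr ?exprn_ge0// lerDl.
    by rewrite lerXn2r ?nnegrE ?addr_ge0//; lra.
  rewrite mulrDr; apply: ler_wpDl; first by rewrite mulr1 exprn_ge0.
  by rewrite -exprMn lerXn2r ?nnegrE ?addr_ge0 ?mulr_ge0//; lra.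
rewrite mulrDl mul1r; apply: lerD; first by rewrite lerDl.
apply: (le_trans h1); rewrite -mulrA; apply: ler_wpM2l => //; exact: exprn_ge0.
Qed.

Lemma ig_L_half phi x : continuous phi -> L_half phi -> ig leb (fun z => `|phi (x + z)| * wt z).
Proof.
move=> cp; rewrite /L_half => hL.
have mp : measurable_fun setT (fun z => `|phi z|).
  by apply: measurableT_comp => //; exact: continuous_row_measurable.
have mpw : measurable_fun setT (fun z => `|phi z| * wt z).
  by apply: measurable_funM => //; exact: measurable_wt.
have pw0 z : 0 <= `|phi z| * wt z by rewrite mulr_ge0// ltW// wt_gt0.
have e z : `|phi z| / (1 + enorm z ^+ n.+1) = `|phi z| * wt z.
  by rewrite /wt -enorm_sq -exprM mulnS.
have i0 : ig leb (fun z => `|phi z| * wt z).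
  apply/(@ge0_igP _ _ _ leb) => //; rewrite -iint_ge0//; last exact/measurable_EFinP.
  apply: le_lt_trans hL; rewrite le_eqVlt; apply/orP; left; apply/eqP.
  by congr iint; apply/funext => z; rewrite e.
have [c c0 hc] := wt_shift x.
have i1 := ig_shift x i0.
apply: (ig_le _ _ (igZ c i1)).
  apply: measurable_funM; last exact: measurable_wt.
  by apply: (measurableT_comp mp); apply: measurable_rowD => //; exact: measurable_cst.
move=> z; rewrite normrM normr_id (ger0_norm (ltW (wt_gt0 z))) mulrCA [z + x]addrC.
by rewrite ler_wpM2l.
Qed.

(** The large-scale half of the domination in [diff2_fubini]; this is where [L_half] is used. *)
Lemma ig_tker_phi k phi x : continuous phi -> L_half phi ->
  ig la (fun s : Rm => In leb (fun z => `|phi (x + z)| * tker k s z)).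
Proof.
move=> cp hL; have [c c0 hc] := tker_le_wt k.
have mp : measurable_fun setT (fun z => `|phi (x + z)|).
  apply: measurableT_comp => //; apply: measurable_row_comp => //.
  by apply: measurable_rowD => //; exact: measurable_cst.
set f := fun (z : 'rV[R]_n) (s : Rm) => `|phi (x + z)| * tker k s z.
have mf : measurable_fun setT (fun p : 'rV[R]_n * Rm => f p.1 p.2).
  apply: measurable_funM; first exact: (measurableT_comp mp measurable_fst).
  exact: (measurableT_comp (measurable_tker k) (@measurable_swap _ _ _ Rm)).
have f1 z : ig la (f z) by apply: igZ; exact: ig_tker.
have f2 (s : Rm) : ig leb (f ^~ s).
  have [s0|s0] := ltP 0 s; last first.
    by apply: (eq_ig _ (@ig0 _ _ _ leb)) => z; rewrite /f /tker ltNge s0 mul0r mulr0.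
  have cn : continuous (fun y => `|phi y|).
    by move=> y; apply: continuous_comp; [exact: cp|exact: norm_continuous].
  apply: (eq_ig _ (igZ ((0 < s)%R%:R * ((1 <= s)%R%:R * s ^- (2 * m + 3))) (ig_wH k x s0 cn))) => z.
  by rewrite /f /tker; ring.
have hg z : In la (fun s => `|f z s|) <= c * (`|phi (x + z)| * wt z).
  rewrite mulrCA; apply: (le_trans _ (ler_wpM2l (normr_ge0 _) (hc z))).
  rewrite -InZ; last exact: ig_tker.
  rewrite le_eqVlt; apply/orP; left; apply/eqP; apply: eq_In => s.
  by rewrite /f normrM normr_id (ger0_norm (tker_ge0 _ _ _)).
by have [_ h _] := real_fubini mf f1 f2 (igZ c (ig_L_half x cp hL)) hg.
Qed.

End TailWeight.

(** * The principal value as an integral of second differences *)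

Section PrincipalValue.
Variables (R : realType) (m : nat).
Local Notation n := (2 * m).+1.
Local Notation Rm := (measurableTypeR R).
Local Notation la := (@lebesgue_measure R).
Local Notation leb := (leb R n).
Implicit Types (y z : 'rV[R]_n) (s t : R).
Variables (phi : 'rV[R]_n -> R) (x : 'rV[R]_n).
Hypotheses (sp : smooth phi) (hL : L_half phi).

Let cp : continuous phi := smooth_continuous sp.

Lemma expVn23 (s : R) : s ^- (2 * m + 3) = s ^- n * s ^- 2.
Proof. by rewrite -invfM -exprD; congr (_ ^+ _)^-1; lia. Qed.

Lemma nsqN z : nsq (- z) = nsq z.
Proof. by apply: eq_bigr => i _; rewrite mxE sqrrN. Qed.

Lemma continuous_rsub : continuous (fun z => phi (x - z)).
Proof.
move=> z; apply: (@continuous_comp _ _ _ (fun z : 'rV[R]_n => - z) (fun w => phi (x + w)) z).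
  exact: opp_continuous.
exact: continuous_rowlshift.
Qed.

Lemma continuous_diff2 : continuous (diff2 phi x).
Proof.
by apply: ctB; [apply: ctB; [exact: ct_cst|exact: continuous_rowlshift]|exact: continuous_rsub].
Qed.

Lemma In_diff2_H k s : 0 < s ->
  In leb (fun z => diff2 phi x z * H k.+1 s z) =
  - (2 * In leb (fun z => (phi (x + z) - phi x) * H k.+1 s z)).
Proof.
move=> s0.
have cpsi : continuous (fun y => phi y - phi x) by apply: ctB => //; exact: ct_cst.
have i1 := ig_wH k x s0 cpsi.
have i2 := ig_opp i1.
have e := In_opp (ig_meas i1).
rewrite mulr_natl mulr2n -{2}e -InD// -InN; last exact: igD.
by apply: eq_In => z; rewrite /diff2 /H nsqN; ring.
Qed.

(** Inserts the superposition of [Ip_invpow] and exchanges the integrals. Second differences rather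
    than first ones make the small scales absolutely convergent. *)
Lemma diff2_fubini k c : 0 < c ->
  (forall N, 0 < N -> Ip (fun s => s ^- (2 * m + 3) * pospow k.+1 (1 - N / s ^+ 2)) = c * N ^- m.+1) ->
  ig leb (fun z => diff2 phi x z * nsq z ^- m.+1) /\
  c * In leb (fun z => diff2 phi x z * nsq z ^- m.+1) =
  Ip (fun s => s ^- (2 * m + 3) * In leb (fun z => diff2 phi x z * H k.+1 s z)).
Proof.
move=> c0 hc.
have [M M0 hM] := diff2_bound x sp.
set f := fun (s : Rm) z => (0 < s)%R%:R * (s ^- (2 * m + 3) * (diff2 phi x z * H k.+1 s z)).
have mD : measurable_fun setT (diff2 phi x) by apply: continuous_row_measurable; exact: continuous_diff2.
have mf : measurable_fun setT (fun p : Rm * 'rV[R]_n => f p.1 p.2).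
  apply: measurable_funM; first exact: (measurableT_comp (@measurable_pos R) measurable_fst).
  apply: measurable_funM; first by apply: measurable_invX; exact: measurable_fst.
  apply: measurable_funM; first exact: (measurableT_comp mD measurable_snd).
  exact: (measurableT_comp (measurable_H k.+1) (@measurable_swap _ _ Rm _)).
have iDH s : 0 < s -> ig leb (fun z => diff2 phi x z * H k.+1 s z).
  move=> s0; apply: (@ig_ccsupp _ _ s).
    by apply: ctM; [exact: continuous_diff2|exact: continuous_H].
  by move=> z; rewrite mulf_eq0 negb_or => /andP[_ /(H_cube s0)].
have f1 s : ig leb (f s).
  have [s0|s0] := ltP 0 s; last first.
    by apply: (eq_ig _ (@ig0 _ _ _ leb)) => z; rewrite /f ltNge s0 mul0r.
  by do 2 apply: igZ; exact: iDH.
have fE z s : f s z = diff2 phi x z * ((0 < s)%R%:R * (s ^- (2 * m + 3) * pospow k.+1 (1 - nsq z / s ^+ 2))).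
  by rewrite /f /H; ring.
(* The superposition formula needs [nsq z > 0]. At the origin the second difference vanishes, so
   both sides are 0 there. *)
have D0 z : nsq z = 0 -> diff2 phi x z = 0.
  move=> z0; have : cube 1 z by apply: nsq_cube; rewrite ?z0 ?expr1n.
  by move=> /hM; rewrite z0 mulr0 normr_le0 => /eqP.
have f2 z : ig la (f ^~ z).
  have [z0|z0] := eqVneq (nsq z) 0.
    by apply: (eq_ig _ (@ig0 _ _ _ la)) => s; rewrite fE D0// mul0r.
  have zp : 0 < nsq z by rewrite lt_def z0 nsq_ge0.
  by apply: (eq_ig _ (igZ (diff2 phi x z) (ig_invpow m k zp))) => s; rewrite fE.
set T1 := fun s : Rm => In leb (tker k s).
set T2 := fun s : Rm => In leb (fun z => `|phi (x + z)| * tker k s z).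
have [iT1 _] := @tker_In R m k.
have iT2 := ig_tker_phi k x cp hL.
have T10 s : 0 <= T1 s by apply: In_ge0 => z; exact: tker_ge0.
have T20 s : 0 <= T2 s by apply: In_ge0 => z; rewrite mulr_ge0// tker_ge0.
have i01 := @ig_itvb R 0 1 (M * 2 ^+ n).
(* For [s <= 1] the second difference is at most [M s^2] on the support, and [s^-(n+2)] times [s^2]
   times the volume [(2s)^n] is constant. For [s > 1] the three terms of the second difference are
   bounded through [tker]. *)
have hg s : In leb (fun z => `|f s z|) <= (0 <= s <= 1)%R%:R * (M * 2 ^+ n) + (2 * `|phi x| * T1 s + 2 * T2 s).
  have r0 : 0 <= 2 * `|phi x| * T1 s + 2 * T2 s by rewrite addr_ge0// !mulr_ge0.
  have l0 : 0 <= (0 <= s <= 1)%R%:R * (M * 2 ^+ n) by rewrite !mulr_ge0// exprn_ge0.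
  have [s0|s0] := ltP 0 s; last first.
    rewrite (@eq_In _ _ _ leb _ (fun=> 0)); first by rewrite In0 addr_ge0.
    by move=> z; rewrite /f ltNge s0 mul0r normr0.
  have s0' := ltW s0; have iH := @ig_H R n k s s0.
  have p0 : 0 <= s ^- (2 * m + 3) by rewrite invr_ge0 exprn_ge0.
  have [s1|s1] := leP s 1.
    rewrite s0' mul1r; apply: ler_wpDr => //.
    apply: (@le_trans _ _ (In leb (fun z => (s ^- (2 * m + 3) * (M * s ^+ 2)) * H k.+1 s z))).
      apply: In_le; [exact: ig_abs|exact: igZ|].
      move=> z; rewrite /f s0 mul1r normrM (ger0_norm p0) normrM (ger0_norm (H_ge0 _ _ _)) -mulrA.
      apply: ler_wpM2l => //; have [->|hz] := eqVneq (H k.+1 s z) 0; first by rewrite !mulr0.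
      apply: ler_wpM2r; first exact: H_ge0.
      have hz2 := H_supp s0 hz.
      apply: (@le_trans _ _ (M * nsq z)); last by rewrite ler_wpM2l// ltW.
      by apply: hM => i; apply: le_trans s1; exact: H_cube s0 hz i.
    rewrite (InZ _ iH); apply: (le_trans (ler_wpM2l _ (In_H_le n k s0))).
      by rewrite !mulr_ge0// exprn_ge0.
    rewrite expVn23 exprMn le_eqVlt; apply/orP; left; apply/eqP.
    have gen (a b h d : R) : a != 0 -> b != 0 -> a^-1 * b^-1 * (h * b) * (d * a) = h * d.
      by move=> a0 b0; field; rewrite a0 b0.
    by apply: gen; rewrite expf_neq0// gt_eqF.
  apply: ler_wpDl; first by rewrite andbF mul0r.
  have tE z : tker k s z = s ^- (2 * m + 3) * H k.+1 s z by rewrite /tker s0 (ltW s1) !mul1r.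
  have it (h : 'rV[R]_n -> R) : continuous h -> ig leb (fun z => `|h z| * tker k s z).
    move=> ch; apply: (eq_ig _ (igZ (s ^- (2 * m + 3)) (_ : ig leb (fun z => `|h z| * H k.+1 s z)))) => [z|].
      by rewrite tE; ring.
    apply: (@ig_ccsupp _ _ s).
      by apply: ctM; [move=> y; apply: continuous_comp; [exact: ch|exact: norm_continuous]|exact: continuous_H].
    by move=> z; rewrite mulf_eq0 negb_or => /andP[_ /(H_cube s0)].
  have i1 : ig leb (tker k s) by apply: (eq_ig _ (igZ (s ^- (2 * m + 3)) iH)) => z; rewrite tE.
  have i2 := it _ (@continuous_rowlshift _ _ phi x cp).
  have i3 := it _ continuous_rsub.
  have e3 : In leb (fun z => `|phi (x - z)| * tker k s z) = T2 s.
    rewrite /T2 -(In_opp (ig_meas i2)); apply: eq_In => z.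
    by rewrite !tE /H nsqN.
  have eT : 2 * `|phi x| * T1 s + 2 * T2 s = In leb (fun z => 2 * `|phi x| * tker k s z + (`|phi (x + z)| * tker k s z + `|phi (x - z)| * tker k s z)).
    symmetry; apply: (etrans (InD (igZ (2 * `|phi x|) i1) (igD i2 i3))).
    congr (_ + _); first exact: InZ.
    apply: (etrans (InD i2 i3)); rewrite e3 [2 * T2 s]mulr_natl mulr2n.
    by congr (_ + _).
  rewrite eT.
  apply: In_le; [exact: ig_abs|by apply: igD; [exact: igZ|exact: igD]|].
  move=> z; rewrite !tE /f s0 mul1r normrM (ger0_norm p0) normrM (ger0_norm (H_ge0 _ _ _)).
  set hh := H _ _ _; rewrite [leRHS](_ : _ = s ^- (2 * m + 3) * ((2 * `|phi x| + `|phi (x + z)| + `|phi (x - z)|) * hh)); last by ring.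
  apply: ler_wpM2l => //; apply: ler_wpM2r; first exact: H_ge0.
  rewrite /diff2; apply: (le_trans (ler_normB _ _)); apply: lerD => //.
  by apply: (le_trans (ler_normB _ _)); rewrite normrM ger0_norm.
have ig1 := igD i01 (igD (igZ (2 * `|phi x|) iT1) (igZ 2 iT2)).
have [_ j2 e] := real_fubini mf f1 f2 ig1 hg.
have e2 z : In la (f ^~ z) = c * (diff2 phi x z * nsq z ^- m.+1).
  have [z0|z0] := eqVneq (nsq z) 0.
    rewrite (D0 z z0) mul0r mulr0 -(In0 la); apply: eq_In => s; by rewrite fE D0// mul0r.
  have zp : 0 < nsq z by rewrite lt_def z0 nsq_ge0.
  rewrite mulrCA -hc// /Ip -(InZ _ (ig_invpow m k zp)); apply: eq_In => s; exact: fE.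
have cn : c != 0 by rewrite gt_eqF.
have j3 : ig leb (fun z => diff2 phi x z * nsq z ^- m.+1).
  by apply: (eq_ig _ (igZ c^-1 j2)) => z; rewrite e2 mulKf.
split => //; rewrite -(InZ c j3) -(eq_In leb e2) -e; apply: eq_In => s.
have [s0|s0] := ltP 0 s; last first.
  by rewrite mul0r -(In0 leb); apply: eq_In => z; rewrite /f ltNge s0 mul0r.
rewrite mul1r -(InZ _ (iDH s s0)); apply: eq_In => z.
by rewrite /f s0 mul1r.
Qed.

Definition pvi (eps : R) z : R := if eps < enorm z then (phi x - phi (x - z)) * nsq z ^- m.+1 else 0.

Lemma measurable_far eps : measurable_fun setT (fun z => (eps < enorm z)%R%:R : R).
Proof.
have mo : measurable [set z : 'rV[R]_n | eps < enorm z].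
  have me : measurable_fun setT (@enorm R n).
    by apply: (measurableT_comp (@measurable_sqrt R)); apply: measurable_nsq; exact: measurable_id.
  rewrite -[X in measurable X]setTI; have := me measurableT `]eps, +oo[%classic (measurable_itv _).
  by congr measurable; apply/seteqP; split => z /=; rewrite in_itv/= andbT.
have := @measurable_indic _ 'rV[R]_n R setT _ mo.
by congr measurable_fun; apply/funext => z; rewrite indicE mem_setE.
Qed.

(** For [|z| > eps] the singular kernel is at most [1 + eps^-(n+1)] times [wt]. *)
Lemma ig_pvi eps : 0 < eps -> ig leb (pvi eps).
Proof.
move=> e0.
have pE z : pvi eps z = (eps < enorm z)%R%:R * ((phi x - phi (x - z)) * nsq z ^- m.+1).
  by rewrite /pvi; case: ifP => _; rewrite ?mul1r ?mul0r.
set c := 1 + (eps ^+ 2) ^- m.+1.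
have i1 := igZ `|phi x| (@ig_wt R m).
have i2 := ig_opp (ig_L_half x cp hL).
apply: (ig_le _ _ (igZ c (igD i1 i2))).
  rewrite (_ : pvi eps = (fun z => (eps < enorm z)%R%:R * ((phi x - phi (x - z)) * nsq z ^- m.+1))); last by apply/funext.
  apply: measurable_funM; first exact: measurable_far.
  apply: measurable_funM.
    apply: measurable_funB; first exact: measurable_cst.
    by apply: continuous_row_measurable; exact: continuous_rsub.
  by apply: measurable_invX; apply: measurable_nsq; exact: measurable_id.
move=> z; rewrite pE normrM normr_nat.
have w0 := ltW (wt_gt0 z).
have wN : wt (- z) = wt z by rewrite /wt nsqN.
rewrite wN -mulrDl; have e2 : 0 < (eps ^+ 2) ^+ m.+1 by rewrite !exprn_gt0.
have c0 : 0 <= c by rewrite addr_ge0// invr_ge0 ltW.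
have [ez|_] := ltP eps (enorm z); last by rewrite mul0r !mulr_ge0// addr_ge0.
have nz : eps ^+ 2 <= nsq z by rewrite -enorm_sq lerXn2r ?nnegrE ?enorm_ge0// ltW.
have nz1 : (eps ^+ 2) ^+ m.+1 <= nsq z ^+ m.+1 by rewrite lerXn2r ?nnegrE ?nsq_ge0 ?sqr_ge0.
have n0 : 0 < nsq z ^+ m.+1 by exact: lt_le_trans nz1.
rewrite mul1r normrM mulrCA; apply: ler_pM => //; first exact: ler_normB.
rewrite ger0_norm ?invr_ge0 ?(ltW n0)// /wt ler_pdivlMr; last by rewrite ltr_pwDl// ltW.
rewrite mulrDr mulr1 mulVf ?gt_eqF// addrC lerD2l lef_pV2 ?posrE//.
Qed.

(** Substitute [y = x - z] and average with the image under [z -> -z]: the first difference becomes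
    half of the second one. The integrand is signed, hence the recourse to [iint_integrable]. *)
Lemma pv_truncE eps : 0 < eps ->
  pv_trunc phi x eps = (2^-1 * In leb (fun z => (eps < enorm z)%R%:R * (diff2 phi x z * nsq z ^- m.+1)))%:E /\
  ig leb (fun z => (eps < enorm z)%R%:R * (diff2 phi x z * nsq z ^- m.+1)).
Proof.
move=> e0; have i1 := ig_pvi e0.
have i2 := ig_opp i1.
have i3 := ig_shift (- x) i2.
have enN z : enorm (- z) = enorm z by rewrite /enorm -!/(nsq _) nsqN.
have e12 z : pvi eps z + pvi eps (- z) = (eps < enorm z)%R%:R * (diff2 phi x z * nsq z ^- m.+1).
  rewrite /pvi enN nsqN opprK; case: ifP => _; last by rewrite mul0r addr0.
  by rewrite mul1r -mulrDl /diff2; congr (_ * _); ring.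
have i4 := igD i1 i2; split; last by apply: (eq_ig e12).
rewrite -(eq_In leb e12) (InD i1 i2) (In_opp (ig_meas i1)).
have -> : pv_trunc phi x eps = iint (fun y => (pvi eps (- (y - x)))%:E).
  congr iint; apply/funext => y; rewrite opprB /pvi opprB addrCA subrr addr0.
  by case: ifP => // _; rewrite -enorm_sq -exprM (_ : (2 * m.+1 = n.+1)%N)// mulnS.
rewrite iint_integrable// (InE i3); congr EFin.
rewrite (In_shift _ (ig_meas i2)) (In_opp (ig_meas i1)).
by field.
Qed.

(** Second differences make the full integral absolutely convergent, so dominated convergence along
    [eps = 1/(j+1)] identifies the limit, and limits are unique. *)
Lemma pv_value v : pv_trunc phi x eps @[eps --> 0^'+] --> v%:E ->
  v = 2^-1 * In leb (fun z => diff2 phi x z * nsq z ^- m.+1).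
Proof.
move=> hv.
have [c c0 hc] := Ip_invpow R m 0.
have [iD _] := diff2_fubini c0 hc.
set g := fun z => diff2 phi x z * nsq z ^- m.+1 in iD *.
set ej := fun j : nat => j.+1%:R^-1 : R.
have ej0 j : 0 < ej j by rewrite invr_gt0.
set gj := fun j z => (ej j < enorm z)%R%:R * g z.
have c1 : (fun j => In leb (gj j)) @ \oo --> In leb g.
  have mg j : measurable_fun setT (fun z => (gj j z)%:E).
    by apply/measurable_EFinP; have [_ h] := pv_truncE (ej0 j); exact: ig_meas h.
  have mg' : measurable_fun setT (fun z => (g z)%:E) by apply/measurable_EFinP; exact: ig_meas iD.
  have ig_g : leb.-integrable setT (fun z => `|g z|%:E) by exact: (ig_abs iD).
  have fg : forall z, setT z -> (fun j => (gj j z)%:E) @ \oo --> (g z)%:E.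
    move=> z _; apply: cvg_near_cst.
    have [z0|z0] := eqVneq (nsq z) 0.
      by apply: nearW => j; rewrite /gj /g z0 exprS mul0r invr0 !mulr0.
    have ez : 0 < enorm z by rewrite sqrtr_gt0 lt_def z0 nsq_ge0.
    have [N hN] : exists N : nat, (enorm z)^-1 < N%:R by exists (Num.bound (enorm z)^-1); rewrite archi_boundP// invr_ge0 ltW.
    near=> j; rewrite /gj (_ : ej j < enorm z) ?mul1r// /ej invf_plt ?posrE//.
    apply: (lt_le_trans hN); rewrite ler_nat; apply: leqW; near: j; exact: nbhs_infty_ge.
  have fb : forall j z, setT z -> (`|(gj j z)%:E| <= (`|g z|)%:E)%E.
    move=> j z _; rewrite lee_fin /gj normrM normr_nat.
    by case: (ej j < enorm z); rewrite ?mul1r// mul0r.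
  have fin z : setT z -> `|g z|%:E \is a fin_num by [].
  have := dominated_cvg measurableT mg fg fin ig_g fb.
  rewrite (InE iD); under eq_fun => j.
    rewrite (InE (pv_truncE (ej0 j)).2); over.
  by move=> /fine_cvgP[].
have cej : ej @ \oo --> 0^'+.
  move=> P; rewrite /at_right nbhs_nearE near_withinE => hP.
  have hh : \forall j \near \oo, 0 < ej j -> P (ej j) by exact: (@cvg_harmonic R _ hP).
  apply: (@filterS _ \oo _ _ _ _ hh) => j h; exact: (h (ej0 j)).
have c2 : (fun j => pv_trunc phi x (ej j)) @ \oo --> v%:E by exact: (cvg_comp _ _ cej hv).
have c3 : (fun j => pv_trunc phi x (ej j)) @ \oo --> (2^-1 * In leb g)%:E.
  apply: cvg_EFin; first by apply: nearW => j; rewrite (pv_truncE (ej0 j)).1.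
  rewrite (_ : fine \o _ = (fun j => 2^-1 * In leb (gj j))); first exact: cvgMl_tmp.
  by apply/funext => j /=; rewrite (pv_truncE (ej0 j)).1.
have e := @cvg_unique _ (@ereal_hausdorff R) _ _ _ _ c2 c3; exact: (EFin_inj (e _)).
Unshelve. all: by end_near. Qed.

End PrincipalValue.

Lemma oneDsqV_le1 (R : realType) (t : R) : (1 + t ^+ 2)^-1 <= 1.
Proof. by rewrite invf_le1 ?oneDsq_gt0// lerDl sqr_ge0. Qed.

(** Bounded near 0 and of order [t^-4] at infinity: enough for the moments of order 0 and 1 on the
    half-line. *)
Definition decays (R : realType) (A : R) (j : R -> R) : Prop :=
  forall t, 0 < t -> `|j t| <= A * (1 + t ^+ 2) ^- 2.

(** * The ladder down to scale 0 and up to infinity *)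

Section Pointwise.
Variables (R : realType) (n : nat).
Local Notation Rm := (measurableTypeR R).
Local Notation la := (@lebesgue_measure R).
Local Notation leb := (leb R n).
Implicit Types (x y z : 'rV[R]_n) (s t a b : R) (w : 'rV[R]_n -> R).

Lemma smooth_cst c : smooth (fun _ : 'rV[R]_n => c : R).
Proof.
have h (s : seq 'I_n) : exists d : R, iter_partial s (fun _ : 'rV[R]_n => c : R) = cst d.
  elim: s => [|i s [d /= ->]]; first by exists c.
  by exists 0; apply/funext => x; rewrite /partial derive_cst.
move=> s; have [d ->] := h s; split => [|i x]; last exact: derivable_cst.
exact: ct_cst.
Qed.

Lemma lap_cst c : lap (fun _ : 'rV[R]_n => c : R) = fun=> 0.
Proof.
apply/funext => x; rewrite /lap big1// => i _.
have -> : partial i (fun _ : 'rV[R]_n => c) = cst 0 by apply/funext => y; rewrite /partial derive_cst.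
by rewrite /partial derive_cst.
Qed.

Lemma lap_subcst w c : smooth w -> lap (fun y => w y - c) = lap w.
Proof.
move=> sw; apply/funext => x; apply: eq_bigr => i _; congr (partial i _ x).
apply/funext => y; have h := is_deriveB (smooth_pd i sw y) (is_derive_cst c y (delta_mx 0 i)).
by have [_ e] := h; rewrite /partial -[LHS]/('D_(delta_mx 0 i) (w - cst c) y) e subr0.
Qed.

(** The ladder applied to the constant 1, whose Laplacian vanishes, shows that the normalized kernel
    mass does not depend on the scale. *)
Lemma In_H_hom k b : 0 < b -> b ^- n * In leb (H k.+2 b) = In leb (H k.+2 1).
Proof.
set o : 'rV[R]_n -> R := fun=> 1.
have Je t : J k.+2 o (0 : 'rV[R]_n) t = t ^- n * In leb (H k.+2 t).
  by rewrite /J (eq_In leb (fun z => mul1r (H k.+2 t z))).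
have h a t : 0 < a -> a <= t -> J k.+2 o (0 : 'rV[R]_n) t = J k.+2 o 0 a.
  move=> a0 at'; apply/eqP; rewrite -subr_eq0 (J_ladder k 0 (smooth_cst 1) a0 at') lap_cst.
  have Jz s : J k.+3 (fun _ : 'rV[R]_n => 0 : R) (0 : 'rV[R]_n) s = 0.
    have e : In leb (fun z => 0 * H k.+3 s z) = 0 by apply: etrans (In0 leb); apply: eq_In => z; exact: mul0r.
    by rewrite /J e mulr0.
  rewrite /Ii -[X in _ == X](In0 la); apply/eqP; apply: eq_In => s.
  by rewrite Jz !mulr0.
move=> b0; have e1 : In leb (H k.+2 1) = J k.+2 o (0 : 'rV[R]_n) 1 by rewrite Je expr1n invr1 mul1r.
rewrite e1 -Je; have [b1|b1] := leP b 1; first by rewrite (h b 1).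
by rewrite (h 1 b)// ltW.
Qed.

Lemma J_subcst k w x t : 0 < t -> continuous w ->
  J k.+2 (fun y => w y - w x) x t = J k.+2 w x t - w x * In leb (H k.+2 1).
Proof.
move=> t0 cw; rewrite -(In_H_hom k t0) /J mulrCA -mulrBr; congr (_ * _).
have i1 := ig_wH k.+1 x t0 cw; have i2 := igZ (w x) (@ig_H R n k.+1 t t0).
rewrite -(InZ _ (@ig_H R n k.+1 t t0)) -(InB i1 i2); apply: eq_In => z.
by rewrite mulrBl.
Qed.

Section Ladder.
Variables (k : nat) (phi : 'rV[R]_n -> R) (x : 'rV[R]_n) (A : R) (j : R -> R).
Hypothesis sp : smooth phi.
Hypothesis jE : forall t, J k.+3 (lap phi) x t = j t.
Hypothesis hA : decays A j.

Lemma decays_ge0 : 0 <= A.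
Proof.
have := le_trans (normr_ge0 _) (hA ltr01); rewrite pmulr_lge0// invr_gt0 exprn_gt0//; exact: oneDsq_gt0.
Qed.

Lemma decays_meas : measurable_fun setT (j : Rm -> R).
Proof.
have := measurable_J k.+3 x (smooth_continuous (smooth_lap sp)).
by congr measurable_fun; apply/funext => t; exact: jE.
Qed.

Lemma decays_le t : 0 < t -> `|j t| <= A * (1 + t ^+ 2)^-1.
Proof.
move=> t0; apply: (le_trans (hA t0)); apply: (ler_wpM2l decays_ge0).
by rewrite lef_pV2 ?posrE ?exprn_gt0 ?oneDsq_gt0// ler_eXnr// lerDl sqr_ge0.
Qed.

Lemma decays_Mle t : 0 < t -> `|t * j t| <= A * (1 + t ^+ 2)^-1.
Proof.
move=> t0; rewrite normrM gtr0_norm//; have o0 := oneDsq_gt0 t; have o0' := ltW o0.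
apply: (le_trans (ler_wpM2l (ltW t0) (hA t0))); rewrite mulrCA; apply: (ler_wpM2l decays_ge0).
rewrite [(_ + _) ^+ 2]expr2 invfM mulrA ler_piMl ?invr_ge0//.
by rewrite ler_pdivrMr// mul1r; have := sqr_ge0 (t - 1); nra.
Qed.

(** Subtracting the value at [x] makes the average tend to 0 at small scales, so the lower end of
    the ladder can be sent to 0. *)
Lemma ladder0 b : 0 < b -> J k.+2 (fun y => phi y - phi x) x b =
  Ip (fun t => (t <= b)%R%:R * (t * j t)) / (2 * k.+3%:R).
Proof.
have A0 := decays_ge0; have mj := decays_meas.
move=> b0; set psi := fun y => phi y - phi x.
have spsi : smooth psi by exact: (smoothD sp (smoothN (smooth_cst (phi x)))).
set c := 2 * k.+3%:R : R; have c0 : 0 < c by rewrite /c -natrM ltr0n.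
have ci0 : 0 <= c^-1 by rewrite invr_ge0 ltW.
have htA1 t : 0 < t -> `|t * j t| <= A.
  move=> t0; apply: (le_trans (decays_Mle t0)); rewrite -[leRHS]mulr1.
  exact: (ler_wpM2l decays_ge0 (oneDsqV_le1 t)).
have ib : measurable_fun setT (fun t : Rm => (t <= b)%R%:R : R).
  have := @measurable_indic _ Rm R setT `]-oo, b]%classic (measurable_itv _).
  by congr measurable_fun; apply/funext => t; rewrite indicE mem_setE in_itv.
have mI : measurable_fun setT (fun t : Rm => (t <= b)%R%:R * (t * j t)) by do 2 apply: measurable_funM => //.
have bI t : 0 < t -> `|(t <= b)%R%:R * (t * j t)| <= A * (1 + t ^+ 2)^-1.
  move=> t0; rewrite normrM normr_nat; apply: le_trans (decays_Mle t0).
  by case: (t <= b); rewrite ?mul1r// mul0r.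
have iI := ig_Ip mI bI.
rewrite mulrC -[RHS]/(c^-1 * In la _).
apply/eqP; rewrite -subr_eq0 -normr_le0; apply/ler_addgt0Pr => e e0; rewrite add0r.
have cpsi := smooth_continuous spsi.
have [r r0 hr] : exists2 r, 0 < r & forall z, cube r z -> `|psi (x + z)| <= e / (2 * 2 ^+ n).
  have e1 : 0 < e / (2 * 2 ^+ n) by rewrite divr_gt0// mulr_gt0// exprn_gt0.
  have /cvgrPdist_lt /(_ _ e1) := cpsi x.
  move=> /nbhs_ballP[r /= r0 h]; exists (r / 2); first by rewrite divr_gt0.
  move=> z hz; have := h (x + z); rewrite -ball_normE /ball_ /= opprD addrA subrr sub0r normrN.
  rewrite /psi subrr sub0r normrN => h'; apply/ltW/h'.
  apply/row_norm_lt => // i; apply: (le_lt_trans (hz i)).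
  by rewrite ltr_pdivrMr// ltr_pMr// ltr1n.
(* Below [r] continuity makes the average at most [e/2]; the last entry makes the discarded integral
   over [[0, a]], at most [a A / c], also at most [e/2]. *)
set a := Num.min (Num.min r b) (e * c / (2 * (A + 1))).
have A1 : 0 < A + 1 by rewrite ltr_wpDl.
have a0 : 0 < a by rewrite !lt_min r0 b0 divr_gt0 ?mulr_gt0.
have ab : a <= b by rewrite /a !ge_min lexx orbT.
have ar : a <= r by rewrite /a !ge_min lexx.
have ae : a <= e * c / (2 * (A + 1)) by rewrite /a ge_min lexx orbT.
have hJa : `|J k.+2 psi x a| <= e / 2.
  have h : 0 <= e / (2 * 2 ^+ n) by rewrite divr_ge0 ?mulr_ge0 ?exprn_ge0// ltW.
  apply: (le_trans (@J_le _ _ k.+1 psi x a _ a0 cpsi h _)).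
    by move=> z hz; apply: hr => i; exact: le_trans (hz i) ar.
  have gen (p q : R) : q != 0 -> p / (2 * q) * q = p / 2 by move=> q0; field.
  by rewrite gen// expf_neq0.
have lpsi : lap psi = lap phi by exact: lap_subcst.
have hl : J k.+2 psi x b - J k.+2 psi x a = Ii a b (fun t => t / c * j t).
  by rewrite (J_ladder k x spsi a0 ab) lpsi; congr Ii; apply/funext => t; rewrite jE.
have -> : J k.+2 psi x b = J k.+2 psi x a + Ii a b (fun t => t / c * j t).
  by rewrite -hl addrC subrK.
rewrite -addrA; apply: (le_trans (ler_normD _ _)); rewrite [leRHS](splitr e); apply: lerD; first exact: hJa.
have iab : ig la (fun t : Rm => (a <= t <= b)%R%:R * (t / c * j t)).
  apply: (@ig_Ii _ a b (A / c)).
    have mid : measurable_fun setT (fun t : Rm => t / c : R) by apply: measurable_funM => //; exact: measurable_cst.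
    exact: (measurable_funM mid decays_meas).
  move=> t /andP[at' _]; have t0 : 0 < t by exact: lt_le_trans at'.
  rewrite (mulrAC t) (normrM (t * j t)) (ger0_norm ci0).
  exact: (ler_wpM2r ci0 (htA1 t t0)).
rewrite /Ii -(InZ _ iI) -(InB iab (igZ _ iI)).
apply: (@le_trans _ _ (In la (fun t : Rm => (0 <= t <= a)%R%:R * (A / c)))); last first.
  rewrite (In_itvb _ (ltW a0)) subr0.
  have Ac : 0 <= A / c := divr_ge0 A0 (ltW c0).
  apply: (le_trans (ler_wpM2l Ac ae)).
  have gen (p q h : R) : h != 0 -> q != 0 -> p / h * (e * h / (2 * q)) = p / q * (e / 2).
    by move=> h0 q0; field; rewrite h0 q0.
  rewrite (gen A (A + 1) c (lt0r_neq0 c0) (lt0r_neq0 A1)).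
  have e2 : 0 <= e / 2 := divr_ge0 (ltW e0) (ler0n _ 2).
  rewrite -[leRHS]mul1r; apply: (ler_wpM2r e2).
  by rewrite (ler_pdivrMr _ _ A1) mul1r lerDl.
apply: In_absle; [exact: (igB iab (igZ _ iI))|exact: ig_itvb|].
have Ac : 0 <= A / c := divr_ge0 A0 (ltW c0).
have R0 (d : bool) : 0 <= d%:R * (A / c) := mulr_ge0 (ler0n _ d) Ac.
move=> t; have [t0|t0] := ltP 0 t; last first.
  have ta : (a <= t) = false by apply/negbTE; rewrite -ltNge (le_lt_trans t0).
  rewrite ta !mul0r mulr0 subrr normr0; exact: R0.
rewrite mul1r; have [tb|tb] := leP t b; last first.
  rewrite andbF !mul0r mulr0 subrr normr0; exact: R0.
rewrite andbT mul1r; have [at'|ta] := leP a t.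
  rewrite mul1r (mulrAC t) [c^-1 * _]mulrC subrr normr0; exact: R0.
rewrite mul0r sub0r normrN (ltW ta) (ltW t0) mul1r (normrM c^-1) (ger0_norm ci0) mulrC.
exact: (ler_wpM2r ci0 (htA1 t t0)).
Qed.

(** The value is 1; it stays symbolic. *)
Definition c1 : R := Ip (fun p : R => (1 <= p)%R%:R * p ^- 2).

Lemma ig_c1 : ig la (fun p : Rm => (0 < p)%R%:R * ((1 <= p)%R%:R * p ^- 2)).
Proof.
apply: (@ig_Ip _ _ 2).
  apply: measurable_funM; last exact: (measurable_invX _ (@measurable_id _ _ setT)).
  have := @measurable_indic _ Rm R setT `[1%R, +oo[%classic (measurable_itv _).
  by congr measurable_fun; apply/funext => t; rewrite indicE mem_setE in_itv/= andbT.
move=> p p0; have o0 := oneDsq_gt0 p; rewrite normrM normr_nat.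
have [p1|_] := leP 1 p; last by rewrite mul0r mulr_ge0// invr_ge0 ltW.
rewrite mul1r ger0_norm ?invr_ge0 ?sqr_ge0// ler_pdivlMr// mulrC ler_pdivrMr ?exprn_gt0//.
by have := exprn_ege1 2 p1; lra.
Qed.

Lemma c1_gt0 : 0 < c1.
Proof.
apply: (@lt_le_trans _ _ (In la (fun p : Rm => (1 <= p <= 2)%R%:R * 2 ^- 2))).
  by rewrite In_itvb ?ler1n// mulr_gt0 ?invr_gt0// subr_gt0 ltr1n.
apply: In_le; [exact: ig_itvb|exact: ig_c1|].
move=> p; have [/andP[p1 p2]|_] := boolP (1 <= p <= 2); last first.
  by have [p0|] := ltP 0 p; rewrite ?mul0r// mul1r mulr_ge0// invr_ge0 sqr_ge0.
have p0 : 0 < p by exact: lt_le_trans p1.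
rewrite p0 p1 !mul1r lef_pV2 ?posrE ?exprn_gt0// lerXn2r ?nnegrE// ltW//.
Qed.

(** Insert [ladder0] and exchange: the integral of [s^-2] over [s >= t] is a multiple of [1/t] and
    cancels the factor [t]. This rewrites the principal value formula in terms of averages of the
    Laplacian. *)
Lemma Ip_Jpsi : ig la (fun s : Rm => (0 < s)%R%:R * (s ^- 2 * J k.+2 (fun y => phi y - phi x) x s)) /\
  Ip (fun s => s ^- 2 * J k.+2 (fun y => phi y - phi x) x s) =
  c1 / (2 * k.+3%:R) * Ip j.
Proof.
have A0 := decays_ge0; have mj := decays_meas.
set c := 2 * k.+3%:R : R; have c0 : 0 < c by rewrite /c -natrM ltr0n.
set f := fun t s : Rm => (0 < t)%R%:R * (t * j t) * ((0 < s)%R%:R * ((t <= s)%R%:R * s ^- 2)).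
have mts : measurable_fun setT (fun p : Rm * Rm => (p.1 <= p.2)%R%:R : R).
  have mo : measurable [set p : Rm * Rm | p.1 <= p.2].
    rewrite -[X in measurable X]setTI.
    have md : measurable_fun setT (fun p : Rm * Rm => p.2 - p.1 : Rm).
      by apply: measurable_funB; [exact: measurable_snd|exact: measurable_fst].
    have := md measurableT `[0%R, +oo[%classic (measurable_itv _).
    by congr measurable; apply/seteqP; split => p /=; rewrite in_itv/= andbT subr_ge0.
  have := @measurable_indic _ _ R setT _ mo.
  by congr measurable_fun; apply/funext => p; rewrite indicE mem_setE.
have mf : measurable_fun setT (fun p : Rm * Rm => f p.1 p.2).
  apply: measurable_funM.
    apply: measurable_funM; first exact: (measurableT_comp (@measurable_pos R) measurable_fst).
    by apply: measurable_funM; [exact: measurable_fst|exact: (measurableT_comp decays_meas measurable_fst)].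
  apply: measurable_funM; first exact: (measurableT_comp (@measurable_pos R) measurable_snd).
  by apply: measurable_funM => //; apply: measurable_invX; exact: measurable_snd.
have e1 t : 0 < t -> ig la (fun s : Rm => (0 < s)%R%:R * ((t <= s)%R%:R * s ^- 2)) /\
    Ip (fun s => (t <= s)%R%:R * s ^- 2) = t^-1 * c1.
  move=> t0; have ti : 0 < t^-1 by rewrite invr_gt0.
  have tn : t != 0 by rewrite gt_eqF.
  have i1 := ig_la_scale ti ig_c1.
  have e s : t ^- 2 * (fun p : Rm => (0 < p)%R%:R * ((1 <= p)%R%:R * p ^- 2)) (t^-1 * s) = (0 < s)%R%:R * ((t <= s)%R%:R * s ^- 2).
    have hq : t ^- 2 * (t^-1 * s) ^- 2 = s ^- 2 by rewrite -invfM -exprMn mulVKf.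
    have hs : (1 <= t^-1 * s) = (t <= s) by rewrite -(ler_pM2l t0) mulr1 mulVKf.
    by rewrite /= pmulr_rgt0// hs mulrCA [t ^- 2 * _]mulrCA hq.
  split; first by apply: (eq_ig _ (igZ (t ^- 2) i1)) => s; exact: e.
  rewrite /Ip -(eq_In la e) (InZ _ i1) (In_la_scale ti (ig_meas ig_c1)) invrK -/c1.
  by rewrite /c1 /Ip; field.
have f1 t : ig la (f t).
  have [t0|t0] := ltP 0 t; last first.
    by apply: (eq_ig _ (@ig0 _ _ _ la)) => s; rewrite /f ltNge t0/= !mul0r.
  by apply: igZ; have [] := e1 t t0.
have f2 s : ig la (f ^~ s).
  have i2 := ig_Ip (measurable_funM (@measurable_id _ _ setT) decays_meas) decays_Mle.
  apply: (ig_le _ _ (igZ (s ^- 2) (ig_abs i2))); first exact: measurable_slice2 mf s.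
  move=> t; rewrite /f normrM mulrC [X in X * _]ger0_norm; last by rewrite !mulr_ge0// invr_ge0 sqr_ge0.
  apply: ler_wpM2r => //; rewrite mulrA -[leRHS]mul1r ler_wpM2r ?invr_ge0 ?sqr_ge0//.
  by case: (0 < s); case: (t <= s); rewrite ?mul1r ?mul0r ?mulr0.
have ij := ig_Ip decays_meas decays_le.
have iaj := ig_abs ij.
have val t : In la (f t) = c1 * ((0 < t)%R%:R * j t).
  have [t0|t0] := ltP 0 t; last first.
    rewrite mul0r mulr0 -(In0 la); apply: eq_In => s; by rewrite /f ltNge t0/= !mul0r.
  have [i1 v1] := e1 t t0.
  rewrite /f InZ// -/(Ip (fun s => (t <= s)%R%:R * s ^- 2)) v1 t0 !mul1r.
  by field; rewrite gt_eqF.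
have hg t : In la (fun s => `|f t s|) <= c1 * `|(0 < t)%R%:R * j t|.
  have [t0|t0] := ltP 0 t; last first.
    rewrite mul0r normr0 mulr0 le_eqVlt; apply/orP; left; apply/eqP.
    by rewrite -(In0 la); apply: eq_In => s; rewrite /f ltNge t0/= !mul0r normr0.
  have [i1 v1] := e1 t t0.
  rewrite mul1r (_ : c1 * `|j t| = `|t * j t| * (t^-1 * c1)); last by rewrite normrM gtr0_norm//; field; rewrite gt_eqF.
  rewrite -v1 /Ip -(InZ _ i1) le_eqVlt; apply/orP; left; apply/eqP; apply: eq_In => s.
  by rewrite /f t0 mul1r normrM [X in _ * X = _]ger0_norm// !mulr_ge0// invr_ge0 sqr_ge0.
have [_ j2 e] := real_fubini mf f1 f2 (igZ c1 iaj) hg.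
have e2 s : (0 < s)%R%:R * (s ^- 2 * J k.+2 (fun y => phi y - phi x) x s) = c^-1 * In la (f ^~ s).
  have [s0|s0] := ltP 0 s; last first.
    rewrite mul0r (_ : In la _ = 0) ?mulr0// -(In0 la); apply: eq_In => t.
    by rewrite /f [0 < s]ltNge s0/= mul0r mulr0.
  rewrite mul1r (ladder0 s0) -/c mulrA [LHS]mulrC; congr (_ * _).
  rewrite /Ip -InZ.
    by apply: eq_In => t; rewrite /f s0 mul1r; ring.
  have sn : s ^- 2 != 0 by rewrite invr_eq0 expf_neq0// gt_eqF.
  apply: (eq_ig _ (igZ (s ^- 2)^-1 (f2 s))) => t.
  by rewrite /f s0 mul1r; move: sn; set q := s ^- 2 => qn; field.
split; first by apply: (eq_ig _ (igZ c^-1 j2)) => s; rewrite e2.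
rewrite /Ip (eq_In la e2) (InZ _ j2) -e (eq_In la val) (InZ _ ij).
by rewrite mulrCA mulrA.
Qed.

(** Let [b] tend to infinity in [ladder0]. The average of [phi] disappears, and [phi x] is left as a
    first moment in scale of the averages of its Laplacian. *)
Lemma Ip_phi C : (forall b, 1 <= b -> `|J k.+2 phi x b| <= C / b) ->
  Ip (fun t => t * j t) = - (2 * k.+3%:R * In leb (H k.+2 1)) * phi x.
Proof.
have A0 := decays_ge0; have mj := decays_meas.
move=> hC; set c := 2 * k.+3%:R : R; have c0 : 0 < c by rewrite /c -natrM ltr0n.
have C0 : 0 <= C by have := le_trans (normr_ge0 _) (hC 1 (lexx _)); rewrite divr1.
set I := Ip _; apply/eqP; rewrite -subr_eq0 -normr_le0; apply/ler_addgt0Pr => e e0; rewrite add0r.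
(* The tail of the moment is at most [A om / b] and the average term at most [c C / b]; this [b]
   makes their sum at most [e]. *)
set b := 1 + (c * C + A * om R) / e.
have S0 : 0 <= c * C + A * om R by rewrite addr_ge0// mulr_ge0 ?om_ge0// ltW.
have b1 : 1 <= b by rewrite lerDl divr_ge0// ltW.
have b0 : 0 < b by exact: lt_le_trans b1.
have hl := ladder0 b0; rewrite (J_subcst k x b0 (smooth_continuous sp)) -/c in hl.
set Ib := Ip _ in hl.
have -> : I - - (c * In leb (H k.+2 1)) * phi x = (I - Ib) + c * J k.+2 phi x b.
  have -> : Ib = c * (J k.+2 phi x b - phi x * In leb (H k.+2 1)) by rewrite hl; field; rewrite gt_eqF.
  by ring.
apply: (le_trans (ler_normD _ _)).
apply: (@le_trans _ _ (A * om R / b + c * (C / b))).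
  apply: lerD; last by rewrite normrM (gtr0_norm c0) ler_wpM2l ?hC// ltW.
  have ib : measurable_fun setT (fun t : Rm => (t <= b)%R%:R : R).
    have := @measurable_indic _ Rm R setT `]-oo, b]%classic (measurable_itv _).
    by congr measurable_fun; apply/funext => t; rewrite indicE mem_setE in_itv.
  have mt : measurable_fun setT (fun t : Rm => t * j t) by exact: measurable_funM.
  have mI : measurable_fun setT (fun t : Rm => (t <= b)%R%:R * (t * j t)) by exact: measurable_funM.
  have bI t : 0 < t -> `|(t <= b)%R%:R * (t * j t)| <= A * (1 + t ^+ 2)^-1.
    move=> t0; rewrite normrM normr_nat; apply: le_trans (decays_Mle t0).
    by case: (t <= b); rewrite ?mul1r// mul0r.
  have i1 := ig_Ip mt decays_Mle; have i2 := ig_Ip mI bI.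
  rewrite /I /Ib /Ip -(InB i1 i2).
  rewrite mulrAC /om /Ip -(InZ _ (@ig_oneDsqr_pos R)).
  apply: In_absle; [exact: igB|by apply: igZ; exact: ig_oneDsqr_pos|].
  move=> t; have [t0|t0] := ltP 0 t; last by rewrite !mul0r subrr normr0 mulr0.
  have o0 := oneDsq_gt0 t; have o0' := ltW o0.
  rewrite !mul1r; have [tb|tb] := leP t b.
    by rewrite mul1r subrr normr0 mulr_ge0 ?invr_ge0// divr_ge0// ltW.
  rewrite mul0r subr0 normrM gtr0_norm//; apply: (le_trans (ler_wpM2l (ltW t0) (hA t0))).
  rewrite mulrCA -mulrA; apply: ler_wpM2l => //.
  rewrite [(_ + _) ^+ 2]expr2 invfM mulrA; apply: ler_wpM2r; first by rewrite invr_ge0.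
  rewrite ler_pdivrMr// mulrC ler_pdivlMr//.
  by apply: (@le_trans _ _ (t * t)); [rewrite ler_wpM2l// ltW|rewrite -expr2 lerDr].
rewrite mulrA -mulrDl addrC ler_pdivrMr// /b mulrDr mulr1 mulrC.
by rewrite [e * _]mulrC divfK ?gt_eqF// lerDr ltW.
Qed.

End Ladder.
End Pointwise.

(** * Inverting the half Laplacian *)

Section Mollified.
Variables (R : realType) (n : nat).
Local Notation Rm := (measurableTypeR R).
Local Notation la := (@lebesgue_measure R).
Local Notation leb := (leb R n).
Implicit Types (x y z : 'rV[R]_n) (s t : R).
Variables (k K : nat) (w : 'rV[R]_n -> R) (t : R).
Hypotheses (cw : continuous w) (t0 : 0 < t).

(** Only scales [s >= 1]: there the energy estimate is uniform in the centre. Small scales are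
    treated separately. *)
Definition far_decay C (w : 'rV[R]_n -> R) : Prop := forall x s, 1 <= s -> `|J k.+3 w x s| <= C * s ^- 4.

Lemma sq_le_far (C s : R) : 0 <= C -> 1 <= s -> C * s ^- 4 <= 4 * C * (1 + s ^+ 2) ^- 2.
Proof.
move=> C0 s1; have s0 : 0 < s by exact: lt_le_trans s1.
rewrite [4 * C]mulrC -mulrA; apply: ler_wpM2l => //.
rewrite ler_pdivlMr ?exprn_gt0 ?oneDsq_gt0// mulrC ler_pdivrMr ?exprn_gt0//.
rewrite (_ : 4 * s ^+ 4 = (2 * s ^+ 2) ^+ 2); last by ring.
have o0 := ltW (oneDsq_gt0 s); have s20 : 0 <= 2 * s ^+ 2 by rewrite mulr_ge0 ?sqr_ge0.
rewrite lerXn2r ?nnegrE//.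
by have := exprn_ege1 2 s1; lra.
Qed.

Lemma sq_le_near (M s : R) : 0 <= M -> 0 < s -> s <= 1 -> M <= 4 * M * (1 + s ^+ 2) ^- 2.
Proof.
move=> M0 s0 s1; rewrite [4 * M]mulrC -mulrA -[leLHS]mulr1; apply: ler_wpM2l => //.
rewrite ler_pdivlMr ?exprn_gt0 ?oneDsq_gt0// mul1r (_ : 4 = 2 ^+ 2); last by ring.
rewrite lerXn2r ?nnegrE ?(ltW (oneDsq_gt0 s))//.
by have := exprn_ile1 2 (ltW s0) s1; lra.
Qed.

Lemma far_ge0 C : far_decay C w -> 0 <= C.
Proof. by move=> /(_ 0 1 (lexx _)) /(le_trans (normr_ge0 _)); rewrite expr1n invr1 mulr1. Qed.

(** At small scales only the local boundedness of the continuous [w] is available, so the constant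
    depends on [x]. *)
Lemma local_decays C x : far_decay C w -> exists A, forall v, cube t v -> decays A (J k.+3 w (x + v)).
Proof.
move=> hC; have C0 := far_ge0 hC.
have [M M0 hM] := @continuous_cube_bounded _ _ (t + 1) _ (@continuous_rowlshift _ _ w x cw).
have M20 : 0 <= M * 2 ^+ n by rewrite mulr_ge0// exprn_ge0.
exists (4 * C + 4 * (M * 2 ^+ n)) => v hv s s0; rewrite mulrDl.
have q0 : 0 <= (1 + s ^+ 2) ^- 2 by rewrite invr_ge0 exprn_ge0// ltW// oneDsq_gt0.
have [s1|/ltW s1] := leP s 1; last first.
  apply: ler_wpDr; first by rewrite !mulr_ge0.
  exact: le_trans (hC _ _ s1) (sq_le_far C0 s1).
apply: ler_wpDl; first by rewrite !mulr_ge0.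
apply: le_trans (sq_le_near M20 s0 s1).
apply: (@J_le _ _ k.+2 w (x + v) s M s0 cw M0) => z hz; rewrite -addrA; apply: hM => i.
rewrite mxE; apply: (le_trans (ler_normD _ _)); apply: lerD; first exact: hv.
exact: le_trans (hz i) s1.
Qed.

(** The Laplacian to be treated need not be bounded on the whole space, but its averages at a fixed
    scale are; the Gaussian arguments are run on this bounded function. *)
Definition mol (y : 'rV[R]_n) : R := In leb (fun v => w (y + v) * H K.+1 t v).

Lemma measurable_mol : measurable_fun setT mol.
Proof.
apply: (@measurable_In1 _ _ 'rV[R]_n 'rV[R]_n R leb (fun y v => w (y + v) * H K.+1 t v)).
apply: measurable_funM.
  by apply: measurable_row_comp => //; apply: measurable_rowD.
exact: (measurableT_comp (continuous_row_measurable (@continuous_H _ _ K.+1 t)) measurable_snd).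
Qed.

Lemma measurable_HH : measurable_fun setT (H K.+1 t : 'rV[R]_n -> R).
Proof. exact: continuous_row_measurable (@continuous_H _ _ K.+1 t). Qed.

Lemma J_mol l x s : 0 < s -> J l.+1 mol x s = In leb (fun v => J l.+1 w (x + v) s * H K.+1 t v).
Proof.
move=> s0.
have [M M0 hM] := @continuous_cube_bounded _ _ (s + t) _ (@continuous_rowlshift _ _ w x cw).
set f := fun z v => w (x + z + v) * H K.+1 t v * H l.+1 s z.
have mw : measurable_fun setT (fun p : 'rV[R]_n * 'rV[R]_n => w (x + p.1 + p.2)).
  apply: measurable_row_comp => //; apply: measurable_rowD; last exact: measurable_snd.
  by apply: measurable_rowD; [exact: measurable_cst|exact: measurable_fst].
have mHl : measurable_fun setT (H l.+1 s : 'rV[R]_n -> R) by exact: continuous_row_measurable (@continuous_H _ _ _ _).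
have mf : measurable_fun setT (fun p : 'rV[R]_n * 'rV[R]_n => f p.1 p.2).
  apply: measurable_funM; last exact: (measurableT_comp mHl measurable_fst).
  by apply: measurable_funM => //; exact: (measurableT_comp measurable_HH measurable_snd).
have iw z := ig_wH K (x + z) t0 cw.
have f1 z : ig leb (f z).
  by apply: (eq_ig _ (igZ (H l.+1 s z) (iw z))) => v; exact: mulrC.
have iw2 v := ig_wH l (x + v) s0 cw.
have f2 v : ig leb (f ^~ v).
  apply: (eq_ig _ (igZ (H K.+1 t v) (iw2 v))) => z; rewrite /f addrAC mulrA; congr (_ * _).
  exact: mulrC.
have iK := @ig_H R n K t t0; have il := @ig_H R n l s s0.
have hb z v : `|f z v| <= M * H l.+1 s z * H K.+1 t v.
  have Hs0 := H_ge0 l.+1 s z; have Ht0 := H_ge0 K.+1 t v.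
  rewrite /f (normrM (_ * H K.+1 t v)) (normrM (w _)) (ger0_norm Ht0) (ger0_norm Hs0).
  have [->|hz] := eqVneq (H l.+1 s z) 0; first by rewrite !(mulr0, mul0r).
  have [->|hv] := eqVneq (H K.+1 t v) 0; first by rewrite !(mulr0, mul0r).
  rewrite mulrAC; apply: (ler_wpM2r Ht0); apply: (ler_wpM2r Hs0).
  rewrite -addrA; apply: hM => i; rewrite mxE.
  by apply: (le_trans (ler_normD _ _)); apply: lerD; [exact: H_cube s0 hz i|exact: H_cube t0 hv i].
have hg z : In leb (fun v => `|f z v|) <= (M * In leb (H K.+1 t)) * H l.+1 s z.
  rewrite mulrAC -(InZ _ iK).
  by apply: In_le; [exact: (ig_abs (f1 z))|exact: igZ|exact: hb].
have [_ j2 e] := real_fubini mf f1 f2 (igZ _ il) hg.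
have e1 z : In leb (f z) = mol (x + z) * H l.+1 s z.
  rewrite mulrC /mol -(InZ _ (iw z)); apply: eq_In => v; exact: mulrC.
have e2 v : In leb (f ^~ v) = s ^+ n * (J l.+1 w (x + v) s * H K.+1 t v).
  have sn : s ^+ n != 0 := expf_neq0 n (lt0r_neq0 s0).
  rewrite /J mulrA (mulVKf sn) mulrC -(InZ _ (iw2 v)); apply: eq_In => z.
  by rewrite /f addrAC mulrA; congr (_ * _); exact: mulrC.
rewrite {1}/J -(eq_In leb e1) e (eq_In leb e2) InZ.
  by rewrite (mulKf (expf_neq0 n (lt0r_neq0 s0))).
have sn : s ^+ n != 0 := expf_neq0 n (lt0r_neq0 s0).
apply: (eq_ig _ (igZ (s ^- n) j2)) => v.
by rewrite e2 (mulKf sn).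
Qed.

Lemma ig_JH l x s : 0 < s -> ig leb (fun v => J l.+1 w (x + v) s * H K.+1 t v).
Proof.
move=> s0.
have [M M0 hM] := @continuous_cube_bounded _ _ (s + t) _ (@continuous_rowlshift _ _ w x cw).
have iK := @ig_H R n K t t0.
apply: (ig_le _ _ (igZ (M * 2 ^+ n) iK)).
  apply: measurable_funM; last exact: measurable_HH.
  apply: measurable_Jm; [exact: continuous_row_measurable| |exact: measurable_cst].
  by apply: measurable_rowD => //; exact: measurable_cst.
move=> v; have Ht0 := H_ge0 K.+1 t v.
rewrite normrM (ger0_norm Ht0).
have [->|hv] := eqVneq (H K.+1 t v) 0; first by rewrite !mulr0.
apply: (ler_wpM2r Ht0); apply: (J_le _ s0 cw M0) => z hz; rewrite -addrA; apply: hM => i; rewrite mxE.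
rewrite [s + t]addrC.
by apply: (le_trans (ler_normD _ _)); apply: lerD; [exact: H_cube t0 hv i|exact: hz].
Qed.

(** In contrast with [local_decays], the constant is uniform in the centre: large scales inherit the
    decay of [w], and small scales use the global bound [B]. *)
Lemma mol_decays C B : far_decay C w -> (forall y, `|mol y| <= B) ->
  exists A, forall x, decays A (J k.+3 mol x).
Proof.
move=> hC hB; have C0 := far_ge0 hC.
have B0 : 0 <= B by exact: le_trans (normr_ge0 _) (hB 0).
have iK := @ig_H R n K t t0; have IK0 : 0 <= In leb (H K.+1 t) by apply: In_ge0 => v; exact: H_ge0.
have B20 : 0 <= B * 2 ^+ n by rewrite mulr_ge0// exprn_ge0.
have CI0 : 0 <= C * In leb (H K.+1 t) by rewrite mulr_ge0.
exists (4 * (C * In leb (H K.+1 t)) + 4 * (B * 2 ^+ n)) => x s s0; rewrite mulrDl.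
have q0 : 0 <= (1 + s ^+ 2) ^- 2 by rewrite invr_ge0 exprn_ge0// ltW// oneDsq_gt0.
have [s1|/ltW s1] := leP s 1; last first.
  apply: ler_wpDr; first by rewrite mulr_ge0// mulr_ge0.
  apply: le_trans (sq_le_far CI0 s1).
  rewrite (J_mol _ _ s0) mulrAC -(InZ _ iK).
  apply: In_absle; [exact: ig_JH|exact: igZ|].
  move=> v; rewrite normrM (ger0_norm (H_ge0 _ _ _)); apply: (ler_wpM2r (H_ge0 _ _ _)); exact: hC.
apply: ler_wpDl; first by rewrite mulr_ge0// mulr_ge0.
apply: le_trans (sq_le_near B20 s0 s1).
have il := @ig_H R n k.+2 s s0.
have sn0 : 0 <= s ^- n by rewrite invr_ge0 exprn_ge0// ltW.
rewrite /J normrM (ger0_norm sn0).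
apply: (@le_trans _ _ (s ^- n * (B * In leb (H k.+3 s)))).
  apply: (ler_wpM2l sn0); rewrite -(InZ _ il).
  have mM : measurable_fun setT (fun z => mol (x + z) * H k.+3 s z).
    apply: measurable_funM; last exact: continuous_row_measurable (@continuous_H _ _ _ _).
    by apply: (measurableT_comp measurable_mol); apply: measurable_rowD => //; exact: measurable_cst.
  have le z : `|mol (x + z) * H k.+3 s z| <= B * H k.+3 s z.
    by rewrite normrM (ger0_norm (H_ge0 _ _ _)); apply: (ler_wpM2r (H_ge0 _ _ _)); exact: hB.
  by apply: In_absle; [exact: (ig_le mM le (igZ B il))|exact: igZ|exact: le].
rewrite mulrCA; apply: (ler_wpM2l B0); rewrite mulrC ler_pdivrMr ?exprn_gt0// -exprMn; exact: In_H_le.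
Qed.

(** Mollification commutes with the moments in scale. Here the local constants suffice, as the
    kernel only sees a cube around [x]. *)
Lemma mol_Ip i C x : (i <= 1)%N -> far_decay C w ->
  ig leb (fun v => Ip (fun s => s ^+ i * J k.+3 w (x + v) s) * H K.+1 t v) /\
  In leb (fun v => Ip (fun s => s ^+ i * J k.+3 w (x + v) s) * H K.+1 t v) =
  Ip (fun s => s ^+ i * J k.+3 mol x s).
Proof.
move=> i1 hC; have [A hA] := local_decays x hC.
have iK := @ig_H R n K t t0.
set f := fun v s => (0 < s)%R%:R * (s ^+ i * (J k.+3 w (x + v) s * H K.+1 t v)).
have mJ : measurable_fun setT (fun p : 'rV[R]_n * Rm => J k.+3 w (x + p.1) p.2).
  apply: measurable_Jm; [exact: continuous_row_measurable| |exact: measurable_snd].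
  by apply: measurable_rowD; [exact: measurable_cst|exact: measurable_fst].
have mf : measurable_fun setT (fun p : 'rV[R]_n * Rm => f p.1 p.2).
  apply: measurable_funM; first exact: (measurableT_comp (@measurable_pos R) measurable_snd).
  apply: measurable_funM; first by apply: measurable_funX; exact: measurable_snd.
  by apply: measurable_funM => //; exact: (measurableT_comp measurable_HH measurable_fst).
have ijv v : cube t v -> ig la (fun s : Rm => (0 < s)%R%:R * (s ^+ i * J k.+3 w (x + v) s)) /\
   In la (fun s : Rm => `|(0 < s)%R%:R * (s ^+ i * J k.+3 w (x + v) s)|) <= A * om R.
  move=> hv; have hAv := hA v hv.
  have b s : 0 < s -> `|s ^+ i * J k.+3 w (x + v) s| <= A * (1 + s ^+ 2)^-1.
    move=> s0; case: i i1 {f mf} => [|[|//]] _; first by rewrite expr0 mul1r; exact: (decays_le hAv).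
    by rewrite expr1; exact: (decays_Mle hAv).
  have m1 : measurable_fun setT (fun s : Rm => s ^+ i * J k.+3 w (x + v) s).
    by apply: measurable_funM; [exact: measurable_funX|exact: (@measurable_slice1 _ _ 'rV[R]_n Rm R (fun v s => J k.+3 w (x + v) s) mJ v)].
  have ii := ig_Ip m1 b; split => //.
  rewrite /om /Ip -(InZ _ (@ig_oneDsqr_pos R)).
  apply: In_le; [exact: ig_abs|by apply: igZ; exact: ig_oneDsqr_pos|].
  move=> s; rewrite normrM normr_nat; have [s0|_] := ltP 0 s; last by rewrite !mul0r mulr0.
  by rewrite !mul1r; exact: b.
have f1 v : ig la (f v).
  have [h0|hv] := eqVneq (H K.+1 t v) 0.
    by apply: (eq_ig _ (@ig0 _ _ _ la)) => s; rewrite /f h0 !mulr0.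
  have [ii _] := ijv v (H_cube t0 hv).
  by apply: (eq_ig _ (igZ (H K.+1 t v) ii)) => s; rewrite /f; ring.
have f2 s : ig leb (f ^~ s).
  have [s0|s0] := ltP 0 s; last first.
    by apply: (eq_ig _ (@ig0 _ _ _ leb)) => v; rewrite /f ltNge s0 mul0r.
  by apply: igZ; apply: igZ; exact: ig_JH.
have hg v : In la (fun s => `|f v s|) <= (A * om R) * H K.+1 t v.
  have Ht0 := H_ge0 K.+1 t v.
  have [h0|hv] := eqVneq (H K.+1 t v) 0.
    rewrite h0 mulr0 le_eqVlt; apply/orP; left; apply/eqP; apply: etrans (In0 la).
    by apply: eq_In => s; rewrite /f h0 !mulr0 normr0.
  have [ii hi] := ijv v (H_cube t0 hv).
  apply: le_trans (ler_wpM2r Ht0 hi).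
  rewrite mulrC -(InZ _ (ig_abs ii)) le_eqVlt; apply/orP; left; apply/eqP; apply: eq_In => s.
  by rewrite /f !mulrA normrM (ger0_norm Ht0) mulrC.
have [j1 _ e] := real_fubini mf f1 f2 (igZ _ iK) hg.
have e1 v : In la (f v) = Ip (fun s => s ^+ i * J k.+3 w (x + v) s) * H K.+1 t v.
  have [h0|hv] := eqVneq (H K.+1 t v) 0.
    by rewrite h0 mulr0; apply: etrans (In0 la); apply: eq_In => s; rewrite /f h0 !mulr0.
  have [ii _] := ijv v (H_cube t0 hv).
  by rewrite mulrC /Ip -(InZ _ ii); apply: eq_In => s; rewrite /f; ring.
split; first exact: (eq_ig e1 j1).
rewrite -(eq_In leb e1) e; apply: eq_In => s.
have [s0|s0] := ltP 0 s; last first.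
  by rewrite mul0r; apply: etrans (In0 leb); apply: eq_In => v; rewrite /f ltNge s0 mul0r.
have iJ := ig_JH k.+2 x s0.
rewrite mul1r (J_mol _ _ s0) -(InZ _ iJ); apply: eq_In => v.
by rewrite /f s0 mul1r.
Qed.

End Mollified.

(** The bookkeeping of normalizing constants in [riesz_bound], with letters in place of the
    integrals. *)
Lemma const_identity (F : fieldType) (a b c d e h l q : F) :
  a != 0 -> b != 0 -> c != 0 -> d != 0 -> e != 0 -> h != 0 -> l != 0 ->
  - (a^-1 * (b / c)) * (d^-1 * ((- (e * (b / h)) * l)^-1 * q)) = (e * (b / h) * l * d * (c / b) * a)^-1 * q.
Proof.
move=> a0 b0 c0 d0 e0 h0 l0; rewrite [- _ * l]mulNr invrN !mulNr !mulrN opprK !mulrA; congr (_ * q).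
by rewrite !invfM !invrK; field; rewrite a0 ?b0 ?c0 ?d0 ?e0 ?h0 ?l0.
Qed.

(** * Gaussian inversion and the resulting potential bound *)

Section RieszBound.
Variables (R : realType) (m : nat).
Hypothesis m0 : (0 < m)%N.
Local Notation n := (2 * m).+1.
Local Notation Rm := (measurableTypeR R).
Local Notation la := (@lebesgue_measure R).
Local Notation leb := (leb R n).
Implicit Types (x y z v : 'rV[R]_n) (s t r : R).

Lemma ig_invB B : 0 < B -> ig la (fun r : Rm => (0 < r)%R%:R * (r ^+ 2 + B)^-1) /\
  Ip (fun r => (r ^+ 2 + B)^-1) = (Num.sqrt B)^-1 * om R.
Proof.
move=> B0; have q0 : 0 < Num.sqrt B by rewrite sqrtr_gt0.
have q2 : Num.sqrt B ^+ 2 = B by rewrite sqr_sqrtr// ltW.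
set q := Num.sqrt B in q0 q2 *; have qn : q != 0 by rewrite gt_eqF.
have qi : 0 < q^-1 by rewrite invr_gt0.
have i1 := ig_la_scale qi (@ig_oneDsqr_pos R).
have e r : q ^- 2 * ((0 < q^-1 * r)%R%:R * (1 + (q^-1 * r) ^+ 2)^-1) = (0 < r)%R%:R * (r ^+ 2 + B)^-1.
  rewrite pmulr_rgt0// mulrCA -invfM -q2; congr (_ * _^-1).
  by field.
split; first by apply: (eq_ig _ (igZ (q ^- 2) i1)) => r; exact: e.
rewrite /Ip -(eq_In la e) (InZ _ i1) (In_la_scale qi (ig_meas (@ig_oneDsqr_pos R))) invrK -/(om R).
by rewrite /om /Ip; field.
Qed.

Lemma expRN_le (a : R) : 0 <= a -> expR (- a) <= expR 1 * (m.+1)`!%:R * (1 + a) ^- m.+1.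
Proof.
move=> a0; have a1 : 0 < 1 + a by rewrite ltr_pwDl.
have f0 : 0 < (m.+1)`!%:R :> R by rewrite ltr0n fact_gt0.
have h : (1 + a) ^+ m.+1 / (m.+1)`!%:R <= expR (1 + a).
  by apply: le_trans (expR_ge1Dxn m (ltW a1)); rewrite lerDr.
rewrite ler_pdivlMr ?exprn_gt0// expRN mulrC ler_pdivrMr ?expR_gt0//.
rewrite mulrAC -expRD; rewrite ler_pdivrMr// in h.
Qed.

(** Write [q^2 = t^2 + r^2] and [X = q^2 + |z|^2]. By [expRN_le] the integrand is at most
    [c q X^-(m+1)]. With [B = t^2 + |z|^2 <= X] this is at most [c B^(1/2-m) / X], and the integral
    of [1/X] over [r] is [om B^(-1/2)]. *)
Lemma gs_radial : exists2 C, 0 <= C & forall t z, 0 < t ->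
  ig la (fun r : Rm => (0 < r)%R%:R * (Num.sqrt (t ^+ 2 + r ^+ 2) ^- n * gs (Num.sqrt (t ^+ 2 + r ^+ 2)) z)) /\
  Ip (fun r => Num.sqrt (t ^+ 2 + r ^+ 2) ^- n * gs (Num.sqrt (t ^+ 2 + r ^+ 2)) z) <= C * (t ^+ 2 + nsq z) ^- m.
Proof.
set c := expR 1 * (m.+1)`!%:R : R.
have c0 : 0 <= c by rewrite mulr_ge0 ?expR_ge0.
exists (c * om R); first by rewrite mulr_ge0// om_ge0.
move=> t z t0; have N0 := nsq_ge0 z; have t2 : 0 < t ^+ 2 by rewrite exprn_gt0.
set B := t ^+ 2 + nsq z; have B0 : 0 < B by rewrite ltr_wpDr.
set g := fun r : R => Num.sqrt (t ^+ 2 + r ^+ 2) ^- n * gs (Num.sqrt (t ^+ 2 + r ^+ 2)) z.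
have [iB eB] := ig_invB B0.
have sB0 : 0 < Num.sqrt B by rewrite sqrtr_gt0.
set D := c * (Num.sqrt B * B ^- m).
have g0 r : 0 <= g r by rewrite mulr_ge0 ?gs_ge0// invr_ge0 exprn_ge0// sqrtr_ge0.
have hg r : g r <= D * (r ^+ 2 + B)^-1.
  have r2 := sqr_ge0 r.
  set tau := t ^+ 2 + r ^+ 2; have tau0 : 0 < tau by rewrite ltr_pwDl.
  set q := Num.sqrt tau; have q0 : 0 < q by rewrite sqrtr_gt0.
  have q2 : q ^+ 2 = tau by rewrite sqr_sqrtr// ltW.
  have X0 : 0 < r ^+ 2 + B by rewrite ltr_wpDl.
  have eX : tau + nsq z = r ^+ 2 + B by rewrite /tau /B; ring.
  set X := r ^+ 2 + B in X0 eX *; set Q := Num.sqrt X; have Q0 : 0 < Q by rewrite sqrtr_gt0.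
  have Q2 : Q ^+ 2 = X by rewrite sqr_sqrtr// ltW.
  have qQ : q <= Q by rewrite ler_wsqrtr// -eX lerDl.
  have bQ : Num.sqrt B <= Q by rewrite ler_wsqrtr// lerDr.
  have b2 : Num.sqrt B ^+ 2 = B by rewrite sqr_sqrtr// ltW.
  have h1 : gs q z <= c * (tau ^+ m.+1 * X ^- m.+1).
    have := expRN_le (divr_ge0 N0 (ltW tau0)); rewrite -/c.
    rewrite (_ : 1 + nsq z / tau = X / tau); last by rewrite -eX; field; rewrite gt_eqF.
    by rewrite /gs q2 exprMn invfM exprVn invrK [tau ^+ _ * _]mulrC.
  apply: (@le_trans _ _ (q ^- n * (c * (tau ^+ m.+1 * X ^- m.+1)))).
    by rewrite ler_wpM2l// invr_ge0 exprn_ge0// ltW.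
  have -> : q ^- n * (c * (tau ^+ m.+1 * X ^- m.+1)) = c * (q * X ^- m.+1).
    have -> : tau ^+ m.+1 = q * q ^+ n by rewrite -q2 -exprM mulnS -[RHS]exprS.
    have gen (a b d h : R) : a != 0 -> a^-1 * (b * (d * a * h)) = b * (d * h) by move=> a0; field.
    have gen' := gen (q ^+ n) c q (X ^- m.+1) (expf_neq0 n (lt0r_neq0 q0)); exact: gen'.
  rewrite /D -[c * _ * _]mulrA; apply: (ler_wpM2l c0).
  rewrite [X ^+ m.+1]exprS invfM mulrA mulrAC; apply: ler_wpM2r; first by rewrite invr_ge0 ltW.
  have hm (y Y : R) : 0 < y -> y ^+ 2 = Y -> y * Y ^- m = y^-1 * Y ^- m.-1.
    move=> y0 <-; rewrite -{1}(prednK m0) exprS.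
    have gen (a b : R) : a != 0 -> b != 0 -> a * (a ^+ 2 * b)^-1 = a^-1 * b^-1 by move=> a0 b0; field; rewrite a0 b0.
    by apply: gen; rewrite ?expf_neq0// gt_eqF.
  have Xm0 : 0 <= X ^- m by rewrite invr_ge0 exprn_ge0// ltW.
  apply: (le_trans (ler_wpM2r Xm0 qQ)); rewrite (hm _ _ Q0 Q2) (hm _ _ sB0 b2).
  apply: ler_pM; rewrite ?invr_ge0 ?exprn_ge0 ?(ltW Q0) ?(ltW X0)//.
    by rewrite lef_pV2 ?posrE.
  by rewrite lef_pV2 ?posrE ?exprn_gt0// lerXn2r ?nnegrE ?(ltW B0) ?(ltW X0)// /X lerDr.
have mq : measurable_fun setT (fun r : Rm => Num.sqrt (t ^+ 2 + r ^+ 2) : R).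
  apply: (measurableT_comp (@measurable_sqrt R)); apply: measurable_funD; first exact: measurable_cst.
  exact: measurable_funX.
have mg : measurable_fun setT (fun r : Rm => (0 < r)%R%:R * g r).
  apply: measurable_funM; first exact: measurable_pos.
  apply: measurable_funM; first exact: measurable_invX.
  by apply: measurable_gs => //; exact: measurable_cst.
have le r : 0 <= (0 < r)%R%:R * g r <= D * ((0 < r)%R%:R * (r ^+ 2 + B)^-1).
  apply/andP; split; first by rewrite mulr_ge0.
  rewrite [leRHS]mulrCA; exact: (ler_wpM2l (ler0n _ _) (hg r)).
split.
  apply: (ig_le mg _ (igZ D iB)) => r; have /andP[h1 h2] := le r.
  by rewrite ger0_norm.
apply: (le_trans (In_gt0_le mg le (igZ D iB))).
rewrite (InZ _ iB) -/(Ip (fun r => (r ^+ 2 + B)^-1)) eB /D le_eqVlt; apply/orP; left; apply/eqP.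
by field; rewrite expf_neq0 ?gt_eqF.
Qed.

Lemma measurable_Eg (w : 'rV[R]_n -> R) d (T : measurableType d) (a : T -> R) (b : T -> 'rV[R]_n) :
  measurable_fun setT w -> measurable_fun setT a -> measurable_fun setT b ->
  measurable_fun setT (fun p : T => Eg (a p) w (b p)).
Proof.
move=> mw ma mb; apply: measurable_funM; first exact: measurable_invX.
apply: (@measurable_In1 _ _ T _ R leb (fun p z => w (b p + z) * gs (a p) z)).
apply: measurable_funM.
  apply: (measurableT_comp mw); apply: measurable_rowD; last exact: measurable_snd.
  exact: (measurableT_comp mb measurable_fst).
by apply: measurable_gs; [exact: (measurableT_comp ma measurable_fst)|exact: measurable_snd].
Qed.

(** [gs_radial] integrated against [|f|]: integrating Gaussian averages over the widths produces the
    Riesz kernel, smoothed at scale [t]. *)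
Lemma Ip_Eg_abs (f : 'rV[R]_n -> R) : ig leb f ->
  exists2 C, 0 <= C & forall x t, 0 < t ->
  ig la (fun r : Rm => (0 < r)%R%:R * Eg (Num.sqrt (t ^+ 2 + r ^+ 2)) (fun y => `|f y|) x) /\
  Ip (fun r => Eg (Num.sqrt (t ^+ 2 + r ^+ 2)) (fun y => `|f y|) x) <=
  C * In leb (fun z => `|f (x + z)| * (t ^+ 2 + nsq z) ^- m).
Proof.
move=> i_f; have [C C0 hC] := gs_radial; exists C => // x t t0.
have mf0 := ig_meas i_f.
have ifx : ig leb (fun z => `|f (x + z)|).
  by apply: (eq_ig _ (ig_abs (ig_shift x i_f))) => z; rewrite addrC.
set q := fun r : Rm => Num.sqrt (t ^+ 2 + r ^+ 2).
have t2 : 0 < t ^+ 2 by rewrite exprn_gt0.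
have tq r : t <= q r.
  rewrite -[t](ger0_norm (ltW t0)) -sqrtr_sqr ler_wsqrtr// lerDl; exact: sqr_ge0.
have mq : measurable_fun setT q.
  apply: (measurableT_comp (@measurable_sqrt R)); apply: measurable_funD; first exact: measurable_cst.
  exact: measurable_funX.
set h := fun z r => `|f (x + z)| * ((0 < r)%R%:R * (q r ^- n * gs (q r) z)).
have mh : measurable_fun setT (fun p : 'rV[R]_n * Rm => h p.1 p.2).
  apply: measurable_funM; first exact: (measurableT_comp (ig_meas ifx) measurable_fst).
  apply: measurable_funM; first exact: (measurableT_comp (@measurable_pos R) measurable_snd).
  have mq2 : measurable_fun setT (fun p : 'rV[R]_n * Rm => q p.2) by exact: (measurableT_comp mq measurable_snd).
  apply: measurable_funM; first exact: measurable_invX.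
  by apply: measurable_gs => //; exact: measurable_fst.
have h0 z r : 0 <= h z r.
  by rewrite !mulr_ge0 ?gs_ge0// invr_ge0 exprn_ge0// sqrtr_ge0.
have f1 z : ig la (h z) by apply: igZ; have [] := hC t z t0.
have f2 r : ig leb (h ^~ r).
  apply: (ig_le _ _ (igZ (q r ^- n) ifx)).
    exact: (@measurable_slice2 _ _ 'rV[R]_n Rm R h mh r).
  move=> z; rewrite ger0_norm// /h mulrC ler_wpM2r//.
  have qn0 : 0 <= q r ^- n by rewrite invr_ge0 exprn_ge0// sqrtr_ge0.
  case: (0 < r); rewrite ?mul0r// mul1r ler_piMr ?gs_le1//.
have mk : measurable_fun setT (fun z : 'rV[R]_n => (t ^+ 2 + nsq z) ^- m).
  apply: measurable_invX; apply: measurable_funD; first exact: measurable_cst.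
  by apply: measurable_nsq; exact: measurable_id.
have k0 z : 0 <= (t ^+ 2 + nsq z) ^- m.
  by rewrite invr_ge0 exprn_ge0// addr_ge0 ?nsq_ge0// ltW.
have ifk : ig leb (fun z => `|f (x + z)| * (t ^+ 2 + nsq z) ^- m).
  apply: (ig_le _ _ (igZ ((t ^+ 2) ^- m) ifx)).
    by apply: measurable_funM => //; exact: (ig_meas ifx).
  move=> z; rewrite normrM normr_id (ger0_norm (k0 z)) mulrC ler_wpM2r//.
  have tz : 0 < t ^+ 2 + nsq z by rewrite ltr_wpDr// nsq_ge0.
  by rewrite lef_pV2 ?posrE ?exprn_gt0// lerXn2r ?nnegrE ?(ltW t2) ?(ltW tz)// lerDl nsq_ge0.
have hg z : In la (fun r => `|h z r|) <= C * (`|f (x + z)| * (t ^+ 2 + nsq z) ^- m).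
  have [i1 l1] := hC t z t0.
  rewrite mulrCA; apply: le_trans (ler_wpM2l (normr_ge0 _) l1).
  rewrite /Ip -(InZ _ i1) le_eqVlt; apply/orP; left; apply/eqP; apply: eq_In => r.
  by rewrite ger0_norm.
have [j1 j2 e] := real_fubini mh f1 f2 (igZ C ifk) hg.
have e2 r : In leb (h ^~ r) = (0 < r)%R%:R * Eg (q r) (fun y => `|f y|) x.
  have ig1 : ig leb (fun z => `|f (x + z)| * gs (q r) z).
    apply: (ig_le _ _ ifx) => [|z].
      by apply: measurable_funM; [exact: (ig_meas ifx)|apply: measurable_gs => //; exact: measurable_cst].
    by rewrite normrM normr_id (ger0_norm (gs_ge0 _ _)) ler_piMr ?gs_le1.
  rewrite /Eg mulrA -(InZ _ ig1); apply: eq_In => z.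
  rewrite /h; ring.
split; first by apply: (eq_ig _ j2) => r; exact: e2.
rewrite /Ip -(eq_In la e2) -e -(InZ _ ifk); apply: In_le => //; first exact: igZ.
move=> z; apply: le_trans (hg z); rewrite le_eqVlt; apply/orP; left; apply/eqP; apply: eq_In => r.
by rewrite ger0_norm.
Qed.

Lemma expRN_sqrt_In_gt0 j i : 0 < Ip (fun p : R => expR (- p) * p ^+ j * Num.sqrt p ^+ i).
Proof.
apply: (@lt_le_trans _ _ (In la (fun p : Rm => (1 <= p <= 2)%R%:R * expR (- 2)))).
  by rewrite In_itvb ?ler1n// mulr_gt0 ?expR_gt0// subr_gt0 ltr1n.
apply: In_le; [exact: ig_itvb|exact: ig_expRN_sqrt|].
move=> p; have [/andP[p1 p2]|_] := boolP (1 <= p <= 2); last first.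
  by rewrite mul0r; have [p0|] := ltP 0 p; rewrite ?mul0r// mul1r expRN_sqrt_ge0.
rewrite (lt_le_trans ltr01 p1) !mul1r -[leLHS]mulr1.
have s1 : 1 <= Num.sqrt p by rewrite -sqrtr1 ler_wsqrtr.
apply: ler_pM; rewrite ?expR_ge0// ?exprn_ege1//.
by rewrite -[leLHS]mulr1; apply: ler_pM; rewrite ?expR_ge0// ?exprn_ege1// ler_expR lerN2.
Qed.

Lemma om_gt0 : 0 < om R.
Proof.
apply: (@lt_le_trans _ _ (In la (fun p : Rm => (1 <= p <= 2)%R%:R * (1 + 2 ^+ 2)^-1))).
  by rewrite In_itvb ?ler1n// mulr_gt0 ?invr_gt0 ?oneDsq_gt0// subr_gt0 ltr1n.
apply: In_le; [exact: ig_itvb|exact: ig_oneDsqr_pos|].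
move=> p; have [/andP[p1 p2]|_] := boolP (1 <= p <= 2); last first.
  by rewrite mul0r mulr_ge0// invr_ge0 ltW// oneDsq_gt0.
have p0 := lt_le_trans ltr01 p1.
by rewrite p0 !mul1r lef_pV2 ?posrE ?oneDsq_gt0// lerD2l lerXn2r ?nnegrE// ltW.
Qed.

(** A Gaussian average passes under the scale integral and merges with the inner Gaussian by the
    semigroup law. *)
Lemma Eg_Ip_comm (w F : 'rV[R]_n -> R) A c r x : 0 < r -> measurable_fun setT w ->
  (exists M, forall y, `|w y| <= M) ->
  (forall y s, 0 < s -> `|Eg s w y| <= A * (1 + s ^+ 2) ^- 2) ->
  (forall y, F y = c * Ip (fun s => Eg s w y)) ->
  Eg r F x = c * (g1 R ^+ n * Ip (fun s => Eg (Num.sqrt (s ^+ 2 + r ^+ 2)) w x)).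
Proof.
move=> r0 mw hw hA hF; have [M hM] := hw.
have A0 : 0 <= A.
  have := le_trans (normr_ge0 _) (hA 0 1 ltr01); rewrite pmulr_lge0// invr_gt0 exprn_gt0//; exact: oneDsq_gt0.
have hA1 y s : 0 < s -> `|Eg s w y| <= A * (1 + s ^+ 2)^-1.
  move=> s0; apply: (le_trans (hA y s s0)); apply: ler_wpM2l => //.
  by rewrite lef_pV2 ?posrE ?exprn_gt0 ?oneDsq_gt0// ler_eXnr// lerDl sqr_ge0.
have [ir _] := @In_gs R n r r0.
set f := fun z s => (0 < s)%R%:R * Eg s w (x + z) * gs r z.
have mE : measurable_fun setT (fun p : 'rV[R]_n * Rm => (0 < p.2)%R%:R * Eg p.2 w (x + p.1)).
  apply: measurable_funM; first exact: (measurableT_comp (@measurable_pos R) measurable_snd).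
  have mxz : measurable_fun setT (fun p : 'rV[R]_n * Rm => x + p.1).
    by apply: measurable_rowD; [exact: measurable_cst|exact: measurable_fst].
  exact: (measurable_Eg mw measurable_snd mxz).
have mf : measurable_fun setT (fun p : 'rV[R]_n * Rm => f p.1 p.2).
  by apply: measurable_funM => //; apply: measurable_gs; [exact: measurable_cst|exact: measurable_fst].
have mEs y : measurable_fun setT (fun s : Rm => Eg s w y) by apply: measurable_Eg => //.
have iE y := ig_Ip (mEs y) (hA1 y).
have f1 z : ig la (f z).
  by apply: (eq_ig _ (igZ (gs r z) (iE (x + z)))) => s; exact: mulrC.
have mEr s : measurable_fun setT (Eg s w : 'rV[R]_n -> R) by apply: measurable_Eg => //; exact: measurable_cst.
have iEr s : 0 < s -> ig leb (fun z => Eg s w (x + z) * gs r z).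
  move=> s0; apply: ig_Eg => //; exists A => y; apply: (le_trans (hA1 y s s0)).
  rewrite -[leRHS]mulr1; exact: (ler_wpM2l A0 (oneDsqV_le1 s)).
have f2 s : ig leb (f ^~ s).
  have [s0|s0] := ltP 0 s; last first.
    by apply: (eq_ig _ (@ig0 _ _ _ leb)) => z; rewrite /f ltNge s0 !mul0r.
  by apply: (eq_ig _ (iEr s s0)) => z; rewrite /f s0 mul1r.
have hg z : In la (fun s => `|f z s|) <= (A * om R) * gs r z.
  have gz := gs_ge0 r z.
  have io := igZ A (@ig_oneDsqr_pos R).
  rewrite [leRHS]mulrC /om /Ip -(InZ _ (@ig_oneDsqr_pos R)) -(InZ _ io).
  apply: In_le; [exact: (ig_abs (f1 z))|exact: igZ|].
  move=> s; rewrite /f (normrM (_ * Eg s w (x + z))) (ger0_norm gz) mulrC; apply: (ler_wpM2l gz).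
  rewrite (normrM _%:R) normr_nat mulrCA; have [s0|_] := ltP 0 s; last by rewrite !mul0r.
  by rewrite !mul1r; exact: hA1.
have [_ j2 e] := real_fubini mf f1 f2 (igZ _ ir) hg.
have e1 z : F (x + z) * gs r z = c * In la (f z).
  rewrite hF -mulrA; congr (_ * _); rewrite mulrC /Ip -(InZ _ (iE (x + z))); apply: eq_In => s; exact: mulrC.
have [j1 _ _] := real_fubini mf f1 f2 (igZ _ ir) hg.
rewrite {1}/Eg (eq_In leb e1) (InZ _ j1) e mulrCA; congr (_ * _).
have e2 s : In leb (f ^~ s) = r ^+ n * ((0 < s)%R%:R * Eg r (Eg s w) x).
  have rn : r ^+ n != 0 := expf_neq0 n (lt0r_neq0 r0).
  have [s0|s0] := ltP 0 s; last first.
    by rewrite mul0r mulr0; apply: etrans (In0 leb); apply: eq_In => z; rewrite /f ltNge s0 !mul0r.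
  by rewrite mul1r {1}/Eg (mulVKf rn); apply: eq_In => z; rewrite /f s0 mul1r.
have M0 : 0 <= M by exact: le_trans (normr_ge0 _) (hM 0).
have e3 s : (0 < s)%R%:R * Eg r (Eg s w) x = g1 R ^+ n * ((0 < s)%R%:R * Eg (Num.sqrt (s ^+ 2 + r ^+ 2)) w x).
  have [s0|s0] := ltP 0 s; last by rewrite !mul0r mulr0.
  have [is_ es] := @In_gs R n s s0.
  rewrite !mul1r (@Eg_semigroup _ _ w s r x (M * (s * g1 R) ^+ n) s0 r0 mw)//.
    by move=> y; apply: ig_Eg.
  move=> y; rewrite -es -(InZ _ is_); apply: In_le; [|exact: igZ|].
    apply: (eq_ig _ (ig_abs (ig_Eg y s0 mw hw))) => z.
    by rewrite normrM (ger0_norm (gs_ge0 _ _)).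
  by move=> z; apply: (ler_wpM2r (gs_ge0 _ _)).
have rn : r ^+ n != 0 := expf_neq0 n (lt0r_neq0 r0).
have g1n : g1 R ^+ n != 0 := expf_neq0 n (lt0r_neq0 (g1_gt0 R)).
have j3 : ig la (fun s : Rm => (0 < s)%R%:R * Eg (Num.sqrt (s ^+ 2 + r ^+ 2)) w x).
  apply: (eq_ig _ (igZ ((r ^+ n) * g1 R ^+ n)^-1 j2)) => s.
  by rewrite e2 e3 [r ^+ n * (_ * _)]mulrA mulKf// mulf_neq0.
rewrite -(InZ _ j3) -(eq_In la e3) -[RHS](mulKf rn); congr (_ * _).
rewrite -InZ; first exact: eq_In.
by apply: (eq_ig _ (igZ (g1 R ^+ n) j3)) => s; rewrite e3.
Qed.

(* Integrating the Gaussian averages of [f = - c * Ip (J (lap phi))] over all widths inverts the half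
   Laplacian: by the semigroup law the double integral collapses to the ladder for [phi]. *)
Lemma riesz_bound (phi f : 'rV[R]_n -> R) k K C1 C2 c2 : 0 < c2 -> smooth phi -> ig leb f ->
  far_decay k C1 (lap phi) ->
  (forall x b, 1 <= b -> `|J k.+2 phi x b| <= C2 / b) ->
  (forall t, 0 < t -> exists B, forall x, `|J K.+1 (lap phi) x t| <= B) ->
  (forall x, f x = - c2 * Ip (J k.+3 (lap phi) x)) ->
  exists2 C, 0 <= C & forall x t, 0 < t ->
   `|J K.+1 phi x t| <= C * In leb (fun z => `|f (x + z)| * (t ^+ 2 + nsq z) ^- m).
Proof.
move=> c20 sp i_f hC1 hC2 hB hf.
have cp := smooth_continuous sp; have cw := smooth_continuous (smooth_lap sp).
have cpm := continuous_row_measurable cp.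
have n2 : (2 <= n)%N by rewrite ltnS muln_gt0.
have n0 : (0 < n)%N by [].
set G := Gam R k.+2; have G0 : 0 < G by exact: Gam_gt0.
have D0 i : 0 < Ip (fun p : R => expR (- p) * p ^+ k.+3 * Num.sqrt p ^+ (n - i.+1)) by exact: expRN_sqrt_In_gt0.
set D := fun i => Ip (fun p : R => expR (- p) * p ^+ k.+3 * Num.sqrt p ^+ (n - i.+1)) in D0 *.
set kap := 2 * k.+3%:R * In leb (H k.+2 1) : R.
have kap0 : 0 < kap.
  have h := @In_H_ge R n k.+1 1 ltr01 n0.
  have : 0 < (3 / 4) ^+ k.+2 * (1 / n%:R) ^+ n :> R.
    by rewrite mulr_gt0 ?exprn_gt0 ?divr_gt0// ltr0n.
  by move=> h1; rewrite /kap -natrM mulr_gt0 ?ltr0n// (lt_le_trans h1).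
have [C3 C30 h3] := Ip_Eg_abs i_f.
have g10 : 0 < g1 R ^+ n by rewrite exprn_gt0// g1_gt0.
set c5 := c2 * (G / D 0%N) * g1 R ^+ n * om R * (D 1%N / G) * kap.
have hq1 : 0 < G / D 0%N := divr_gt0 G0 (D0 0%N).
have hq2 : 0 < D 1%N / G := divr_gt0 (D0 1%N) G0.
have c50 : 0 < c5 := mulr_gt0 (mulr_gt0 (mulr_gt0 (mulr_gt0 (mulr_gt0 c20 hq1) g10) om_gt0) hq2) kap0.
exists (c5^-1 * (g1 R ^+ n * C3)); first by rewrite !mulr_ge0// ?invr_ge0 ltW.
move=> x t t0; have t0' := ltW t0.
have tn0 : 0 < t ^+ n by rewrite exprn_gt0.
set w := lap phi in cw *; set M := mol K w t.
have mM : measurable_fun setT M by exact: measurable_mol.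
have [B hBt] := hB t t0.
have bM : exists B, forall y, `|M y| <= B.
  exists (t ^+ n * B) => y; have := hBt y.
  by rewrite /J -/(mol K w t y) -/M normrM ger0_norm ?invr_ge0 ?(ltW tn0)// mulrC ler_pdivrMr// mulrC.
have [B' hB'] := bM.
have [A hA] := mol_decays cw t0 hC1 hB'.
have [A' hA'] := Eg_decay mM bM hA.
have mf := ig_meas i_f.
have decw y : exists A, decays A (J k.+3 w y).
  have [A1 h1] := @local_decays R n k w t cw C1 y hC1; exists A1.
  have c0 : cube t (0 : 'rV[R]_n) by move=> i; rewrite mxE normr0.
  by have := h1 0 c0; rewrite addr0.
(* [Phi] is [t^n] times the average to be bounded, and [F] the same average of [f]. Up to constants
   [Phi] is the first moment in scale of the averages of [M], and [F] the zeroth. *)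
pose Phi := In leb (fun v => phi (x + v) * H K.+1 t v).
pose F := fun y => In leb (fun v => f (y + v) * H K.+1 t v).
have ePhi : kap * Phi = - Ip (fun s => s ^+ 1 * J k.+3 M x s).
  have [iI <-] := @mol_Ip R n k K w t cw t0 1 C1 x isT hC1.
  have iP := ig_wH K x t0 cp.
  rewrite /Phi -(InZ _ iP) -(InN iI).
  apply: eq_In => v; have [A1 h1] := decw (x + v).
  rewrite mulrA -mulNr; congr (_ * _).
  rewrite (@eq_Ip _ _ (fun s => s * J k.+3 w (x + v) s)); last by move=> s _; rewrite expr1.
  by rewrite (Ip_phi sp (fun _ => erefl) h1 (hC2 (x + v))) mulNr opprK.
have eF y : F y = - c2 * Ip (fun s => s ^+ 0 * J k.+3 M y s).
  have [iI <-] := @mol_Ip R n k K w t cw t0 0 C1 y isT hC1.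
  rewrite -(InZ _ iI); apply: eq_In => v; rewrite hf mulrA; congr (_ * _ * _).
  by apply: eq_Ip => s _; rewrite expr0 mul1r.
have eE i : (i <= 1)%N -> forall y, Ip (fun s => s ^+ i * J k.+3 M y s) = G / D i * Ip (fun s => s ^+ i * Eg s M y).
  move=> i1 y; have := @Ip_Eg_J R n k i M y A i1 mM bM (hA y) n2.
  rewrite -/G -/(D i) => h.
  by rewrite mulrAC h mulrAC mulfV ?mul1r// gt_eqF// D0.
have eF2 y : F y = - (c2 * (G / D 0%N)) * Ip (fun s => Eg s M y).
  rewrite eF eE// mulrA mulNr; congr (_ * _).
  by apply: eq_Ip => s _; rewrite expr0 mul1r.
have ePhi2 : Phi = - (kap^-1 * (G / D 1%N)) * Ip (fun s => s * Eg s M x).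
  rewrite -[LHS](mulKf (lt0r_neq0 kap0)) ePhi eE// mulrN mulrA mulNr; congr (- (_ * _)).
have e3 r : 0 < r -> Eg r F x = - (c2 * (G / D 0%N)) * (g1 R ^+ n * Ip (fun s => Eg (Num.sqrt (s ^+ 2 + r ^+ 2)) M x)).
  by move=> r0; apply: (Eg_Ip_comm x r0 mM bM hA' eF2).
have mEx : measurable_fun setT (fun s : Rm => Eg s M x) by apply: measurable_Eg.
(* Integrating the Gaussian averages of [F] over [r] gives a quadrant integral of a function of
   [r^2 + s^2]; polar coordinates turn it into the first moment, that is, into [Phi]. *)
have e4 := @Ip_polar R (fun s => Eg s M x) A' mEx (hA' x).
set af := fun y : 'rV[R]_n => `|f y|.
have maf : measurable_fun setT af by exact: measurableT_comp.
have ish y : ig leb (fun z => af (y + z)).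
  by apply: (eq_ig _ (ig_abs (ig_shift y i_f))) => z; rewrite addrC.
have Ish y : In leb (fun z => af (y + z)) = In leb af.
  by rewrite -(In_shift y maf); apply: eq_In => z; rewrite addrC.
have mgs : measurable_fun setT (gs t : 'rV[R]_n -> R) by apply: measurable_gs => //; exact: measurable_cst.
have maf2 y : measurable_fun setT (fun z => af (y + z)) by exact: ig_meas (ish y).
have hw y : ig leb (fun z => af (y + z) * gs t z).
  apply: (ig_le _ _ (ish y)) => [|z]; first exact: measurable_funM.
  by rewrite normrM normr_id (ger0_norm (gs_ge0 _ _)) ler_piMr ?gs_le1.
have hM' y : In leb (fun z => `|af (y + z)| * gs t z) <= In leb af.
  rewrite -(Ish y); apply: In_le => // [|z].
    by apply: (eq_ig _ (hw y)) => z; rewrite normr_id.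
  by rewrite normr_id ler_piMr ?gs_le1.
have tn : t ^+ n != 0 := lt0r_neq0 tn0.
(* The kernel [H] lies below the Gaussian of the same width, so one more use of the semigroup law,
   in [h5], merges the mollification with the average over width [r]. *)
have bF y : `|F y| <= t ^+ n * Eg t af y.
  rewrite /Eg (mulVKf tn).
  have le z : `|f (y + z) * H K.+1 t z| <= af (y + z) * gs t z.
    rewrite normrM (ger0_norm (H_ge0 _ _ _)); apply: ler_wpM2l => //; exact: H_le_gs.
  have mfy : measurable_fun setT (fun z => f (y + z) * H K.+1 t z).
    apply: measurable_funM; last exact: measurable_HH.
    by apply: (measurableT_comp mf); apply: measurable_rowD => //; exact: measurable_cst.
  by apply: In_absle => //; exact: (ig_le mfy le (hw y)).
have bEaf y : `|Eg t af y| <= t ^- n * In leb af.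
  have tv : 0 <= t ^- n by rewrite invr_ge0 ltW.
  rewrite /Eg normrM (ger0_norm tv); apply: (ler_wpM2l tv).
  apply: le_trans (hM' y); rewrite ger0_norm; last by apply: In_ge0 => z; exact: (mulr_ge0 (normr_ge0 _) (gs_ge0 _ _)).
  by rewrite le_eqVlt; apply/orP; left; apply/eqP; apply: eq_In => z; rewrite normr_id.
have mFf : measurable_fun setT F.
  apply: (@measurable_In1 _ _ 'rV[R]_n 'rV[R]_n R leb (fun y v => f (y + v) * H K.+1 t v)).
  apply: measurable_funM; first by apply: (measurableT_comp mf); apply: measurable_rowD.
  exact: (measurableT_comp (@measurable_HH R n K t) measurable_snd).
have mEaf : measurable_fun setT (Eg t af : 'rV[R]_n -> R) by apply: measurable_Eg => //; exact: measurable_cst.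
have bF2 : exists B, forall y, `|F y| <= B.
  exists (t ^+ n * (t ^- n * In leb af)) => y; apply: (le_trans (bF y)).
  by apply: ler_wpM2l; [exact: ltW|apply: le_trans (bEaf y); exact: ler_norm].
(* The widths combine to the square root of [t^2 + r^2], the form expected by [Ip_Eg_abs]. *)
have h5 r : 0 < r -> `|Eg r F x| <= t ^+ n * (g1 R ^+ n * Eg (Num.sqrt (t ^+ 2 + r ^+ 2)) af x).
  move=> r0; have rv : 0 <= r ^- n by rewrite invr_ge0 exprn_ge0// ltW.
  rewrite -(@Eg_semigroup _ _ af t r x (In leb af) t0 r0 maf hw hM').
  have i1 := ig_Eg x r0 mEaf (ex_intro _ _ bEaf).
  rewrite {2}/Eg mulrCA {1}/Eg normrM (ger0_norm rv); apply: (ler_wpM2l rv).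
  rewrite -(InZ _ i1); apply: In_absle; [exact: ig_Eg|exact: igZ|].
  move=> z; rewrite normrM (ger0_norm (gs_ge0 _ _)) mulrA; apply: (ler_wpM2r (gs_ge0 _ _)); exact: bF.
have [i6 h6] := h3 x t t0.
have mEF : measurable_fun setT (fun r : Rm => (0 < r)%R%:R * Eg r F x).
  by apply: measurable_funM; [exact: measurable_pos|apply: measurable_Eg].
have h7 r : `|(0 < r)%R%:R * Eg r F x| <= t ^+ n * g1 R ^+ n * ((0 < r)%R%:R * Eg (Num.sqrt (t ^+ 2 + r ^+ 2)) af x).
  rewrite normrM normr_nat mulrCA; have [r0|_] := ltP 0 r; last by rewrite !mul0r.
  by rewrite !mul1r -mulrA; exact: h5.
have i7 := ig_le mEF h7 (igZ _ i6).
set c' := - (c2 * (G / D 0%N)) * g1 R ^+ n.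
have c'n : c' != 0.
  by rewrite mulf_neq0 ?(lt0r_neq0 g10)// oppr_eq0 mulf_neq0 ?(lt0r_neq0 c20)// mulf_neq0 ?invr_eq0 ?(lt0r_neq0 G0)// lt0r_neq0// D0.
have e5 : om R * Ip (fun s => s * Eg s M x) = c'^-1 * Ip (fun r => Eg r F x).
  rewrite -e4 /Ip -(InZ _ i7); apply: eq_In => r; rewrite mulrCA.
  have [r0|_] := ltP 0 r; last by rewrite !mul0r.
  by rewrite e3// [- _ * _]mulrA -/c' mulKf.
have e6 : Phi = c5^-1 * Ip (fun r => Eg r F x).
  have omn := lt0r_neq0 om_gt0.
  have e8 : Ip (fun s => s * Eg s M x) = (om R)^-1 * (c'^-1 * Ip (fun r => Eg r F x)) by rewrite -e5 mulKf.
  rewrite ePhi2 e8 /c5 /c'; have kn := lt0r_neq0 kap0; have gn := lt0r_neq0 g10; have Gn := lt0r_neq0 G0.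
  have d0n := lt0r_neq0 (D0 0%N); have d1n := lt0r_neq0 (D0 1%N); have cn := lt0r_neq0 c20.
  exact: const_identity.
have hP : `|Phi| <= c5^-1 * (t ^+ n * g1 R ^+ n * (C3 * In leb (fun z => `|f (x + z)| * (t ^+ 2 + nsq z) ^- m))).
  have ci : 0 <= c5^-1 by rewrite invr_ge0 ltW.
  rewrite e6 normrM (ger0_norm ci); apply: (ler_wpM2l ci).
  have tg : 0 <= t ^+ n * g1 R ^+ n by rewrite mulr_ge0 ?(ltW tn0) ?(ltW g10).
  apply: le_trans (ler_wpM2l tg h6).
  rewrite /Ip -(InZ _ i6); apply: In_absle => //; exact: igZ.
have tv : 0 <= t ^- n by rewrite invr_ge0 ltW.
rewrite /J -/Phi normrM (ger0_norm tv); apply: (le_trans (ler_wpM2l tv hP)).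
rewrite le_eqVlt; apply/orP; left; apply/eqP.
have gen (a b c d e : R) : a != 0 -> a^-1 * (b * (a * c * (d * e))) = b * (c * d) * e by move=> a0; field.
exact: gen.
Qed.

End RieszBound.

(** * The averages as potentials of the Q-curvature *)

Section PropertyP.
Variable R : realType.
Local Notation Rm := (measurableTypeR R).
Local Notation la := (@lebesgue_measure R).

Lemma J_Z n c k (w : 'rV[R]_n -> R) x t : 0 < t -> continuous w ->
  J k.+1 (fun y => c * w y) x t = c * J k.+1 w x t.
Proof.
move=> t0 cw; rewrite /J mulrCA -(InZ _ (ig_wH k x t0 cw)); congr (_ * _).
by apply: eq_In => z; rewrite mulrA.
Qed.

Lemma H_mono_t n k (t T : R) (z : 'rV[R]_n) : 0 < t -> t <= T -> H k t z <= H k T z.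
Proof.
move=> t0 tT; have T0 : 0 < T by exact: lt_le_trans tT.
have h : 1 - nsq z / t ^+ 2 <= 1 - nsq z / T ^+ 2.
  rewrite lerD2l lerN2 ler_wpM2l ?nsq_ge0// lef_pV2 ?posrE ?exprn_gt0//.
  by rewrite lerXn2r ?nnegrE// ltW.
rewrite /H /pospow; apply: lerXn2r; rewrite ?nnegrE; [by rewrite le_max lexx|by rewrite le_max lexx|].
by rewrite ge_max le_max lexx/= le_max h orbT.
Qed.

Lemma Jlap_bound_fixed n (u : 'rV[R]_n -> R) C0 r0 j k t : smooth u -> 0 <= C0 -> (3 <= n)%N ->
  (forall x, (n%:R - 2) / 2 * grad_sq u x <= - lap u x + C0 * \1_(cube r0) x) -> 0 < t ->
  exists B, forall x, `|J (k.+4 + 2 * j) (iter j.+1 (@lap R n) u) x t| <= B.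
Proof.
move=> su C00 n3 hS t0.
have [C1 C10 h1] := In_lap_iter_le j k.+3 (smooth_lap su).
have [C2 C20 h2] := energy su C00 n3 hS k.
set T := Num.max 1 t; have T1 : 1 <= T by rewrite le_max lexx.
have tT : t <= T by rewrite le_max lexx orbT.
have T0 : 0 < T by exact: lt_le_trans tT.
exists (t ^- n * (C1 * t ^- (2 * j) * (C2 * T ^+ (n - 2)))) => x.
have tv l : 0 <= t ^- l by rewrite invr_ge0 exprn_ge0// ltW.
rewrite /J normrM (ger0_norm (tv n)); apply: ler_wpM2l => //.
have {}h1 := h1 x t t0; rewrite -iterSr in h1; apply: (le_trans h1).
apply: ler_wpM2l; first by rewrite mulr_ge0.
have [_ h] := h2 x T T1; apply: le_trans h.
have ia s : 0 < s -> ig (leb R n) (fun z => `|lap u (x + z)| * H k.+4 s z).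
  move=> s0; apply: (@eq_ig _ _ _ _ (fun z => `|lap u (x + z) * H k.+4 s z|)) => [z|].
    by rewrite normrM (ger0_norm (H_ge0 _ _ _)).
  by apply: ig_abs; apply: ig_wH => //; apply: smooth_continuous; exact: smooth_lap.
apply: In_le; [exact: ia|exact: ia|].
by move=> z; apply: ler_wpM2l => //; exact: H_mono_t.
Qed.

(** For [n = 2m+1] the kernel is the Riesz kernel [|z|^(1-n)] smoothed at scale [s]; for [n = 2m] it
    is a majorant of the kernel of [J]. *)
Definition potential_bound n m l (w f : 'rV[R]_n -> R) : Prop :=
  ig (leb R n) f /\ exists2 C, 0 <= C & forall x s, 0 < s ->
  `|J l w x s| <= C * In (leb R n) (fun z => `|f (x + z)| * (s ^+ 2 + nsq z) ^- m).

Lemma ig_of_iint n (f : 'rV[R]_n -> R) : measurable_fun setT f ->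
  (iint (fun x => `|f x|%:E) < +oo)%E -> ig (leb R n) f.
Proof.
move=> mf h; have ma : measurable_fun setT (fun x => `|f x|) by exact: measurableT_comp.
have i1 : ig (leb R n) (fun x => `|f x|).
  by apply/(@ge0_igP _ _ _ (leb R n)) => //; rewrite -iint_ge0//; exact/measurable_EFinP.
exact: (ig_le mf (fun x => lexx _) i1).
Qed.

(** With [a = |z|^2/s^2] the base [b] of the kernel satisfies [b (1 + a) <= 1], because
    [(1-a)(1+a) <= 1]; the [m]-th power of this is the claim for the kernels. *)
Lemma potential_even m l (w : 'rV[R]_(2 * m) -> R) : continuous w -> ig (leb R (2 * m)) w ->
  (m <= l.+1)%N -> potential_bound m l.+1 w w.
Proof.
move=> cw iw ml; split => //; exists 1 => // x s s0; rewrite mul1r.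
have s20 : 0 < s ^+ 2 by rewrite exprn_gt0.
have tv : 0 <= s ^- (2 * m) by rewrite invr_ge0 exprn_ge0// ltW.
have iwH := ig_wH l x s0 cw.
have ifx : ig (leb R _) (fun z => `|w (x + z)|).
  by apply: (eq_ig _ (ig_abs (ig_shift x iw))) => z; rewrite addrC.
have le z : s ^- (2 * m) * H l.+1 s z <= (s ^+ 2 + nsq z) ^- m.
  have N0 := nsq_ge0 z; have sz : 0 < s ^+ 2 + nsq z by rewrite ltr_wpDr.
  apply: (@le_trans _ _ (s ^- (2 * m) * H m s z)); first by apply: ler_wpM2l => //; exact: H_mono.
  have /andP[b0 b1] := H_base s z; rewrite /H /pospow; set b := Num.max _ _ in b0 b1 *.
  rewrite -[leRHS]mul1r ler_pdivlMr ?exprn_gt0// exprM -exprVn -!exprMn exprn_ile1//.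
    by rewrite !mulr_ge0 ?invr_ge0// ltW.
  rewrite mulrAC mulrC -ler_pdivlMr ?mul1r ?mulr_gt0 ?invr_gt0//.
  have e : ((s ^+ 2)^-1 * (s ^+ 2 + nsq z)) = 1 + nsq z / s ^+ 2 by field; rewrite gt_eqF.
  rewrite e; have a0 : 0 <= nsq z / s ^+ 2 by rewrite divr_ge0// ltW.
  rewrite ge_max invr_ge0 addr_ge0//= -[leRHS]mul1r ler_pdivlMr ?ltr_pwDl//.
  by set a := nsq z / _ in a0 *; have := sqr_ge0 a; nra.
rewrite /J normrM (ger0_norm tv) -(ger0_norm tv) -normrM -(InZ _ iwH).
have mk : measurable_fun setT (fun z : 'rV[R]_(2 * m) => (s ^+ 2 + nsq z) ^- m).
  apply: measurable_invX; apply: measurable_funD; first exact: measurable_cst.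
  by apply: measurable_nsq; exact: measurable_id.
have k0 (z : 'rV[R]_(2 * m)) : 0 <= (s ^+ 2 + nsq z) ^- m.
  by rewrite invr_ge0 exprn_ge0// addr_ge0 ?nsq_ge0// ltW.
have ifk : ig (leb R _) (fun z => `|w (x + z)| * (s ^+ 2 + nsq z) ^- m).
  apply: (ig_le _ _ (igZ ((s ^+ 2) ^- m) ifx)).
    by apply: measurable_funM => //; exact: (ig_meas ifx).
  move=> z; rewrite normrM normr_id (ger0_norm (k0 z)) mulrC ler_wpM2r//.
  have tz : 0 < s ^+ 2 + nsq z by rewrite ltr_wpDr// nsq_ge0.
  by rewrite lef_pV2 ?posrE ?exprn_gt0// lerXn2r ?nnegrE ?(ltW s20) ?(ltW tz)// lerDl nsq_ge0.
apply: In_absle => //; first exact: igZ.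
move=> z; rewrite normrM (ger0_norm tv) normrM (ger0_norm (H_ge0 _ _ _)) mulrCA.
by apply: ler_wpM2l => //; exact: le.
Qed.

(** The principal value is an integral of second differences, then a superposition of kernel
    averages of [phi - phi x], and by [Ip_Jpsi] an integral of averages of the Laplacian. *)
Lemma half_laplacian_formula m k (phi : 'rV[R]_(2 * m).+1 -> R) : smooth phi -> L_half phi ->
  (forall x, exists A, decays A (J k.+3 (lap phi) x)) ->
  exists2 c, 0 < c & forall x v,
   pv_trunc phi x eps @[eps --> 0^'+] --> (v / Chalf R (2 * m).+1)%:E ->
   v = - c * Ip (J k.+3 (lap phi) x).
Proof.
(* Exponent [k.+2] in the superposition, since the ladder leads from [J k.+2] to [J k.+3]. *)
move=> sp hL hd; have [c c0 hc] := Ip_invpow R m k.+1.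
have Ch0 : 0 < Chalf R (2 * m).+1 by rewrite divr_gt0 ?exprn_gt0 ?pi_gt0// ltr0n fact_gt0.
set n1 := 2 * k.+3%:R : R; have n10 : 0 < n1 by rewrite /n1 -natrM ltr0n.
exists (Chalf R (2 * m).+1 * (c^-1 * (c1 R / n1))).
  by rewrite mulr_gt0// mulr_gt0 ?invr_gt0// divr_gt0// c1_gt0.
move=> x v hv; have e1 := pv_value sp hL hv.
have [_ e2] := diff2_fubini x sp hL c0 hc.
have [A hA] := hd x.
have [i3 e3] := Ip_Jpsi sp (fun _ => erefl) hA.
have e4 : Ip (fun s => s ^- (2 * m + 3) * In (leb R (2 * m).+1) (fun z => diff2 phi x z * H k.+2 s z)) =
    - 2 * Ip (fun s => s ^- 2 * J k.+2 (fun y => phi y - phi x) x s).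
  rewrite /Ip -(InZ _ i3); apply: eq_In => s; have [s0|_] := ltP 0 s; last by rewrite !mul0r mulr0.
  by rewrite !mul1r (In_diff2_H x sp k.+1 s0) expVn23 /J; ring.
rewrite e4 e3 -/n1 in e2.
have e5 : v = Chalf R (2 * m).+1 * (2^-1 * In (leb R (2 * m).+1) (fun z => diff2 phi x z * nsq z ^- m.+1)).
  by rewrite -e1 mulrC divfK ?gt_eqF.
rewrite e5; have cn : c != 0 by rewrite gt_eqF.
rewrite -[In (leb R _) _](mulKf cn) e2.
by field; rewrite cn gt_eqF.
Qed.

(** In even dimension [f] is the iterated Laplacian up to sign. In odd dimension it is a half
    Laplacian of it, and [riesz_bound] inverts this once its decay hypotheses are read off from
    [Jlap_bound]. *)
Lemma potential_bound_Q n (u Q : 'rV[R]_n -> R) C0 r0 : smooth u -> 0 <= C0 -> (3 <= n)%N ->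
  (forall x, (n%:R - 2) / 2 * grad_sq u x <= - lap u x + C0 * \1_(cube r0) x) ->
  is_Qcurvature u Q ->
  (iint (fun x => `|Q x * expR (n%:R * u x)|%:E) < +oo)%E ->
  potential_bound n./2 (2 * n./2 + 4 + n./2) (iter n./2 (@lap R n) u) (fun x => Q x * expR (n%:R * u x)).
Proof.
move=> su C00 n3 hS hQ hI; set f := fun x : 'rV[R]_n => Q x * expR (n%:R * u x).
have {}hI : (iint (fun x => `|f x|%:E) < +oo)%E by exact: hI.
have [m [on|en]] : exists m, n = (2 * m).+1 \/ n = (2 * m)%N.
  have h := odd_double_half n; exists n./2; rewrite mul2n.
  by case: (odd n) h => h; [left|right]; exact: esym h.
- subst n; have hm : (2 * m).+1./2 = m by rewrite mul2n /= uphalf_double.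
  rewrite hm; have m0 : (0 < m)%N by lia.
  have hodd : odd (2 * m).+1 by rewrite /= oddM.
  set phi := neglap_pow m u.
  have sphi : smooth phi by exact: smooth_neglap_pow.
  have hf x : L_half phi /\ pv_trunc phi x eps @[eps --> 0^'+] --> (f x / Chalf R (2 * m).+1)%:E.
    by have := hQ x; rewrite /is_frac_lap hodd hm.
  have hL := (hf 0).1.
  set w := iter m.+1 (@lap R (2 * m).+1) u; have sw : smooth w by exact: smooth_iter_lap.
  have cw := smooth_continuous sw.
  have cwm := smooth_continuous (smooth_iter_lap m su).
  have ephi : phi = (fun x => (-1) ^+ m * iter m (@lap R (2 * m).+1) u x) by exact: neglap_powE.
  have elap : lap phi = (fun x => - (-1) ^+ m.+1 * w x).
    have := neglap_powE m.+1 su; rewrite /neglap_pow /= -/(neglap_pow m u) -/phi => e.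
    apply/funext => x; have := congr1 (fun g => g x) e => /= /(congr1 -%R).
    by rewrite opprK => ->; rewrite mulNr.
  have sgn1 j : `|(-1) ^+ j| = 1 :> R by rewrite normrX normrN1 expr1n.
  have Jl l x t : 0 < t -> `|J l.+1 (lap phi) x t| = `|J l.+1 w x t|.
    by move=> t0; rewrite elap (J_Z _ _ _ t0 cw) normrM normrN sgn1 mul1r.
  have Jp l x t : 0 < t -> `|J l.+1 phi x t| = `|J l.+1 (iter m (@lap R (2 * m).+1) u) x t|.
    by move=> t0; rewrite ephi (J_Z _ _ _ t0 cwm) normrM sgn1 mul1r.
  have [C1 C10 h1] := Jlap_bound su C00 n3 hS m 0.
  (* The index [2m+1] fits both uses of [Jlap_bound]: [j = m], [k = 0] gives exponent [(2m+1)+3],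
     and [j = m-1], [k = 1] gives [(2m+1)+2]. The decay [s^-4] follows from [2(m+1) >= 4]. *)
  have hC1 : far_decay (2 * m).+1 C1 (lap phi).
    move=> x s s1; have s0 : 0 < s by exact: lt_le_trans s1.
    rewrite Jl// ler_pdivlMr ?exprn_gt0// mulrC; apply: le_trans (h1 x s s1).
    rewrite (_ : (0.+4 + 2 * m = (2 * m).+4)%N)//.
    by apply: ler_wpM2r => //; rewrite ler_weXn2l//; lia.
  have [C2 C20 h2] := Jlap_bound su C00 n3 hS m.-1 1.
  have hC2 x b : 1 <= b -> `|J (2 * m).+3 phi x b| <= C2 / b.
    move=> b1; have b0 : 0 < b by exact: lt_le_trans b1.
    rewrite Jp// ler_pdivlMr// mulrC; apply: le_trans (h2 x b b1).
    rewrite (_ : (5 + 2 * m.-1 = (2 * m).+3)%N); last by lia.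
    rewrite (_ : (m.-1.+1 = m)%N); last by lia.
    by apply: ler_wpM2r => //; rewrite ler_eXnr//; lia.
  have hB t : 0 < t -> exists B, forall x, `|J (2 * m + 3 + m).+1 (lap phi) x t| <= B.
    move=> t0; have [B hB] := Jlap_bound_fixed m m su C00 n3 hS t0.
    exists B => x; rewrite Jl//; have := hB x.
    by rewrite (_ : (m.+4 + 2 * m = (2 * m + 3 + m).+1)%N)//; lia.
  have hd x : exists A, decays A (J (2 * m).+4 (lap phi) x).
    have [A h] := @local_decays R _ (2 * m).+1 (lap phi) 1 (smooth_continuous (smooth_lap sphi)) C1 x hC1.
    exists A; have c0 : cube 1 (0 : 'rV[R]_(2 * m).+1) by move=> i; rewrite mxE normr0.
    by have := h 0 c0; rewrite addr0.
  have [c c0 hc] := half_laplacian_formula sphi hL hd.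
  have ef x : f x = - c * Ip (J (2 * m).+4 (lap phi) x) by exact: (hc x _ (hf x).2).
  (* [Q] is an arbitrary function; the measurability of [f] is read off from its representation as a
     scale integral. *)
  have i_f : ig (leb R _) f.
    apply: ig_of_iint => //; rewrite (_ : f = (fun x => - c * Ip (J (2 * m).+4 (lap phi) x))); last exact/funext.
    apply: measurable_funM; first exact: measurable_cst.
    apply: (@measurable_In1 _ _ 'rV[R]_(2 * m).+1 Rm R la (fun x s => (0 < s)%R%:R * J (2 * m).+4 (lap phi) x s)).
    apply: measurable_funM; first exact: (measurableT_comp (@measurable_pos R) measurable_snd).
    by apply: measurable_Jm; [exact/continuous_row_measurable/smooth_continuous/smooth_lap|exact: measurable_fst|exact: measurable_snd].
  split => //; have [C C0' hC] := riesz_bound m0 c0 sphi i_f hC1 hC2 hB ef.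
  exists C => // x s s0; apply: le_trans (hC x s s0).
  rewrite Jp//; rewrite (_ : (2 * m + 4 + m = (2 * m + 3 + m).+1)%N)//; lia.
- subst n; have hm : (2 * m)./2 = m by rewrite mul2n doubleK.
  rewrite hm.
  have heven : odd (2 * m) = false by rewrite oddM.
  set w := iter m (@lap R (2 * m)) u.
  have cw := smooth_continuous (smooth_iter_lap m su).
  have ef x : f x = (-1) ^+ m * w x.
    by have := hQ x; rewrite /is_frac_lap heven hm /= neglap_powE.
  have sgn1 j : `|(-1) ^+ j| = 1 :> R by rewrite normrX normrN1 expr1n.
  have eaf x : `|f x| = `|w x| by rewrite ef normrM sgn1 mul1r.
  have iw : ig (leb R _) w.
    apply: ig_of_iint; first exact: continuous_row_measurable.
    by under [X in iint X]funext do rewrite -eaf.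
  have i_f : ig (leb R _) f by apply: (eq_ig _ (igZ ((-1) ^+ m) iw)) => x; rewrite ef.
  split => //.
  have [|_ [C C0' hC]] := @potential_even m (2 * m + 3 + m) w cw iw; first by lia.
  exists C => // x s s0; have := hC x s s0.
  rewrite (_ : (2 * m + 4 + m = (2 * m + 3 + m).+1)%N); last by lia.
  by congr (_ <= _ * _); apply: eq_In => z; rewrite eaf.
Qed.

End PropertyP.

(** * Logarithmic potentials and volume growth *)

Section LogPotential.
Variable R : realType.
Local Notation Rm := (measurableTypeR R).
Local Notation la := (@lebesgue_measure R).

Lemma sqr_norm_le n (z : 'rV[R]_n) : `|z| ^+ 2 <= nsq z.
Proof.
rewrite -(sqr_sqrtr (nsq_ge0 z)) lerXn2r ?nnegrE ?sqrtr_ge0//.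
apply: row_norm_le; first exact: sqrtr_ge0.
by apply: nsq_cube; [exact: sqrtr_ge0|rewrite sqr_sqrtr ?nsq_ge0].
Qed.

Lemma measurable_norm n d (T : measurableType d) (g : T -> 'rV[R]_n) :
  measurable_fun setT g -> measurable_fun setT (fun y => `|g y|).
Proof. by move=> mg; apply: (measurable_row_comp (F := fun z : 'rV[R]_n => `|z|)) => //; exact: norm_continuous. Qed.

(** Split off [(s^2/D)^m <= 1]; then [s/D <= 2/(s+r)] amounts to [s (s + r) <= 2 (s^2 + r^2)]. *)
Lemma weight_le m (s N r : R) : 0 < s -> 0 <= r -> r ^+ 2 <= N ->
  s ^+ (2 * m.+1).-1 * (s ^+ 2 + N) ^- m.+1 <= 2 * (s + r)^-1.
Proof.
move=> s0 r0 rN; have N0 : 0 <= N by exact: le_trans (sqr_ge0 r) rN.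
have s2 : 0 < s ^+ 2 by exact: exprn_gt0.
set D := s ^+ 2 + N; have D0 : 0 < D by exact: ltr_wpDr.
have -> : ((2 * m.+1).-1 = (2 * m).+1)%N by lia.
rewrite !exprS exprM invfM mulrACA -exprVn -exprMn.
have q0 : 0 <= s ^+ 2 / D by exact: divr_ge0 (ltW s2) (ltW D0).
have q1 : s ^+ 2 / D <= 1 by rewrite ler_pdivrMr// mul1r lerDl.
have h1 : (s ^+ 2 / D) ^+ m <= 1 by exact: exprn_ile1.
have sD : 0 <= s / D by exact: divr_ge0 (ltW s0) (ltW D0).
apply: (le_trans (ler_piMr sD h1)).
have sr : 0 < s + r by exact: ltr_wpDr.
rewrite ler_pdivrMr// mulrAC ler_pdivlMr//.
have := sqr_ge0 (s - r); rewrite /D; nra.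
Qed.

Lemma ln_Ii (a t r : R) : 0 < a -> a <= t -> 0 <= r ->
  Ii a t (fun s => (s + r)^-1) = ln (t + r) - ln (a + r).
Proof.
move=> a0 at_ r0.
apply: (@FTC_Ii _ (fun s => ln (s + r)) (fun s => (s + r)^-1)) => // s /andP[as_ _].
  have sr : 0 < s + r by rewrite ltr_wpDr// (lt_le_trans a0).
  have h1 : is_derive s (1 : R) (fun s => s + r) 1.
    by apply: is_derive_eq; rewrite addr0.
  have h2 := is_derive1_ln sr.
  have := @is_derive1_comp R (@ln R) (fun s => s + r) s _ _ h2 h1.
  by rewrite mulr1.
have sr : s + r != 0 by rewrite gt_eqF// ltr_wpDr// (lt_le_trans a0).
by apply: (cvgV sr); apply: cvgD; [exact: cvg_id|exact: cvg_cst].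
Qed.

(** The norm is the maximum norm of row vectors, which bounds every single coordinate; this is what
    later allows a comparison with [logker]. *)
Definition lam (a t : R) n (z : 'rV[R]_n) : R := ln (t + `|z|) - ln (a + `|z|).

(** Exchange the integrals over [s] and [z]. By [weight_le] the power of [s] times the kernel is at
    most [2/(s + |z|)], whose integral over [[a, t]] is the logarithm [lam]. *)
Lemma potential_log n m l (w f : 'rV[R]_n -> R) : continuous w -> potential_bound m.+1 l.+1 w f ->
  exists2 C, 0 <= C & forall x a t, 0 < a -> a <= t ->
  ig (leb R n) (fun z => `|f (x + z)| * lam a t z) /\
  Ii a t (fun s => s ^+ (2 * m.+1).-1 * `|J l.+1 w x s|) <=
     C * In (leb R n) (fun z => `|f (x + z)| * lam a t z).
Proof.
move=> cw [i_f [C C0 hC]]; exists (2 * C); first exact: mulr_ge0.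
have gen (p c g W v : R) : 0 <= c -> 0 <= g -> p * W <= 2 * v -> p * c * (g * W) <= 2 * c * (v * g).
  move=> c0 g0 h; have -> : p * c * (g * W) = c * g * (p * W) by ring.
  have -> : 2 * c * (v * g) = c * g * (2 * v) by ring.
  by rewrite ler_wpM2l// mulr_ge0.
move=> x a t a0 at_.
have ifx : ig (leb R n) (fun z => `|f (x + z)|).
  by have := ig_abs (ig_shift x i_f); apply: eq_ig => z; rewrite addrC.
have mfx := ig_meas ifx.
pose F (s : Rm) (z : 'rV[R]_n) : R := (a <= s <= t)%R%:R * (s + `|z|)^-1 * `|f (x + z)|.
have mF : measurable_fun setT (fun p : Rm * 'rV[R]_n => F p.1 p.2).
  apply: measurable_funM; last exact: (measurableT_comp mfx measurable_snd).
  apply: measurable_funM; first exact: (measurableT_comp (measurable_itvb a t) measurable_fst).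
  apply: (measurableT_comp (@measurable_invr R)); apply: measurable_funD; first exact: measurable_fst.
  by apply: measurable_norm; exact: measurable_snd.
have inv_le (s : R) (z : 'rV[R]_n) : a <= s <= t -> 0 <= (s + `|z|)^-1 <= a^-1.
  move=> /andP[as_ _]; have s0 := lt_le_trans a0 as_.
  have sz : 0 < s + `|z| by rewrite ltr_wpDr.
  by rewrite invr_ge0 (ltW sz)/= lef_pV2 ?posrE// (le_trans as_)// lerDl.
have Fle (s : Rm) (z : 'rV[R]_n) : 0 <= F s z <= (a <= s <= t)%R%:R * (a^-1 * `|f (x + z)|).
  rewrite /F; case: (boolP (a <= s <= t)) => [/(inv_le _ z)/andP[h1 h2]|_]; last by rewrite !mul0r lexx.
  by rewrite !mul1r mulr_ge0//= ler_wpM2r.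
set M := In (leb R n) (fun z => `|f (x + z)|).
have eM s : In (leb R n) (fun z => (a <= s <= t)%R%:R * (a^-1 * `|f (x + z)|)) = (a <= s <= t)%R%:R * (a^-1 * M).
  by rewrite (InZ _ (igZ a^-1 ifx)) (InZ _ ifx).
have iFz s : ig (leb R n) (F s).
  apply: (ig_le (measurable_slice1 mF s) _ (igZ (a <= s <= t)%R%:R (igZ a^-1 ifx))) => z.
  by have /andP[h1 h2] := Fle s z; rewrite ger0_norm.
have iFs z : ig la (fun s => F s z).
  apply: (ig_le (measurable_slice2 mF z) _ (ig_itvb a t (a^-1 * `|f (x + z)|))) => s.
  by have /andP[h1 h2] := Fle s z; rewrite ger0_norm.
have hg s : In (leb R n) (fun z => `|F s z|) <= (a <= s <= t)%R%:R * (a^-1 * M).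
  rewrite -eM; apply: In_le; [exact: (ig_abs (iFz s))|exact: (igZ _ (igZ a^-1 ifx))|].
  by move=> z; have /andP[h1 h2] := Fle s z; rewrite ger0_norm.
have [j1 j2 ej] := real_fubini mF iFz iFs (ig_itvb a t (a^-1 * M)) hg.
have e2 z : In la (fun s => F s z) = `|f (x + z)| * lam a t z.
  rewrite /lam -(ln_Ii a0 at_ (normr_ge0 z)) /Ii -InZ.
    by apply: eq_In => s; rewrite mulrC.
  apply: (@ig_Ii _ a t a^-1).
    apply: (measurableT_comp (@measurable_invr R)); apply: measurable_funD; first exact: measurable_id.
    exact: measurable_cst.
  by move=> s /(inv_le _ z)/andP[h1 h2]; rewrite ger0_norm.
have e3 := eq_In (leb R n) e2.
split; first exact: (eq_ig e2 j2).
rewrite -e3 -ej -(InZ _ j1).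
have [c c0 hc] := @J_bounded _ _ l w x a t a0 cw.
have mJ : measurable_fun setT (fun s : Rm => s ^+ (2 * m.+1).-1 * `|J l.+1 w x s|).
  apply: measurable_funM; first exact: measurable_funX.
  by apply: measurableT_comp => //; exact: measurable_J.
apply: In_le; [apply: (@ig_Ii _ a t (t ^+ (2 * m.+1).-1 * c)) => //|exact: (igZ _ j1)|].
- move=> s h; have /andP[as_ st] := h; have s0 := lt_le_trans a0 as_.
  have p0 := exprn_ge0 (2 * m.+1).-1 (ltW s0).
  rewrite normrM normr_id ger0_norm//; apply: ler_pM => //; last exact: hc.
  by rewrite lerXn2r// nnegrE ltW// (lt_le_trans s0).
move=> s; rewrite -[X in In _ X]/(fun z => F s z) -(InZ _ (iFz s)).
case: (boolP (a <= s <= t)) => h; last first.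
  rewrite mul0r; apply: In_ge0 => z; have /andP[h1 _] := Fle s z.
  by rewrite mulr_ge0// mulr_ge0.
rewrite mul1r; have /andP[as_ st] := h; have s0 := lt_le_trans a0 as_.
have p0 := exprn_ge0 (2 * m.+1).-1 (ltW s0).
apply: (le_trans (ler_wpM2l p0 (hC x s s0))).
have s2 : 0 < s ^+ 2 by exact: exprn_gt0.
have D0 z : 0 < s ^+ 2 + nsq z by apply: ltr_wpDr => //; exact: nsq_ge0.
have iw : ig (leb R n) (fun z => `|f (x + z)| * (s ^+ 2 + nsq z) ^- m.+1).
  apply: (ig_le _ _ (igZ ((s ^+ 2) ^- m.+1) ifx)).
    apply: measurable_funM => //; apply: (measurableT_comp (@measurable_invr R)).
    apply: measurable_funX; apply: measurable_funD; first exact: measurable_cst.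
    by apply: measurable_nsq; exact: measurable_id.
  move=> z; have q0 : 0 <= (s ^+ 2 + nsq z) ^- m.+1 by rewrite invr_ge0 exprn_ge0// ltW.
  rewrite normrM normr_id (ger0_norm q0) mulrC ler_wpM2r//.
  have sD : s ^+ 2 <= s ^+ 2 + nsq z by rewrite lerDl; exact: nsq_ge0.
  rewrite lef_pV2 ?posrE ?exprn_gt0//; apply: lerXn2r => //; rewrite nnegrE; exact: ltW.
rewrite mulrA -(InZ _ iw).
apply: In_le; [exact: igZ|exact: (igZ _ (iFz s))|] => z.
rewrite /F h mul1r; apply: gen => //.
by apply: weight_le => //; exact: sqr_norm_le.
Qed.

End LogPotential.

(** * Jensen's inequality and a kernel in one coordinate *)

Section Jensen.
Context d (T : measurableType d) (R : realType) (mu : {measure set T -> \bar R}).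

(** Jensen for a measure of mass at most [e], the added 1 making up for the missing mass. Integrate
    the tangent inequality [exp L >= exp b (1 + L - b)], where [b] is the exponent on the left. For
    [b <= 1] conclude with [exp b (1 - b) <= 1], for [b > 1] with mass at most [e]. *)
Lemma expR_jensen (G L : T -> R) (e : R) : 0 < e -> (forall x, 0 <= G x) -> ig mu G -> In mu G <= e ->
  ig mu (fun x => G x * L x) -> ig mu (fun x => G x * expR (L x)) ->
  expR (e^-1 * In mu (fun x => G x * L x)) <= 1 + e^-1 * In mu (fun x => G x * expR (L x)).
Proof.
move=> e0 G0 iG Ge iGL iGE; set b := e^-1 * _; set E := In mu _.
have eb : In mu (fun x => G x * L x) = e * b by rewrite mulVKf// gt_eqF.
have h : expR b * ((1 - b) * In mu G + e * b) <= E.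
  rewrite -eb -(InZ _ iG) -(InD (igZ _ iG) iGL) -(InZ _ (igD (igZ _ iG) iGL)).
  apply: In_le; [exact: (igZ _ (igD (igZ _ iG) iGL))|exact: iGE|] => x.
  have -> : expR b * ((1 - b) * G x + G x * L x) = G x * (expR b * (1 + (L x - b))) by ring.
  apply: ler_wpM2l => //; rewrite (_ : expR (L x) = expR b * expR (L x - b)).
    by apply: ler_wpM2l; [exact: expR_ge0|exact: expR_ge1Dx].
  by rewrite -expRD; congr expR; ring.
have E0 := expR_gt0 b.
suff : e * (expR b - 1) <= E.
  by move=> h'; rewrite -lerBlDl mulrC ler_pdivlMr// mulrC.
apply: le_trans h; have M0 : 0 <= In mu G by exact: In_ge0.
have [b1|b1] := leP b 1.
  have hb : expR b * (1 - b) <= 1.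
    rewrite -[leRHS]expR0 -(subrr b) expRD ler_wpM2l ?expR_ge0//.
    by have := expR_ge1Dx (- b).
  have h2 : 0 <= expR b * ((1 - b) * In mu G) by rewrite !mulr_ge0 ?(ltW E0)// subr_ge0.
  rewrite [leRHS]mulrDr; apply: (@le_trans _ _ (expR b * (e * b))); last by rewrite lerDr.
  by rewrite mulrCA ler_pM2l//; lra.
have h3 : (1 - b) * e <= (1 - b) * In mu G by rewrite ler_wnM2l// subr_le0 ltW.
apply: (@le_trans _ _ (expR b * ((1 - b) * e + e * b))); last first.
  by apply: ler_wpM2l; [exact: expR_ge0|rewrite lerD2r].
have -> : (1 - b) * e + e * b = e by ring.
by rewrite mulrC ler_wpM2r ?(ltW e0)// lerBlDr lerDl.
Qed.

End Jensen.

Section LogKernel.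
Variable R : realType.
Local Notation Rm := (measurableTypeR R).
Local Notation la := (@lebesgue_measure R).
Implicit Types a r s : R.

(** The square root of [2r/(a+s)]. *)
Definition sqk a r s : R := expR ((ln (2 * r) - ln (a + s)) / 2).
(** A majorant of [exp(lam/2)] that depends on one coordinate only. The inverse square root is
    integrable at 0, so its integrals are bounded independently of [a]. *)
Definition logker a r s : R := expR 1 + (`|s| <= r)%R%:R * sqk a r `|s|.

Lemma ln2_le1 : ln 2 <= 1 :> R.
Proof. by have := @le_ln1Dx R 1; apply; lra. Qed.

(** The quotient [(r+t)/(a+t)] decreases in [t], so the norm may be replaced by a coordinate of size
    [s <= r], and then [r + s <= 2r]. If [s > r] the quotient is at most 2, which the constant
    [expR 1] covers. *)
Lemma lam_logker a r n (z : 'rV[R]_n) i : 0 < a -> a <= r -> expR (lam a r z / 2) <= logker a r (z 0 i).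
Proof.
move=> a0 ar; have r0 := lt_le_trans a0 ar.
have sz := row_norm_coord z i; rewrite /logker /lam.
set s := `|z 0 i| in sz *; set t := `|z| in sz *.
have s0 : 0 <= s by exact: normr_ge0.
have t0 : 0 <= t by exact: normr_ge0.
have rt : 0 < r + t by exact: ltr_wpDr.
have rs : 0 < r + s by exact: ltr_wpDr.
have at_ : 0 < a + t by exact: ltr_wpDr.
have as_ : 0 < a + s by exact: ltr_wpDr.
have [sr|rs'] := leP s r.
  rewrite mul1r; apply: (@le_trans _ _ (sqk a r s)); last by rewrite lerDr expR_ge0.
  rewrite ler_expR ler_pM2r ?invr_gt0//.
  have h1 : ln (r + s) <= ln (2 * r) by rewrite ler_ln ?posrE ?mulr_gt0//; lra.
  have : ln ((r + t) * (a + s)) <= ln ((r + s) * (a + t)).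
    rewrite ler_ln ?posrE ?mulr_gt0//.
    have := mulr_ge0 (etrans (subr_ge0 a r) ar) (etrans (subr_ge0 s t) sz); nra.
  move: h1; rewrite !lnM ?posrE//; lra.
rewrite mul0r addr0 ler_expR.
have : ln (r + t) <= ln (2 * (a + t)) by rewrite ler_ln ?posrE ?mulr_gt0//; lra.
rewrite lnM ?posrE//; have := ln2_le1; lra.
Qed.

Lemma measurable_logker a r : measurable_fun setT (logker a r : Rm -> R).
Proof.
have mn : measurable_fun setT (fun s : Rm => `|s| : R) by exact: normr_measurable.
apply: measurable_funD; first exact: measurable_cst.
apply: measurable_funM.
  have := @measurable_itvb R (- r) r; congr measurable_fun.
  by apply/funext => s; rewrite ler_norml.
apply: (measurableT_comp (@measurable_expR R)); apply: measurable_funM; last exact: measurable_cst.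
apply: measurable_funB; first exact: measurable_cst.
apply: (measurableT_comp (@measurable_ln R)); apply: measurable_funD => //; exact: measurable_cst.
Qed.

Lemma logker_ge0 a r s : 0 <= logker a r s.
Proof. by rewrite addr_ge0 ?expR_ge0// mulr_ge0 ?expR_ge0. Qed.

Lemma logker_le a r s : 0 < a -> logker a r s <= expR 1 + sqk a r 0.
Proof.
move=> a0; rewrite lerD2l; apply: (@le_trans _ _ (sqk a r `|s|)).
  by case: (`|s| <= r); rewrite ?mul1r// mul0r expR_ge0.
rewrite ler_expR ler_pM2r ?invr_gt0// lerD2l lerN2 ler_ln ?posrE ?addr0 ?lerDl//.
by rewrite ltr_wpDr.
Qed.

(** The antiderivative is twice the square root of [2r(a+s)]; at [s = r] it is at most [4r] because
    [a <= r]. *)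
Lemma Ii_sqk a r : 0 < a -> a <= r -> Ii 0 r (sqk a r) <= 4 * r.
Proof.
move=> a0 ar; have r0 := lt_le_trans a0 ar.
pose g s := 2 * expR ((ln (2 * r) + ln (a + s)) / 2).
have -> : Ii 0 r (sqk a r) = g r - g 0.
  apply: FTC_Ii => [|s /andP[s0 _]|s /andP[s0 _]]; first exact: ltW.
    have as_ : 0 < a + s by exact: ltr_wpDr.
    have h1 : is_derive s (1 : R) (fun s => a + s) 1.
      have -> : (fun s => a + s) = (fun s => s + a) by apply/funext => y; rewrite addrC.
      by apply: is_derive_eq; rewrite addr0.
    have h2 := is_derive1_ln as_.
    have h3 := @is_derive1_comp R (@ln R) (fun s => a + s) s _ _ h2 h1.
    have h4 : is_derive s (1 : R) (fun s => (ln (2 * r) + ln (a + s)) / 2) ((a + s)^-1 / 2).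
      apply: is_derive_eq; rewrite /GRing.scale/=; field; exact: lt0r_neq0.
    have h5 := @is_derive1_comp R (@expR R) _ s _ _ (is_derive_expR _) h4.
    have -> : g = 2 \*: (expR \o (fun s => (ln (2 * r) + ln (a + s)) / 2) : R -> R) by [].
    apply: is_derive_eq; rewrite -[_ *: _]/(_ * _) /sqk.
    have -> : (ln (2 * r) - ln (a + s)) / 2 = (ln (2 * r) + ln (a + s)) / 2 - ln (a + s) by field.
    rewrite expRD expRN lnK ?posrE//; field; exact: lt0r_neq0.
  have as_ : 0 < a + s by exact: ltr_wpDr.
  have cl : {for s, continuous (fun s => a + s)} by apply: cvgD; [exact: cvg_cst|exact: cvg_id].
  have c2 : {for s, continuous (fun s => ln (a + s))}.
    by apply: (continuous_comp cl); exact: continuous_ln.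
  have c3 : {for s, continuous (fun s => (ln (2 * r) - ln (a + s)) / 2)}.
    by apply: cvgM; [apply: cvgB; [exact: cvg_cst|exact: c2]|exact: cvg_cst].
  by apply: (continuous_comp c3); exact: continuous_expR.
have g0 : 0 <= g 0 by rewrite mulr_ge0// expR_ge0.
apply: (@le_trans _ _ (g r)); first by rewrite lerBlDr lerDl.
have r2 : 0 < 2 * r by exact: mulr_gt0.
rewrite /g (_ : 4 * r = 2 * expR (ln (2 * r))); last by rewrite lnK ?posrE//; ring.
rewrite ler_pM2l// ler_expR.
have : ln (a + r) <= ln (2 * r) by rewrite ler_ln ?posrE//; lra.
lra.
Qed.

Lemma ge0_In_la_opp (g : Rm -> R) : measurable_fun setT g -> (forall t, 0 <= g t) ->
  In la (fun t : Rm => g (- t)) = In la g.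
Proof.
move=> mg g0; congr fine; apply: (@ge0_integral_la_opp R (fun s => (g s)%:E)); first exact/measurable_EFinP.
by move=> t; rewrite lee_fin.
Qed.

Lemma ge0_ig_la_shift c (g : Rm -> R) : (forall t, 0 <= g t) -> ig la g -> ig la (fun t : Rm => g (t - c)).
Proof.
move=> g0 i_g; have mg := ig_meas i_g.
apply/ge0_igP => //.
  by apply: (measurableT_comp mg); apply: measurable_funB => //; exact: measurable_cst.
rewrite (@ge0_integral_la_shift R (- c) (fun s => (g s)%:E)); [|exact/measurable_EFinP|by move=> t; rewrite lee_fin].
by rewrite (InE i_g) ltry.
Qed.

(** Uniform in the centre [c]: once the kernel is cut off at distance [r], the singular part may be
    integrated over the whole line, where translation and reflection cost nothing. Each half
    contributes at most [4r]. *)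
Lemma In_logker a r c : 0 < a -> a <= r ->
  ig la (fun s : Rm => (`|s| <= r)%R%:R * logker a r (s - c)) /\
  In la (fun s : Rm => (`|s| <= r)%R%:R * logker a r (s - c)) <= (expR 1 * 2 + 8) * r.
Proof.
move=> a0 ar; have r0 := lt_le_trans a0 ar.
have eabs : (fun s : Rm => (`|s| <= r)%R%:R : R) = (fun s => (- r <= s <= r)%R%:R).
  by apply/funext => s; rewrite ler_norml.
have mb : measurable_fun setT (fun s : Rm => (`|s| <= r)%R%:R : R).
  by rewrite eabs; exact: measurable_itvb.
pose h (s : Rm) : R := (0 <= s <= r)%R%:R * sqk a r s.
have msq : measurable_fun setT (sqk a r : Rm -> R).
  apply: (measurableT_comp (@measurable_expR R)); apply: measurable_funM; last exact: measurable_cst.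
  apply: measurable_funB; first exact: measurable_cst.
  apply: (measurableT_comp (@measurable_ln R)); apply: measurable_funD => //; exact: measurable_cst.
have h0 s : 0 <= h s by rewrite mulr_ge0// expR_ge0.
have ih : ig la h.
  apply: (@ig_Ii _ 0 r (sqk a r 0)) => // s /andP[s0 _].
  rewrite ger0_norm ?expR_ge0// ler_expR ler_pM2r ?invr_gt0// lerD2l lerN2.
  by rewrite ler_ln ?posrE ?addr0 ?lerDl// ltr_wpDr.
have mh := ig_meas ih.
have ihN := ig_la_opp ih.
have hb : In la h <= 4 * r := Ii_sqk a0 ar.
pose h2 (s : Rm) := h s + h (- s).
have ih2 : ig la h2 := igD ih ihN.
have h20 s : 0 <= h2 s := addr_ge0 (h0 s) (h0 (- s)).
have mh2 := ig_meas ih2.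
have iS := ge0_ig_la_shift c h20 ih2.
have i1 := ig_itvb (- r) r (expR 1).
have le1 s : 0 <= (`|s| <= r)%R%:R * logker a r (s - c) <= (- r <= s <= r)%R%:R * expR 1 + h2 (s - c).
  rewrite mulr_ge0 ?logker_ge0//= ler_norml; case: (- r <= s <= r); last by rewrite !mul0r add0r.
  rewrite !mul1r /logker lerD2l /h2 /h; have [p|p] := ger0P (s - c).
    apply: ler_wpDr => //.
    by rewrite mulr_ge0// expR_ge0.
  have q : 0 <= - (s - c) by rewrite oppr_ge0 ltW.
  by rewrite mul0r add0r q.
have m : measurable_fun setT (fun s : Rm => (`|s| <= r)%R%:R * logker a r (s - c)).
  apply: measurable_funM => //; apply: (measurableT_comp (measurable_logker a r)).
  by apply: measurable_funB => //; exact: measurable_cst.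
have i2 := igD i1 iS.
split; first by apply: (ig_le m _ i2) => s; have /andP[p q] := le1 s; rewrite ger0_norm.
apply: (le_trans (In_gt0_le m le1 i2)).
have gen (x y : R) : x <= 4 * r -> y = (r - - r) * expR 1 -> y + (x + x) <= (expR 1 * 2 + 8) * r by move=> h' ->; lra.
rewrite (InD i1 iS) (ge0_In_la_shift _ mh2 h20) (InD ih ihN) (ge0_In_la_opp mh h0).
apply: gen; first exact: hb.
by rewrite In_itvb; [exact: mulrC|clear -r0; lra].
Qed.

(** The integrand is a product over coordinates: the first one carries the kernel, and each of the
    others contributes the length [2r]. *)
Lemma In_logker_cube a r c n : 0 < a -> a <= r ->
  ig (leb R n.+1) (fun x => \1_(cube r) x * logker a r (x 0 ord0 - c)) /\
  In (leb R n.+1) (fun x => \1_(cube r) x * logker a r (x 0 ord0 - c)) <= (expR 1 * 2 + 8) * 2 ^+ n * r ^+ n.+1.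
Proof.
move=> a0 ar; have r0 := lt_le_trans a0 ar.
have [i1 le1] := In_logker c a0 ar.
have mc : measurable_fun setT (fun x : 'rV[R]_n.+1 => logker a r (x 0 ord0 - c)).
  apply: (measurableT_comp (measurable_logker a r)); apply: measurable_funB; last exact: measurable_cst.
  exact: measurable_coord.
split.
  apply: (ig_le _ _ (igZ (expR 1 + sqk a r 0) (@ig_1cube R n.+1 r))).
    by apply: measurable_funM => //; exact: ig_meas (@ig_1cube R n.+1 r).
  move=> x; rewrite normrM (ger0_norm (logker_ge0 _ _ _)) ger0_norm ?indicE// mulrC ler_wpM2r//.
  exact: logker_le.
pose g (i : 'I_n.+1) (s : Rm) : R := (`|s| <= r)%R%:R * (if i == ord0 then logker a r (s - c) else 1).
have mb : measurable_fun setT (fun s : Rm => (`|s| <= r)%R%:R : R).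
  by have := @measurable_itvb R (- r) r; congr measurable_fun; apply/funext => s; rewrite ler_norml.
have mg i : measurable_fun setT (g i).
  apply: measurable_funM => //; case: eqP => _; last exact: measurable_cst.
  by apply: (measurableT_comp (measurable_logker a r)); apply: measurable_funB => //; exact: measurable_cst.
have g0 i t : 0 <= g i t by rewrite /g mulr_ge0//; case: ifP => // _; exact: logker_ge0.
have -> : In (leb R n.+1) (fun x => \1_(cube r) x * logker a r (x 0 ord0 - c)) =
    fine (\int[leb R n.+1]_x (\prod_i g i (x 0%R i))%:E)%E.
  congr fine; apply: eq_integral => x _; congr (_%:E); rewrite indicE.
  have [h|h] := boolP (x \in _).
    move/set_mem : h => h; rewrite mul1r big_ord_recl big1 => [|i _]; first by rewrite /g h mul1r mulr1.
    by rewrite /g h mul1r.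
  have [i hi] : exists i, ~ (`|x 0 i| <= r).
    apply/existsNP => hx; move: h; rewrite notin_setE; exact.
  by rewrite mul0r (bigD1 i)//= /g (negbTE (introN idP hi)) !mul0r.
rewrite ge0_integral_leb_prod// big_ord_recl.
rewrite (_ : (\int[la]_t (g ord0 t)%:E)%E = (In la (fun s : Rm => (`|s| <= r)%R%:R * logker a r (s - c)))%:E); last by rewrite -(InE i1).
rewrite (_ : (\prod_(i < n) _)%E = ((2 * r) ^+ n)%:E); last first.
  rewrite (eq_bigr (fun=> (2 * r)%:E)) => [|i _].
    by elim: n {c mc g mg g0 i1 le1} => [|m IH]; [rewrite big_ord0|rewrite big_ord_recl IH exprS EFinM].
  have -> : (\int[la]_t (g (lift ord0 i) t)%:E = \int[la]_s ((- r <= s <= r)%R%:R * 1)%:E)%E.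
    by apply: eq_integral => s _; rewrite /g ler_norml.
  rewrite InE; last exact: ig_itvb.
  rewrite In_itvb; last by lra.
  by congr EFin; ring.
rewrite -EFinM /= exprMn exprS.
have -> : (expR 1 * 2 + 8) * 2 ^+ n * (r * r ^+ n) = (expR 1 * 2 + 8) * r * (2 ^+ n * r ^+ n) by ring.
by apply: ler_wpM2r => //; rewrite mulr_ge0// exprn_ge0// ltW.
Qed.

End LogKernel.

(** * The exponential bound on the conformal factor *)

Section VolumeGrowth.
Variable R : realType.
Local Notation Rm := (measurableTypeR R).

(** The derivatives of [u] on a cube are not controlled as the cube grows, so [a] depends on [t];
    this is harmless because the final bounds are free of [a]. *)
Lemma smooth_osc n (u : 'rV[R]_n -> R) t : smooth u -> 0 <= t ->
  exists2 a, 0 < a & forall x, cube t x -> forall z, `|z| < a -> `|u (x + z) - u x| < 1.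
Proof.
move=> su t0.
have /choice[B hB] : forall i : 'I_n, exists M, forall z, cube (t + 1) z -> `|partial i u z| <= M.
  move=> i; have [M _ hM] := @continuous_cube_bounded _ _ (t + 1) _ (smooth_continuous (smooth_partial i su)).
  by exists M.
set M := \sum_i `|B i|.
have M0 : 0 <= M by exact: sumr_ge0.
have hM i z : cube (t + 1) z -> `|partial i u z| <= M.
  move=> hz; apply: (le_trans (hB i z hz)); apply: (le_trans (ler_norm _)).
  by rewrite /M (bigD1 i)//= lerDl sumr_ge0.
set K := M * n%:R; have K0 : 0 <= K by exact: mulr_ge0.
have K1 : 0 < K + 1 by exact: ltr_wpDl.
exists (K + 1)^-1; first by rewrite invr_gt0.
move=> x hx z hz; set r := `|z| in hz.
have hr : cube r z by move=> i; exact: row_norm_coord.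
have r1 : r <= 1 by rewrite (le_trans (ltW hz))// invf_le1// lerDr.
have pl i : pd i (fun z => u (x + z)) (fun z => partial i u (x + z)) by exact/pd_lshift/smooth_pd.
have hd i y : cube r y -> `|partial i u (x + y)| <= M.
  move=> hy; apply: hM => j; rewrite mxE; apply: (le_trans (ler_normD _ _)).
  by apply: lerD; [exact: hx|exact: le_trans (hy j) r1].
have := coord_lip pl M0 hd hr; rewrite addr0 => h; apply: (le_lt_trans h).
rewrite mulrA -/K; apply: (@le_lt_trans _ _ (K * (K + 1)^-1)).
  by apply: ler_wpM2l => //; exact: ltW.
by rewrite ltr_pdivrMr// mul1r ltrDl.
Qed.

Lemma ig_tail n (f : 'rV[R]_n -> R) d : ig (leb R n) f -> 0 < d ->
  exists2 r, 0 <= r & In (leb R n) (fun z => (1 - \1_(cube r) z) * `|f z|) <= d.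
Proof.
move=> i_f d0; have iaf := ig_abs i_f.
pose g (k : nat) (z : 'rV[R]_n) : R := (1 - \1_(cube k%:R) z) * `|f z|.
have g0 k z : 0 <= g k z <= `|f z|.
  have h : 0 <= (1 - \1_(cube k%:R) z : R) <= 1.
    by rewrite indicE; case: (_ \in _); rewrite ?subrr ?subr0 ?lexx ?ler01.
  by have /andP[h1 h2] := h; rewrite /g mulr_ge0//= ler_piMl.
have mg k : measurable_fun setT (g k).
  apply: measurable_funM; last exact: ig_meas iaf.
  by apply: measurable_funB; [exact: measurable_cst|exact: ig_meas (@ig_1cube R n k%:R)].
have igg k : ig (leb R n) (g k).
  by apply: (ig_le (mg k) _ iaf) => z; have /andP[h1 h2] := g0 k z; rewrite ger0_norm.
have mg1 k : measurable_fun setT (fun z => (g k z)%:E) by apply/measurable_EFinP.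
have mg2 : measurable_fun setT (fun z : 'rV[R]_n => (0 : R)%:E) by exact: measurable_cst.
have cv : forall z, setT z -> (fun k => (g k z)%:E) @ \oo --> (0 : R)%:E.
  move=> z _; apply: cvg_near_cst.
  have [N hN] : exists N : nat, `|z| < N%:R by exists (Num.bound `|z|); rewrite archi_boundP.
  near=> k; rewrite /g indicE mem_set ?subrr ?mul0r// => i.
  apply: (le_trans (row_norm_coord z i)); apply: (le_trans (ltW hN)); rewrite ler_nat; near: k.
  exact: nbhs_infty_ge.
have fb : forall k z, setT z -> (`|(g k z)%:E| <= (`|f z|)%:E)%E.
  by move=> k z _; have /andP[h1 h2] := g0 k z; rewrite lee_fin ger0_norm.
have fin z : setT z -> `|f z|%:E \is a fin_num by [].
have := dominated_cvg measurableT mg1 cv fin iaf fb.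
rewrite (_ : (\int[leb R n]_x (0 : R)%:E = (0 : R)%:E)%E); last by rewrite integral0.
under eq_fun => k do rewrite (InE (igg k)).
move=> /fine_cvgP[_ /cvgr_lt h].
have := h d d0; move=> [k _ hk].
by exists k%:R => //; apply: ltW; exact: (hk k (leqnn k)).
Unshelve. all: by end_near. Qed.

Lemma lam_ge0 (a t : R) n (z : 'rV[R]_n) : 0 < a -> a <= t -> 0 <= lam a t z.
Proof.
by move=> a0 at_; rewrite subr_ge0 ler_ln ?posrE ?lerD2r// ltr_wpDr// (lt_le_trans a0).
Qed.

Lemma lam_mono (a t r : R) n (z : 'rV[R]_n) : 0 < t -> t <= r -> lam a t z <= lam a r z.
Proof.
by move=> t0 tr; rewrite lerD2r ler_ln ?posrE ?lerD2r// ltr_wpDr// (lt_le_trans t0).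
Qed.

Lemma lam_le (a t : R) n (z : 'rV[R]_n) : 0 < a -> a <= t -> lam a t z <= ln t - ln a.
Proof.
move=> a0 at_; have t0 := lt_le_trans a0 at_; have z0 := normr_ge0 z.
have p1 : 0 < t + `|z| by exact: ltr_wpDr.
have p2 : 0 < a + `|z| by exact: ltr_wpDr.
have : ln ((t + `|z|) * a) <= ln (t * (a + `|z|)).
  by rewrite ler_ln ?posrE ?mulr_gt0//; nra.
rewrite !lnM ?posrE// /lam; lra.
Qed.

(** Here [t + |z| <= 3 |z|], and [ln 3 <= 2]. *)
Lemma lam_far (a t : R) n (z : 'rV[R]_n) : 0 < a -> 0 < t -> t <= 2 * `|z| -> lam a t z <= 2.
Proof.
move=> a0 t0 h; have z0 : 0 < `|z| by lra.
have p1 : 0 < t + `|z| by exact: addr_gt0.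
have p2 : 0 < a + `|z| by exact: addr_gt0.
have : ln (t + `|z|) <= ln ((1 + 2) * (a + `|z|)).
  by rewrite ler_ln ?posrE ?mulr_gt0//; lra.
have : ln (1 + 2) <= 2 :> R by apply: le_ln1Dx; lra.
rewrite lnM ?posrE// /lam; lra.
Qed.

Lemma measurable_lam (a t : R) n : measurable_fun setT (@lam R a t n).
Proof.
have mz c : measurable_fun setT (fun z : 'rV[R]_n => ln (c + `|z|)).
  apply: (measurableT_comp (@measurable_ln R)); apply: measurable_funD; first exact: measurable_cst.
  by apply: measurable_norm; exact: measurable_id.
exact: measurable_funB (mz t) (mz a).
Qed.

Definition far n (r : R) (f : 'rV[R]_n -> R) z := (1 - \1_(cube r) z) * `|f z|.

Lemma far_bounds n r (f : 'rV[R]_n -> R) z : 0 <= far r f z <= `|f z|.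
Proof.
have h : 0 <= (1 - \1_(cube r) z : R) <= 1.
  by rewrite indicE; case: (_ \in _); rewrite ?subrr ?subr0 ?lexx ?ler01.
by have /andP[h1 h2] := h; rewrite /far mulr_ge0//= ler_piMl.
Qed.

Lemma ig_far n r (f : 'rV[R]_n -> R) : ig (leb R n) f -> ig (leb R n) (far r f).
Proof.
move=> i_f; have iaf := ig_abs i_f.
apply: (ig_le _ _ iaf); last by move=> z; have /andP[h1 h2] := far_bounds r f z; rewrite ger0_norm.
apply: measurable_funM; last exact: ig_meas iaf.
by apply: measurable_funB; [exact: measurable_cst|exact: ig_meas (@ig_1cube R n r)].
Qed.

(* For [|x| >= 2 rho] the part of [f] inside the cube of radius [rho] only sees [lam <= 2]. *)
Lemma log_potential_split n (f : 'rV[R]_n -> R) rho x a t r : ig (leb R n) f -> 0 <= rho ->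
  0 < a -> a <= t -> t <= `|x| -> `|x| <= t -> 2 * rho <= t -> t <= r ->
  ig (leb R n) (fun z => `|f (x + z)| * lam a t z) ->
  ig (leb R n) (fun z => far rho f (x + z) * lam a r z) /\
  In (leb R n) (fun z => `|f (x + z)| * lam a t z) <=
    2 * In (leb R n) (fun z => `|f z|) + In (leb R n) (fun z => far rho f (x + z) * lam a r z).
Proof.
move=> i_f rho0 a0 at_ tx xt rt tr ifl; have t0 := lt_le_trans a0 at_; have ar := le_trans at_ tr.
have iaf := ig_abs i_f.
have sh (g : 'rV[R]_n -> R) : ig (leb R n) g -> ig (leb R n) (fun z => g (x + z)).
  by move=> i_g; have := ig_shift x i_g; apply: eq_ig => z; rewrite addrC.
have ifx := sh _ iaf.
have eM : In (leb R n) (fun z => `|f (x + z)|) = In (leb R n) (fun z => `|f z|).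
  rewrite -(In_shift x (ig_meas iaf)); apply: eq_In => z; by rewrite addrC.
have iG := sh _ (ig_far rho i_f).
have l0 (z : 'rV[R]_n) : 0 <= lam a r z by exact: lam_ge0.
have G0 z : 0 <= far rho f (x + z) by have /andP[] := far_bounds rho f (x + z).
have i2 : ig (leb R n) (fun z => far rho f (x + z) * lam a r z).
  apply: (ig_le _ _ (igZ (ln r - ln a) iG)).
    by apply: measurable_funM; [exact: ig_meas iG|exact: measurable_lam].
  move=> z; rewrite (ger0_norm (mulr_ge0 (G0 z) (l0 z))) mulrC.
  by apply: ler_wpM2r => //; exact: lam_le.
split => //; rewrite -eM -(InZ _ ifx) -(InD (igZ 2 ifx) i2).
apply: In_le; [exact: ifl|exact: (igD (igZ 2 ifx) i2)|] => z.
have p0 : 0 <= `|f (x + z)| by exact: normr_ge0.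
rewrite /far indicE; have [h|h] := boolP (x + z \in _).
  rewrite subrr !mul0r addr0 mulrC; apply: ler_wpM2r => //; apply: lam_far => //.
  move/set_mem : h => h; have h1 := row_norm_le rho0 h.
  have h2 : `|x| <= `|x + z| + `|z| by rewrite -[X in `|X| <= _](addrK z); exact: ler_normB.
  lra.
rewrite subr0 mul1r; apply: (@le_trans _ _ (`|f (x + z)| * lam a r z)).
  by apply: ler_wpM2l => //; exact: lam_mono.
by rewrite lerDr mulr_ge0.
Qed.

(** Chains [u_upper_bound], [potential_log] and [log_potential_split] into an exponent [A + k P],
    with [P] the far potential. Jensen moves the exponential inside the integral, and [lam_logker]
    replaces the result by a kernel in one coordinate. *)
Lemma exp_growth n (u Q : 'rV[R]_n.+1 -> R) C0 r0 : smooth u -> 0 <= C0 -> 0 <= r0 -> (3 <= n.+1)%N ->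
  (forall x, (n.+1%:R - 2) / 2 * grad_sq u x <= - lap u x + C0 * \1_(cube r0) x) ->
  is_Qcurvature u Q -> (iint (fun x => `|Q x * expR (n.+1%:R * u x)|%:E) < +oo)%E ->
  exists A D T G, [/\ 0 <= A, 0 <= D, 1 <= T, (forall y, 0 <= G y) & ig (leb R n.+1) G] /\
  forall x r a a0, T <= `|x| -> `|x| <= r -> 0 < a -> a < a0 -> a <= `|x| ->
  (forall z, `|z| < a0 -> `|u (x + z) - u x| < 1) ->
  expR (n.+1%:R * u x) <= A + D * In (leb R n.+1) (fun y => G y * logker a r (y 0 ord0 - x 0 ord0)).
Proof.
move=> su C00 r00 n3 hS hQ hI.
set f := fun x => Q x * expR (n.+1%:R * u x).
have hP := potential_bound_Q su C00 n3 hS hQ hI; rewrite -/f in hP.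
have [m em] : exists m, n.+1./2 = m.+1 by exists (n.+1./2).-1; rewrite prednK// half_gt0; lia.
rewrite em in hP; have i_f := hP.1.
have [C C0' hC] := u_upper_bound su C00 r00 n3 hS (ltn0Sn m).
have ek : (2 * m.+1 + 4 + m.+1 = (2 * m.+1 + 4 + m).+1)%N by rewrite addnS.
rewrite ek in hP.
have [D1 D10 hD] := potential_log (smooth_continuous (smooth_iter_lap m.+1 su)) hP.
set N := n.+1%:R : R; have N0 : 0 <= N by exact: ler0n.
(* [k] bounds the coefficient of the potential in the exponent, the added 1 keeping it positive. Far
   mass at most [d = 1/(2k)] gives [k P = d^-1] times the integral of [lam/2] against that mass, the
   form required by [expR_jensen]. *)
set k := N * (C * D1) + 1; have k1 : 0 < k by rewrite ltr_wpDl// !mulr_ge0.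
set d := (2 * k)^-1; have d0 : 0 < d by rewrite invr_gt0 mulr_gt0.
have [rho rho0 hrho] := ig_tail i_f d0.
set M := In (leb R n.+1) (fun z => `|f z|); have M0 : 0 <= M by apply: In_ge0 => z; exact: normr_ge0.
set A := N * C + k * (2 * M).
have iG := ig_far rho i_f.
have G0 y : 0 <= far rho f y by have /andP[] := far_bounds rho f y.
(* With [|x| >= 1 + 2 rho] both [1 <= |x|] and [2 rho <= |x|] hold, as [u_upper_bound] and
   [log_potential_split] demand. *)
exists (expR A), (expR A * d^-1), (1 + 2 * rho), (far rho f); split.
  have A0 := expR_ge0 A; have d0' : 0 <= d^-1 by rewrite invr_ge0 ltW.
  split; [exact: A0|exact: (mulr_ge0 A0 d0')|by rewrite lerDl mulr_ge0|exact: G0|exact: iG].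
move=> x r a a0 Tx xr a_0 aa ax osc.
have x1 : 1 <= `|x| by lra.
have rx : 2 * rho <= `|x| by lra.
have cx : cube `|x| x by move=> i; exact: row_norm_coord.
have h1 := hC x _ _ x1 cx osc a a_0 aa ax.
have [j1 h2] := hD x a `|x| a_0 ax; rewrite -ek in h2.
have [j2 h3] := log_potential_split i_f rho0 a_0 ax (lexx _) (lexx _) rx xr j1.
set S := In _ _ in h3.
set P := In (leb R n.+1) (fun z => far rho f (x + z) * lam a r z) in h3.
have ar := le_trans ax xr.
have l0 (z : 'rV[R]_n.+1) : 0 <= lam a r z by exact: lam_ge0.
have P0 : 0 <= P by apply: In_ge0 => z; exact: mulr_ge0.
have hu : N * u x <= A + k * P.
  have gen (I U : R) : U <= C + C * I -> I <= D1 * S -> S <= 2 * M + P -> N * U <= A + k * P.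
    move=> g1 g2 g3; rewrite /A.
    have q1 : N * U <= N * (C + C * (D1 * (2 * M + P))).
      apply: ler_wpM2l => //; apply: (le_trans g1); rewrite lerD2l; apply: ler_wpM2l => //.
      by apply: (le_trans g2); apply: ler_wpM2l.
    apply: (le_trans q1); have -> : N * (C + C * (D1 * (2 * M + P))) = N * C + (k - 1) * (2 * M + P) by rewrite /k; ring.
    have q2 : 0 <= 2 * M + P by rewrite addr_ge0// mulr_ge0.
    lra.
  exact: gen h1 h2 h3.
apply: (@le_trans _ _ (expR A * expR (k * P))); first by rewrite -expRD ler_expR.
set I := In (leb R n.+1) (fun y => far rho f y * _).
have -> : expR A + expR A / d * I = expR A * (1 + d^-1 * I) by rewrite mulrDr mulr1 mulrA.
apply: ler_wpM2l; first exact: expR_ge0.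
have sh (g : 'rV[R]_n.+1 -> R) : ig (leb R n.+1) g -> ig (leb R n.+1) (fun z => g (x + z)).
  by move=> i_g; have := ig_shift x i_g; apply: eq_ig => z; rewrite addrC.
have iGx := sh _ iG.
set W := fun z => far rho f (x + z) in iGx *.
have W0 z : 0 <= W z by exact: G0.
have jP : ig (leb R n.+1) (fun z => W z * (lam a r z / 2)).
  by apply: (eq_ig _ (igZ 2^-1 j2)) => z; rewrite /W mulrC mulrA mulrAC.
have eP : k * P = d^-1 * In (leb R n.+1) (fun z => W z * (lam a r z / 2)).
  have -> : In (leb R n.+1) (fun z => W z * (lam a r z / 2)) = 2^-1 * P.
    by rewrite -(InZ _ j2); apply: eq_In => z; rewrite mulrA [RHS]mulrC.
  by rewrite /d invrK; field.
have mz : measurable_fun setT (fun z : 'rV[R]_n.+1 => logker a r (z 0 ord0)).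
  by apply: (measurableT_comp (measurable_logker a r)); exact: measurable_coord.
have jk : ig (leb R n.+1) (fun z => W z * logker a r (z 0 ord0)).
  apply: (ig_le _ _ (igZ (expR 1 + sqk a r 0) iGx)); first by apply: measurable_funM => //; exact: ig_meas iGx.
  move=> z; rewrite (ger0_norm (mulr_ge0 (W0 z) (logker_ge0 _ _ _))) mulrC.
  by apply: ler_wpM2r => //; exact: logker_le.
have le1 z : W z * expR (lam a r z / 2) <= W z * logker a r (z 0 ord0).
  by apply: ler_wpM2l => //; exact: lam_logker.
have je : ig (leb R n.+1) (fun z => W z * expR (lam a r z / 2)).
  apply: (ig_le _ _ jk); last by move=> z; rewrite (ger0_norm (mulr_ge0 (W0 z) (expR_ge0 _))).
  apply: measurable_funM; first exact: ig_meas iGx.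
  apply: (measurableT_comp (@measurable_expR R)); apply: measurable_funM; last exact: measurable_cst.
  exact: measurable_lam.
have hW : In (leb R n.+1) W <= d.
  apply: le_trans hrho; rewrite -(In_shift x (ig_meas iG)) le_eqVlt; apply/orP; left; apply/eqP.
  by apply: eq_In => z; rewrite /W addrC.
rewrite eP; apply: (le_trans (expR_jensen d0 W0 iGx hW jP je)).
rewrite lerD2l; apply: ler_wpM2l; first by rewrite invr_ge0 ltW.
apply: (le_trans (In_le je jk le1)).
have mk : measurable_fun setT (fun y => far rho f y * logker a r (y 0 ord0 - x 0 ord0)).
  apply: measurable_funM; first exact: ig_meas iG.
  apply: (measurableT_comp (measurable_logker a r)); apply: measurable_funB; last exact: measurable_cst.
  exact: measurable_coord.
rewrite /I -(In_shift x mk) le_eqVlt; apply/orP; left; apply/eqP.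
by apply: eq_In => z; rewrite /W addrC mxE addrK.
Qed.

End VolumeGrowth.

(** * Volume of large cubes *)

Section Volume.
Variable R : realType.
Local Notation Rm := (measurableTypeR R).

(** Integrate over [x] first: [In_logker_cube] is uniform in the centre [y], so only the total mass
    of [G] remains. *)
Lemma In_cube_logker n (G : 'rV[R]_n.+1 -> R) a r : 0 < a -> a <= r ->
  (forall y, 0 <= G y) -> ig (leb R n.+1) G ->
  let P (x : 'rV[R]_n.+1) : R := In (leb R n.+1) (fun y => G y * logker a r (y 0 ord0 - x 0 ord0)) in
  ig (leb R n.+1) (fun x => \1_(cube r) x * P x) /\
  In (leb R n.+1) (fun x => \1_(cube r) x * P x) <=
    (expR 1 * 2 + 8) * 2 ^+ n * In (leb R n.+1) G * r ^+ n.+1.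
Proof.
move=> a0 ar G0 iG P.
set K := expR 1 + sqk a r 0; have i1 := @ig_1cube R n.+1 r.
have b0 x : 0 <= \1_(@cube R n.+1 r) x :> R by rewrite indicE.
have k0 (s : R) : 0 <= logker a r s by exact: logker_ge0.
have kK (s : R) : logker a r s <= K by exact: logker_le.
pose F (x y : 'rV[R]_n.+1) : R := \1_(cube r) x * (G y * logker a r (y 0 ord0 - x 0 ord0)).
have F0 x y : 0 <= F x y by exact: (mulr_ge0 (b0 x) (mulr_ge0 (G0 y) (k0 _))).
have mF : measurable_fun setT (fun p : 'rV[R]_n.+1 * 'rV[R]_n.+1 => F p.1 p.2).
  apply: measurable_funM; first exact: (measurableT_comp (ig_meas i1) measurable_fst).
  apply: measurable_funM; first exact: (measurableT_comp (ig_meas iG) measurable_snd).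
  apply: (measurableT_comp (measurable_logker a r)); apply: measurable_funB.
    exact: (measurableT_comp (@measurable_coord R n.+1 ord0) measurable_snd).
  exact: (measurableT_comp (@measurable_coord R n.+1 ord0) measurable_fst).
have iFx x : ig (leb R n.+1) (F x).
  apply: (ig_le (measurable_slice1 mF x) _ (igZ (\1_(cube r) x) (igZ K iG))) => y.
  rewrite (ger0_norm (F0 x y)); apply: (ler_wpM2l (b0 x)); rewrite mulrC.
  exact: (ler_wpM2r (G0 y) (kK _)).
have iFy y : ig (leb R n.+1) (F ^~ y).
  apply: (ig_le (measurable_slice2 mF y) _ (igZ (K * G y) i1)) => x.
  rewrite (ger0_norm (F0 x y)) [leRHS]mulrC; apply: (ler_wpM2l (b0 x)); rewrite mulrC.
  exact: (ler_wpM2r (G0 y) (kK _)).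
set M := In (leb R n.+1) G.
have hg x : In (leb R n.+1) (fun y => `|F x y|) <= (K * M) * \1_(cube r) x.
  have -> : (K * M) * \1_(cube r) x = In (leb R n.+1) (fun y => \1_(cube r) x * (K * G y)).
    by rewrite (InZ _ (igZ K iG)) (InZ _ iG) mulrC.
  apply: (In_le (ig_abs (iFx x)) (igZ _ (igZ K iG))) => y.
  rewrite (ger0_norm (F0 x y)); apply: (ler_wpM2l (b0 x)); rewrite mulrC.
  exact: (ler_wpM2r (G0 y) (kK _)).
have [j1 j2 ej] := real_fubini mF iFx iFy (igZ (K * M) i1) hg.
have igk (x : 'rV[R]_n.+1) : ig (leb R n.+1) (fun y => G y * logker a r (y 0 ord0 - x 0 ord0)).
  apply: (ig_le _ _ (igZ K iG)).
    apply: measurable_funM; first exact: ig_meas iG.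
    apply: (measurableT_comp (measurable_logker a r)); apply: measurable_funB; last exact: measurable_cst.
    exact: measurable_coord.
  move=> y; rewrite (ger0_norm (mulr_ge0 (G0 y) (k0 _))) mulrC.
  exact: (ler_wpM2r (G0 y) (kK _)).
have e1 x : In (leb R n.+1) (F x) = \1_(cube r) x * P x := InZ (\1_(cube r) x) (igk x).
split; first exact: (eq_ig e1 j1).
rewrite -(eq_In _ e1) ej.
set B := (expR 1 * 2 + 8) * 2 ^+ n * r ^+ n.+1.
have -> : (expR 1 * 2 + 8) * 2 ^+ n * M * r ^+ n.+1 = B * M by rewrite mulrAC.
rewrite -(InZ _ iG); apply: (In_le j2 (igZ B iG)) => y.
have [i3 h3] := In_logker_cube (y 0 ord0) n a0 ar.
have -> : In (leb R n.+1) (F^~ y) = G y * In (leb R n.+1) (fun x => \1_(cube r) x * logker a r (x 0 ord0 - y 0 ord0)).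
  rewrite -(InZ _ i3); apply: eq_In => x; rewrite /F mulrCA; congr (_ * (_ * _)).
  by rewrite /logker distrC.
by rewrite mulrC; apply: (ler_wpM2r (G0 y)).
Qed.

(** For [|x| >= T] the bound of [exp_growth] is integrated over the cube; for [|x| < T] the volume
    density is bounded by continuity. Neither constant depends on [r]. *)
Lemma volume_growth n (u Q : 'rV[R]_n.+1 -> R) C0 r0 : smooth u -> 0 <= C0 -> 0 <= r0 -> (3 <= n.+1)%N ->
  (forall x, (n.+1%:R - 2) / 2 * grad_sq u x <= - lap u x + C0 * \1_(cube r0) x) ->
  is_Qcurvature u Q -> (iint (fun x => `|Q x * expR (n.+1%:R * u x)|%:E) < +oo)%E ->
  exists2 C, 0 <= C & forall r, 1 <= r ->
  ig (leb R n.+1) (fun x => \1_(cube r) x * expR (n.+1%:R * u x)) /\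
  In (leb R n.+1) (fun x => \1_(cube r) x * expR (n.+1%:R * u x)) <= C * r ^+ n.+1.
Proof.
move=> su C00 r00 n3 hS hQ hI.
have [A [D [T [G [[A0 D0 T1 G0 iG] hG]]]]] := exp_growth su C00 r00 n3 hS hQ hI.
have cE : continuous (fun x => expR (n.+1%:R * u x)).
  have c1 : continuous (fun x => n.+1%:R * u x) by apply: ctZ; exact: smooth_continuous.
  by move=> x; apply: (@continuous_comp _ _ _ _ (@expR R) x (c1 x)); exact: continuous_expR.
have [B B0 hB] := @continuous_cube_bounded _ _ T _ cE.
set M := In (leb R n.+1) G; have M0 : 0 <= M by exact: In_ge0.
set c := (expR 1 * 2 + 8) * 2 ^+ n * M.
have c0 : 0 <= c by rewrite !mulr_ge0 ?exprn_ge0// addr_ge0// mulr_ge0 ?expR_ge0.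
exists ((A + B) * 2 ^+ n.+1 + D * c).
  by apply: addr_ge0; [rewrite mulr_ge0 ?exprn_ge0// addr_ge0|exact: mulr_ge0].
move=> r r1; have r0' : 0 <= r by lra.
have [a0 a00 osc] := smooth_osc su r0'.
(* Halving makes [a < a0] strict, and [a <= 1 <= T] makes [a] admissible for every [x] with
   [T <= |x|]. *)
set a := Num.min (a0 / 2) 1.
have a_0 : 0 < a by rewrite lt_min divr_gt0//=.
have aa : a < a0 by rewrite gt_min; apply/orP; left; lra.
have a1 : a <= 1 by rewrite ge_min lexx orbT.
have ar := le_trans a1 r1.
pose P (x : 'rV[R]_n.+1) : R := In (leb R n.+1) (fun y => G y * logker a r (y 0 ord0 - x 0 ord0)).
have [iP hP] : ig (leb R n.+1) (fun x => \1_(cube r) x * P x) /\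
  In (leb R n.+1) (fun x => \1_(cube r) x * P x) <= c * r ^+ n.+1 by exact: In_cube_logker.
have P0 x : 0 <= P x by apply: In_ge0 => y; exact: (mulr_ge0 (G0 y) (logker_ge0 _ _ _)).
have b0 x : 0 <= \1_(@cube R n.+1 r) x :> R by rewrite indicE.
have i1 := @ig_1cube R n.+1 r.
have i2 := igD (igZ (A + B) i1) (igZ D iP).
have le1 x : 0 <= \1_(cube r) x * expR (n.+1%:R * u x) <= (A + B) * \1_(cube r) x + D * (\1_(cube r) x * P x).
  rewrite (mulr_ge0 (b0 x) (expR_ge0 _))/= mulrC.
  have -> : (A + B) * \1_(cube r) x + D * (\1_(cube r) x * P x) = (A + B + D * P x) * \1_(cube r) x by ring.
  rewrite indicE; have [h|h] := boolP (x \in _); last by rewrite !mulr0.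
  rewrite !mulr1; move/set_mem : h => h.
  have DP := mulr_ge0 D0 (P0 x).
  have [Tx|Tx] := leP T `|x|.
    have xr := row_norm_le r0' h.
    have ax : a <= `|x| by exact: le_trans a1 (le_trans T1 Tx).
    have := hG x r a a0 Tx xr a_0 aa ax (osc x h); rewrite -/(P x); lra.
  have cT : cube T x by move=> i; exact: le_trans (row_norm_coord x i) (ltW Tx).
  have := hB x cT; rewrite ger0_norm ?expR_ge0//; lra.
have m : measurable_fun setT (fun x => \1_(cube r) x * expR (n.+1%:R * u x)).
  by apply: measurable_funM; [exact: ig_meas i1|exact: continuous_row_measurable].
split; first by apply: (ig_le m _ i2) => x; have /andP[p q] := le1 x; rewrite (ger0_norm p).
apply: (le_trans (In_gt0_le m le1 i2)).
rewrite (InD (igZ (A + B) i1) (igZ D iP)) (InZ _ i1) (InZ _ iP) (In_cube _ r0') exprMn.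
have gen (p q I : R) : I <= c * q -> (A + B) * (p * q) + D * I <= ((A + B) * p + D * c) * q.
  move=> hI'; have -> : ((A + B) * p + D * c) * q = (A + B) * (p * q) + D * (c * q) by ring.
  by rewrite lerD2l; apply: ler_wpM2l.
exact: gen hP.
Qed.

End Volume.

(** * The volume entropy *)

Section Entropy.
Variable R : realType.
Local Notation eball n r := (@Defs.ball0 R n r).

Lemma ball0_cube n r (x : 'rV[R]_n) : 0 < r -> eball n r x -> cube r x.
Proof.
move=> r0 hx; apply: nsq_cube; first exact: ltW.
by rewrite -enorm_sq lerXn2r ?nnegrE ?enorm_ge0 ?(ltW r0)//; exact: ltW.
Qed.

Lemma cube_ball0 n r (x : 'rV[R]_n.+1) : 0 < r -> cube (r / (2 * n.+1%:R)) x -> eball n.+1 r x.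
Proof.
move=> r0 hx; have N0 : 0 < n.+1%:R :> R by rewrite ltr0n.
set b := r / (2 * n.+1%:R) in hx; have b0 : 0 <= b by rewrite divr_ge0 ?(ltW r0)// mulr_ge0.
have N1 : 1 <= n.+1%:R :> R by rewrite ler1n.
rewrite /Defs.ball0/= -ltr_sqr ?nnegrE ?enorm_ge0 ?(ltW r0)// enorm_sq.
apply: (@le_lt_trans _ _ (\sum_(i < n.+1) b ^+ 2)).
  apply: ler_sum => i _; rewrite -[leLHS]real_normK ?num_real//.
  by rewrite lerXn2r ?nnegrE//; exact: hx.
rewrite sumr_const card_ord -mulr_natl.
have e : r = 2 * n.+1%:R * b by rewrite /b mulrC divfK// mulf_neq0// gt_eqF.
have b1 : 0 < b by rewrite divr_gt0// mulr_gt0.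
clearbody b; rewrite e !exprMn; have q : 0 < b ^+ 2 by exact: exprn_gt0.
rewrite ltr_pM2r//; have gen (N : R) : 1 <= N -> N < 2 ^+ 2 * N ^+ 2 by nra.
exact: gen.
Qed.

Lemma ig_ball0 n r : 0 < r -> ig (leb R n) (\1_(eball n r)).
Proof.
move=> r0; apply: (ig_le _ _ (@ig_1cube R n r)).
  apply: measurable_indic; apply: open_row_measurable.
  have -> : eball n r = (@nsq R n) @^-1` [set y | y < r ^+ 2].
    by apply/seteqP; split => x /=; rewrite -enorm_sq ltr_sqr ?nnegrE ?enorm_ge0 ?(ltW r0).
  by move/continuousP : (@continuous_nsq R n); apply; exact: open_lt.
move=> x; rewrite ger0_norm ?indicE//; have [h|h] := boolP (x \in eball n r); last by [].
by rewrite mem_set//; apply: ball0_cube => //; exact: set_mem.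
Qed.

(** The ball contains the cube of half-side [r/(2n)], [n] being the dimension; the volume of that
    cube is the left-hand side. *)
Lemma evol_ball_ge n (r : R) : 0 < r -> (r / n.+1%:R) ^+ n.+1 <= fine (evol_ball n.+1 r).
Proof.
move=> r0; have ib := @ig_ball0 n.+1 r r0.
have -> : evol_ball n.+1 r = (In (leb R n.+1) (\1_(eball n.+1 r)))%:E.
  by rewrite -(InE ib); apply: iint_integrable.
have N0 : 0 < n.+1%:R :> R by rewrite ltr0n.
set b := r / (2 * n.+1%:R); have b0 : 0 <= b by rewrite divr_ge0 ?(ltW r0)// mulr_ge0.
have -> : r / n.+1%:R = 2 * b by rewrite /b; field; rewrite gt_eqF.
rewrite /= -(@In_cube R n.+1 b b0); apply: (In_le (@ig_1cube R n.+1 b) ib) => x.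
rewrite !indicE; have [h|h] := boolP (x \in cube b); last by [].
by rewrite mem_set//; apply: cube_ball0 => //; exact: set_mem.
Qed.

Lemma gvol_ball_le n (u : 'rV[R]_n -> R) r : 0 < r ->
  ig (leb R n) (fun x => \1_(cube r) x * expR (n%:R * u x)) ->
  fine (gvol_ball u r) <= In (leb R n) (fun x => \1_(cube r) x * expR (n%:R * u x)).
Proof.
move=> r0 ic; have ib := @ig_ball0 n r r0.
have le1 x : 0 <= \1_(eball n r) x * expR (n%:R * u x) <= \1_(cube r) x * expR (n%:R * u x).
  rewrite mulr_ge0 ?expR_ge0 ?indicE//=; apply: (ler_wpM2r (expR_ge0 _)).
  have [h|h] := boolP (x \in eball n r); last by [].
  by rewrite mem_set//; apply: ball0_cube => //; exact: set_mem.
have m : measurable_fun setT (fun x => \1_(eball n r) x * expR (n%:R * u x)).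
  have -> : (fun x => \1_(eball n r) x * expR (n%:R * u x)) =
            (fun x => \1_(eball n r) x * (\1_(cube r) x * expR (n%:R * u x))).
    apply/funext => x; rewrite indicE; have [h|h] := boolP (x \in eball n r); last by rewrite !mul0r.
    by rewrite indicE mem_set ?mul1r//; apply: ball0_cube => //; exact: set_mem.
  by apply: measurable_funM; [exact: ig_meas ib|exact: ig_meas ic].
have ig1 : ig (leb R n) (fun x => \1_(eball n r) x * expR (n%:R * u x)).
  by apply: (ig_le m _ ic) => x; have /andP[p q] := le1 x; rewrite (ger0_norm p).
have -> : gvol_ball u r = (In (leb R n) (fun x => \1_(eball n r) x * expR (n%:R * u x)))%:E.
  by rewrite -(InE ig1); apply: iint_integrable.
exact: (In_gt0_le m le1 ic).
Qed.

(** Numerator and denominator are both of order [N ln r] with [N] the dimension, up to additive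
    constants; any slack [e > 0] absorbs these once [r] is large. *)
Lemma entropy_le1 n (u : 'rV[R]_n.+1 -> R) C : 0 <= C ->
  (forall r, 1 <= r -> fine (gvol_ball u r) <= C * r ^+ n.+1) -> (vol_entropy u <= 1%:E)%E.
Proof.
move=> C0 hC; apply/lee_addgt0Pr => e e0; rewrite -EFinD.
set N := n.+1%:R : R; have N1 : 1 <= N by rewrite ler1n.
have N0 : 0 < N by exact: lt_le_trans N1.
have lN : 0 <= ln N by exact: ln_ge0.
(* The value of [ln r] at which [ln (C + 1) + N ln r = (1 + e) N (ln r - ln N)]. Using [C + 1] keeps
   the logarithm meaningful when [C = 0], and the terms added in [r1] make the denominator
   positive. *)
set K := (ln (C + 1) + (1 + e) * (N * ln N)) / (e * N).
have eN : 0 < e * N by exact: mulr_gt0.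
set r1 := expR (`|K| + ln N + 1).
have q1 : 0 <= `|K| + ln N + 1 by rewrite !addr_ge0.
have r11 : 1 <= r1 by rewrite -[leLHS]expR0 ler_expR.
apply: (@le_trans _ _ (ereal_sup ((fun r : R => (ln (fine (gvol_ball u r)) / ln (fine (evol_ball n.+1 r)))%:E) @` [set r | r1 < r]))).
  apply: ereal_inf_lbound; exists [set r | r1 < r] => //.
  by exists r1; split => //; exact: num_real.
apply: ge_ereal_sup => _ [r /= hr <-]; rewrite lee_fin.
have rp : 0 < r by lra.
have lr : `|K| + ln N + 1 < ln r by rewrite -[ltLHS]expRK ltr_ln ?posrE ?expR_gt0.
have hE : N * (ln r - ln N) <= ln (fine (evol_ball n.+1 r)).
  have rN : 0 < r / N by exact: divr_gt0.
  have p : 0 < (r / N) ^+ n.+1 by exact: exprn_gt0.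
  have h := evol_ball_ge n rp.
  have -> : N * (ln r - ln N) = ln ((r / N) ^+ n.+1) by rewrite lnXn// ln_div ?posrE// -mulr_natl.
  by rewrite ler_ln ?posrE// (lt_le_trans p).
have d0 : 0 < N * (ln r - ln N) by rewrite mulr_gt0//; have := normr_ge0 K; lra.
have E0 := lt_le_trans d0 hE.
rewrite ler_pdivrMr//; apply: (@le_trans _ _ ((1 + e) * (N * (ln r - ln N)))); last first.
  by rewrite ler_pM2l//; lra.
(* [ln] is 0 at nonpositive arguments, while the right-hand side is nonnegative. *)
have [v0|v0] := leP (fine (gvol_ball u r)) 0.
  by rewrite ln0// mulr_ge0 ?(ltW d0)//; lra.
have C1 : 0 < C + 1 by lra.
have hV : ln (fine (gvol_ball u r)) <= ln (C + 1) + N * ln r.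
  have rn : 0 < r ^+ n.+1 by exact: exprn_gt0.
  have -> : ln (C + 1) + N * ln r = ln ((C + 1) * r ^+ n.+1) by rewrite lnM ?posrE// lnXn// -mulr_natl.
  have r1' : 1 <= r by lra.
  rewrite ler_ln ?posrE ?mulr_gt0//; apply: (le_trans (hC r r1')).
  by rewrite ler_pM2r// lerDl.
have hK : K * (e * N) <= ln r * (e * N) by rewrite ler_pM2r//; have := ler_norm K; lra.
have eK : K * (e * N) = ln (C + 1) + (1 + e) * (N * ln N) by rewrite /K divfK// gt_eqF.
have gen (a b c d V : R) : V <= a + N * b -> c = a + (1 + e) * (N * d) -> c <= b * (e * N) ->
  V <= (1 + e) * (N * (b - d)) by move=> g1 g2 g3; rewrite g2 in g3; lra.
exact: (gen _ _ _ _ _ hV eK hK).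
Qed.

(** Outside the ball the positive factor [2 (n-1) exp(-2u)] is divided out of the curvature. The
    cube [r] contains that ball, and on it the defect is bounded by compactness. *)
Lemma scal_curv_bound n (u : 'rV[R]_n -> R) r0 : smooth u -> (3 <= n)%N ->
  (forall x : 'rV[R]_n, r0 < enorm x -> 0 <= scal_curv u x) ->
  exists C0 r, [/\ 0 <= C0, 0 <= r &
    forall x, (n%:R - 2) / 2 * grad_sq u x <= - lap u x + C0 * \1_(cube r) x].
Proof.
move=> su n3 hr; set r := Num.max 0 r0; have r00 : 0 <= r by rewrite le_max lexx.
have cg : continuous (fun x => (n%:R - 2) / 2 * grad_sq u x + lap u x).
  apply: ctD; first by apply: ctM; [exact: ct_cst|exact: continuous_grad_sq].
  exact/smooth_continuous/smooth_lap.
have [C C0 hC] := @continuous_cube_bounded _ _ r _ cg.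
exists C, r; split => // x; rewrite indicE; have [h|h] := boolP (x \in cube r).
  move/set_mem : h => h; have := le_trans (ler_norm _) (hC x h); rewrite mulr1; lra.
have er : r0 < enorm x.
  rewrite [r0 < _]ltNge; apply: contra h => h; rewrite mem_set//; apply: nsq_cube => //.
  rewrite -enorm_sq lerXn2r ?nnegrE ?enorm_ge0//; apply: (le_trans h); by rewrite le_max lexx orbT.
have := hr x er; rewrite /scal_curv pmulr_rge0; first by rewrite mulr0 addr0; lra.
rewrite mulr_gt0 ?expR_gt0// mulr_gt0// subr_gt0 ltr1n; lia.
Qed.

End Entropy.

Theorem theorem1p4 (R : realType) (n : nat) (u : 'rV[R]_n -> R) :
  (3 <= n)%N ->
  smooth u ->
  complete_metric u ->
  finite_total_Q u ->
  (exists r0 : R, forall x : 'rV[R]_n, r0 < enorm x -> 0 <= scal_curv u x) ->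
  (vol_entropy u <= 1%:E)%E.
Proof.
case: n u => // n u n3 su _ [Q [hQ hI]] [r0 hr].
have [C0 [r [C00 r00 hS]]] := scal_curv_bound su n3 hr.
have [C C0' hC] := volume_growth su C00 r00 n3 hS hQ hI.
apply: (entropy_le1 C0') => t t1; have [i1 h1] := hC t t1.
by apply: le_trans h1; apply: gvol_ball_le => //; exact: lt_le_trans t1.
Qed.
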